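(* Let $T>0$, $r\ge0$, $\rho\in[-1,1]$, $\alpha\ge0$, and let $\mu_1(S,t)$, $\mu_2(S,t)$ satisfy $r\le\mu_1(S,t)\le\mu_2(S,t)$ on $(0,\infty)\times[0,T]$. For $i=1,2$ let $P^{\mu_i}$ be the solution on $G=(0,\infty)^2\times[0,T]$ of $$P_t+\Big(\mu_i(S,t)-(a(H,t)-r)\rho\frac{\sigma(S,t)}{b(H,t)}\Big)SP_S+rHP_H+\tfrac12\sigma^2S^2P_{SS}+\rho\sigma bSHP_{SH}+\tfrac12b^2H^2P_{HH}-rP=-\alpha\sqrt{1-\rho^2}\sigma S|P_S|,$$ $P(S,H,T)=g(S)$, where for each $i$ the data $(\mu_i,\sigma,a,b,g)$ satisfy the standing assumptions in the context. If $P^{\mu_i}_S\ge0$ on $G$ for $i=1$ or $i=2$, then $P^{\mu_1}\le P^{\mu_2}$ on $G$; if $P^{\mu_i}_S\le0$ on $G$ for $i=1$ or $i=2$, then $P^{\mu_1}\ge P^{\mu_2}$ on $G$.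
   Context: Model: non-traded asset $dS=\mu(S,t)Sdt+\sigma(S,t)SdZ$, traded asset $dH=a(H,t)Hdt+b(H,t)HdW$, $Z,W$ of correlation $\rho$. Solutions are continuous viscosity solutions in the class $\mathcal C$ of locally bounded $u$ on $G$ with $u/(1+(|\ln S|+|\ln H|)^k)\to0$ uniformly in $t$ as $|\ln S|+|\ln H|\to\infty$ for some $k>0$. Standing assumptions (with $\tilde\mu=\mu-(a-r)\rho\sigma/b$): (1) there are $C_1,\dots,C_4>0$ with $|\sigma(S_1,t)-\sigma(S_2,t)|\le C_1|\ln S_1-\ln S_2|$, $\sigma(S,t)\le C_2\sqrt{S(1+\ln S)}$, $|b(H_1,t)-b(H_2,t)|\le C_3|\ln H_1-\ln H_2|$, $b(H,t)\le C_4\sqrt{H(1+\ln H)}$, $\sigma,b$ differentiable in their first variable; (2) there are $K,C_5>0$ with $|\tilde\mu|\le K(1+|\ln S|+|\ln H|)$, $|\tilde\mu(S_1,H_1,t)-\tilde\mu(S_2,H_2,t)|\le C_5|\ln S_1-\ln S_2|$, $\tilde\mu$ differentiable in its first two variables; (3) $g(S)\le L(1+(\ln S)^{2\lambda})$ for some $L>0,\lambda\ge1$; (4) $\mu,\sigma,a,b$ bounded; (5) there is $\delta>0$ with $\sigma^2(e^x,t)\xi_1^2+2\rho\sigma(e^x,t)b(e^y,t)\xi_1\xi_2+b^2(e^y,t)\xi_2^2\ge\delta\sqrt{\xi_1^2+\xi_2^2}$ for all $\xi\in\mathbb R^2$.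
   Formalization: Assumption (5), impossible for small ξ, is read with δ(ξ1²+ξ2²) on the right; the bounds by √(S(1+ln S)) and √(H(1+ln H)) in (1), undefined for small S, H, are dropped; the Lipschitz bound in (2) also allows a term |ln H1−ln H2|. *)

(* Defs.v *)
From Stdlib Require Import Reals.
From Coquelicot Require Import Coquelicot.
Open Scope R_scope.

Definition inG (T S H t : R) : Prop := 0 < S /\ 0 < H /\ 0 <= t <= T.

(* x^y for x >= 0 with the convention 0^y = 0 (Rpower is exp(y ln x)). *)
Definition rpow0 (x y : R) : R := if Req_EM_T x 0 then 0 else Rpower x y.

Definition mu_tilde (mu sigma a b : R -> R -> R) (r rho : R) (S H t : R) : R :=
  mu S t - (a H t - r) * rho * sigma S t / b H t.

Definition Fop (mu sigma a b : R -> R -> R) (r rho alpha : R) (S H t : R)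
  (p pt pS pH pSS pSH pHH : R) : R :=
  pt + mu_tilde mu sigma a b r rho S H t * S * pS + r * H * pH
  + / 2 * (sigma S t) ^ 2 * S ^ 2 * pSS
  + rho * sigma S t * b H t * S * H * pSH
  + / 2 * (b H t) ^ 2 * H ^ 2 * pHH
  - r * p
  + alpha * sqrt (1 - rho ^ 2) * sigma S t * S * Rabs pS.

Definition continuous3 (f : R -> R -> R -> R) : Prop :=
  forall x y z eps, 0 < eps -> exists d, 0 < d /\
    forall x' y' z', Rabs (x' - x) < d -> Rabs (y' - y) < d -> Rabs (z' - z) < d ->
      Rabs (f x' y' z' - f x y z) < eps.

Definition test_fn (phi phit phiS phiH phiSS phiSH phiHH : R -> R -> R -> R) : Prop :=
  continuous3 phi /\ continuous3 phit /\ continuous3 phiS /\ continuous3 phiH /\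
  continuous3 phiSS /\ continuous3 phiSH /\ continuous3 phiHH /\
  forall S H t,
    is_derive (fun t' => phi S H t') t (phit S H t) /\
    is_derive (fun s => phi s H t) S (phiS S H t) /\
    is_derive (fun h => phi S h t) H (phiH S H t) /\
    is_derive (fun s => phiS s H t) S (phiSS S H t) /\
    is_derive (fun h => phiS S h t) H (phiSH S H t) /\
    is_derive (fun h => phiH S h t) H (phiHH S H t).

Definition local_max_G (T : R) (u phi : R -> R -> R -> R) (S0 H0 t0 : R) : Prop :=
  exists d, 0 < d /\ forall S H t, inG T S H t ->
    Rabs (S - S0) < d -> Rabs (H - H0) < d -> Rabs (t - t0) < d ->
    u S H t - phi S H t <= u S0 H0 t0 - phi S0 H0 t0.

Definition local_min_G (T : R) (u phi : R -> R -> R -> R) (S0 H0 t0 : R) : Prop :=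
  exists d, 0 < d /\ forall S H t, inG T S H t ->
    Rabs (S - S0) < d -> Rabs (H - H0) < d -> Rabs (t - t0) < d ->
    u S0 H0 t0 - phi S0 H0 t0 <= u S H t - phi S H t.

Definition visc_sub (T : R) (mu sigma a b : R -> R -> R) (r rho alpha : R)
  (u : R -> R -> R -> R) : Prop :=
  forall phi phit phiS phiH phiSS phiSH phiHH,
    test_fn phi phit phiS phiH phiSS phiSH phiHH ->
    forall S0 H0 t0, inG T S0 H0 t0 -> t0 < T -> local_max_G T u phi S0 H0 t0 ->
      0 <= Fop mu sigma a b r rho alpha S0 H0 t0 (u S0 H0 t0)
             (phit S0 H0 t0) (phiS S0 H0 t0) (phiH S0 H0 t0)
             (phiSS S0 H0 t0) (phiSH S0 H0 t0) (phiHH S0 H0 t0).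

Definition visc_super (T : R) (mu sigma a b : R -> R -> R) (r rho alpha : R)
  (u : R -> R -> R -> R) : Prop :=
  forall phi phit phiS phiH phiSS phiSH phiHH,
    test_fn phi phit phiS phiH phiSS phiSH phiHH ->
    forall S0 H0 t0, inG T S0 H0 t0 -> t0 < T -> local_min_G T u phi S0 H0 t0 ->
      Fop mu sigma a b r rho alpha S0 H0 t0 (u S0 H0 t0)
          (phit S0 H0 t0) (phiS S0 H0 t0) (phiH S0 H0 t0)
          (phiSS S0 H0 t0) (phiSH S0 H0 t0) (phiHH S0 H0 t0) <= 0.

Definition contG (T : R) (u : R -> R -> R -> R) : Prop :=
  forall S0 H0 t0, inG T S0 H0 t0 -> forall eps, 0 < eps -> exists d, 0 < d /\
    forall S H t, inG T S H t ->
      Rabs (S - S0) < d -> Rabs (H - H0) < d -> Rabs (t - t0) < d ->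
      Rabs (u S H t - u S0 H0 t0) < eps.

Definition class_C (T : R) (u : R -> R -> R -> R) : Prop :=
  (forall S0 H0 t0, inG T S0 H0 t0 -> exists d M, 0 < d /\
     forall S H t, inG T S H t ->
       Rabs (S - S0) < d -> Rabs (H - H0) < d -> Rabs (t - t0) < d ->
       Rabs (u S H t) <= M) /\
  (exists k, 0 < k /\ forall eps, 0 < eps -> exists M, 0 < M /\
     forall S H t, inG T S H t -> M < Rabs (ln S) + Rabs (ln H) ->
       Rabs (u S H t) / (1 + rpow0 (Rabs (ln S) + Rabs (ln H)) k) < eps).

Definition is_solution (T : R) (mu sigma a b : R -> R -> R) (r rho alpha : R)
  (g : R -> R) (u : R -> R -> R -> R) : Prop :=
  contG T u /\ class_C T u /\
  visc_sub T mu sigma a b r rho alpha u /\ visc_super T mu sigma a b r rho alpha u /\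
  (forall S H, 0 < S -> 0 < H -> u S H T = g S).

Definition standing (T : R) (mu sigma a b : R -> R -> R) (r rho : R) (g : R -> R) : Prop :=
  (exists C1, 0 < C1 /\ forall S1 S2 t, 0 < S1 -> 0 < S2 -> 0 <= t <= T ->
     Rabs (sigma S1 t - sigma S2 t) <= C1 * Rabs (ln S1 - ln S2)) /\
  (exists C3, 0 < C3 /\ forall H1 H2 t, 0 < H1 -> 0 < H2 -> 0 <= t <= T ->
     Rabs (b H1 t - b H2 t) <= C3 * Rabs (ln H1 - ln H2)) /\
  (forall S t, 0 < S -> 0 <= t <= T -> ex_derive (fun s => sigma s t) S) /\
  (forall H t, 0 < H -> 0 <= t <= T -> ex_derive (fun h => b h t) H) /\
  (exists K, 0 < K /\ forall S H t, inG T S H t ->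
     Rabs (mu_tilde mu sigma a b r rho S H t) <= K * (1 + Rabs (ln S) + Rabs (ln H))) /\
  (exists C5, 0 < C5 /\ forall S1 H1 S2 H2 t, inG T S1 H1 t -> inG T S2 H2 t ->
     Rabs (mu_tilde mu sigma a b r rho S1 H1 t - mu_tilde mu sigma a b r rho S2 H2 t)
       <= C5 * (Rabs (ln S1 - ln S2) + Rabs (ln H1 - ln H2))) /\
  (forall S H t, inG T S H t ->
     ex_derive (fun s => mu_tilde mu sigma a b r rho s H t) S /\
     ex_derive (fun h => mu_tilde mu sigma a b r rho S h t) H) /\
  (exists L lam, 0 < L /\ 1 <= lam /\ forall S, 0 < S ->
     g S <= L * (1 + rpow0 (Rabs (ln S)) (2 * lam))) /\
  (exists M, forall S H t, inG T S H t ->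
     Rabs (mu S t) <= M /\ Rabs (sigma S t) <= M /\
     Rabs (a H t) <= M /\ Rabs (b H t) <= M) /\
  (exists delta, 0 < delta /\ forall x y t xi1 xi2, 0 <= t <= T ->
     (sigma (exp x) t) ^ 2 * xi1 ^ 2 + 2 * rho * sigma (exp x) t * b (exp y) t * xi1 * xi2
       + (b (exp y) t) ^ 2 * xi2 ^ 2 >= delta * (xi1 ^ 2 + xi2 ^ 2)).

Definition PS_nonneg (T : R) (P : R -> R -> R -> R) : Prop :=
  forall S H t, inG T S H t -> exists d, is_derive (fun s => P s H t) S d /\ 0 <= d.
Definition PS_nonpos (T : R) (P : R -> R -> R -> R) : Prop :=
  forall S H t, inG T S H t -> exists d, is_derive (fun s => P s H t) S d /\ d <= 0.

(* Main.v *)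
(** Since P_S has a constant sign, the drift term mu * S * P_S is monotone in mu, so one of the two
    solutions is a sub- or supersolution of the equation of the other one, and the theorem reduces to
    the comparison principle.  The coefficients are arbitrary functions of time (not even measurable),
    so the usual doubling of the time variable is not available.  Instead, in the variables
    (ln S, ln H), with u a subsolution and w = - v a subsolution of the opposite equation, let
    M(t) = sup u(z,t) + w(z',t) - (be/4) |z - z'|^2.  At a time t0 where M is positive, freeze the
    coefficients at the maximum point: for times t at which the coefficients are close to those at t0,
    a regularization of u grows backwards in time at most like a random walk with these frozen
    coefficients, while at the other times its growth rate is at least bounded.  Coupling the walks of
    u and w through the same signs replaces the matrix inequality of the theorem on sums.  The times
    are coloured by finitely many classes of nearly equal coefficients; almost every time is, in outer
    measure, a density point of its own colour class, so the exceptional times contribute nothing and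
    M(s) <= M(t) up to a small error whenever s <= t.  Finally be tends to infinity. *)
Require Import Defs.
From Stdlib Require Import Reals List ZArith Lra Lia Psatz Classical ClassicalEpsilon
  FunctionalExtensionality Cantor.
From Coquelicot Require Import Coquelicot.
Open Scope R_scope.

(** * Suprema and compactness *)

(** A superjet at time t sees the coefficients at t only, so neither mollification nor integration
    in time is possible. All information in time is therefore read off from slopes at touching
    points, and outer measure is encoded by monotone 1-Lipschitz majorants, which makes sense for
    colour classes of any kind. In space the estimate has to be carried over a whole interval from
    t0 + h back to t0. The function from which the walk starts must dominate the sup-convolution at
    t0 + h, preserve the inequality that couples the two functions, and have a known gradient near
    the maximum point. The Lasry-Lions regularization [hull] does all of this with second
    differences bounded by 4 be. Averaging it further gives Taylor expansions with a cubic
    remainder; the constant Q of that remainder depends on h, which is harmless because the number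
    of steps of the walk is chosen after Q. Solutions may grow, so a small multiple of exp(A (T -
    t)) (ch x + ch y) is subtracted and the result is truncated from below at - L. This gives
    uniform continuity and confines positive maxima to a box, where a finite net of points controls
    the coefficients. *)

Definition Sup {T : Type} (f : T -> R) : R :=
  real (Lub_Rbar (fun v => exists x, v = f x)).

(** [real] sends infinite values to 0, so [Sup f] is the supremum only if f is bounded above on an
    inhabited type; c and x0 witness this. *)
Lemma Sup_spec {T : Type} (f : T -> R) (c : R) (x0 : T) :
  (forall x, f x <= c) ->
  (forall x, f x <= Sup f) /\ (forall b, (forall x, f x <= b) -> Sup f <= b).
Proof.
  intros Hc. unfold Sup.
  destruct (Lub_Rbar_correct (fun v => exists x, v = f x)) as [Hub Hlub].
  set (l := Lub_Rbar _) in *.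
  assert (H1 : Rbar_le l c).
  { apply Hlub. intros v [x ->]. apply Hc. }
  assert (H2 : Rbar_le (f x0) l) by (apply Hub; now exists x0).
  destruct l as [l| |]; simpl in *; try easy.
  split.
  - intros x. apply (Hub (f x)). now exists x.
  - intros b Hb. assert (H := Hlub (Finite b)). simpl in H. apply H.
    intros v [x ->]. apply Hb.
Qed.

Lemma Sup_ub {T : Type} (f : T -> R) (c : R) (x : T) :
  (forall x, f x <= c) -> f x <= Sup f.
Proof. intros Hc. now apply (Sup_spec f c x Hc). Qed.

Lemma Sup_le {T : Type} (f : T -> R) (c : R) (x0 : T) :
  (forall x, f x <= c) -> Sup f <= c.
Proof. intros Hc. now apply (Sup_spec f c x0 Hc). Qed.

Lemma Sup_approx {T : Type} (f : T -> R) (c e : R) (x0 : T) :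
  (forall x, f x <= c) -> 0 < e -> exists x, Sup f - e < f x.
Proof.
  intros Hc He. apply NNPP. intros Hn.
  assert (Sup f <= Sup f - e); [|lra].
  apply (Sup_spec f c x0 Hc). intros x. apply Rnot_lt_le. intros Hx.
  apply Hn. now exists x.
Qed.

Lemma Sup_eq_max {T : Type} (f : T -> R) (x : T) :
  (forall x', f x' <= f x) -> Sup f = f x.
Proof.
  intros H. apply Rle_antisym.
  - now apply (Sup_le f (f x) x).
  - now apply (Sup_ub f (f x) x).
Qed.

(** Sequential compactness with a built-in rate. The extraction is only asked to satisfy n <= phi n,
    which together with the rate is stable under composition and so passes to products. *)
Definition bwc {T : Type} (dist : T -> T -> R) (K : T -> Prop) : Prop :=
  forall u : nat -> T, (forall n, K (u n)) ->
  exists l (phi : nat -> nat), K l /\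
    forall n, (n <= phi n)%nat /\ dist (u (phi n)) l < / (INR n + 1).

Definition dist1 (x y : R) : R := Rabs (x - y).
Definition distp {T1 T2 : Type} (d1 : T1 -> T1 -> R) (d2 : T2 -> T2 -> R)
  (a b : T1 * T2) : R := Rmax (d1 (fst a) (fst b)) (d2 (snd a) (snd b)).

Lemma inv_INR1_pos (n : nat) : 0 < / (INR n + 1).
Proof. apply Rinv_0_lt_compat. assert (H := pos_INR n). lra. Qed.

Lemma inv_INR1_le (n m : nat) : (n <= m)%nat -> / (INR m + 1) <= / (INR n + 1).
Proof.
  intros H. apply le_INR in H. assert (H0 := pos_INR n).
  apply Rinv_le_contravar; lra.
Qed.

Lemma inv_INR1_small (e : R) : 0 < e -> exists n, / (INR n + 1) < e.
Proof.
  intros He. destruct (archimed_cor1 e He) as [n [Hn Hn0]].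
  exists n. apply Rle_lt_trans with (2 := Hn).
  assert (0 < INR n) by now apply lt_0_INR.
  apply Rinv_le_contravar; lra.
Qed.

Lemma bwc_interval (a b : R) : bwc dist1 (fun x => a <= x <= b).
Proof.
  intros u Hu.
  destruct (Bolzano_Weierstrass u (fun x => a <= x <= b) (compact_P3 a b) Hu) as [l Hl].
  assert (Hnear : forall e, 0 < e -> forall n, exists p, (n <= p)%nat /\ Rabs (u p - l) < e).
  { intros e He n.
    destruct (Hl (fun x => Rabs (x - l) < e) n) as [p [Hp Hp']].
    - exists (mkposreal e He). now intros x.
    - now exists p. }
  assert (Hs : forall n, { p | (n <= p)%nat /\ Rabs (u p - l) < / (INR n + 1) }).
  { intros n. apply constructive_indefinite_description.
    apply Hnear, inv_INR1_pos. }
  exists l, (fun n => proj1_sig (Hs n)). split.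
  - split; apply Rnot_lt_le; intros H.
    + destruct (Hnear (a - l) ltac:(lra) O) as [p [_ Hp]].
      apply Rabs_def2 in Hp. specialize (Hu p). lra.
    + destruct (Hnear (l - b) ltac:(lra) O) as [p [_ Hp]].
      apply Rabs_def2 in Hp. specialize (Hu p). lra.
  - intros n. exact (proj2_sig (Hs n)).
Qed.

Lemma bwc_prod {T1 T2 : Type} (d1 : T1 -> T1 -> R) (d2 : T2 -> T2 -> R) K1 K2 :
  bwc d1 K1 -> bwc d2 K2 -> bwc (distp d1 d2) (fun a => K1 (fst a) /\ K2 (snd a)).
Proof.
  intros H1 H2 u Hu.
  destruct (H1 (fun n => fst (u n))) as [l1 [p1 [Hl1 Hp1]]]; [intros n; apply Hu|].
  destruct (H2 (fun n => snd (u (p1 n)))) as [l2 [p2 [Hl2 Hp2]]]; [intros n; apply Hu|].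
  exists (l1, l2), (fun n => p1 (p2 n)). split; [easy|].
  intros n. destruct (Hp1 (p2 n)) as [A1 B1]. destruct (Hp2 n) as [A2 B2].
  split; [lia|]. unfold distp; simpl. apply Rmax_lub_lt; [|easy].
  apply Rlt_le_trans with (1 := B1). now apply inv_INR1_le.
Qed.

Definition contd {T : Type} (dist : T -> T -> R) (K : T -> Prop) (f : T -> R) : Prop :=
  forall l, K l -> forall e, 0 < e -> exists d, 0 < d /\
    forall x, K x -> dist x l < d -> Rabs (f x - f l) < e.

Lemma bwc_bounded {T : Type} (dist : T -> T -> R) (K : T -> Prop) (f : T -> R) :
  bwc dist K -> contd dist K f -> exists c, forall x, K x -> f x <= c.
Proof.
  intros HK Hf. apply NNPP. intros Hn.
  assert (Hs : forall n : nat, { x | K x /\ INR n < f x }).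
  { intros n. apply constructive_indefinite_description. apply NNPP. intros Hn'.
    apply Hn. exists (INR n). intros x Hx. apply Rnot_lt_le. intros H. apply Hn'. now exists x. }
  destruct (HK (fun n => proj1_sig (Hs n))) as [l [p [Hl Hp]]].
  { intros n. apply (proj2_sig (Hs n)). }
  destruct (Hf l Hl 1 Rlt_0_1) as [d [Hd Hd']].
  destruct (inv_INR1_small d Hd) as [n1 Hn1].
  destruct (INR_unbounded (f l + 1)) as [n2 Hn2].
  set (n := (n1 + n2)%nat).
  destruct (Hp n) as [A B]; cbv beta in B.
  assert (C := proj2_sig (Hs (p n))). cbv beta in C. destruct C as [C1 C2].
  assert (D := Hd' _ C1).
  assert (/ (INR n + 1) <= / (INR n1 + 1)) by (apply inv_INR1_le; unfold n; lia).
  specialize (D ltac:(lra)). apply Rabs_def2 in D.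
  assert (INR n2 <= INR (p n)) by (apply le_INR; unfold n in *; lia).
  lra.
Qed.

Lemma bwc_max {T : Type} (dist : T -> T -> R) (K : T -> Prop) (f : T -> R) (a : T) :
  bwc dist K -> contd dist K f -> K a -> exists m, K m /\ forall x, K x -> f x <= f m.
Proof.
  intros HK Hf Ha.
  destruct (bwc_bounded dist K f HK Hf) as [c Hc].
  (* [Sup] ranges over a whole type, so the supremum over K is taken on the subtype. *)
  set (g := fun x : {x | K x} => f (proj1_sig x)).
  assert (Hg : forall x, g x <= c) by (intros [x Hx]; now apply Hc).
  set (x0 := exist K a Ha : {x | K x}).
  assert (Hs : forall n : nat, { x | Sup g - / (INR n + 1) < g x }).
  { intros n. apply constructive_indefinite_description.
    apply (Sup_approx g c _ x0 Hg), inv_INR1_pos. }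
  destruct (HK (fun n => proj1_sig (proj1_sig (Hs n)))) as [l [p [Hl Hp]]].
  { intros n. apply (proj2_sig (proj1_sig (Hs n))). }
  exists l. split; [easy|]. intros x Hx.
  apply Rle_trans with (Sup g).
  { apply (Sup_ub g c (exist K x Hx) Hg). }
  apply Rnot_lt_le. intros Hlt.
  set (e := (Sup g - f l) / 2). assert (He : 0 < e) by (unfold e; lra).
  destruct (Hf l Hl e He) as [d [Hd Hd']].
  destruct (inv_INR1_small d Hd) as [n1 Hn1].
  destruct (inv_INR1_small e He) as [n2 Hn2].
  set (n := (n1 + n2)%nat).
  destruct (Hp n) as [A B]; cbv beta in B.
  assert (C := proj2_sig (Hs (p n))). cbv beta in C.
  assert (D := Hd' _ (proj2_sig (proj1_sig (Hs (p n))))).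
  assert (/ (INR n + 1) <= / (INR n1 + 1)) by (apply inv_INR1_le; unfold n; lia).
  assert (/ (INR (p n) + 1) <= / (INR n2 + 1)) by (apply inv_INR1_le; unfold n in *; lia).
  assert (D2 := D (Rlt_trans _ _ _ (Rlt_le_trans _ _ _ B H) Hn1)). apply Rabs_def2 in D2.
  assert (C2 := Rlt_le_trans _ _ _ C (Rle_refl _)). unfold g at 2 in C2. unfold e in *. lra.
Qed.

Lemma bwc_heine {T : Type} (dist : T -> T -> R) (K : T -> Prop) (f : T -> R) :
  (forall a b c, dist a c <= dist a b + dist b c) ->
  bwc dist K -> contd dist K f ->
  forall e, 0 < e -> exists d, 0 < d /\
    forall x y, K x -> K y -> dist x y < d -> Rabs (f x - f y) < e.
Proof.
  intros Htri HK Hf e He. apply NNPP. intros Hn.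
  assert (Hs : forall n : nat, { xy | K (fst xy) /\ K (snd xy) /\
      dist (fst xy) (snd xy) < / (INR n + 1) /\ e <= Rabs (f (fst xy) - f (snd xy)) }).
  { intros n. apply constructive_indefinite_description. apply NNPP. intros Hn'.
    apply Hn. exists (/ (INR n + 1)). split; [apply inv_INR1_pos|].
    intros x y Hx Hy Hd. apply Rnot_le_lt. intros H. apply Hn'. now exists (x, y). }
  destruct (HK (fun n => snd (proj1_sig (Hs n)))) as [l [p [Hl Hp]]].
  { intros n. apply (proj2_sig (Hs n)). }
  destruct (Hf l Hl (e / 2) ltac:(lra)) as [d [Hd Hd']].
  destruct (inv_INR1_small (d / 2) ltac:(lra)) as [n Hn1].
  destruct (Hp n) as [A B]; cbv beta in B.
  destruct (proj2_sig (Hs (p n))) as [C1 [C2 [C3 C4]]].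
  set (x := fst (proj1_sig (Hs (p n)))) in *. set (y := snd (proj1_sig (Hs (p n)))) in *.
  assert (/ (INR (p n) + 1) <= / (INR n + 1)) by (now apply inv_INR1_le).
  assert (D1 := Hd' _ C1). assert (D2 := Hd' _ C2).
  assert (H1 := Htri x y l).
  specialize (D1 ltac:(lra)). specialize (D2 ltac:(lra)).
  apply Rabs_def2 in D1. apply Rabs_def2 in D2.
  assert (Rabs (f x - f y) < e); [|lra]. apply Rabs_def1; lra.
Qed.

Lemma dist1_tri a b c : dist1 a c <= dist1 a b + dist1 b c.
Proof.
  unfold dist1. replace (a - c) with ((a - b) + (b - c)) by ring. apply Rabs_triang.
Qed.

Lemma distp_tri {T1 T2 : Type} (d1 : T1 -> T1 -> R) (d2 : T2 -> T2 -> R) :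
  (forall a b c, d1 a c <= d1 a b + d1 b c) ->
  (forall a b c, d2 a c <= d2 a b + d2 b c) ->
  forall a b c, distp d1 d2 a c <= distp d1 d2 a b + distp d1 d2 b c.
Proof.
  intros H1 H2 a b c. unfold distp. apply Rmax_lub.
  - eapply Rle_trans; [apply (H1 _ (fst b))|]. apply Rplus_le_compat; apply Rmax_l.
  - eapply Rle_trans; [apply (H2 _ (snd b))|]. apply Rplus_le_compat; apply Rmax_r.
Qed.

Definition cont2 (f : R -> R -> R) : Prop :=
  forall x y e, 0 < e -> exists d, 0 < d /\
    forall x' y', Rabs (x' - x) < d -> Rabs (y' - y) < d -> Rabs (f x' y' - f x y) < e.

Lemma cont2_max (f : R -> R -> R) (r x0 y0 : R) :
  cont2 f ->
  (forall x y, r < Rabs x \/ r < Rabs y -> f x y <= f x0 y0) ->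
  exists x y, forall x' y', f x' y' <= f x y.
Proof.
  intros Hf Hout.
  (* The box is enlarged to contain (x0, y0), so that its maximum also dominates the values
     outside. *)
  set (r' := Rmax r (Rmax (Rabs x0) (Rabs y0))).
  assert (H1 : r <= r') by apply Rmax_l.
  assert (H2 : Rabs x0 <= r') by (eapply Rle_trans; [|apply Rmax_r]; apply Rmax_l).
  assert (H3 : Rabs y0 <= r') by (eapply Rle_trans; [|apply Rmax_r]; apply Rmax_r).
  apply Rabs_le_between in H2. apply Rabs_le_between in H3.
  destruct (bwc_max (distp dist1 dist1)
    (fun a => (- r' <= fst a <= r') /\ (- r' <= snd a <= r')) (fun a => f (fst a) (snd a)) (x0, y0))
    as [[mx my] [Km Hm]].
  - apply (bwc_prod dist1 dist1 (fun x => - r' <= x <= r') (fun x => - r' <= x <= r'));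
      apply bwc_interval.
  - intros [x y] _ e He. destruct (Hf x y e He) as [d [Hd Hd']].
    exists d. split; [easy|]. intros [x' y'] _ Hdist. simpl.
    unfold distp, dist1 in Hdist; simpl in Hdist.
    apply Hd'; eapply Rle_lt_trans; try exact Hdist; [apply Rmax_l|apply Rmax_r].
  - simpl. lra.
  - exists mx, my. intros x y. simpl in *.
    destruct (Rlt_le_dec r (Rabs x)) as [Hx|Hx]; [|destruct (Rlt_le_dec r (Rabs y)) as [Hy|Hy]].
    + apply Rle_trans with (f x0 y0); [auto|]. apply (Hm (x0, y0)). simpl; lra.
    + apply Rle_trans with (f x0 y0); [auto|]. apply (Hm (x0, y0)). simpl; lra.
    + apply (Hm (x, y)). simpl.
      apply Rabs_le_between in Hx. apply Rabs_le_between in Hy. lra.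
Qed.

Definition cont_on (a b : R) (f : R -> R) : Prop :=
  forall t, a <= t <= b -> forall e, 0 < e -> exists d, 0 < d /\
    forall s, a <= s <= b -> Rabs (s - t) < d -> Rabs (f s - f t) < e.

Lemma cont_on_sub a b a' b' f :
  a <= a' -> b' <= b -> cont_on a b f -> cont_on a' b' f.
Proof.
  intros Ha Hb Hf t Ht e He. destruct (Hf t ltac:(lra) e He) as [d [Hd Hd']].
  exists d. split; [easy|]. intros s Hs. apply Hd'. lra.
Qed.

(** Continuous induction: continuity keeps the inequality at the supremum of the good times, and the
    local hypothesis pushes it strictly beyond. *)
Lemma right_increments_mono (a b : R) (f : R -> R) :
  a <= b -> cont_on a b f ->
  (forall t, a <= t < b -> exists d, 0 < d /\ forall h, 0 < h < d -> f t <= f (t + h)) ->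
  f a <= f b.
Proof.
  intros Hab Hf Hloc.
  set (E := fun t => a <= t <= b /\ f a <= f t).
  destruct (completeness E) as [m [Hm1 Hm2]].
  - exists b. intros t [Ht _]. lra.
  - exists a. split; [lra|lra].
  - assert (Ham : a <= m) by (apply Hm1; split; lra).
    assert (Hmb : m <= b) by (apply Hm2; intros t [Ht _]; lra).
    assert (HEm : f a <= f m).
    { apply Rnot_lt_le. intros Hlt.
      destruct (Hf m ltac:(lra) (f a - f m) ltac:(lra)) as [d [Hd Hd']].
      assert (m <= m - d); [|lra].
      apply Hm2. intros t [Ht1 Ht2]. apply Rnot_lt_le. intros Hlt'.
      assert (t <= m) by (apply Hm1; now split).
      specialize (Hd' t Ht1). assert (Rabs (t - m) < d) by (apply Rabs_def1; lra).
      specialize (Hd' H0). apply Rabs_def2 in Hd'. lra. }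
    destruct (Req_dec m b) as [->|Hne]; [easy|].
    destruct (Hloc m ltac:(lra)) as [d [Hd Hd']].
    set (h := Rmin (d / 2) (b - m)).
    assert (0 < h) by (apply Rmin_glb_lt; lra).
    assert (h <= d / 2) by apply Rmin_l. assert (h <= b - m) by apply Rmin_r.
    assert (m + h <= m); [|lra].
    apply Hm1. split; [lra|]. specialize (Hd' h ltac:(lra)). lra.
Qed.

(** * Outer measure on the time axis *)

(** chi stands for the primitive of the indicator of an open set containing A: nondecreasing,
    1-Lipschitz, and of slope one around each point of A. The increments of such functions replace
    the measures of open covers. *)
Definition maj (A : R -> Prop) (chi : R -> R) : Prop :=
  (forall s t, s <= t -> 0 <= chi t - chi s <= t - s) /\
  (forall t, A t -> exists d, 0 < d /\
     forall s s', t - d < s -> s <= s' -> s' < t + d -> s' - s <= chi s' - chi s).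

Definition null (A : R -> Prop) : Prop :=
  forall e, 0 < e -> exists chi, maj A chi /\ forall s t, chi t - chi s <= e.

Lemma maj_id (A : R -> Prop) : maj A (fun t => t).
Proof. split; [intros; lra|]. intros t _. exists 1. split; intros; lra. Qed.

Lemma maj_sub (A B : R -> Prop) chi : (forall t, B t -> A t) -> maj A chi -> maj B chi.
Proof. intros H [H1 H2]. split; auto. Qed.

(* The right regularization sup_{h >= 0} (f (t + h) - K h) has slope exactly K wherever the
   "rising sun" condition holds. *)
Lemma maj_rising_sun (A : R -> Prop) (f : R -> R) (K c : R) :
  0 < K -> (forall s t, s <= t -> f s <= f t) -> (forall t, f t <= c) ->
  (forall t, A t -> exists d tau, 0 < d /\ t + d <= tau /\
     forall s, t - d < s < t + d -> f s - K * s <= f tau - K * tau) ->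
  exists chi, maj A chi /\ forall t, f t <= K * chi t <= c.
Proof.
  intros HK Hmono Hc HA.
  (* The absolute value encodes h >= 0 while the supremum ranges over all reals. *)
  set (F := fun t h => f (t + Rabs h) - K * Rabs h).
  assert (HF : forall t h, F t h <= c).
  { intros t h. unfold F. assert (H := Hc (t + Rabs h)). assert (H' := Rabs_pos h). nra. }
  set (G := fun t => Sup (F t)).
  assert (Hge : forall t tau, t <= tau -> f tau - K * (tau - t) <= G t).
  { intros t tau Htau. assert (H := Sup_ub (F t) c (tau - t) (HF t)).
    unfold F at 1 in H. rewrite Rabs_pos_eq in H by lra.
    replace (t + (tau - t)) with tau in H by ring. exact H. }
  assert (Hle : forall t b, (forall tau, t <= tau -> f tau - K * (tau - t) <= b) -> G t <= b).
  { intros t b Hb. unfold G. apply (Sup_le _ _ 0). intros h. unfold F.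
    specialize (Hb (t + Rabs h)). assert (H := Rabs_pos h).
    replace (t + Rabs h - t) with (Rabs h) in Hb by ring. apply Hb. lra. }
  assert (Gmono : forall s t, s <= t -> G s <= G t).
  { intros s t Hst. apply (Sup_le _ _ 0). intros h.
    eapply Rle_trans; [|apply (Hge t (t + Rabs h)); assert (H := Rabs_pos h); lra].
    unfold F. assert (H := Hmono (s + Rabs h) (t + Rabs h) ltac:(lra)). lra. }
  assert (Glip : forall s t, s <= t -> G t <= G s + K * (t - s)).
  { intros s t Hst. apply Hle. intros tau Htau. assert (H := Hge s tau ltac:(lra)). lra. }
  exists (fun t => / K * G t).
  assert (HKG : forall t, K * (/ K * G t) = G t) by (intros t; field; lra).
  assert (HiK := Rinv_0_lt_compat K HK).
  assert (HdivG : forall x y, 0 <= y -> x <= K * y -> / K * x <= y).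
  { intros x y Hy Hxy. apply Rmult_le_reg_l with K; [easy|].
    replace (K * (/ K * x)) with x by (field; lra). easy. }
  split; [split|].
  - intros s t Hst. assert (H1 := Gmono s t Hst). assert (H2 := Glip s t Hst).
    replace (/ K * G t - / K * G s) with (/ K * (G t - G s)) by ring. split.
    + apply Rmult_le_pos; lra.
    + apply HdivG; lra.
  - intros t Ht. destruct (HA t Ht) as [d [tau [Hd [Htau Hs]]]].
    exists d. split; [easy|]. intros s s' H1 H2 H3.
    (* Times u in [s, s'] do no better than tau, which lies beyond s'. So the supremum at s is the
       one at s' lowered by K (s' - s). *)
    assert (HG : G s <= G s' - K * (s' - s)).
    { apply Hle. intros u Hu. destruct (Rle_lt_dec s' u) as [H4|H4].
      - assert (H := Hge s' u H4). lra.
      - assert (H := Hge s' tau ltac:(lra)). assert (H' := Hs u ltac:(lra)). lra. }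
    replace (/ K * G s' - / K * G s) with (/ K * (G s' - G s)) by ring.
    apply Rmult_le_reg_l with K; [easy|].
    replace (K * (/ K * (G s' - G s))) with (G s' - G s) by (field; lra). lra.
  - intros t. rewrite HKG. split.
    + assert (H := Hge t t (Rle_refl t)). lra.
    + apply Hle. intros tau Htau. assert (H := Hc tau). nra.
Qed.

(** Mirror image of [maj_rising_sun], obtained by reversing both time and sign. *)
Lemma maj_setting_sun (A : R -> Prop) (f : R -> R) (K c : R) :
  0 < K -> (forall s t, s <= t -> f s <= f t) -> (forall t, c <= f t) ->
  (forall t, A t -> exists d tau, 0 < d /\ tau <= t - d /\
     forall s, t - d < s < t + d -> f tau - K * tau <= f s - K * s) ->
  exists chi, maj A chi /\ forall t, c <= K * chi t <= f t.
Proof.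
  intros HK Hmono Hc HA.
  destruct (maj_rising_sun (fun t => A (- t)) (fun t => - f (- t)) K (- c) HK)
    as [chi [[H1 H2] H3]].
  - intros s t Hst. apply Ropp_le_contravar, Hmono. lra.
  - intros t. apply Ropp_le_contravar, Hc.
  - intros t Ht. destruct (HA _ Ht) as [d [tau [Hd [Htau Hs]]]].
    exists d, (- tau). split; [easy|split; [lra|]].
    intros s Hs'. assert (H := Hs (- s) ltac:(lra)). rewrite Ropp_involutive. lra.
  - exists (fun t => - chi (- t)). split; [split|].
    + intros s t Hst. assert (H := H1 (- t) (- s) ltac:(lra)). lra.
    + intros t Ht. destruct (H2 (- t)) as [d [Hd Hd']]; [now rewrite Ropp_involutive|].
      exists d. split; [easy|]. intros s s' Hs1 Hs2 Hs3.
      assert (H := Hd' (- s') (- s) ltac:(lra) ltac:(lra) ltac:(lra)). lra.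
    + intros t. assert (H := H3 (- t)). rewrite Ropp_involutive in H. lra.
Qed.

Definition glue (s : R) (chi1 chi2 : R -> R) (u : R) : R :=
  if Rle_dec u s then chi1 u else chi1 s + chi2 u - chi2 s.

Lemma glue_l s chi1 chi2 u : u <= s -> glue s chi1 chi2 u = chi1 u.
Proof. intros H. unfold glue. now destruct (Rle_dec u s). Qed.

Lemma glue_r s chi1 chi2 u : s <= u -> glue s chi1 chi2 u = chi1 s + chi2 u - chi2 s.
Proof.
  intros H. unfold glue. destruct (Rle_dec u s) as [H'|H']; [|easy].
  replace u with s by lra. ring.
Qed.

(** Cutting and pasting of majorants underlies the additivity of the outer measure on adjacent
    intervals. At t = s both conditions are required, since every neighbourhood of s meets both
    sides. *)
Lemma maj_glue (A1 A2 : R -> Prop) (s : R) (chi1 chi2 : R -> R) :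
  maj A1 chi1 -> maj A2 chi2 ->
  maj (fun t => (t <= s -> A1 t) /\ (s <= t -> A2 t)) (glue s chi1 chi2).
Proof.
  intros [H1 H1'] [H2 H2']. split.
  - intros u v Huv.
    destruct (Rle_lt_dec v s) as [Hv|Hv]; [|destruct (Rle_lt_dec u s) as [Hu|Hu]].
    + rewrite !glue_l by lra. auto.
    + rewrite (glue_l s _ _ u) by lra. rewrite glue_r by lra.
      assert (Ha := H1 u s Hu). assert (Hb := H2 s v ltac:(lra)). lra.
    + rewrite !glue_r by lra. assert (Hb := H2 u v Huv). lra.
  - intros t [Ht1 Ht2].
    assert (E1 : exists d, 0 < d /\ forall u u', t - d < u -> u <= u' -> u' < t + d -> u' <= s ->
              u' - u <= chi1 u' - chi1 u).
    { destruct (Rle_lt_dec t s) as [Hts|Hts].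
      - destruct (H1' t (Ht1 Hts)) as [d [Hd Hd']]. exists d. split; auto.
      - exists (t - s). split; [lra|]. intros; lra. }
    assert (E2 : exists d, 0 < d /\ forall u u', t - d < u -> u <= u' -> u' < t + d -> s <= u ->
              u' - u <= chi2 u' - chi2 u).
    { destruct (Rle_lt_dec s t) as [Hts|Hts].
      - destruct (H2' t (Ht2 Hts)) as [d [Hd Hd']]. exists d. split; auto.
      - exists (s - t). split; [lra|]. intros; lra. }
    destruct E1 as [d1 [Hd1 E1]]. destruct E2 as [d2 [Hd2 E2]].
    exists (Rmin d1 d2). assert (Hm1 := Rmin_l d1 d2). assert (Hm2 := Rmin_r d1 d2).
    split; [now apply Rmin_glb_lt|]. intros u v Hu Huv Hv.
    destruct (Rle_lt_dec v s) as [Hvs|Hvs]; [|destruct (Rle_lt_dec u s) as [Hus|Hus]].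
    + rewrite !glue_l by lra. apply E1; lra.
    + rewrite (glue_l s _ _ u) by lra. rewrite glue_r by lra.
      destruct (Rle_lt_dec s (t - Rmin d1 d2)) as [Hc|Hc]; [lra|].
      assert (Ha := E1 u s ltac:(lra) ltac:(lra) ltac:(lra) ltac:(lra)).
      assert (Hb := E2 s v ltac:(lra) ltac:(lra) ltac:(lra) ltac:(lra)). lra.
    + rewrite !glue_r by lra.
      assert (Hb := E2 u v ltac:(lra) ltac:(lra) ltac:(lra) ltac:(lra)). lra.
Qed.

(* theta A a t is the outer measure of A between a and t. *)
Definition theta (A : R -> Prop) (a t : R) : R :=
  - Sup (fun c : {chi | maj A chi} => proj1_sig c a - proj1_sig c t).

Lemma theta_le A a t chi : a <= t -> maj A chi -> theta A a t <= chi t - chi a.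
Proof.
  intros Hat Hchi. unfold theta.
  assert (H := Sup_ub (fun c : {chi | maj A chi} => proj1_sig c a - proj1_sig c t) 0 (exist _ chi Hchi)).
  simpl in H. assert (chi a - chi t <= Sup (fun c : {chi | maj A chi} => proj1_sig c a - proj1_sig c t)); [|lra].
  apply H. intros [c [Hc1 Hc2]]. simpl. assert (H' := Hc1 a t Hat). lra.
Qed.

Lemma theta_ge A a t b : (forall chi, maj A chi -> b <= chi t - chi a) -> b <= theta A a t.
Proof.
  intros Hb. unfold theta.
  assert (Sup (fun c : {chi | maj A chi} => proj1_sig c a - proj1_sig c t) <= - b); [|lra].
  apply (Sup_le _ _ (exist _ (fun t => t) (maj_id A))). intros [chi Hchi]. simpl.
  specialize (Hb chi Hchi). lra.
Qed.

Lemma theta_approx A a t e : a <= t -> 0 < e -> exists chi, maj A chi /\ chi t - chi a < theta A a t + e.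
Proof.
  intros Hat He. apply NNPP. intros Hn.
  assert (theta A a t + e <= theta A a t); [|lra].
  apply theta_ge. intros chi Hchi. apply Rnot_lt_le. intros H. apply Hn. now exists chi.
Qed.

(** A nearly optimal majorant up to s, continued by chi, is almost a majorant of A up to t; only the
    two end points s and t escape chi. *)
Lemma theta_incr_le A a s t chi :
  a <= s -> s <= t -> maj (fun u => s < u < t /\ A u) chi ->
  theta A a t - theta A a s <= chi t - chi s.
Proof.
  intros Has Hst Hchi. apply le_epsilon. intros e He.
  destruct (Req_dec s t) as [->|Hne]; [lra|].
  destruct (theta_approx A a s (e / 3) Has ltac:(lra)) as [chi0 [Hchi0 H0]].
  set (e' := Rmin (e / 3) ((t - s) / 2)).
  assert (He' : 0 < e') by (apply Rmin_glb_lt; lra).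
  assert (He1 : e' <= e / 3) by apply Rmin_l. assert (He2 : e' <= (t - s) / 2) by apply Rmin_r.
  (* The identity on [s, s + e'] and after t - e' covers the end points, at a cost of 2 e' on
     [s, t]. *)
  set (x := glue s chi0 (glue (s + e') (fun t => t) (glue (t - e') chi (fun t => t)))).
  assert (Hx : maj A x).
  { apply maj_sub with (2 := maj_glue _ _ s _ _ Hchi0 (maj_glue _ _ (s + e') _ _ (maj_id A)
      (maj_glue _ _ (t - e') _ _ Hchi (maj_id A)))).
    intros u Hu. cbv beta. repeat split; intros; try easy; try lra. }
  assert (H := theta_le A a t x ltac:(lra) Hx).
  assert (Hxa : x a = chi0 a) by (apply glue_l; lra).
  assert (Hxt : x t = chi0 s + e' + (chi (t - e') - chi (s + e')) + e').
  { unfold x. rewrite glue_r by lra. rewrite (glue_r (s + e')) by lra.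
    rewrite (glue_l (s + e') _ _ s) by lra. rewrite (glue_r (t - e')) by lra.
    rewrite (glue_l (t - e')) by lra. ring. }
  destruct Hchi as [Hm _]. assert (Ha := Hm s (s + e') ltac:(lra)).
  assert (Hb := Hm (t - e') t ltac:(lra)). lra.
Qed.

Lemma theta_incr A a s t : a <= s -> s <= t -> 0 <= theta A a t - theta A a s <= t - s.
Proof.
  intros Has Hst. split.
  - assert (theta A a s <= theta A a t); [|lra]. apply theta_ge. intros chi Hchi.
    eapply Rle_trans; [apply (theta_le A a s chi Has Hchi)|].
    destruct Hchi as [Hm _]. assert (H := Hm s t Hst). lra.
  - apply (theta_incr_le A a s t (fun t => t) Has Hst (maj_id _)).
Qed.

Definition clip (a b t : R) : R := Rmax a (Rmin t b).

Lemma clip_in a b t : a <= t <= b -> clip a b t = t.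
Proof. intros [H1 H2]. unfold clip. rewrite Rmin_left, Rmax_right; lra. Qed.

Lemma clip_range a b t : a <= b -> a <= clip a b t <= b.
Proof.
  intros H. unfold clip. split; [apply Rmax_l|]. apply Rmax_lub; [easy|apply Rmin_r].
Qed.

Lemma clip_mono a b s t : s <= t -> clip a b s <= clip a b t.
Proof.
  intros H. unfold clip. apply Rle_max_compat_l. now apply Rle_min_compat_r.
Qed.

Lemma clip_lip a b s t : a <= b -> Rabs (clip a b s - clip a b t) <= Rabs (s - t).
Proof.
  intros H. unfold clip, Rmax, Rmin.
  repeat destruct (Rle_dec _ _); unfold Rabs; repeat destruct (Rcase_abs _); lra.
Qed.

Definition mono_on (a b : R) (f : R -> R) : Prop :=
  forall s t, a <= s -> s <= t -> t <= b -> f s <= f t.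

Lemma clip_cont a b f : a <= b -> cont_on a b f -> forall t e, 0 < e -> exists d, 0 < d /\
  forall s, Rabs (s - t) < d -> Rabs (f (clip a b s) - f (clip a b t)) < e.
Proof.
  intros Hab Hf t e He.
  destruct (Hf (clip a b t) (clip_range a b t Hab) e He) as [d [Hd Hd']].
  exists d. split; [easy|]. intros s Hs. apply Hd'; [now apply clip_range|].
  eapply Rle_lt_trans; [now apply clip_lip|easy].
Qed.

(** F. Riesz's inequality: if f has right difference quotients above K at every point of A, then K
    times the outer measure of A is at most the increase of f. *)
Lemma maj_right_steep (a b : R) (f : R -> R) (K : R) (A : R -> Prop) :
  a <= b -> cont_on a b f -> mono_on a b f -> 0 < K ->
  (forall t, A t -> a < t < b /\ forall d, 0 < d -> exists s, t < s < t + d /\ K * (s - t) < f s - f t) ->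
  exists chi, maj A chi /\ forall t, f (clip a b t) <= K * chi t <= f b.
Proof.
  intros Hab Hf Hm HK HA.
  apply (maj_rising_sun A (fun t => f (clip a b t)) K (f b) HK).
  - intros s t Hst. assert (H1 := clip_range a b s Hab). assert (H2 := clip_range a b t Hab).
    apply Hm; [lra| |lra]. now apply clip_mono.
  - intros t. assert (H1 := clip_range a b t Hab). apply Hm; lra.
  - intros t Ht. destruct (HA t Ht) as [Htab Hst].
    destruct (Hst (b - t) ltac:(lra)) as [tau [Htau1 Htau2]].
    set (gap := f tau - f t - K * (tau - t)). assert (Hgap : 0 < gap) by (unfold gap; lra).
    destruct (clip_cont a b f Hab Hf t (gap / 2) ltac:(lra)) as [d [Hd Hd']].
    (* Half of the gap pays for the oscillation of f near t, the other half for the term K (t -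
       s). *)
    set (d' := Rmin d (Rmin (tau - t) (gap / (2 * K)))).
    assert (Hg2 : 0 < gap / (2 * K)) by (apply Rdiv_lt_0_compat; lra).
    assert (0 < d') by (repeat apply Rmin_glb_lt; lra).
    assert (d' <= d) by apply Rmin_l.
    assert (d' <= tau - t) by (eapply Rle_trans; [apply Rmin_r|apply Rmin_l]).
    assert (Hdg : d' <= gap / (2 * K)) by (eapply Rle_trans; [apply Rmin_r|apply Rmin_r]).
    exists d', tau. split; [easy|split; [lra|]]. intros s Hs.
    assert (Hs' : Rabs (s - t) < d) by (apply Rabs_def1; lra).
    apply Hd' in Hs'. apply Rabs_def2 in Hs'.
    rewrite (clip_in a b t) in Hs' by lra. rewrite (clip_in a b tau) by lra.
    assert (K * (t - s) <= gap / 2).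
    { apply Rle_trans with (K * (gap / (2 * K))); [apply Rmult_le_compat_l; lra|].
      right. field. lra. }
    unfold gap in *. lra.
Qed.

Lemma maj_left_steep (a b : R) (f : R -> R) (K : R) (A : R -> Prop) :
  a <= b -> cont_on a b f -> mono_on a b f -> 0 < K ->
  (forall t, A t -> a < t < b /\ forall d, 0 < d -> exists s, t - d < s < t /\ K * (t - s) < f t - f s) ->
  exists chi, maj A chi /\ forall t, f a <= K * chi t <= f (clip a b t).
Proof.
  intros Hab Hf Hm HK HA.
  apply (maj_setting_sun A (fun t => f (clip a b t)) K (f a) HK).
  - intros s t Hst. assert (H1 := clip_range a b s Hab). assert (H2 := clip_range a b t Hab).
    apply Hm; [lra| |lra]. now apply clip_mono.
  - intros t. assert (H1 := clip_range a b t Hab). apply Hm; lra.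
  - intros t Ht. destruct (HA t Ht) as [Htab Hst].
    destruct (Hst (t - a) ltac:(lra)) as [tau [Htau1 Htau2]].
    set (gap := f t - f tau - K * (t - tau)). assert (Hgap : 0 < gap) by (unfold gap; lra).
    destruct (clip_cont a b f Hab Hf t (gap / 2) ltac:(lra)) as [d [Hd Hd']].
    set (d' := Rmin d (Rmin (t - tau) (gap / (2 * K)))).
    assert (Hg2 : 0 < gap / (2 * K)) by (apply Rdiv_lt_0_compat; lra).
    assert (0 < d') by (repeat apply Rmin_glb_lt; lra).
    assert (d' <= d) by apply Rmin_l.
    assert (d' <= t - tau) by (eapply Rle_trans; [apply Rmin_r|apply Rmin_l]).
    assert (Hdg : d' <= gap / (2 * K)) by (eapply Rle_trans; [apply Rmin_r|apply Rmin_r]).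
    exists d', tau. split; [easy|split; [lra|]]. intros s Hs.
    assert (Hs' : Rabs (s - t) < d) by (apply Rabs_def1; lra).
    apply Hd' in Hs'. apply Rabs_def2 in Hs'.
    rewrite (clip_in a b t) in Hs' by lra. rewrite (clip_in a b tau) by lra.
    assert (K * (s - t) <= gap / 2).
    { apply Rle_trans with (K * (gap / (2 * K))); [apply Rmult_le_compat_l; lra|].
      right. field. lra. }
    unfold gap in *. lra.
Qed.

Lemma theta_cont A a b : cont_on a b (theta A a).
Proof.
  intros t Ht e He. exists e. split; [easy|]. intros s Hs Hst.
  apply Rabs_def2 in Hst. destruct (Rle_lt_dec s t) as [H|H].
  - assert (H1 := theta_incr A a s t ltac:(lra) ltac:(lra)). apply Rabs_def1; lra.
  - assert (H1 := theta_incr A a t s ltac:(lra) ltac:(lra)). apply Rabs_def1; lra.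
Qed.

Lemma maj_cont A chi a b : maj A chi -> cont_on a b chi.
Proof.
  intros [Hm _] t Ht e He. exists e. split; [easy|]. intros s Hs Hst.
  apply Rabs_def2 in Hst. destruct (Rle_lt_dec s t) as [H|H].
  - assert (H1 := Hm s t ltac:(lra)). apply Rabs_def1; lra.
  - assert (H1 := Hm t s ltac:(lra)). apply Rabs_def1; lra.
Qed.

Lemma cont_on_minus a b f g : cont_on a b f -> cont_on a b g -> cont_on a b (fun t => f t - g t).
Proof.
  intros Hf Hg t Ht e He.
  destruct (Hf t Ht (e / 2) ltac:(lra)) as [d1 [Hd1 H1]].
  destruct (Hg t Ht (e / 2) ltac:(lra)) as [d2 [Hd2 H2]].
  exists (Rmin d1 d2). split; [now apply Rmin_glb_lt|]. intros s Hs Hst.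
  assert (Ha := H1 s Hs (Rlt_le_trans _ _ _ Hst (Rmin_l _ _))).
  assert (Hb := H2 s Hs (Rlt_le_trans _ _ _ Hst (Rmin_r _ _))).
  apply Rabs_def2 in Ha. apply Rabs_def2 in Hb. apply Rabs_def1; lra.
Qed.

(* Where a set has positive outer measure, its outer density is one. *)
Lemma null_low_density (A E : R -> Prop) (a b eta : R) :
  a <= b -> 0 < eta ->
  (forall t, E t -> A t /\ a < t < b /\ forall d, 0 < d ->
     exists s, t < s < t + d /\ theta A a s - theta A a t < (1 - eta) * (s - t)) ->
  null E.
Proof.
  intros Hab Heta HE e He.
  destruct (theta_approx A a b (e * (eta / 2)) Hab ltac:(nra)) as [chi [Hchi Hb]].
  (* xi is nondecreasing and increases by at most e eta / 2 in all. At a point of E, chi has slope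
     one and [theta] has right quotients below 1 - eta, so xi is steeper than eta / 2 there and
     Riesz's inequality bounds the measure of E by e. *)
  set (xi := fun t => chi t - theta A a t).
  assert (Hxi : mono_on a b xi).
  { intros s t Hs Hst Ht. unfold xi.
    assert (H := theta_incr_le A a s t chi Hs Hst (maj_sub _ _ _ (fun u H => proj2 H) Hchi)). lra. }
  destruct (maj_right_steep a b xi (eta / 2) E Hab) as [x [Hx Hx']].
  - apply cont_on_minus; [eapply maj_cont; eauto|apply theta_cont].
  - exact Hxi.
  - lra.
  - intros t Ht. destruct (HE t Ht) as [HAt [Htab Hst]]. split; [easy|].
    intros d Hd. destruct (proj2 Hchi t HAt) as [d1 [Hd1 Hd1']].
    destruct (Hst (Rmin d d1)) as [s [Hs1 Hs2]]; [now apply Rmin_glb_lt|].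
    assert (Hm1 := Rmin_l d d1). assert (Hm2 := Rmin_r d d1).
    exists s. split; [lra|]. unfold xi.
    assert (H := Hd1' t s ltac:(lra) ltac:(lra) ltac:(lra)). nra.
  - exists x. split; [easy|]. intros s t.
    assert (H1 := Hx' s). assert (H2 := Hx' t).
    assert (H3 := Hxi a (clip a b s) ltac:(lra)). assert (H4 := clip_range a b s Hab).
    specialize (H3 ltac:(lra) ltac:(lra)).
    assert (Ht0 : 0 <= theta A a a) by (apply theta_ge; intros; lra).
    assert (theta A a a <= 0).
    { apply Rle_trans with (a - a); [apply (theta_le A a a (fun t => t) (Rle_refl a) (maj_id A))|lra]. }
    unfold xi in *. apply Rmult_le_reg_l with (eta / 2); lra.
Qed.

(* The heart of Lebesgue's theorem on the differentiation of monotone functions. *)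
Lemma null_corner (f : R -> R) (a b r q : R) (N : R -> Prop) :
  a <= b -> cont_on a b f -> mono_on a b f -> 0 < r -> r < q ->
  (forall t, N t -> a < t < b /\
     (forall d, 0 < d -> exists s, t - d < s < t /\ f t - f s < r * (t - s)) /\
     (forall d, 0 < d -> exists s, t < s < t + d /\ q * (s - t) < f s - f t)) ->
  null N.
Proof.
  intros Hab Hf Hm Hr Hrq HN e He.
  (* Right quotients above q: on every subinterval f increases by at least q times the outer measure
     of N. *)
  assert (C1 : forall s t, a <= s -> s <= t -> t <= b ->
            q * (theta N a t - theta N a s) <= f t - f s).
  { intros s t Hs Hst Ht.
    destruct (maj_right_steep s t f q (fun u => s < u < t /\ N u) Hst) as [x [Hx Hx']].
    - now apply cont_on_sub with a b.
    - intros u v Hu Huv Hv. apply Hm; lra.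
    - lra.
    - intros u [Hu HNu]. split; [easy|]. intros d Hd. apply (HN u HNu). easy.
    - assert (H := theta_incr_le N a s t x Hs Hst Hx).
      assert (H1 := Hx' s). assert (H2 := Hx' t).
      rewrite clip_in in H1 by lra. rewrite clip_in in H2 by lra.
      apply Rle_trans with (q * (x t - x s)); [apply Rmult_le_compat_l; lra|lra]. }
  (* To the left of a point of N, f grows slower than r, so by [C1] the outer measure of N grows
     slower than r / q, whereas chi grows with slope one. Hence the left quotients of xi exceed 1 -
     r / q, which is more than k. *)
  set (k := (1 - r / q) / 2).
  assert (Hrq' : r / q < 1) by (apply Rmult_lt_reg_r with q; [lra|]; unfold Rdiv;
    rewrite Rmult_assoc, Rinv_l by lra; lra).
  assert (Hk : 0 < k) by (unfold k; lra).
  destruct (theta_approx N a b (e * k) Hab ltac:(nra)) as [chi [Hchi Hb]].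
  set (xi := fun t => chi t - theta N a t).
  assert (Hxi : mono_on a b xi).
  { intros s t Hs Hst Ht. unfold xi.
    assert (H := theta_incr_le N a s t chi Hs Hst (maj_sub _ _ _ (fun u H => proj2 H) Hchi)). lra. }
  destruct (maj_left_steep a b xi k N Hab) as [x [Hx Hx']].
  - apply cont_on_minus; [eapply maj_cont; eauto|apply theta_cont].
  - exact Hxi.
  - exact Hk.
  - intros t Ht. destruct (HN t Ht) as [Htab [Hl _]]. split; [easy|].
    intros d Hd. destruct (proj2 Hchi t Ht) as [d1 [Hd1 Hd1']].
    set (d2 := Rmin (Rmin d d1) (t - a)).
    assert (Hm0 : 0 < d2) by (repeat apply Rmin_glb_lt; lra).
    assert (Hm1 : d2 <= d) by (eapply Rle_trans; [apply Rmin_l|apply Rmin_l]).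
    assert (Hm2 : d2 <= d1) by (eapply Rle_trans; [apply Rmin_l|apply Rmin_r]).
    assert (Hm3 : d2 <= t - a) by apply Rmin_r.
    destruct (Hl d2 Hm0) as [s [Hs1 Hs2]].
    exists s. split; [lra|]. unfold xi.
    assert (H := Hd1' s t ltac:(lra) ltac:(lra) ltac:(lra)).
    assert (H' := C1 s t ltac:(lra) ltac:(lra) ltac:(lra)).
    assert (theta N a t - theta N a s < (r / q) * (t - s)).
    { apply Rmult_lt_reg_l with q; [lra|].
      replace (q * (r / q * (t - s))) with (r * (t - s)) by (field; lra). lra. }
    unfold k. nra.
  - exists x. split; [easy|]. intros s t.
    assert (H1 := Hx' s). assert (H2 := Hx' t).
    assert (H4 := clip_range a b t Hab).
    assert (H3 := Hxi (clip a b t) b ltac:(lra) ltac:(lra) ltac:(lra)).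
    assert (Ht0 : 0 <= theta N a a) by (apply theta_ge; intros; lra).
    assert (theta N a a <= 0).
    { apply Rle_trans with (a - a); [apply (theta_le N a a (fun t => t) (Rle_refl a) (maj_id N))|lra]. }
    unfold xi in *. apply Rmult_le_reg_l with k; lra.
Qed.

Lemma le_small_mult (x y : R) : (forall e, 0 < e < 1 -> x <= e * y) -> x <= 0.
Proof.
  intros H. apply Rnot_lt_le. intros Hx.
  assert (H0 := H (/ 2) ltac:(lra)).
  assert (Hy : 0 < y) by lra.
  set (e := Rmin (/ 2) (x / (2 * y))).
  assert (He0 : 0 < x / (2 * y)) by (apply Rdiv_lt_0_compat; lra).
  assert (He : 0 < e) by (apply Rmin_glb_lt; lra).
  assert (He1 : e <= / 2) by apply Rmin_l. assert (He2 : e <= x / (2 * y)) by apply Rmin_r.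
  assert (H1 := H e ltac:(lra)).
  assert (e * y <= x / (2 * y) * y) by (apply Rmult_le_compat_r; lra).
  replace (x / (2 * y) * y) with (x / 2) in H2 by (field; lra). lra.
Qed.

Lemma null_union (A : nat -> R -> Prop) :
  (forall n, null (A n)) -> null (fun t => exists n, A n t).
Proof.
  intros HA e He.
  (* The weights sum up to e / 4. *)
  set (c := fun n : nat => e / 8 * (/ 2) ^ n).
  assert (Hc : forall n, 0 < c n).
  { intros n. unfold c. apply Rmult_lt_0_compat; [lra|]. apply pow_lt. lra. }
  assert (Hs : forall n, { chi | maj (A n) chi /\ forall s t, chi t - chi s <= c n }).
  { intros n. apply constructive_indefinite_description. apply HA, Hc. }
  set (x := fun n t => proj1_sig (Hs n) t - proj1_sig (Hs n) 0).
  assert (Hx : forall n t, Rabs (x n t) <= c n).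
  { intros n t. unfold x. destruct (Hs n) as [chi [H1 H2]]. simpl.
    assert (Ha := H2 0 t). assert (Hb := H2 t 0). apply Rabs_le. lra. }
  assert (Hxm : forall n s t, s <= t -> 0 <= x n t - x n s).
  { intros n s t Hst. unfold x. destruct (Hs n) as [chi [H1 H2]]. simpl.
    assert (H := proj1 H1 s t Hst). lra. }
  assert (Hcs : is_series c (e / 4)).
  { unfold c. replace (e / 4) with (scal (e / 8) (/ (1 - / 2))).
    - apply (is_series_scal (e / 8) (fun n => (/ 2) ^ n)).
      apply is_series_geom. rewrite Rabs_pos_eq; lra.
    - unfold scal; simpl; unfold mult; simpl. field. }
  assert (Hex : forall t, ex_series (fun n => x n t)).
  { intros t. apply (ex_series_le (fun n => x n t) c).
    - intros n. apply Hx.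
    - now exists (e / 4). }
  set (X := fun t => Series (fun n => x n t)).
  assert (HX : forall t, Rabs (X t) <= e / 4).
  { intros t. rewrite <- (is_series_unique _ _ Hcs).
    eapply Rle_trans; [apply Series_Rabs|].
    - apply (ex_series_le (fun n => Rabs (x n t)) c).
      + intros n. unfold norm; simpl; unfold abs; simpl. rewrite Rabs_Rabsolu. apply Hx.
      + now exists (e / 4).
    - apply Series_le; [|now exists (e / 4)]. intros n. split; [apply Rabs_pos|apply Hx]. }
  assert (Hinc : forall s t, s <= t -> forall n, x n t - x n s <= X t - X s).
  { intros s t Hst n. unfold X. rewrite <- Series_minus by apply Hex.
    set (y := fun k => x k t - x k s).
    assert (Hy : ex_series y).
    { apply (ex_series_minus (fun k => x k t) (fun k => x k s)); apply Hex. }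
    assert (Hyp : forall k, 0 <= y k) by (intros k; now apply Hxm).
    change (y n <= Series y).
    apply Rle_trans with (sum_n y n).
    - destruct n as [|n]; [rewrite sum_O; lra|]. rewrite sum_Sn. unfold plus; simpl.
      assert (0 <= sum_n y n); [|lra]. rewrite sum_n_Reals. apply cond_pos_sum. exact Hyp.
    - rewrite sum_n_Reals. apply sum_incr.
      + apply is_series_Reals. now apply Series_correct.
      + exact Hyp. }
  (* The sum X of the majorants need not be 1-Lipschitz; the rising sun function restores this. With
     K = 1/2 the bounds - e / 4 <= X <= chi / 2 <= e / 4 limit the total increase of chi to e. *)
  destruct (maj_rising_sun (fun t => exists n, A n t) X (/ 2) (e / 4) ltac:(lra)) as [chi [H1 H2]].
  - intros s t Hst. assert (H := Hinc s t Hst O). assert (H' := Hxm O s t Hst). lra.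
  - intros t. assert (H := HX t). apply Rabs_le_between in H. lra.
  - intros t [n Hn].
    destruct (proj2 (proj1 (proj2_sig (Hs n))) t Hn) as [d [Hd Hd']].
    exists (d / 2), (t + d / 2). split; [lra|split; [lra|]]. intros s Hst.
    assert (H := Hd' s (t + d / 2) ltac:(lra) ltac:(lra) ltac:(lra)).
    assert (H' := Hinc s (t + d / 2) ltac:(lra) n). unfold x in H'. lra.
  - exists chi. split; [easy|]. intros s t.
    assert (Ha := H2 s). assert (Hb := H2 t). assert (H := HX s). apply Rabs_le_between in H. lra.
Qed.

(** q belongs to the superdifferential of Phi at t, with a two-sided neighbourhood of t. *)
Definition touch_above (Phi : R -> R) (t q : R) : Prop :=
  forall e, 0 < e -> exists d, 0 < d /\ forall s, Rabs (s - t) < d ->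
    Phi s <= Phi t + q * (s - t) + e * Rabs (s - t).

Lemma touch_above_linear Phi t q c : touch_above (fun s => Phi s + c * s) t q -> touch_above Phi t (q - c).
Proof.
  intros H e He. destruct (H e He) as [d [Hd Hd']]. exists d. split; [easy|].
  intros s Hs. specialize (Hd' s Hs). lra.
Qed.

Lemma cont_on_plus_linear a b f c : cont_on a b f -> cont_on a b (fun t => f t + c * t).
Proof.
  intros Hf t Ht e He. destruct (Hf t Ht (e / 2) ltac:(lra)) as [d [Hd Hd']].
  assert (Hc : 0 < 2 * (Rabs c + 1)) by (assert (H := Rabs_pos c); lra).
  exists (Rmin d (e / (2 * (Rabs c + 1)))). split.
  - apply Rmin_glb_lt; [easy|]. now apply Rdiv_lt_0_compat.
  - intros s Hs Hst. assert (H1 := Hd' s Hs (Rlt_le_trans _ _ _ Hst (Rmin_l _ _))).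
    assert (H2 := Rlt_le_trans _ _ _ Hst (Rmin_r _ _)).
    replace (f s + c * s - (f t + c * t)) with ((f s - f t) + c * (s - t)) by ring.
    eapply Rle_lt_trans; [apply Rabs_triang|]. rewrite Rabs_mult.
    assert (H3 : (Rabs c + 1) * Rabs (s - t) < e / 2).
    { apply Rlt_le_trans with ((Rabs c + 1) * (e / (2 * (Rabs c + 1)))).
      - apply Rmult_lt_compat_l; lra.
      - right. field. lra. }
    assert (H4 := Rabs_pos (s - t)). nra.
Qed.

(** If Phi decreased from s to t, a function of strictly negative slope could be made to touch it
    from above at an interior time. *)
Lemma touch_above_mono (a b : R) (Phi : R -> R) :
  cont_on a b Phi -> (forall t q, a < t < b -> touch_above Phi t q -> 0 <= q) ->
  mono_on a b Phi.
Proof.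
  intros Hc Ht s t Has Hst Htb. apply Rnot_lt_le. intros Hlt.
  destruct (Req_dec s t) as [->|Hne]; [lra|].
  set (gap := Phi s - Phi t). assert (Hgap : 0 < gap) by (unfold gap; lra).
  destruct (Hc s ltac:(lra) (gap / 4) ltac:(lra)) as [d [Hd Hd']].
  set (u1 := s + Rmin (d / 2) ((t - s) / 2)).
  assert (Hu1 : 0 < Rmin (d / 2) ((t - s) / 2)) by (apply Rmin_glb_lt; lra).
  assert (Hu2 : Rmin (d / 2) ((t - s) / 2) <= d / 2) by apply Rmin_l.
  assert (Hu3 : Rmin (d / 2) ((t - s) / 2) <= (t - s) / 2) by apply Rmin_r.
  assert (Hsu : s < u1 < t) by (unfold u1; lra).
  assert (HPu : Rabs (Phi u1 - Phi s) < gap / 4).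
  { apply Hd'; [lra|]. apply Rabs_def1; unfold u1; lra. }
  apply Rabs_def2 in HPu.
  set (del := gap / 4 / (t - s)). assert (Hdel : 0 < del) by (apply Rdiv_lt_0_compat; lra).
  assert (Hdel' : del * (t - s) = gap / 4) by (unfold del; field; lra).
  (* At s the penalty K m^2 equals the whole gap, which keeps the maximum away from s. The linear
     term changes by only a quarter of the gap over [s, t], which keeps it away from t. *)
  set (K := gap / (u1 - s) ^ 2).
  assert (Hus : 0 < (u1 - s) ^ 2) by (apply pow_lt; lra).
  assert (HK : 0 < K) by (apply Rdiv_lt_0_compat; lra).
  assert (HK' : K * (u1 - s) ^ 2 = gap) by (unfold K; field; lra).
  set (m := fun u => Rmax 0 (u1 - u)).
  set (phi := fun u => - del * (u - s) + K * (m u) ^ 2).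
  (* An upper quadratic expansion of m^2 that holds across the kink of m; it yields the slope of phi
     at the maximum. *)
  assert (Hm2 : forall u v, (m v) ^ 2 <= (m u) ^ 2 - 2 * m u * (v - u) + (v - u) ^ 2).
  { intros u v. unfold m, Rmax. destruct (Rle_dec 0 (u1 - u)); destruct (Rle_dec 0 (u1 - v)).
    - right; ring.
    - assert (H := pow2_ge_0 (u1 - v)). lra.
    - assert (H : (u1 - v) ^ 2 <= (u - v) ^ 2) by (apply pow_incr; lra). lra.
    - assert (H := pow2_ge_0 (v - u)). lra. }
  assert (Hm0 : forall u, 0 <= m u) by (intros u; apply Rmax_l).
  destruct (bwc_max dist1 (fun u => s <= u <= t) (fun u => Phi u - phi u) u1) as [u [Hu Hmax]].
  - apply bwc_interval.
  - intros u Hu e He.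
    destruct (Hc u ltac:(lra) (e / 2) ltac:(lra)) as [d1 [Hd1 Hd1']].
    set (L := del + 2 * K * (m u) + K * (2 + 2 * Rabs (u1 - u))).
    assert (HL : 0 < L).
    { unfold L. assert (H := Rabs_pos (u1 - u)). assert (H' := Hm0 u).
      assert (0 <= K * m u) by (apply Rmult_le_pos; lra).
      assert (0 < K * (2 + 2 * Rabs (u1 - u))) by (apply Rmult_lt_0_compat; lra). lra. }
    exists (Rmin d1 (Rmin 1 (e / (2 * L)))). split.
    { repeat apply Rmin_glb_lt; try lra. apply Rdiv_lt_0_compat; lra. }
    intros v Hv Hvu. unfold dist1 in Hvu.
    assert (H1 := Hd1' v ltac:(lra) (Rlt_le_trans _ _ _ Hvu (Rmin_l _ _))).
    assert (H2 := Rlt_le_trans _ _ _ Hvu (Rmin_r _ _)).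
    assert (H3 := Rlt_le_trans _ _ _ H2 (Rmin_l _ _)).
    assert (H4 := Rlt_le_trans _ _ _ H2 (Rmin_r _ _)).
    assert (H5 : Rabs (phi v - phi u) <= L * Rabs (v - u)).
    { unfold phi.
      assert (Hmm : Rabs (m v - m u) <= Rabs (v - u)).
      { unfold m, Rmax. destruct (Rle_dec 0 (u1 - u)); destruct (Rle_dec 0 (u1 - v));
        unfold Rabs; repeat destruct (Rcase_abs _); lra. }
      replace (- del * (v - s) + K * m v ^ 2 - (- del * (u - s) + K * m u ^ 2))
        with (- del * (v - u) + K * ((m v + m u) * (m v - m u))) by ring.
      eapply Rle_trans; [apply Rabs_triang|]. rewrite !Rabs_mult, Rabs_Ropp.
      rewrite (Rabs_pos_eq del), (Rabs_pos_eq K) by lra.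
      assert (Hmb : Rabs (m v + m u) <= 1 + 2 * m u).
      { rewrite Rabs_pos_eq by (assert (Ha := Hm0 u); assert (Hb := Hm0 v); lra).
        apply Rabs_le_between in Hmm. assert (Hvu' := Rabs_pos_eq). lra. }
      assert (HA := Rabs_pos (m v + m u)). assert (HB := Rabs_pos (m v - m u)).
      assert (HC := Rabs_pos (v - u)). assert (HD := Rabs_pos (u1 - u)). assert (HE := Hm0 u).
      assert (Rabs (m v + m u) * Rabs (m v - m u) <= (1 + 2 * m u) * Rabs (v - u))
        by (apply Rmult_le_compat; lra).
      assert (K * (Rabs (m v + m u) * Rabs (m v - m u)) <= K * ((1 + 2 * m u) * Rabs (v - u)))
        by (apply Rmult_le_compat_l; lra).
      assert (0 <= K * Rabs (v - u)) by (apply Rmult_le_pos; lra).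
      assert (0 <= K * Rabs (v - u) * Rabs (u1 - u)) by (apply Rmult_le_pos; lra).
      unfold L. nra. }
    assert (H6 : L * Rabs (v - u) < e / 2).
    { apply Rlt_le_trans with (L * (e / (2 * L))); [apply Rmult_lt_compat_l; lra|right; field; lra]. }
    apply Rabs_def2 in H1. apply Rabs_le_between in H5. apply Rabs_def1; lra.
  - lra.
  - assert (Hb := Hmax u1 ltac:(lra)).
    assert (E1 : m u1 = 0) by (unfold m; rewrite Rmax_left; lra).
    assert (Es : m s = u1 - s) by (unfold m; rewrite Rmax_right; lra).
    assert (Et : m t = 0) by (unfold m; rewrite Rmax_left; lra).
    assert (Hdu : 0 < del * (u1 - s)) by (apply Rmult_lt_0_compat; lra).
    assert (Hint : s < u < t).
    { destruct (Req_dec u s) as [->|]; [|destruct (Req_dec u t) as [->|]; [|lra]].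
      - unfold phi in Hb. rewrite E1, Es in Hb. unfold gap in *.
        replace (K * (u1 - s) ^ 2) with (Phi s - Phi t) in Hb by lra. nra.
      - unfold phi in Hb. rewrite E1, Et in Hb. unfold gap in *. nra. }
    assert (0 <= - del - 2 * K * m u).
    { apply (Ht u); [lra|]. intros e He.
      set (dd := Rmin (e / K) (Rmin (u - s) (t - u))).
      assert (0 < e / K) by (apply Rdiv_lt_0_compat; lra).
      exists dd. split; [unfold dd; repeat apply Rmin_glb_lt; lra|].
      intros v Hv. assert (V1 := Rlt_le_trans _ _ _ Hv (Rmin_l _ _)).
      assert (V2 := Rlt_le_trans _ _ _ Hv (Rmin_r _ _)).
      assert (V3 := Rlt_le_trans _ _ _ V2 (Rmin_l _ _)).
      assert (V4 := Rlt_le_trans _ _ _ V2 (Rmin_r _ _)).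
      assert (Hvst : s <= v <= t) by (apply Rabs_def2 in V3; apply Rabs_def2 in V4; lra).
      assert (H1 := Hmax v Hvst). unfold phi in H1. assert (H2 := Hm2 u v).
      assert (H3 : K * (v - u) ^ 2 <= e * Rabs (v - u)).
      { rewrite <- (pow2_abs (v - u)). assert (HP := Rabs_pos (v - u)).
        assert (K * Rabs (v - u) <= e); [|nra].
        apply Rle_trans with (K * (e / K)); [apply Rmult_le_compat_l; lra|right; field; lra]. }
      assert (H4 : K * m v ^ 2 <= K * (m u ^ 2 - 2 * m u * (v - u) + (v - u) ^ 2))
        by (apply Rmult_le_compat_l; lra).
      nra. }
    assert (H1 := Hm0 u). nra.
Qed.

Lemma rational_between (x y : R) :
  0 <= x -> x < y -> exists m l : nat, x < INR m / (INR l + 1) < y.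
Proof.
  intros Hx Hxy. destruct (inv_INR1_small (y - x) ltac:(lra)) as [l Hl].
  assert (Hl0 := pos_INR l).
  destruct (nfloor_ex (x * (INR l + 1)) ltac:(nra)) as [m [Hm1 Hm2]].
  exists (S m), l. rewrite S_INR. split.
  - apply Rmult_lt_reg_r with (INR l + 1); [lra|].
    unfold Rdiv. rewrite Rmult_assoc, Rinv_l, Rmult_1_r by lra. lra.
  - apply Rmult_lt_reg_r with (INR l + 1); [lra|].
    unfold Rdiv. rewrite Rmult_assoc, Rinv_l, Rmult_1_r by lra.
    assert (1 < (y - x) * (INR l + 1)); [|lra].
    apply Rmult_lt_reg_l with (/ (INR l + 1)); [apply inv_INR1_pos|].
    replace (/ (INR l + 1) * ((y - x) * (INR l + 1))) with (y - x) by (field; lra). lra.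
Qed.

(** D is the upper right derivative, cut at 0 from below. If D is not a slope from above, then left
    quotients drop below some D - e at arbitrarily small scales, and two rationals between D - e and
    D separate left from right. Their numerators and denominators make the exceptional set a
    countable union. *)
Lemma touch_or_corner (f : R -> R) (a b t k : R) :
  mono_on a b f -> a < t < b ->
  (exists d, 0 < d /\ forall s, t < s < t + d -> f s - f t <= k * (s - t)) ->
  (exists q, q <= k /\ touch_above f t q) \/
  (exists m l m' l' : nat, INR m / (INR l + 1) < INR m' / (INR l' + 1) /\ 0 < INR m / (INR l + 1) /\
     (forall d, 0 < d -> exists s, t - d < s < t /\ f t - f s < INR m / (INR l + 1) * (t - s)) /\
     (forall d, 0 < d -> exists s, t < s < t + d /\ INR m' / (INR l' + 1) * (s - t) < f s - f t)).
Proof.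
  intros Hmono Ht [d0 [Hd0 Hk]].
  set (P := fun q => q <= 0 \/ forall d, 0 < d -> exists s, t < s < t + d /\ q * (s - t) < f s - f t).
  assert (HPk : forall q, P q -> q <= Rmax k 0).
  { intros q [Hq|Hq]; [eapply Rle_trans; [exact Hq|apply Rmax_r]|].
    destruct (Hq d0 Hd0) as [s [Hs1 Hs2]]. assert (H := Hk s Hs1).
    apply Rle_trans with k; [|apply Rmax_l]. apply Rnot_lt_le. intros Hlt. nra. }
  assert (Hk0 : 0 <= k).
  { set (s := t + Rmin (d0 / 2) (b - t)).
    assert (0 < Rmin (d0 / 2) (b - t)) by (apply Rmin_glb_lt; lra).
    assert (Rmin (d0 / 2) (b - t) <= d0 / 2) by apply Rmin_l.
    assert (Rmin (d0 / 2) (b - t) <= b - t) by apply Rmin_r.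
    assert (H2 := Hk s ltac:(unfold s; lra)).
    assert (H3 := Hmono t s ltac:(lra) ltac:(unfold s; lra) ltac:(unfold s; lra)).
    assert (0 < s - t) by (unfold s; lra). nra. }
  rewrite Rmax_left in HPk by lra.
  destruct (completeness P) as [D [HD1 HD2]].
  { exists k. intros q Hq. auto. }
  { exists 0. left. lra. }
  assert (HD0 : 0 <= D) by (apply HD1; left; lra).
  assert (HDk : D <= k) by (apply HD2; intros q Hq; auto).
  destruct (classic (touch_above f t D)) as [Htouch|Hnt]; [left; now exists D|right].
  unfold touch_above in Hnt. apply not_all_ex_not in Hnt. destruct Hnt as [e Hnt].
  apply imply_to_and in Hnt. destruct Hnt as [He Hnt].
  assert (Hright : exists d, 0 < d /\ forall s, t < s < t + d -> f s - f t <= (D + e) * (s - t)).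
  { apply NNPP. intros Hn. assert (P (D + e)); [|specialize (HD1 _ H); lra].
    right. intros d Hd. apply NNPP. intros Hn'. apply Hn. exists d. split; [easy|].
    intros s Hs. apply Rnot_lt_le. intros Hlt. apply Hn'. now exists s. }
  destruct Hright as [d1 [Hd1 Hright]].
  assert (Hleft : forall d, 0 < d -> exists s, t - d < s < t /\ f t - f s < (D - e) * (t - s)).
  { intros d Hd. apply NNPP. intros Hn. apply Hnt. exists (Rmin d d1). split; [now apply Rmin_glb_lt|].
    intros s Hs. assert (S1 := Rlt_le_trans _ _ _ Hs (Rmin_l _ _)).
    assert (S2 := Rlt_le_trans _ _ _ Hs (Rmin_r _ _)).
    destruct (Rtotal_order s t) as [Hst|[->|Hst]].
    - rewrite Rabs_left in * by lra. apply Rnot_lt_le. intros Hlt. apply Hn.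
      exists s. split; [lra|]. nra.
    - replace (t - t) with 0 by ring. rewrite Rabs_R0. lra.
    - rewrite Rabs_pos_eq in * by lra. assert (H := Hright s ltac:(lra)). nra. }
  assert (HDe : 0 < D - e).
  { destruct (Hleft (t - a) ltac:(lra)) as [s [Hs1 Hs2]].
    assert (H := Hmono s t ltac:(lra) ltac:(lra) ltac:(lra)). nra. }
  destruct (rational_between (D - e) (D - 2 * e / 3) ltac:(lra) ltac:(lra)) as [m [l Hml]].
  destruct (rational_between (D - 2 * e / 3) (D - e / 3) ltac:(lra) ltac:(lra)) as [m' [l' Hml']].
  assert (Hq : exists q, P q /\ D - e / 3 < q).
  { apply NNPP. intros Hn. assert (D <= D - e / 3); [|lra]. apply HD2. intros q Hq.
    apply Rnot_lt_le. intros Hlt. apply Hn. now exists q. }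
  destruct Hq as [q [[Hq0|Hq] Hq']]; [lra|].
  exists m, l, m', l'. split; [lra|split; [lra|split]].
  - intros d Hd. destruct (Hleft d Hd) as [s [Hs1 Hs2]]. exists s. split; [easy|]. nra.
  - intros d Hd. destruct (Hq d Hd) as [s [Hs1 Hs2]]. exists s. split; [easy|]. nra.
Qed.

Lemma null_corners (f : R -> R) (a b : R) :
  a <= b -> cont_on a b f -> mono_on a b f ->
  null (fun t => exists m l m' l' : nat, a < t < b /\
     INR m / (INR l + 1) < INR m' / (INR l' + 1) /\ 0 < INR m / (INR l + 1) /\
     (forall d, 0 < d -> exists s, t - d < s < t /\ f t - f s < INR m / (INR l + 1) * (t - s)) /\
     (forall d, 0 < d -> exists s, t < s < t + d /\ INR m' / (INR l' + 1) * (s - t) < f s - f t)).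
Proof.
  intros Hab Hc Hm.
  apply null_union; intros m. apply null_union; intros l.
  apply null_union; intros m'. apply null_union; intros l'.
  destruct (classic (INR m / (INR l + 1) < INR m' / (INR l' + 1) /\ 0 < INR m / (INR l + 1)))
    as [[H1 H2]|Hn].
  - apply (null_corner f a b (INR m / (INR l + 1)) (INR m' / (INR l' + 1))); try easy.
  - intros e He. exists (fun _ => 0). split; [split|].
    + intros; lra.
    + intros t [H1 [H2 [H3 H4]]]. exfalso. now apply Hn.
    + intros; lra.
Qed.

(* A function whose slopes at touching points are >= -C, and >= 0 at the times of E, behaves as
   if its derivative were >= 0 on E up to outer measure. *)
Lemma touch_above_increment (E : R -> Prop) (Phi : R -> R) (a al be C : R) :
  a <= al -> al < be -> 0 <= C -> cont_on al be Phi ->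
  (forall t q, al < t < be -> touch_above Phi t q -> - C <= q /\ (E t -> 0 <= q)) ->
  Phi al <= Phi be + C * ((be - al) - (theta E a be - theta E a al)).
Proof.
  intros Haal Halbe HC Hcont Ht.
  set (f := fun t => Phi t + C * t).
  assert (Hfc : cont_on al be f) by now apply cont_on_plus_linear.
  assert (Hfm : mono_on al be f).
  { apply touch_above_mono; [easy|]. intros t q Htt Hq.
    destruct (Ht t (q - C) Htt) as [H _]; [now apply touch_above_linear|lra]. }
  set (Df := f be - f al). assert (HDf : 0 <= Df) by (assert (H := Hfm al be); unfold Df; lra).
  assert (Hth := theta_incr E a al be Haal ltac:(lra)).
  set (Dt := theta E a be - theta E a al) in *.
  assert (C * Dt - Df <= 0); [|unfold Df, f, Dt in *; lra].
  destruct (Req_dec C 0) as [->|HC0]; [lra|].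
  apply le_small_mult with (C + 2 * C * (be - al)). intros e He.
  (* The steep times, where f has right quotients above k, are covered by x1 at the price Df / k,
     and the corners by x2 at the price e. *)
  set (k := C * (1 - e)). assert (Hk : 0 < k) by (unfold k; nra).
  destruct (maj_right_steep al be f k (fun t => al < t < be /\ forall d, 0 < d ->
      exists s, t < s < t + d /\ k * (s - t) < f s - f t) ltac:(lra) Hfc Hfm Hk ltac:(easy))
    as [x1 [Hx1 Hx1']].
  destruct (null_corners f al be ltac:(lra) Hfc Hfm e ltac:(lra)) as [x2 [Hx2 Hx2']].
  (* Every point of E has x1 or x2 of slope one around it. The slope 1 - e leaves room for the
     rising sun condition and changes the final estimate only by a factor tending to one. *)
  destruct (maj_rising_sun (fun t => al < t < be /\ E t) (fun t => x1 t + x2 t) (1 - e)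
    (/ k * f be + x2 al + e) ltac:(lra)) as [x [Hx Hx']].
  - intros s t Hst. assert (H1 := proj1 Hx1 s t Hst). assert (H2 := proj1 Hx2 s t Hst). lra.
  - intros t. assert (H1 := Hx1' t). assert (H2 := Hx2' al t).
    assert (x1 t <= / k * f be); [|lra].
    apply Rmult_le_reg_l with k; [easy|]. rewrite <- Rmult_assoc, Rinv_r by lra. lra.
  - intros t [Htab HEt].
    (* A time of E that is neither steep nor a corner has a touching slope q <= k < C of f. Then q -
       C < 0 is a slope of Phi, which E forbids. *)
    assert (Hcase : exists d, 0 < d /\ forall s s', t - d < s -> s <= s' -> s' < t + d ->
               s' - s <= (x1 s' + x2 s') - (x1 s + x2 s)).
    { destruct (classic (forall d, 0 < d -> exists s, t < s < t + d /\ k * (s - t) < f s - f t))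
        as [Hsteep|Hn].
      - destruct (proj2 Hx1 t (conj Htab Hsteep)) as [d [Hd Hd']]. exists d. split; [easy|].
        intros s s' H1 H2 H3. assert (H := Hd' s s' H1 H2 H3).
        assert (H' := proj1 Hx2 s s' H2). lra.
      - destruct (touch_or_corner f al be t k Hfm Htab) as [[q [Hq Hqt]]|[m [l [m' [l' Hcorner]]]]].
        + apply not_all_ex_not in Hn. destruct Hn as [d Hn]. apply imply_to_and in Hn.
          destruct Hn as [Hd Hn]. exists d. split; [easy|]. intros s Hs. apply Rnot_lt_le.
          intros Hlt. apply Hn. now exists s.
        + exfalso. apply touch_above_linear in Hqt. apply (Ht t _ Htab) in Hqt.
          destruct Hqt as [_ Hqt]. specialize (Hqt HEt). unfold k in Hq. nra.
        + destruct (proj2 Hx2 t) as [d [Hd Hd']].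
          { now exists m, l, m', l'. }
          exists d. split; [easy|]. intros s s' H1 H2 H3. assert (H := Hd' s s' H1 H2 H3).
          assert (H' := proj1 Hx1 s s' H2). lra. }
    destruct Hcase as [d [Hd Hd']].
    exists (d / 2), (t + d / 2). split; [lra|split; [lra|]]. intros s Hs.
    assert (H := Hd' s (t + d / 2) ltac:(lra) ltac:(lra) ltac:(lra)).
    assert (0 <= e * (t + d / 2 - s)) by (apply Rmult_le_pos; lra). lra.
  - assert (Hinc := theta_incr_le E a al be x Haal ltac:(lra) Hx).
    assert (H1 := Hx' al). assert (H2 := Hx' be). assert (H3 := Hx1' al).
    rewrite clip_in in H3 by lra.
    assert (H4 : f al * / k <= x1 al).
    { apply Rmult_le_reg_l with k; [easy|]. replace (k * (f al * / k)) with (f al) by (field; lra). lra. }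
    assert (H5 : (1 - e) * Dt <= / k * Df + e).
    { unfold Df. apply Rle_trans with ((1 - e) * (x be - x al)); [apply Rmult_le_compat_l; unfold Dt; lra|]. lra. }
    assert (H6 : k * ((1 - e) * Dt) <= Df + k * e).
    { apply Rle_trans with (k * (/ k * Df + e)); [apply Rmult_le_compat_l; lra|].
      right. field. lra. }
    assert (H7 : k * e <= C * e) by (unfold k; nra).
    assert (H8 : C * Dt - k * ((1 - e) * Dt) <= e * (2 * C * (be - al))).
    { unfold k. replace (C * Dt - C * (1 - e) * ((1 - e) * Dt)) with (C * Dt * (2 * e - e * e)) by ring.
      assert (C * Dt * (2 * e - e * e) <= C * Dt * (2 * e)) by (apply Rmult_le_compat_l; nra).
      assert (C * Dt <= C * (be - al)) by (apply Rmult_le_compat_l; lra). nra. }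
    lra.
Qed.

(** At a density point of its own class the C-term is at most C e h. The remaining times form a
    countable union of null sets, and there the increment C h is absorbed by C times a majorant of
    total increase at most e. *)
Lemma coloured_time_mono (T C k : R) (j : R -> nat) (M : R -> R) :
  0 < T -> 0 <= C -> cont_on 0 T M ->
  (forall t, 0 < t < T -> exists h0, 0 < h0 /\ forall h, 0 < h < h0 ->
     M t <= M (t + h) + k * h +
       C * (h - (theta (fun u => j u = j t) 0 (t + h) - theta (fun u => j u = j t) 0 t))) ->
  forall s t, 0 <= s -> s <= t -> t <= T -> M s <= M t + k * (t - s).
Proof.
  intros HT HC Hc HM.
  assert (Hpos : forall s t, 0 < s -> s <= t -> t <= T -> M s <= M t + k * (t - s)).
  { intros s t Hs Hst HtT.
    assert (M s - (M t + k * (t - s)) <= 0); [|lra].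
    apply le_small_mult with (C * (t - s) + C). intros e He.
    set (th := fun n => theta (fun u => j u = n) 0).
    assert (HZ : null (fun u => exists n, j u = n /\ 0 < u < T /\ forall d, 0 < d ->
       exists v, u < v < u + d /\ th n v - th n u < (1 - e) * (v - u))).
    { apply null_union. intros n. apply (null_low_density (fun u => j u = n) _ 0 T e); try lra.
      intros u Hu. exact Hu. }
    destruct (HZ e ltac:(lra)) as [x [Hx Hx']].
    (* After both compensations every right increment is nonnegative at small scales: C x serves the
       exceptional times and C e the density points. *)
    assert (Hmono : M s + (k + C * e) * s + C * x s <= M t + (k + C * e) * t + C * x t).
    { apply (right_increments_mono s t (fun u => M u + (k + C * e) * u + C * x u)); [easy| |].
      - intros u Hu. apply (cont_on_minus s t (fun u => M u + (k + C * e) * u) (fun u => - (C * x u))) in Hu.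
        + intros eps Heps. destruct (Hu eps Heps) as [d [Hd Hd']]. exists d. split; [easy|].
          intros v Hv Hvu. specialize (Hd' v Hv Hvu).
          replace (M v + (k + C * e) * v + C * x v - (M u + (k + C * e) * u + C * x u)) with
            (M v + (k + C * e) * v - - (C * x v) - (M u + (k + C * e) * u - - (C * x u))) by ring.
          exact Hd'.
        + apply cont_on_plus_linear. apply cont_on_sub with 0 T; lra || easy.
        + intros v Hv eps Heps.
          exists (eps / (C + 1)). split; [apply Rdiv_lt_0_compat; lra|]. intros w Hw Hwv.
          assert (Hxw : Rabs (x w - x v) <= Rabs (w - v)).
          { destruct (Rle_lt_dec w v) as [Hwv'|Hwv'].
            - assert (H := proj1 Hx w v Hwv'). rewrite (Rabs_left1 (w - v)) by lra. apply Rabs_le. lra.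
            - assert (H := proj1 Hx v w ltac:(lra)). rewrite (Rabs_pos_eq (w - v)) by lra. apply Rabs_le. lra. }
          replace (- (C * x w) - - (C * x v)) with (- (C * (x w - x v))) by ring.
          rewrite Rabs_Ropp, Rabs_mult, (Rabs_pos_eq C) by easy.
          apply Rle_lt_trans with (C * Rabs (w - v)); [now apply Rmult_le_compat_l|].
          apply Rle_lt_trans with ((C + 1) * Rabs (w - v)); [assert (H := Rabs_pos (w - v)); nra|].
          apply Rlt_le_trans with ((C + 1) * (eps / (C + 1))); [apply Rmult_lt_compat_l; lra|right; field; lra].
      - intros u Hu. destruct (HM u ltac:(lra)) as [h0 [Hh0 Hh]].
        destruct (classic (exists n, j u = n /\ 0 < u < T /\ forall d, 0 < d ->
          exists v, u < v < u + d /\ th n v - th n u < (1 - e) * (v - u))) as [Hbad|Hgood].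
        + destruct (proj2 Hx u Hbad) as [d [Hd Hd']].
          exists (Rmin h0 d). split; [now apply Rmin_glb_lt|]. intros h Hhd.
          assert (H1 := Rmin_l h0 d). assert (H2 := Rmin_r h0 d).
          assert (H3 := Hh h ltac:(lra)).
          assert (H4 := Hd' u (u + h) ltac:(lra) ltac:(lra) ltac:(lra)).
          assert (H5 := theta_incr (fun v => j v = j u) 0 u (u + h) ltac:(lra) ltac:(lra)).
          assert (H6 : C * (h - (theta (fun u0 => j u0 = j u) 0 (u + h) - theta (fun u0 => j u0 = j u) 0 u)) <= C * h)
            by (apply Rmult_le_compat_l; lra).
          assert (H7 : C * h <= C * (x (u + h) - x u)) by (apply Rmult_le_compat_l; lra).
          assert (0 <= C * e * h) by (apply Rmult_le_pos; [apply Rmult_le_pos|]; lra). lra.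
        + assert (Hd : exists d, 0 < d /\ forall v, u < v < u + d ->
              (1 - e) * (v - u) <= th (j u) v - th (j u) u).
          { apply NNPP. intros Hn. apply Hgood. exists (j u). split; [easy|split; [lra|]].
            intros d Hd. apply NNPP. intros Hn'. apply Hn. exists d. split; [easy|].
            intros v Hv. apply Rnot_lt_le. intros Hlt. apply Hn'. now exists v. }
          destruct Hd as [d [Hd Hd']].
          exists (Rmin h0 d). split; [now apply Rmin_glb_lt|]. intros h Hhd.
          assert (H1 := Rmin_l h0 d). assert (H2 := Rmin_r h0 d).
          assert (H3 := Hh h ltac:(lra)). assert (H4 := Hd' (u + h) ltac:(lra)). unfold th in H4.
          assert (H5 := proj1 Hx u (u + h) ltac:(lra)).
          assert (H6 : C * (h - (theta (fun u0 => j u0 = j u) 0 (u + h) - theta (fun u0 => j u0 = j u) 0 u)) <= C * (e * h))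
            by (apply Rmult_le_compat_l; lra).
          assert (0 <= C * (x (u + h) - x u)) by (apply Rmult_le_pos; lra). lra. }
    assert (H1 := Hx' s t).
    assert (C * (x t - x s) <= C * e) by (apply Rmult_le_compat_l; lra). lra. }
  intros s t Hs Hst HtT.
  destruct (Req_dec s t) as [->|Hne]; [lra|].
  destruct (Req_dec s 0) as [->|Hs0]; [|apply Hpos; lra].
  apply le_epsilon. intros e He.
  destruct (Hc 0 ltac:(lra) (e / 2) ltac:(lra)) as [d [Hd Hd']].
  set (K := Rabs k + 1). assert (HK : 0 < K) by (unfold K; assert (H := Rabs_pos k); lra).
  set (u := Rmin (Rmin (d / 2) t) (e / (2 * K))).
  assert (0 < e / (2 * K)) by (apply Rdiv_lt_0_compat; lra).
  assert (Hu : 0 < u) by (repeat apply Rmin_glb_lt; lra).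
  assert (u <= d / 2) by (eapply Rle_trans; [apply Rmin_l|apply Rmin_l]).
  assert (u <= t) by (eapply Rle_trans; [apply Rmin_l|apply Rmin_r]).
  assert (Hu3 : u <= e / (2 * K)) by apply Rmin_r.
  assert (H2 := Hd' u ltac:(lra)). rewrite Rabs_pos_eq in H2 by lra. specialize (H2 ltac:(lra)).
  apply Rabs_def2 in H2. assert (H3 := Hpos u t Hu ltac:(lra) HtT).
  assert (H4 : - k * u <= e / 2).
  { apply Rle_trans with (K * u).
    - apply Rmult_le_compat_r; [lra|]. unfold K. assert (H5 := Rle_abs (- k)). rewrite Rabs_Ropp in H5. lra.
    - apply Rle_trans with (K * (e / (2 * K))); [apply Rmult_le_compat_l; lra|right; field; lra]. }
  lra.
Qed.

(** * Smoothing *)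

Definition ctn (phi : R -> R) : Prop := forall x, continuous phi x.

Lemma continuous_eps (phi : R -> R) (x : R) :
  (forall e, 0 < e -> exists d, 0 < d /\ forall y, Rabs (y - x) < d -> Rabs (phi y - phi x) < e) ->
  continuous phi x.
Proof.
  intros H. apply filterlim_locally. intros e. destruct (H e (cond_pos e)) as [d [Hd Hd']].
  exists (mkposreal d Hd). intros y Hy. now apply Hd'.
Qed.

Lemma ctn_shift phi e : ctn phi -> ctn (fun s => phi (s + e)).
Proof.
  intros H x. apply (continuous_comp (fun s => s + e) phi); [|apply H].
  apply (continuous_plus (fun s : R => s) (fun _ => e)); [apply continuous_id|apply continuous_const].
Qed.

Lemma ctn_lin phi psi a b : ctn phi -> ctn psi -> ctn (fun s => a * phi s + b * psi s).
Proof.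
  intros H1 H2 x.
  apply (continuous_plus (fun s => a * phi s) (fun s => b * psi s)).
  - apply (continuous_scal_r a phi). apply H1.
  - apply (continuous_scal_r b psi). apply H2.
Qed.

(** Each window average gains one derivative, namely the central difference quotient [Dv], at the
    price of a factor 1 / tau. *)
Definition Av (tau : R) (phi : R -> R) (x : R) : R := / (2 * tau) * RInt phi (x - tau) (x + tau).
Definition Dv (tau : R) (phi : R -> R) (x : R) : R := / (2 * tau) * (phi (x + tau) - phi (x - tau)).

Lemma ctn_ex_RInt phi a b : ctn phi -> ex_RInt phi a b.
Proof. intros H. apply (ex_RInt_continuous (V := R_CompleteNormedModule)). intros; apply H. Qed.

Lemma Av_lin tau phi psi a b x : ctn phi -> ctn psi ->
  Av tau (fun s => a * phi s + b * psi s) x = a * Av tau phi x + b * Av tau psi x.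
Proof.
  intros H1 H2. unfold Av.
  rewrite (RInt_plus (V := R_CompleteNormedModule) (fun s => a * phi s) (fun s => b * psi s)).
  2: { apply (ex_RInt_scal (V := R_CompleteNormedModule) phi); now apply ctn_ex_RInt. }
  2: { apply (ex_RInt_scal (V := R_CompleteNormedModule) psi); now apply ctn_ex_RInt. }
  rewrite (RInt_scal (V := R_CompleteNormedModule) phi) by now apply ctn_ex_RInt.
  rewrite (RInt_scal (V := R_CompleteNormedModule) psi) by now apply ctn_ex_RInt.
  unfold plus, scal; simpl; unfold mult; simpl. ring.
Qed.

Lemma Av_le_local tau phi c x : 0 < tau -> ctn phi ->
  (forall s, x - tau < s < x + tau -> phi s <= c) -> Av tau phi x <= c.
Proof.
  intros Ht H Hc. unfold Av.
  assert (RInt phi (x - tau) (x + tau) <= RInt (fun _ => c) (x - tau) (x + tau)).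
  { apply RInt_le; [lra|now apply ctn_ex_RInt|apply ex_RInt_const|intros s Hs; now apply Hc]. }
  rewrite RInt_const in H0. unfold scal in H0; simpl in H0; unfold mult in H0; simpl in H0.
  set (I := (RInt phi (x - tau) (x + tau) : R)) in *. change (/ (2 * tau) * I <= c).
  apply Rmult_le_reg_l with (2 * tau); [lra|].
  replace (2 * tau * (/ (2 * tau) * I)) with I by (field; lra). lra.
Qed.

Lemma Av_opp tau phi x : ctn phi -> Av tau (fun s => - phi s) x = - Av tau phi x.
Proof.
  intros H. unfold Av. rewrite (RInt_opp (V := R_CompleteNormedModule) phi) by now apply ctn_ex_RInt.
  unfold opp; simpl. ring.
Qed.

Lemma ctn_opp phi : ctn phi -> ctn (fun s => - phi s).
Proof. intros H x. apply (continuous_opp phi). apply H. Qed.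

Lemma Av_close_local tau phi c e x : 0 < tau -> ctn phi ->
  (forall s, x - tau < s < x + tau -> Rabs (phi s - c) <= e) -> Rabs (Av tau phi x - c) <= e.
Proof.
  intros Ht H Hc.
  assert (H1 : Av tau phi x <= c + e).
  { apply Av_le_local; auto. intros s Hs. specialize (Hc s Hs). apply Rabs_le_between in Hc. lra. }
  assert (H2 : - Av tau phi x <= - c + e).
  { rewrite <- Av_opp by easy. apply Av_le_local; auto using ctn_opp.
    intros s Hs. specialize (Hc s Hs). apply Rabs_le_between in Hc. lra. }
  apply Rabs_le. lra.
Qed.

Lemma Av_bound tau phi L x : 0 < tau -> ctn phi -> (forall s, Rabs (phi s) <= L) -> Rabs (Av tau phi x) <= L.
Proof.
  intros Ht H HL. replace (Av tau phi x) with (Av tau phi x - 0) by ring.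
  apply Av_close_local; auto. intros s _. rewrite Rminus_0_r. apply HL.
Qed.

Lemma Av_shift tau phi e x : ctn phi -> Av tau (fun s => phi (s + e)) x = Av tau phi (x + e).
Proof.
  intros H. unfold Av. f_equal.
  rewrite <- (RInt_ext (fun s => scal 1 (phi (1 * s + e)))).
  - rewrite (RInt_comp_lin (V := R_CompleteNormedModule) phi 1 e).
    + f_equal; ring.
    + now apply ctn_ex_RInt.
  - intros s _. unfold scal; simpl; unfold mult; simpl. rewrite !Rmult_1_l. reflexivity.
Qed.

Lemma Av_derive tau phi x : 0 < tau -> ctn phi -> is_derive (Av tau phi) x (Dv tau phi x).
Proof.
  intros Ht H. unfold Av, Dv.
  apply (is_derive_scal (fun x => RInt phi (x - tau) (x + tau)) x (/ (2 * tau))).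
  replace (phi (x + tau) - phi (x - tau)) with
    (minus (scal 1 (phi (x + tau))) (scal 1 (phi (x - tau)))) by
    (unfold minus, plus, opp, scal; simpl; unfold mult; simpl; ring).
  assert (Hi : forall y, is_derive (RInt phi 0) y (phi y)).
  { intros y. apply (is_derive_RInt phi (RInt phi 0) 0 y); [|apply H].
    exists (mkposreal 1 Rlt_0_1). intros z _. apply (RInt_correct (V := R_CompleteNormedModule)).
    now apply ctn_ex_RInt. }
  apply (is_derive_ext (fun x => minus (RInt phi 0 (x + tau)) (RInt phi 0 (x - tau)))).
  - intros y. rewrite <- (RInt_Chasles (V := R_CompleteNormedModule) phi 0 (y - tau) (y + tau))
      by now apply ctn_ex_RInt.
    unfold minus, plus, opp; simpl. ring.
  - apply (is_derive_minus (fun x => RInt phi 0 (x + tau)) (fun x => RInt phi 0 (x - tau))).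
    + apply (is_derive_comp (RInt phi 0) (fun x => x + tau)); [apply Hi|auto_derive; auto].
    + apply (is_derive_comp (RInt phi 0) (fun x => x - tau)); [apply Hi|auto_derive; auto].
Qed.

Lemma Av_ctn tau phi : 0 < tau -> ctn phi -> ctn (Av tau phi).
Proof.
  intros Ht H x. apply (ex_derive_continuous (Av tau phi)).
  exists (Dv tau phi x). now apply Av_derive.
Qed.

Lemma Dv_bound tau phi L x : 0 < tau -> (forall s, Rabs (phi s) <= L) -> Rabs (Dv tau phi x) <= L / tau.
Proof.
  intros Ht HL. unfold Dv. rewrite Rabs_mult, (Rabs_pos_eq (/ (2 * tau))).
  2: { left. apply Rinv_0_lt_compat. lra. }
  apply Rmult_le_reg_l with (2 * tau); [lra|].
  replace (2 * tau * (/ (2 * tau) * Rabs (phi (x + tau) - phi (x - tau)))) with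
    (Rabs (phi (x + tau) - phi (x - tau))) by (field; lra).
  replace (2 * tau * (L / tau)) with (L + L) by (field; lra).
  eapply Rle_trans; [apply Rabs_triang|]. rewrite Rabs_Ropp. apply Rplus_le_compat; apply HL.
Qed.

Lemma Dv_derive tau phi phi1 x : (forall s, is_derive phi s (phi1 s)) ->
  is_derive (Dv tau phi) x (Dv tau phi1 x).
Proof.
  intros H. unfold Dv.
  apply (is_derive_scal (fun x => phi (x + tau) - phi (x - tau)) x (/ (2 * tau))).
  replace (phi1 (x + tau) - phi1 (x - tau)) with
    (minus (scal 1 (phi1 (x + tau))) (scal 1 (phi1 (x - tau)))) by
    (unfold minus, plus, opp, scal; simpl; unfold mult; simpl; ring).
  apply (is_derive_minus (fun x => phi (x + tau)) (fun x => phi (x - tau))).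
  - apply (is_derive_comp phi (fun x => x + tau)); [apply H|auto_derive; auto].
  - apply (is_derive_comp phi (fun x => x - tau)); [apply H|auto_derive; auto].
Qed.

Lemma mvt_bound (f f' : R -> R) (x e b : R) :
  (forall s, is_derive f s (f' s)) ->
  (forall s, Rabs (s - x) <= Rabs e -> Rabs (f' s) <= b) ->
  Rabs (f (x + e) - f x) <= b * Rabs e.
Proof.
  intros H Hb.
  destruct (MVT_gen f x (x + e) f') as [c [Hc1 Hc2]].
  - intros s _. apply H.
  - intros s _. apply continuity_pt_filterlim.
    apply (ex_derive_continuous f). exists (f' s). apply H.
  - rewrite Hc2. replace (x + e - x) with e by ring. rewrite Rabs_mult.
    apply Rmult_le_compat_r; [apply Rabs_pos|]. apply Hb.
    unfold Rmin, Rmax in Hc1. destruct (Rle_dec x (x + e));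
      unfold Rabs; repeat destruct (Rcase_abs _); lra.
Qed.

Lemma taylor2 (f f1 f2 : R -> R) (b x e : R) :
  (forall s, is_derive f s (f1 s)) -> (forall s, is_derive f1 s (f2 s)) ->
  (forall s, Rabs (f2 s) <= b) -> Rabs (f (x + e) - f x - e * f1 x) <= b * Rabs e ^ 2.
Proof.
  intros H1 H2 Hb.
  assert (H := mvt_bound (fun s => f s - (s - x) * f1 x) (fun s => f1 s - f1 x) x e (b * Rabs e)).
  replace (f (x + e) - f x - e * f1 x) with
    (f (x + e) - (x + e - x) * f1 x - (f x - (x - x) * f1 x)) by ring.
  replace (b * Rabs e ^ 2) with (b * Rabs e * Rabs e) by ring. apply H.
  - intros s. apply (is_derive_minus f (fun s => (s - x) * f1 x)); [apply H1|].
    auto_derive; auto. ring.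
  - intros s Hs. replace s with (x + (s - x)) by ring.
    eapply Rle_trans; [apply (mvt_bound f1 f2 x (s - x) b); auto|].
    apply Rmult_le_compat_l; [|easy]. eapply Rle_trans; [apply Rabs_pos|apply (Hb 0)].
Qed.

Lemma taylor3 (f f1 f2 : R -> R) (l x e : R) : 0 <= l ->
  (forall s, is_derive f s (f1 s)) -> (forall s, is_derive f1 s (f2 s)) ->
  (forall s t, Rabs (f2 s - f2 t) <= l * Rabs (s - t)) ->
  Rabs (f (x + e) - f x - e * f1 x - / 2 * e ^ 2 * f2 x) <= l * Rabs e ^ 3.
Proof.
  intros Hl H1 H2 Hlip.
  assert (H := mvt_bound (fun s => f s - (s - x) * f1 x - / 2 * (s - x) ^ 2 * f2 x)
    (fun s => f1 s - f1 x - (s - x) * f2 x) x e (l * Rabs e ^ 2)).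
  replace (f (x + e) - f x - e * f1 x - / 2 * e ^ 2 * f2 x) with
    (f (x + e) - (x + e - x) * f1 x - / 2 * (x + e - x) ^ 2 * f2 x -
      (f x - (x - x) * f1 x - / 2 * (x - x) ^ 2 * f2 x)) by ring.
  replace (l * Rabs e ^ 3) with (l * Rabs e ^ 2 * Rabs e) by ring. apply H.
  - intros s. apply (is_derive_minus (fun s => f s - (s - x) * f1 x) (fun s => / 2 * (s - x) ^ 2 * f2 x)).
    + apply (is_derive_minus f (fun s => (s - x) * f1 x)); [apply H1|]. auto_derive; auto. ring.
    + auto_derive; auto. simpl. field.
  - intros s Hs.
    assert (H0 := mvt_bound (fun u => f1 u - (u - x) * f2 x) (fun u => f2 u - f2 x) x (s - x) (l * Rabs (s - x))).
    replace (f1 s - f1 x - (s - x) * f2 x) with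
      (f1 (x + (s - x)) - (x + (s - x) - x) * f2 x - (f1 x - (x - x) * f2 x)).
    2: { replace (x + (s - x)) with s by ring. ring. }
    eapply Rle_trans; [apply H0|].
    + intros u. apply (is_derive_minus f1 (fun u => (u - x) * f2 x)); [apply H2|]. auto_derive; auto. ring.
    + intros u Hu. eapply Rle_trans; [apply Hlip|]. apply Rmult_le_compat_l; auto.
    + replace (l * Rabs (s - x) * Rabs (s - x)) with (l * Rabs (s - x) ^ 2) by ring.
      apply Rmult_le_compat_l; [easy|]. apply pow_incr. split; [apply Rabs_pos|easy].
Qed.

(** Three averages give two derivatives, the second being Lipschitz with constant L / tau^3. This is
    just enough for a cubic Taylor remainder. *)
Definition A3 (tau : R) (phi : R -> R) : R -> R := Av tau (Av tau (Av tau phi)).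
Definition A3d (tau : R) (phi : R -> R) : R -> R := Dv tau (Av tau (Av tau phi)).
Definition A3dd (tau : R) (phi : R -> R) : R -> R := Dv tau (Dv tau (Av tau phi)).

Section A3.
Variable tau : R.
Hypothesis Htau : 0 < tau.

Lemma A3_derive phi x : ctn phi -> is_derive (A3 tau phi) x (A3d tau phi x).
Proof. intros H. apply Av_derive; auto. repeat apply Av_ctn; auto. Qed.

Lemma A3d_derive phi x : ctn phi -> is_derive (A3d tau phi) x (A3dd tau phi x).
Proof. intros H. apply Dv_derive. intros s. apply Av_derive; auto. apply Av_ctn; auto. Qed.

Lemma A3_lin phi psi a b x : ctn phi -> ctn psi ->
  A3 tau (fun s => a * phi s + b * psi s) x = a * A3 tau phi x + b * A3 tau psi x.
Proof.
  intros H1 H2. unfold A3.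
  replace (Av tau (fun s => a * phi s + b * psi s)) with (fun s => a * Av tau phi s + b * Av tau psi s).
  2: { extensionality s. now rewrite Av_lin. }
  replace (Av tau (fun s => a * Av tau phi s + b * Av tau psi s)) with
    (fun s => a * Av tau (Av tau phi) s + b * Av tau (Av tau psi) s).
  2: { extensionality s. rewrite Av_lin; auto; apply Av_ctn; auto. }
  apply Av_lin; repeat apply Av_ctn; auto.
Qed.

Lemma A3_shift phi e x : ctn phi -> A3 tau (fun s => phi (s + e)) x = A3 tau phi (x + e).
Proof.
  intros H. unfold A3.
  replace (Av tau (fun s => phi (s + e))) with (fun s => Av tau phi (s + e)).
  2: { extensionality s. now rewrite Av_shift. }
  replace (Av tau (fun s => Av tau phi (s + e))) with (fun s => Av tau (Av tau phi) (s + e)).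
  2: { extensionality s. rewrite Av_shift; auto. apply Av_ctn; auto. }
  apply Av_shift. repeat apply Av_ctn; auto.
Qed.

Lemma A3_bound phi L x : ctn phi -> (forall s, Rabs (phi s) <= L) -> Rabs (A3 tau phi x) <= L.
Proof.
  intros H HL. unfold A3.
  apply Av_bound; auto; [repeat apply Av_ctn; auto|]. intros s.
  apply Av_bound; auto; [repeat apply Av_ctn; auto|]. intros u.
  apply Av_bound; auto.
Qed.

Lemma A3_close_local phi c e x : ctn phi ->
  (forall s, Rabs (s - x) <= 3 * tau -> Rabs (phi s - c) <= e) -> Rabs (A3 tau phi x - c) <= e.
Proof.
  intros H HL. unfold A3.
  apply Av_close_local; auto; [repeat apply Av_ctn; auto|]. intros s Hs.
  apply Av_close_local; auto; [repeat apply Av_ctn; auto|]. intros u Hu.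
  apply Av_close_local; auto. intros v Hv. apply HL. apply Rabs_le. lra.
Qed.

Lemma A3d_bound phi L x : ctn phi -> (forall s, Rabs (phi s) <= L) -> Rabs (A3d tau phi x) <= L / tau.
Proof.
  intros H HL. apply Dv_bound; auto. intros s.
  apply Av_bound; auto; [repeat apply Av_ctn; auto|]. intros u. apply Av_bound; auto.
Qed.

Lemma A3dd_bound phi L x : ctn phi -> (forall s, Rabs (phi s) <= L) -> Rabs (A3dd tau phi x) <= L / tau ^ 2.
Proof.
  intros H HL. replace (L / tau ^ 2) with (L / tau / tau) by (field; lra).
  apply Dv_bound; auto. intros s. apply Dv_bound; auto. intros u. apply Av_bound; auto.
Qed.

Lemma A3dd_lip phi L x y : ctn phi -> (forall s, Rabs (phi s) <= L) ->
  Rabs (A3dd tau phi x - A3dd tau phi y) <= L / tau ^ 3 * Rabs (x - y).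
Proof.
  intros H HL.
  replace x with (y + (x - y)) at 1 by ring.
  apply (mvt_bound (A3dd tau phi) (Dv tau (Dv tau (Dv tau phi)))).
  - intros s. apply Dv_derive. intros u. apply Dv_derive. intros v. apply Av_derive; auto.
  - intros s _. replace (L / tau ^ 3) with (L / tau / tau / tau) by (field; lra).
    apply Dv_bound; auto. intros u. apply Dv_bound; auto. intros v. apply Dv_bound; auto.
Qed.

Lemma A3_taylor3 phi L x e : ctn phi -> (forall s, Rabs (phi s) <= L) ->
  Rabs (A3 tau phi (x + e) - A3 tau phi x - e * A3d tau phi x - / 2 * e ^ 2 * A3dd tau phi x)
    <= L / tau ^ 3 * Rabs e ^ 3.
Proof.
  intros H HL. apply taylor3.
  - apply Rmult_le_pos; [eapply Rle_trans; [apply Rabs_pos|apply (HL 0)]|].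
    left. apply Rinv_0_lt_compat. now apply pow_lt.
  - intros s. now apply A3_derive.
  - intros s. now apply A3d_derive.
  - intros s t. now apply A3dd_lip.
Qed.

Lemma A3_taylor2 phi L x e : ctn phi -> (forall s, Rabs (phi s) <= L) ->
  Rabs (A3 tau phi (x + e) - A3 tau phi x - e * A3d tau phi x) <= L / tau ^ 2 * Rabs e ^ 2.
Proof.
  intros H HL. apply taylor2 with (A3dd tau phi).
  - intros s. now apply A3_derive.
  - intros s. now apply A3d_derive.
  - intros s. now apply A3dd_bound.
Qed.

Lemma A3_taylor1 phi L x e : ctn phi -> (forall s, Rabs (phi s) <= L) ->
  Rabs (A3 tau phi (x + e) - A3 tau phi x) <= L / tau * Rabs e.
Proof.
  intros H HL. apply mvt_bound with (A3d tau phi).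
  - intros s. now apply A3_derive.
  - intros s _. now apply A3d_bound.
Qed.

Lemma A3_diff phi psi x e : ctn phi -> ctn psi ->
  (forall s, Rabs (phi s - psi s) <= e) -> Rabs (A3 tau phi x - A3 tau psi x) <= e.
Proof.
  intros H1 H2 He.
  replace (A3 tau phi x - A3 tau psi x) with (1 * A3 tau phi x + (-1) * A3 tau psi x) by ring.
  rewrite <- A3_lin by easy. apply A3_bound; [now apply ctn_lin|].
  intros s. replace (1 * phi s + -1 * psi s) with (phi s - psi s) by ring. apply He.
Qed.

Lemma A3d_diff phi psi x e : ctn phi -> ctn psi ->
  (forall s, Rabs (phi s - psi s) <= e) -> Rabs (A3d tau phi x - A3d tau psi x) <= e / tau.
Proof.
  intros H1 H2 He. unfold A3d.
  replace (Dv tau (Av tau (Av tau phi)) x - Dv tau (Av tau (Av tau psi)) x) with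
    (Dv tau (Av tau (Av tau (fun s => 1 * phi s + (-1) * psi s))) x).
  - apply A3d_bound; [now apply ctn_lin|].
    intros s. replace (1 * phi s + -1 * psi s) with (phi s - psi s) by ring. apply He.
  - unfold Dv.
    replace (Av tau (fun s => 1 * phi s + -1 * psi s)) with (fun s => 1 * Av tau phi s + -1 * Av tau psi s)
      by (extensionality s; now rewrite Av_lin).
    rewrite !Av_lin by now apply Av_ctn. ring.
Qed.

Lemma A3dd_diff phi psi x e : ctn phi -> ctn psi ->
  (forall s, Rabs (phi s - psi s) <= e) -> Rabs (A3dd tau phi x - A3dd tau psi x) <= e / tau ^ 2.
Proof.
  intros H1 H2 He.
  replace (A3dd tau phi x - A3dd tau psi x) with (A3dd tau (fun s => 1 * phi s + (-1) * psi s) x).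
  - apply A3dd_bound; [now apply ctn_lin|].
    intros s. replace (1 * phi s + -1 * psi s) with (phi s - psi s) by ring. apply He.
  - unfold A3dd, Dv. rewrite !Av_lin by easy. ring.
Qed.

End A3.

Definition unif_cont2 (f : R -> R -> R) : Prop :=
  forall e, 0 < e -> exists d, 0 < d /\
    forall x y x' y', Rabs (x' - x) < d -> Rabs (y' - y) < d -> Rabs (f x' y' - f x y) < e.

(** C^{2,1} regularity expressed by a uniform Taylor expansion. In this form it is linear in F and
    its coefficients, so it passes with the same Q to averages of translates, in particular to
    random walks. *)
Definition C21 (F p1 p2 X11 X12 X22 : R -> R -> R) (Q : R) : Prop :=
  forall x y e d, Rabs (F (x + e) (y + d) - F x y - p1 x y * e - p2 x y * d
     - / 2 * (X11 x y * e ^ 2 + 2 * X12 x y * e * d + X22 x y * d ^ 2)) <= Q * (Rabs e + Rabs d) ^ 3.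

(** Semiconvexity and semiconcavity together. *)
Definition second_diff (f : R -> R -> R) (C : R) : Prop :=
  forall x y e d, Rabs (f (x + e) (y + d) + f (x - e) (y - d) - 2 * f x y) <= C * (e ^ 2 + d ^ 2).

(** Averaging separately in x and y takes averages of translates of f, so the second difference
    constant C is kept exactly. Q depends on kap through the width tau, and later the length of the
    steps is adapted to it. *)
Lemma smoothing (f : R -> R -> R) (L C kap : R) :
  unif_cont2 f -> (forall x y, Rabs (f x y) <= L) -> second_diff f C -> 0 < kap ->
  exists F p1 p2 X11 X12 X22 Q, 0 <= Q /\ C21 F p1 p2 X11 X12 X22 Q /\ second_diff F C /\
    forall x y, Rabs (F x y - f x y) <= kap.
Proof.
  intros Huc HL HC Hkap.
  destruct (Huc kap Hkap) as [d0 [Hd0 Hd0']].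
  (* Triple averages look as far as 3 tau, which stays below d0. *)
  set (tau := d0 / 4). assert (Htau : 0 < tau) by (unfold tau; lra).
  assert (HL0 : 0 <= L) by (eapply Rle_trans; [apply Rabs_pos|apply (HL 0 0)]).
  assert (Hfx : forall x, ctn (f x)).
  { intros x y. apply continuous_eps. intros e He. destruct (Huc e He) as [d [Hd Hd']].
    exists d. split; [easy|]. intros y' Hy. apply Hd'; [|easy]. rewrite Rminus_diag, Rabs_R0. easy. }
  set (g := fun x y => A3 tau (f x) y).
  set (g1 := fun x y => A3d tau (f x) y).
  set (g2 := fun x y => A3dd tau (f x) y).
  assert (Hslice : forall x e, 0 < e -> exists d, 0 < d /\ forall x', Rabs (x' - x) < d ->
            forall y, Rabs (f x' y - f x y) <= e).
  { intros x e He. destruct (Huc e He) as [d [Hd Hd']]. exists d. split; [easy|].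
    intros x' Hx y. left. apply Hd'; [easy|]. rewrite Rminus_diag, Rabs_R0. easy. }
  assert (Hg : forall y, ctn (fun x => g x y)).
  { intros y x. apply continuous_eps. intros e He.
    destruct (Hslice x (e / 2) ltac:(lra)) as [d [Hd Hd']]. exists d. split; [easy|].
    intros x' Hx. apply Rle_lt_trans with (e / 2); [|lra]. apply A3_diff; auto. }
  assert (Hg1 : forall y, ctn (fun x => g1 x y)).
  { intros y x. apply continuous_eps. intros e He.
    destruct (Hslice x (e / 2 * tau) ltac:(nra)) as [d [Hd Hd']]. exists d. split; [easy|].
    intros x' Hx. apply Rle_lt_trans with (e / 2); [|lra].
    replace (e / 2) with (e / 2 * tau / tau) by (field; lra). apply A3d_diff; auto. }
  assert (Hg2 : forall y, ctn (fun x => g2 x y)).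
  { intros y x. apply continuous_eps. intros e He.
    assert (0 < tau ^ 2) by now apply pow_lt.
    destruct (Hslice x (e / 2 * tau ^ 2) ltac:(nra)) as [d [Hd Hd']]. exists d. split; [easy|].
    intros x' Hx. apply Rle_lt_trans with (e / 2); [|lra].
    replace (e / 2) with (e / 2 * tau ^ 2 / tau ^ 2) by (field; lra). apply A3dd_diff; auto. }
  assert (Bg : forall y x, Rabs (g x y) <= L) by (intros; apply A3_bound; auto).
  assert (Bg1 : forall y x, Rabs (g1 x y) <= L / tau) by (intros; apply A3d_bound; auto).
  assert (Bg2 : forall y x, Rabs (g2 x y) <= L / tau ^ 2) by (intros; apply A3dd_bound; auto).
  set (q := L / tau ^ 3).
  assert (Hq : 0 <= q).
  { apply Rmult_le_pos; [easy|]. left. apply Rinv_0_lt_compat. now apply pow_lt. }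
  exists (fun x y => A3 tau (fun s => g s y) x), (fun x y => A3d tau (fun s => g s y) x),
    (fun x y => A3 tau (fun s => g1 s y) x), (fun x y => A3dd tau (fun s => g s y) x),
    (fun x y => A3d tau (fun s => g1 s y) x), (fun x y => A3 tau (fun s => g2 s y) x), q.
  split; [easy|split; [|split]].
  - intros x y e d.
    (* The expansion is done in y first and its remainder rho is averaged in x. The coefficients of
       d^0, d^1 and d^2 are then expanded in x to the orders three, two and one. *)
    set (rho := fun s => g s (y + d) - g s y - d * g1 s y - / 2 * d ^ 2 * g2 s y).
    assert (Hrho : forall s, Rabs (rho s) <= q * Rabs d ^ 3).
    { intros s. apply (A3_taylor3 tau Htau (f s) L y d); auto. }
    assert (Hrc : ctn rho).
    { replace rho with (fun s => 1 * (1 * g s (y + d) + (-1) * g s y) + 1 * ((- d) * g1 s y + (- (/ 2 * d ^ 2)) * g2 s y))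
        by (extensionality s; unfold rho; ring).
      apply (ctn_lin (fun s => 1 * g s (y + d) + (-1) * g s y) (fun s => (- d) * g1 s y + (- (/ 2 * d ^ 2)) * g2 s y)).
      - apply (ctn_lin (fun s => g s (y + d)) (fun s => g s y)); apply Hg.
      - apply (ctn_lin (fun s => g1 s y) (fun s => g2 s y)); [apply Hg1|apply Hg2]. }
    assert (Hdec : A3 tau (fun s => g s (y + d)) (x + e) =
       A3 tau (fun s => g s y) (x + e) + d * A3 tau (fun s => g1 s y) (x + e)
       + / 2 * d ^ 2 * A3 tau (fun s => g2 s y) (x + e) + A3 tau rho (x + e)).
    { replace (fun s => g s (y + d)) with
        (fun s => 1 * (1 * g s y + d * g1 s y) + 1 * (/ 2 * d ^ 2 * g2 s y + 1 * rho s))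
        by (extensionality s; unfold rho; ring).
      rewrite (A3_lin tau Htau (fun s => 1 * g s y + d * g1 s y) (fun s => / 2 * d ^ 2 * g2 s y + 1 * rho s)).
      2: apply ctn_lin; [apply Hg|apply Hg1].
      2: apply ctn_lin; [apply Hg2|easy].
      rewrite (A3_lin tau Htau (fun s => g s y) (fun s => g1 s y)); [|apply Hg|apply Hg1].
      rewrite (A3_lin tau Htau (fun s => g2 s y) rho); [|apply Hg2|easy]. ring. }
    rewrite Hdec.
    assert (E0 := A3_bound tau Htau rho _ (x + e) Hrc Hrho).
    assert (E1 := A3_taylor3 tau Htau (fun s => g s y) L x e (Hg y) (Bg y)).
    assert (E2 := A3_taylor2 tau Htau (fun s => g1 s y) (L / tau) x e (Hg1 y) (Bg1 y)).
    assert (E3 := A3_taylor1 tau Htau (fun s => g2 s y) (L / tau ^ 2) x e (Hg2 y) (Bg2 y)).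
    fold q in E1.
    replace (L / tau / tau ^ 2) with q in E2 by (unfold q; field; lra).
    replace (L / tau ^ 2 / tau) with q in E3 by (unfold q; field; lra).
    set (a0 := A3 tau (fun s => g s y) (x + e)) in *. set (a1 := A3 tau (fun s => g1 s y) (x + e)) in *.
    set (a2 := A3 tau (fun s => g2 s y) (x + e)) in *. set (a3 := A3 tau rho (x + e)) in *.
    set (b0 := A3 tau (fun s => g s y) x) in *. set (b0d := A3d tau (fun s => g s y) x) in *.
    set (b0dd := A3dd tau (fun s => g s y) x) in *.
    set (b1 := A3 tau (fun s => g1 s y) x) in *. set (b1d := A3d tau (fun s => g1 s y) x) in *.
    set (b2 := A3 tau (fun s => g2 s y) x) in *.
    replace (a0 + d * a1 + / 2 * d ^ 2 * a2 + a3 - b0 - b0d * e - b1 * d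
      - / 2 * (b0dd * e ^ 2 + 2 * b1d * e * d + b2 * d ^ 2)) with
      ((a0 - b0 - e * b0d - / 2 * e ^ 2 * b0dd) + d * (a1 - b1 - e * b1d)
        + / 2 * d ^ 2 * (a2 - b2) + a3) by field.
    eapply Rle_trans; [apply Rabs_triang|].
    eapply Rle_trans; [apply Rplus_le_compat_r, Rabs_triang|].
    eapply Rle_trans; [apply Rplus_le_compat_r, Rplus_le_compat_r, Rabs_triang|].
    rewrite !Rabs_mult. rewrite (Rabs_pos_eq (/ 2)) by lra.
    rewrite (Rabs_pos_eq (d ^ 2)) by apply pow2_ge_0. rewrite <- (pow2_abs d).
    set (D := Rabs d) in *. set (E := Rabs e) in *.
    assert (HD : 0 <= D) by apply Rabs_pos. assert (HE : 0 <= E) by apply Rabs_pos.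
    assert (M1 := Rmult_le_compat_l D _ _ HD E2).
    assert (M2 := Rmult_le_compat_l (/ 2 * D ^ 2) _ _ ltac:(assert (H := pow2_ge_0 D); lra) E3).
    assert (0 <= q * (D ^ 2 * E)) by (apply Rmult_le_pos; [easy|apply Rmult_le_pos; [apply pow2_ge_0|easy]]).
    assert (0 <= q * (D * E ^ 2)) by (apply Rmult_le_pos; [easy|apply Rmult_le_pos; [easy|apply pow2_ge_0]]).
    replace (q * (E + D) ^ 3) with (q * E ^ 3 + 3 * (q * (D * E ^ 2)) + 3 * (q * (D ^ 2 * E)) + q * D ^ 3) by ring.
    replace (D * (q * E ^ 2)) with (q * (D * E ^ 2)) in M1 by ring.
    replace (/ 2 * D ^ 2 * (q * E)) with (/ 2 * (q * (D ^ 2 * E))) in M2 by ring.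
    lra.
  - intros x y e d.
    (* Averaging commutes with translations, so the second difference of the smoothed function is
       the average of D2. *)
    set (D2 := fun s t => f (s + e) (t + d) + f (s - e) (t - d) - 2 * f s t).
    assert (HD2 : forall s t, g (s + e) (t + d) + g (s - e) (t - d) - 2 * g s t = A3 tau (D2 s) t).
    { intros s t. unfold g.
      rewrite <- (A3_shift tau Htau (f (s + e)) d t) by easy.
      replace (t - d) with (t + - d) by ring. rewrite <- (A3_shift tau Htau (f (s - e)) (- d) t) by easy.
      replace (D2 s) with (fun t => 1 * (1 * f (s + e) (t + d) + 1 * f (s - e) (t + - d)) + (-2) * f s t)
        by (extensionality u; unfold D2, Rminus; ring).
      rewrite (A3_lin tau Htau (fun t => 1 * f (s + e) (t + d) + 1 * f (s - e) (t + - d)) (f s)).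
      2: apply ctn_lin; apply (ctn_shift (f _)); easy. 2: easy.
      rewrite (A3_lin tau Htau (fun t => f (s + e) (t + d)) (fun t => f (s - e) (t + - d)));
        [ring|apply (ctn_shift (f _)); easy|apply (ctn_shift (f _)); easy]. }
    assert (HF : A3 tau (fun s => g s (y + d)) (x + e) + A3 tau (fun s => g s (y - d)) (x - e)
         - 2 * A3 tau (fun s => g s y) x = A3 tau (fun s => A3 tau (D2 s) y) x).
    { rewrite <- (A3_shift tau Htau (fun s => g s (y + d)) e x) by apply Hg.
      replace (x - e) with (x + - e) by ring. rewrite <- (A3_shift tau Htau (fun s => g s (y - d)) (- e) x) by apply Hg.
      replace (fun s => A3 tau (D2 s) y) with
        (fun s => 1 * (1 * g (s + e) (y + d) + 1 * g (s + - e) (y - d)) + (-2) * g s y).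
      2: { extensionality s. rewrite <- HD2. unfold Rminus. ring. }
      rewrite (A3_lin tau Htau (fun s => 1 * g (s + e) (y + d) + 1 * g (s + - e) (y - d)) (fun s => g s y)).
      2: apply ctn_lin; [apply (ctn_shift (fun s => g s (y + d))), Hg|apply (ctn_shift (fun s => g s (y - d))), Hg].
      2: apply Hg.
      rewrite (A3_lin tau Htau (fun s => g (s + e) (y + d)) (fun s => g (s + - e) (y - d)));
        [ring|apply (ctn_shift (fun s => g s (y + d))), Hg|apply (ctn_shift (fun s => g s (y - d))), Hg]. }
    rewrite HF.
    assert (HD2c : forall s, ctn (D2 s)).
    { intros s. replace (D2 s) with (fun t => 1 * (1 * f (s + e) (t + d) + 1 * f (s - e) (t + - d)) + (-2) * f s t)
        by (extensionality u; unfold D2, Rminus; ring).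
      apply (ctn_lin (fun t => 1 * f (s + e) (t + d) + 1 * f (s - e) (t + - d)) (f s)); [|easy].
      apply (ctn_lin (fun t => f (s + e) (t + d)) (fun t => f (s - e) (t + - d))); apply (ctn_shift (f _)); easy. }
    apply A3_bound; [easy| |].
    + replace (fun s => A3 tau (D2 s) y) with
        (fun s => 1 * (1 * g (s + e) (y + d) + 1 * g (s + - e) (y - d)) + (-2) * g s y).
      2: { extensionality s. rewrite <- HD2. unfold Rminus. ring. }
      apply (ctn_lin (fun s => 1 * g (s + e) (y + d) + 1 * g (s + - e) (y - d)) (fun s => g s y)); [|apply Hg].
      apply (ctn_lin (fun s => g (s + e) (y + d)) (fun s => g (s + - e) (y - d)));
        [apply (ctn_shift (fun s => g s (y + d))), Hg|apply (ctn_shift (fun s => g s (y - d))), Hg].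
    + intros s. apply A3_bound; auto. intros t. apply HC.
  - intros x y. apply A3_close_local; auto. intros s Hs.
    apply A3_close_local; auto. intros t Ht. left. apply Hd0'; unfold tau in *; lra.
Qed.

Lemma le_of_cube (x y q : R) : 0 <= q -> (forall l, 0 < l < 1 -> l ^ 2 * x <= l ^ 2 * y + q * l ^ 3) -> x <= y.
Proof.
  intros Hq H. apply Rnot_lt_le. intros Hlt.
  set (l := Rmin (/ 2) ((x - y) / (2 * (q + 1)))).
  assert (H0 : 0 < (x - y) / (2 * (q + 1))) by (apply Rdiv_lt_0_compat; lra).
  assert (Hl : 0 < l) by (apply Rmin_glb_lt; lra).
  assert (Hl1 : l <= / 2) by apply Rmin_l. assert (Hl2 : l <= (x - y) / (2 * (q + 1))) by apply Rmin_r.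
  specialize (H l ltac:(lra)).
  assert (Hp : 0 < l ^ 2) by now apply pow_lt.
  assert (x <= y + q * l).
  { apply Rmult_le_reg_l with (l ^ 2); [easy|]. replace (l ^ 2 * (y + q * l)) with (l ^ 2 * y + q * l ^ 3) by ring. easy. }
  assert ((q + 1) * l <= (x - y) / 2).
  { apply Rle_trans with ((q + 1) * ((x - y) / (2 * (q + 1)))); [apply Rmult_le_compat_l; lra|right; field; lra]. }
  nra.
Qed.

(** With the increment scaled by l, the sum of the expansions at both signs gives l^2 times the form
    up to order l^3; then l tends to 0. *)
Lemma C21_hessian_form F p1 p2 X11 X12 X22 Q C x y e d :
  0 <= Q -> C21 F p1 p2 X11 X12 X22 Q -> second_diff F C ->
  Rabs (X11 x y * e ^ 2 + 2 * X12 x y * e * d + X22 x y * d ^ 2) <= C * (e ^ 2 + d ^ 2).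
Proof.
  intros HQ HF HC. set (X := X11 x y * e ^ 2 + 2 * X12 x y * e * d + X22 x y * d ^ 2).
  set (n := Rabs e + Rabs d).
  assert (Hn : 0 <= n) by (unfold n; assert (H := Rabs_pos e); assert (H' := Rabs_pos d); lra).
  assert (Hl : forall l, 0 < l < 1 -> Rabs (l ^ 2 * X) <= l ^ 2 * (C * (e ^ 2 + d ^ 2)) + 2 * Q * n ^ 3 * l ^ 3).
  { intros l Hl. assert (H1 := HF x y (l * e) (l * d)). assert (H2 := HF x y (- (l * e)) (- (l * d))).
    assert (H3 := HC x y (l * e) (l * d)).
    rewrite !Rabs_Ropp in H2.
    assert (Hn' : (Rabs (l * e) + Rabs (l * d)) ^ 3 = n ^ 3 * l ^ 3).
    { rewrite !Rabs_mult, (Rabs_pos_eq l) by lra. unfold n. ring. }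
    rewrite Hn' in *.
    apply Rabs_le_between in H1. apply Rabs_le_between in H2. apply Rabs_le_between in H3.
    unfold Rminus in H3 at 1 2.
    apply Rabs_le. unfold X. unfold Rminus in *. split; lra. }
  assert (HQn : 0 <= 2 * Q * n ^ 3) by (apply Rmult_le_pos; [lra|now apply pow_le]).
  apply Rabs_le. split.
  - assert (- X <= C * (e ^ 2 + d ^ 2)); [|lra].
    apply (le_of_cube _ _ _ HQn). intros l Hll. assert (H := Hl l Hll). apply Rabs_le_between in H. lra.
  - apply (le_of_cube _ _ _ HQn). intros l Hll. assert (H := Hl l Hll). apply Rabs_le_between in H. lra.
Qed.

(** * Random walks *)

(** The second difference of F at the shifted point, with a step of the size n of the shift, is
    expanded from both base points. The remainders add up to (1 + 1 + 8 + 8 + 2) Q n^3, and dividing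
    by n^2 leaves 20 Q n. *)
Lemma C21_hessian_lip F p1 p2 X11 X12 X22 Q x y v1 v2 a b :
  0 <= Q -> C21 F p1 p2 X11 X12 X22 Q -> Rabs a + Rabs b <= 1 ->
  Rabs ((X11 (x + v1) (y + v2) * a ^ 2 + 2 * X12 (x + v1) (y + v2) * a * b + X22 (x + v1) (y + v2) * b ^ 2)
      - (X11 x y * a ^ 2 + 2 * X12 x y * a * b + X22 x y * b ^ 2)) <= 20 * Q * (Rabs v1 + Rabs v2).
Proof.
  intros HQ HF Hab. set (n := Rabs v1 + Rabs v2).
  assert (Hv1 := Rabs_pos v1). assert (Hv2 := Rabs_pos v2).
  destruct (Req_dec n 0) as [Hn0|Hn0].
  { assert (v1 = 0) by (apply NNPP; intros H; apply Rabs_no_R0 in H; unfold n in *; lra).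
    assert (v2 = 0) by (apply NNPP; intros H'; apply Rabs_no_R0 in H'; unfold n in *; lra).
    subst. rewrite !Rplus_0_r, Rminus_diag, Rabs_R0, Hn0. lra. }
  assert (Hn : 0 < n) by (unfold n in *; lra).
  set (e := n * a). set (d := n * b).
  assert (He : Rabs e + Rabs d <= n).
  { unfold e, d. rewrite !Rabs_mult, (Rabs_pos_eq n) by lra. nra. }
  assert (H1 := HF x y (v1 + e) (v2 + d)). assert (H2 := HF x y (v1 - e) (v2 - d)).
  assert (H3 := HF x y v1 v2).
  assert (H4 := HF (x + v1) (y + v2) e d). assert (H5 := HF (x + v1) (y + v2) (- e) (- d)).
  assert (Hc : forall u w k, Rabs u + Rabs w <= k * n -> Q * (Rabs u + Rabs w) ^ 3 <= Q * (k ^ 3 * n ^ 3)).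
  { intros u w k Hk. apply Rmult_le_compat_l; [easy|]. replace (k ^ 3 * n ^ 3) with ((k * n) ^ 3) by ring.
    apply pow_incr. split; [|easy]. assert (Ha := Rabs_pos u). assert (Hb := Rabs_pos w). lra. }
  assert (B1 := Hc (v1 + e) (v2 + d) 2). assert (B2 := Hc (v1 - e) (v2 - d) 2).
  assert (B3 := Hc v1 v2 1). assert (B4 := Hc e d 1). assert (B5 := Hc (- e) (- d) 1).
  assert (T1 := Rabs_triang v1 e). assert (T2 := Rabs_triang v2 d).
  assert (T3 := Rabs_triang v1 (- e)). assert (T4 := Rabs_triang v2 (- d)).
  rewrite (Rabs_Ropp e), (Rabs_Ropp d) in *.
  fold (v1 - e) in T3. fold (v2 - d) in T4.
  fold n in B3, H3. specialize (B1 ltac:(unfold n in *; lra)). specialize (B2 ltac:(unfold n in *; lra)).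
  specialize (B3 ltac:(lra)). specialize (B4 ltac:(lra)). specialize (B5 ltac:(lra)).
  assert (H1' := Rle_trans _ _ _ H1 B1). assert (H2' := Rle_trans _ _ _ H2 B2).
  assert (H3' := Rle_trans _ _ _ H3 B3). assert (H4' := Rle_trans _ _ _ H4 B4).
  assert (H5' := Rle_trans _ _ _ H5 B5). clear H1 H2 H3 H4 H5 B1 B2 B3 B4 B5.
  replace (x + (v1 + e)) with (x + v1 + e) in H1' by ring. replace (y + (v2 + d)) with (y + v2 + d) in H1' by ring.
  replace (x + (v1 - e)) with (x + v1 + - e) in H2' by ring. replace (y + (v2 - d)) with (y + v2 + - d) in H2' by ring.
  set (Xv := X11 (x + v1) (y + v2) * a ^ 2 + 2 * X12 (x + v1) (y + v2) * a * b + X22 (x + v1) (y + v2) * b ^ 2).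
  set (X0 := X11 x y * a ^ 2 + 2 * X12 x y * a * b + X22 x y * b ^ 2).
  apply Rmult_le_reg_l with (n ^ 2); [now apply pow_lt|].
  rewrite <- (Rabs_pos_eq (n ^ 2)) at 1 by apply pow2_ge_0. rewrite <- Rabs_mult.
  apply Rabs_le_between in H1'. apply Rabs_le_between in H2'. apply Rabs_le_between in H3'.
  apply Rabs_le_between in H4'. apply Rabs_le_between in H5'.
  apply Rabs_le. unfold Xv, X0, e, d in *. split; lra.
Qed.

(** A bound independent of Q. Halving the increment gives |rr l| <= 2 |rr (l/2)| + C l^2 N / 4;
    iterated, the geometric sum is C N / 2, while 2^k |rr (2^-k)| tends to 0 because rr is O(l^2),
    with a constant that may involve Q. *)
Lemma C21_quadratic_bound F p1 p2 X11 X12 X22 Q C x y e d :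
  0 <= Q -> C21 F p1 p2 X11 X12 X22 Q -> second_diff F C ->
  Rabs (F (x + e) (y + d) - F x y - p1 x y * e - p2 x y * d) <= / 2 * C * (e ^ 2 + d ^ 2).
Proof.
  intros HQ HF HC.
  set (rr := fun l : R => F (x + l * e) (y + l * d) - F x y - p1 x y * (l * e) - p2 x y * (l * d)).
  set (N := e ^ 2 + d ^ 2). set (n := Rabs e + Rabs d).
  assert (Hhalf : forall l, Rabs (rr l) <= 2 * Rabs (rr (l / 2)) + C * l ^ 2 / 4 * N).
  { intros l. assert (H := HC (x + l / 2 * e) (y + l / 2 * d) (l / 2 * e) (l / 2 * d)).
    replace (x + l / 2 * e + l / 2 * e) with (x + l * e) in H by field.
    replace (y + l / 2 * d + l / 2 * d) with (y + l * d) in H by field.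
    replace (x + l / 2 * e - l / 2 * e) with x in H by field.
    replace (y + l / 2 * d - l / 2 * d) with y in H by field.
    replace (rr l) with (2 * rr (l / 2) + (F (x + l * e) (y + l * d) + F x y - 2 * F (x + l / 2 * e) (y + l / 2 * d)))
      by (unfold rr; field).
    eapply Rle_trans; [apply Rabs_triang|]. rewrite Rabs_mult, (Rabs_pos_eq 2) by lra.
    apply Rplus_le_compat_l. eapply Rle_trans; [exact H|]. right. unfold N. field. }
  assert (Hdy : forall k : nat, Rabs (rr 1) <= 2 ^ k * Rabs (rr ((/ 2) ^ k)) + / 2 * C * N * (1 - (/ 2) ^ k)).
  { induction k as [|k IH]; [simpl; lra|].
    eapply Rle_trans; [exact IH|].
    assert (H := Hhalf ((/ 2) ^ k)). replace ((/ 2) ^ k / 2) with ((/ 2) ^ S k) in H by (simpl; field).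
    assert (H2 : 0 < 2 ^ k) by (apply pow_lt; lra).
    assert (H' := Rmult_le_compat_l (2 ^ k) _ _ (Rlt_le _ _ H2) H).
    assert (Hi : 2 ^ k * (/ 2) ^ k = 1) by (rewrite <- Rpow_mult_distr; replace (2 * / 2) with 1 by field; apply pow1).
    replace (2 ^ k * (2 * Rabs (rr ((/ 2) ^ S k)) + C * ((/ 2) ^ k) ^ 2 / 4 * N)) with
      (2 ^ S k * Rabs (rr ((/ 2) ^ S k)) + C * (2 ^ k * (/ 2) ^ k) * (/ 2) ^ k / 4 * N) in H' by (simpl; field).
    rewrite Hi in H'. simpl (/ 2) at 3. replace ((/ 2) ^ S k) with (/ 2 * (/ 2) ^ k) in * by reflexivity. lra. }
  assert (Hrr : forall l, 0 < l <= 1 -> Rabs (rr l) <= (/ 2 * (C * N) + Q * n ^ 3) * l ^ 2).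
  { intros l Hl. assert (H1 := HF x y (l * e) (l * d)).
    assert (H2 := C21_hessian_form F p1 p2 X11 X12 X22 Q C x y (l * e) (l * d) HQ HF HC).
    assert (H3 : Q * (Rabs (l * e) + Rabs (l * d)) ^ 3 <= Q * n ^ 3 * l ^ 2).
    { rewrite !Rabs_mult, (Rabs_pos_eq l) by lra.
      replace (l * Rabs e + l * Rabs d) with (l * n) by (unfold n; ring).
      replace (Q * (l * n) ^ 3) with (Q * n ^ 3 * (l * l ^ 2)) by ring.
      apply Rmult_le_compat_l.
      - apply Rmult_le_pos; [easy|]. apply pow_le. unfold n.
        assert (Ha := Rabs_pos e). assert (Hb := Rabs_pos d). lra.
      - assert (H := pow2_ge_0 l). nra. }
    assert (H1' := Rle_trans _ _ _ H1 H3).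
    apply Rabs_le_between in H1'. apply Rabs_le_between in H2.
    apply Rabs_le. unfold rr, N. split; lra. }
  replace (F (x + e) (y + d) - F x y - p1 x y * e - p2 x y * d) with (rr 1)
    by (unfold rr; rewrite !Rmult_1_l; reflexivity).
  fold N. apply le_epsilon. intros eps Heps.
  set (K := / 2 * (C * N) + Q * n ^ 3) in *.
  assert (HK : 0 <= K).
  { assert (H := Hrr 1 ltac:(lra)). assert (H' := Rabs_pos (rr 1)). lra. }
  assert (HCN : 0 <= C * N).
  { eapply Rle_trans; [|apply (HC x y e d)]. apply Rabs_pos. }
  destruct (pow_lt_1_zero (/ 2) ltac:(rewrite Rabs_pos_eq; lra) (eps / (K + 1))
    ltac:(apply Rdiv_lt_0_compat; lra)) as [k Hk].
  specialize (Hk k (le_n k)). assert (Hkp : 0 < (/ 2) ^ k) by (apply pow_lt; lra).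
  rewrite Rabs_pos_eq in Hk by lra.
  assert (Hk1 : (/ 2) ^ k <= 1) by (rewrite <- (pow1 k); apply pow_incr; lra).
  assert (H := Hdy k). assert (H1 := Hrr ((/ 2) ^ k) ltac:(lra)).
  assert (H2 : 0 < 2 ^ k) by (apply pow_lt; lra).
  assert (Hi : 2 ^ k * (/ 2) ^ k = 1) by (rewrite <- Rpow_mult_distr; replace (2 * / 2) with 1 by field; apply pow1).
  assert (H3 : 2 ^ k * Rabs (rr ((/ 2) ^ k)) <= K * (/ 2) ^ k).
  { apply Rle_trans with (2 ^ k * (K * ((/ 2) ^ k) ^ 2)); [apply Rmult_le_compat_l; lra|].
    right. transitivity ((2 ^ k * (/ 2) ^ k) * (K * (/ 2) ^ k)); [ring|rewrite Hi; ring]. }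
  assert (H4 : K * (/ 2) ^ k <= eps).
  { apply Rle_trans with ((K + 1) * (/ 2) ^ k); [nra|].
    apply Rle_trans with ((K + 1) * (eps / (K + 1))); [apply Rmult_le_compat_l; lra|right; field; lra]. }
  assert (0 <= / 2 * C * N * (/ 2) ^ k) by (apply Rmult_le_pos; lra). lra.
Qed.

(** One step of a symmetric random walk: each of the moves u, - u, v, - v has probability 1/4, so
    the covariance is (u u^T + v v^T) / 2. *)
Definition walk (u1 u2 v1 v2 : R) (F : R -> R -> R) (x y : R) : R :=
  / 4 * (F (x + u1) (y + u2) + F (x - u1) (y - u2) + F (x + v1) (y + v2) + F (x - v1) (y - v2)).

Lemma Rabs4 a b c d k : Rabs a <= k -> Rabs b <= k -> Rabs c <= k -> Rabs d <= k ->
  Rabs (/ 4 * (a + b + c + d)) <= k.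
Proof.
  intros H1 H2 H3 H4. apply Rabs_le_between in H1. apply Rabs_le_between in H2.
  apply Rabs_le_between in H3. apply Rabs_le_between in H4. apply Rabs_le. lra.
Qed.

Lemma walk_C21 u1 u2 v1 v2 F p1 p2 X11 X12 X22 Q :
  C21 F p1 p2 X11 X12 X22 Q ->
  C21 (walk u1 u2 v1 v2 F) (walk u1 u2 v1 v2 p1) (walk u1 u2 v1 v2 p2)
    (walk u1 u2 v1 v2 X11) (walk u1 u2 v1 v2 X12) (walk u1 u2 v1 v2 X22) Q.
Proof.
  intros HF x y e d.
  set (E := fun x y => F (x + e) (y + d) - F x y - p1 x y * e - p2 x y * d
     - / 2 * (X11 x y * e ^ 2 + 2 * X12 x y * e * d + X22 x y * d ^ 2)).
  assert (H := Rabs4 _ _ _ _ _ (HF (x + u1) (y + u2) e d) (HF (x - u1) (y - u2) e d)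
    (HF (x + v1) (y + v2) e d) (HF (x - v1) (y - v2) e d)).
  unfold walk.
  replace (x + e + u1) with (x + u1 + e) by ring. replace (x + e - u1) with (x - u1 + e) by ring.
  replace (x + e + v1) with (x + v1 + e) by ring. replace (x + e - v1) with (x - v1 + e) by ring.
  replace (y + d + u2) with (y + u2 + d) by ring. replace (y + d - u2) with (y - u2 + d) by ring.
  replace (y + d + v2) with (y + v2 + d) by ring. replace (y + d - v2) with (y - v2 + d) by ring.
  eapply Rle_trans; [|exact H]. right. f_equal. field.
Qed.

Lemma walk_second_diff u1 u2 v1 v2 F C :
  second_diff F C -> second_diff (walk u1 u2 v1 v2 F) C.
Proof.
  intros HC x y e d.
  assert (H := Rabs4 _ _ _ _ _ (HC (x + u1) (y + u2) e d) (HC (x - u1) (y - u2) e d)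
    (HC (x + v1) (y + v2) e d) (HC (x - v1) (y - v2) e d)).
  unfold walk.
  replace (x + e + u1) with (x + u1 + e) by ring. replace (x + e - u1) with (x - u1 + e) by ring.
  replace (x + e + v1) with (x + v1 + e) by ring. replace (x + e - v1) with (x - v1 + e) by ring.
  replace (y + d + u2) with (y + u2 + d) by ring. replace (y + d - u2) with (y - u2 + d) by ring.
  replace (y + d + v2) with (y + v2 + d) by ring. replace (y + d - v2) with (y - v2 + d) by ring.
  replace (x - e + u1) with (x + u1 - e) by ring. replace (x - e - u1) with (x - u1 - e) by ring.
  replace (x - e + v1) with (x + v1 - e) by ring. replace (x - e - v1) with (x - v1 - e) by ring.
  replace (y - d + u2) with (y + u2 - d) by ring. replace (y - d - u2) with (y - u2 - d) by ring.
  replace (y - d + v2) with (y + v2 - d) by ring. replace (y - d - v2) with (y - v2 - d) by ring.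
  eapply Rle_trans; [|exact H]. right. f_equal. field.
Qed.

(** Opposite moves cancel the first-order terms, so the walk sees the Hessian up to a cubic
    error. *)
Lemma walk_increment u1 u2 v1 v2 F p1 p2 X11 X12 X22 Q x y :
  0 <= Q -> C21 F p1 p2 X11 X12 X22 Q ->
  Rabs (walk u1 u2 v1 v2 F x y - F x y
     - / 4 * (X11 x y * u1 ^ 2 + 2 * X12 x y * u1 * u2 + X22 x y * u2 ^ 2
              + (X11 x y * v1 ^ 2 + 2 * X12 x y * v1 * v2 + X22 x y * v2 ^ 2)))
    <= Q * (Rabs u1 + Rabs u2 + Rabs v1 + Rabs v2) ^ 3.
Proof.
  intros HQ HF.
  assert (Ha := Rabs_pos u1). assert (Hb := Rabs_pos u2). assert (Hc := Rabs_pos v1). assert (Hd := Rabs_pos v2).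
  set (n := Rabs u1 + Rabs u2 + Rabs v1 + Rabs v2).
  assert (Hn : forall k, 0 <= k <= n -> Q * k ^ 3 <= Q * n ^ 3).
  { intros k Hk. apply Rmult_le_compat_l; [easy|]. apply pow_incr. easy. }
  assert (H1 := HF x y u1 u2). assert (H2 := HF x y (- u1) (- u2)).
  assert (H3 := HF x y v1 v2). assert (H4 := HF x y (- v1) (- v2)).
  rewrite !Rabs_Ropp in H2, H4.
  assert (Hu := Hn (Rabs u1 + Rabs u2) ltac:(unfold n; lra)).
  assert (Hv := Hn (Rabs v1 + Rabs v2) ltac:(unfold n; lra)).
  assert (H := Rabs4 _ _ _ _ _ (Rle_trans _ _ _ H1 Hu) (Rle_trans _ _ _ H2 Hu) (Rle_trans _ _ _ H3 Hv) (Rle_trans _ _ _ H4 Hv)).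
  eapply Rle_trans; [|exact H]. right. f_equal. unfold walk, Rminus. field.
Qed.

Lemma walk_increment_bound u1 u2 v1 v2 F C x y : second_diff F C ->
  Rabs (walk u1 u2 v1 v2 F x y - F x y) <= / 4 * C * (u1 ^ 2 + u2 ^ 2 + (v1 ^ 2 + v2 ^ 2)).
Proof.
  intros HC. assert (H1 := HC x y u1 u2). assert (H2 := HC x y v1 v2).
  apply Rabs_le_between in H1. apply Rabs_le_between in H2.
  unfold walk. apply Rabs_le. lra.
Qed.

Definition walks (u1 u2 v1 v2 : R) (k : nat) (F : R -> R -> R) : R -> R -> R :=
  Nat.iter k (walk u1 u2 v1 v2) F.

Lemma walks_C21 u1 u2 v1 v2 k F p1 p2 X11 X12 X22 Q :
  C21 F p1 p2 X11 X12 X22 Q ->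
  C21 (walks u1 u2 v1 v2 k F) (walks u1 u2 v1 v2 k p1) (walks u1 u2 v1 v2 k p2)
    (walks u1 u2 v1 v2 k X11) (walks u1 u2 v1 v2 k X12) (walks u1 u2 v1 v2 k X22) Q.
Proof. intros HF. induction k as [|k IH]; [easy|]. simpl. now apply walk_C21. Qed.

Lemma walks_second_diff u1 u2 v1 v2 k F C :
  second_diff F C -> second_diff (walks u1 u2 v1 v2 k F) C.
Proof. intros HF. induction k as [|k IH]; [easy|]. simpl. now apply walk_second_diff. Qed.

Lemma walks_increment_bound u1 u2 v1 v2 k F C x y : second_diff F C ->
  Rabs (walks u1 u2 v1 v2 k F x y - F x y) <= INR k * (/ 4 * C * (u1 ^ 2 + u2 ^ 2 + (v1 ^ 2 + v2 ^ 2))).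
Proof.
  intros HC. induction k as [|k IH].
  - simpl. rewrite Rminus_diag, Rabs_R0. lra.
  - assert (H := walk_increment_bound u1 u2 v1 v2 _ C x y (walks_second_diff u1 u2 v1 v2 k F C HC)).
    rewrite S_INR. simpl. unfold walks in *.
    set (g := Nat.iter k (walk u1 u2 v1 v2) F) in *.
    replace (walk u1 u2 v1 v2 g x y - F x y) with ((walk u1 u2 v1 v2 g x y - g x y) + (g x y - F x y)) by ring.
    eapply Rle_trans; [apply Rabs_triang|]. lra.
Qed.

(* Driving both walks by the same signs plays the role of the matrix inequality of the theorem on
   sums. *)
Lemma walks_coupling u1 u2 v1 v2 u1' u2' v1' v2' e m k F G : 0 < e ->
  (forall x y x' y', F x y + G x' y' <= m + ((x - x') ^ 2 + (y - y') ^ 2) / (2 * e)) ->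
  forall x y x' y', walks u1 u2 v1 v2 k F x y + walks u1' u2' v1' v2' k G x' y' <=
    m + ((x - x') ^ 2 + (y - y') ^ 2) / (2 * e)
      + INR k * (((u1 - u1') ^ 2 + (u2 - u2') ^ 2 + (v1 - v1') ^ 2 + (v2 - v2') ^ 2) / (4 * e)).
Proof.
  intros He H. induction k as [|k IH]; intros x y x' y'.
  - simpl. specialize (H x y x' y'). lra.
  - rewrite S_INR. unfold walks in *. simpl Nat.iter. unfold walk at 1 3.
    assert (H1 := IH (x + u1) (y + u2) (x' + u1') (y' + u2')).
    assert (H2 := IH (x - u1) (y - u2) (x' - u1') (y' - u2')).
    assert (H3 := IH (x + v1) (y + v2) (x' + v1') (y' + v2')).
    assert (H4 := IH (x - v1) (y - v2) (x' - v1') (y' - v2')).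
    set (c := ((u1 - u1') ^ 2 + (u2 - u2') ^ 2 + (v1 - v1') ^ 2 + (v2 - v2') ^ 2) / (4 * e)) in *.
    (* The cross terms cancel between opposite signs, so each step raises the averaged penalty by
       the constant c only. *)
    assert (Hq : / 4 * (((x + u1 - (x' + u1')) ^ 2 + (y + u2 - (y' + u2')) ^ 2) / (2 * e)
       + ((x - u1 - (x' - u1')) ^ 2 + (y - u2 - (y' - u2')) ^ 2) / (2 * e)
       + ((x + v1 - (x' + v1')) ^ 2 + (y + v2 - (y' + v2')) ^ 2) / (2 * e)
       + ((x - v1 - (x' - v1')) ^ 2 + (y - v2 - (y' - v2')) ^ 2) / (2 * e))
       = ((x - x') ^ 2 + (y - y') ^ 2) / (2 * e) + c) by (unfold c; field; lra).
    set (q1 := ((x + u1 - (x' + u1')) ^ 2 + (y + u2 - (y' + u2')) ^ 2) / (2 * e)) in *.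
    set (q2 := ((x - u1 - (x' - u1')) ^ 2 + (y - u2 - (y' - u2')) ^ 2) / (2 * e)) in *.
    set (q3 := ((x + v1 - (x' + v1')) ^ 2 + (y + v2 - (y' + v2')) ^ 2) / (2 * e)) in *.
    set (q4 := ((x - v1 - (x' - v1')) ^ 2 + (y - v2 - (y' - v2')) ^ 2) / (2 * e)) in *.
    set (q0 := ((x - x') ^ 2 + (y - y') ^ 2) / (2 * e)) in *.
    clearbody q1 q2 q3 q4 q0 c. lra.
Qed.

(** * Test functions from superjets *)

Definition small_o (W : R -> R) : Prop :=
  forall e, 0 < e -> exists d, 0 < d /\ forall s, Rabs s < d -> W s <= e * Rabs s.

Lemma Rmin_lip a b c : Rabs (Rmin c a - Rmin c b) <= Rabs (a - b).
Proof.
  unfold Rmin. repeat destruct (Rle_dec _ _); unfold Rabs; repeat destruct (Rcase_abs _); lra.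
Qed.

Lemma Rmax_lip a b c : Rabs (Rmax c a - Rmax c b) <= Rabs (a - b).
Proof.
  unfold Rmax. repeat destruct (Rle_dec _ _); unfold Rabs; repeat destruct (Rcase_abs _); lra.
Qed.

(* The majorant is the integral of twice sup_s (W(s)^+ / |s|) min(1, 2 u / |s|), which is continuous
   in u although W is arbitrary. *)
Lemma small_o_C1_majorant (W : R -> R) : small_o W ->
  exists om om' : R -> R, (forall s, is_derive om s (om' s)) /\ ctn om' /\ om 0 = 0 /\ om' 0 = 0 /\
    exists d, 0 < d /\ forall s, Rabs s < d -> W s <= om s.
Proof.
  intros HW. destruct (HW 1 Rlt_0_1) as [d0 [Hd0 H0]].
  (* c tends to 0 at the origin although W^+ may be very irregular. The factor in h below is 0 at u
     = 0 and equals 1 as soon as u >= |s| / 2. *)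
  set (c := fun s => if Rlt_dec (Rabs s) d0 then Rmax 0 (W s) / Rabs s else 0).
  set (h := fun u s => c s * Rmin 1 (2 * Rmax 0 u / Rabs s)).
  assert (Hc : forall e s, 0 <= e -> (Rabs s < d0 -> W s <= e * Rabs s) -> 0 <= c s <= e).
  { intros e s He Hs. unfold c. destruct (Rlt_dec (Rabs s) d0) as [Hlt|Hlt]; [|lra].
    destruct (Req_dec s 0) as [->|Hs0].
    - rewrite Rabs_R0. unfold Rdiv. rewrite Rinv_0, Rmult_0_r. lra.
    - assert (Hp := Rabs_pos_lt s Hs0). assert (HM : 0 <= Rmax 0 (W s) <= e * Rabs s).
      { split; [apply Rmax_l|]. apply Rmax_lub; [apply Rmult_le_pos; lra|auto]. }
      split; [apply Rdiv_le_0_compat; lra|].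
      apply Rmult_le_reg_r with (Rabs s); [easy|]. unfold Rdiv. rewrite Rmult_assoc, Rinv_l, Rmult_1_r; lra. }
  assert (Hm : forall u s, 0 <= Rmin 1 (2 * Rmax 0 u / Rabs s) <= 1).
  { intros u s. split; [|apply Rmin_l]. apply Rmin_glb; [lra|].
    assert (H := Rmax_l 0 u). destruct (Req_dec s 0) as [->|Hs0].
    - rewrite Rabs_R0. unfold Rdiv. rewrite Rinv_0. lra.
    - apply Rdiv_le_0_compat; [lra|now apply Rabs_pos_lt]. }
  assert (Hc1 : forall s, 0 <= c s <= 1).
  { intros s. apply Hc; [lra|]. intros Hs. apply H0; easy. }
  assert (Hh : forall u s, 0 <= h u s <= 1).
  { intros u s. unfold h. assert (H1 := Hc1 s). assert (H2 := Hm u s). nra. }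
  set (eta := fun u => 2 * Sup (h u)).
  assert (Hsup : forall u s, h u s <= Sup (h u)).
  { intros u s. apply (Sup_ub (h u) 1). intros; apply Hh. }
  assert (Heta0 : forall u, 0 <= eta u).
  { intros u. unfold eta. assert (H := Hsup u 0). assert (H' := Hh u 0). lra. }
  assert (Hneg : forall u, u <= 0 -> eta u = 0).
  { intros u Hu. unfold eta. assert (Sup (h u) <= 0).
    { apply (Sup_le _ _ 0). intros s. unfold h. rewrite (Rmax_left 0 u) by lra.
      unfold Rdiv. rewrite Rmult_0_r, Rmult_0_l. rewrite Rmin_right by lra. lra. }
    assert (H' := Heta0 u). unfold eta in H'. lra. }
  assert (Hcont : ctn eta).
  { intros u. apply continuous_eps. intros e He.
    destruct (HW (e / 8) ltac:(lra)) as [d [Hd Hd']].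
    exists (d * (e / 16)). split; [apply Rmult_lt_0_compat; lra|]. intros u' Hu.
    assert (Hdiff : forall s, Rabs (h u' s - h u s) <= e / 8).
    { intros s. unfold h.
      assert (H1 := Hc1 s). assert (H2 := Hm u s). assert (H2' := Hm u' s).
      (* For small |s| the factor c s is itself small; for the other s the cut-off is Lipschitz in u
         with constant 2 / d. *)
      destruct (Rlt_le_dec (Rabs s) d) as [Hs|Hs].
      - assert (Hcs : 0 <= c s <= e / 8) by (apply Hc; [lra|intros _; now apply Hd']).
        apply Rabs_le. nra.
      - rewrite <- Rmult_minus_distr_l, Rabs_mult, (Rabs_pos_eq (c s)) by easy.
        assert (Hl : Rabs (Rmin 1 (2 * Rmax 0 u' / Rabs s) - Rmin 1 (2 * Rmax 0 u / Rabs s)) <= e / 8).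
        { eapply Rle_trans; [apply Rmin_lip|].
          replace (2 * Rmax 0 u' / Rabs s - 2 * Rmax 0 u / Rabs s) with
            ((Rmax 0 u' - Rmax 0 u) * (2 / Rabs s)) by (field; lra).
          rewrite Rabs_mult. assert (Hd2 : 0 <= 2 / Rabs s <= 2 / d).
          { split; [apply Rdiv_le_0_compat; lra|]. apply Rmult_le_compat_l; [lra|]. apply Rinv_le_contravar; lra. }
          rewrite (Rabs_pos_eq (2 / Rabs s)) by easy.
          apply Rle_trans with (d * (e / 16) * (2 / d)).
          - apply Rmult_le_compat; try lra; [apply Rabs_pos|].
            eapply Rle_trans; [apply Rmax_lip|]. lra.
          - right. field. lra. }
        assert (H3 := Rabs_pos (Rmin 1 (2 * Rmax 0 u' / Rabs s) - Rmin 1 (2 * Rmax 0 u / Rabs s))). nra. }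
    unfold eta.
    assert (S1 : Sup (h u') <= Sup (h u) + e / 8).
    { apply (Sup_le _ _ 0). intros s. assert (H1 := Hdiff s). apply Rabs_le_between in H1. assert (H2 := Hsup u s). lra. }
    assert (S2 : Sup (h u) <= Sup (h u') + e / 8).
    { apply (Sup_le _ _ 0). intros s. assert (H1 := Hdiff s). apply Rabs_le_between in H1. assert (H2 := Hsup u' s). lra. }
    apply Rabs_def1; lra. }
  set (I := fun s => RInt eta 0 s : R).
  assert (HI : forall s, is_derive I s (eta s)).
  { intros y. apply (is_derive_RInt eta I 0 y); [|apply Hcont].
    exists (mkposreal 1 Rlt_0_1). intros z _. apply (RInt_correct (V := R_CompleteNormedModule)).
    now apply ctn_ex_RInt. }
  assert (I0 : I 0 = 0) by (unfold I; rewrite RInt_point; reflexivity).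
  assert (HIpos : forall s, 0 <= I s).
  { intros s. destruct (Rle_lt_dec 0 s) as [Hs|Hs].
    - unfold I. apply RInt_ge_0; [easy|now apply ctn_ex_RInt|]. intros; apply Heta0.
    - unfold I. rewrite (RInt_ext eta (fun _ => 0)).
      + rewrite RInt_const. unfold scal; simpl; unfold mult; simpl. lra.
      + intros x Hx. rewrite Rmax_left in Hx by lra. apply Hneg. lra. }
  assert (HIW : forall s, 0 < s < d0 -> forall w, Rabs w = s -> W w <= I s).
  { intros s Hs w Hw. apply Rle_trans with (Rmax 0 (W w)); [apply Rmax_r|].
    assert (Hcw : c w = Rmax 0 (W w) / s).
    { unfold c. rewrite Hw. destruct (Rlt_dec s d0); [easy|lra]. }
    (* On this range the cut-off is one, so the integral over (s / 2, s) alone is at least s times c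
       w, the positive part of W w. *)
    assert (Hlow : forall u, s / 2 < u < s -> 2 * c w <= eta u).
    { intros u Hu. unfold eta. apply Rmult_le_compat_l; [lra|].
      eapply Rle_trans; [|apply (Hsup u w)]. unfold h. rewrite Rmin_left; [lra|].
      rewrite Hw, (Rmax_right 0 u) by lra.
      apply Rmult_le_reg_r with s; [lra|]. unfold Rdiv. rewrite Rmult_assoc, Rinv_l by lra. lra. }
    assert (HC : I s = I (s / 2) + RInt eta (s / 2) s).
    { unfold I. rewrite <- (RInt_Chasles (V := R_CompleteNormedModule) eta 0 (s / 2) s) by now apply ctn_ex_RInt.
      reflexivity. }
    assert (HR : RInt (fun _ => 2 * c w) (s / 2) s <= RInt eta (s / 2) s).
    { apply RInt_le; [lra|apply ex_RInt_const|now apply ctn_ex_RInt|easy]. }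
    rewrite RInt_const in HR. unfold scal in HR; simpl in HR; unfold mult in HR; simpl in HR.
    assert (E : (s - s / 2) * (2 * c w) = Rmax 0 (W w)) by (rewrite Hcw; field; lra).
    assert (HP := HIpos (s / 2)). rewrite HC, <- E. lra. }
  (* I vanishes on the negative half-line, so this is I(|s|); its derivative is continuous at 0
     because eta 0 = 0. *)
  exists (fun s => I s + I (- s)), (fun s => eta s - eta (- s)). split; [|split; [|split; [|split]]].
  - intros s. replace (eta s - eta (- s)) with (plus (eta s) (scal (-1) (eta (- s))))
      by (unfold plus, scal; simpl; unfold mult; simpl; ring).
    apply (is_derive_plus I (fun s => I (- s))); [apply HI|].
    apply (is_derive_comp I (fun s => - s)); [apply HI|auto_derive; auto].
  - intros s. apply (continuous_minus eta (fun s => eta (- s))); [apply Hcont|].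
    apply (continuous_comp (fun s => - s) eta); [|apply Hcont].
    apply (continuous_opp (fun s : R => s)). apply continuous_id.
  - rewrite Ropp_0, I0. ring.
  - rewrite Ropp_0. ring.
  - exists d0. split; [easy|]. intros s Hs.
    destruct (Rtotal_order s 0) as [Hlt|[->|Hgt]].
    + assert (H := HIW (- s) ltac:(rewrite Rabs_left in Hs; lra) s (Rabs_left s Hlt)).
      assert (H' := HIpos s). lra.
    + assert (H := H0 0 ltac:(rewrite Rabs_R0; lra)). rewrite Rabs_R0 in H. rewrite Ropp_0, I0. lra.
    + assert (H := HIW s ltac:(rewrite Rabs_pos_eq in Hs; lra) s (Rabs_pos_eq s ltac:(lra))).
      assert (H' := HIpos (- s)). lra.
Qed.

Lemma ln1p_expansion (c : R) : 0 < c -> exists d, 0 < d /\ d <= / 2 /\ forall s, Rabs s < d ->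
  Rabs (ln (1 + s) - (s - s ^ 2 / 2)) <= c * s ^ 2 /\ Rabs (ln (1 + s) - s) <= s ^ 2.
Proof.
  intros Hc. exists (Rmin (/ 4) (c / 2)). split; [apply Rmin_glb_lt; lra|].
  split; [eapply Rle_trans; [apply Rmin_l|lra]|]. intros s Hs.
  assert (S1 := Rlt_le_trans _ _ _ Hs (Rmin_l _ _)). assert (S2 := Rlt_le_trans _ _ _ Hs (Rmin_r _ _)).
  set (g := fun u => ln (1 + u) - (u - u ^ 2 / 2)).
  assert (Hg0 : g 0 = 0) by (unfold g; rewrite Rplus_0_r, ln_1; field).
  assert (H : Rabs (g s) <= 2 * Rabs s ^ 3).
  { destruct (MVT_gen g 0 s (fun u => u ^ 2 / (1 + u))) as [v [Hv1 Hv2]].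
    - intros u Hu. unfold g. apply Rabs_def2 in S1. unfold Rmin, Rmax in Hu.
      destruct (Rle_dec 0 s); auto_derive; try lra; field; lra.
    - intros u Hu. apply continuity_pt_filterlim. apply (ex_derive_continuous g).
      apply Rabs_def2 in S1. unfold Rmin, Rmax in Hu.
      unfold g. destruct (Rle_dec 0 s); auto_derive; lra.
    - rewrite Hg0, !Rminus_0_r in Hv2. rewrite Hv2, Rabs_mult.
      assert (Hv : Rabs v <= Rabs s).
      { unfold Rmin, Rmax in Hv1. destruct (Rle_dec 0 s); unfold Rabs; repeat destruct (Rcase_abs _); lra. }
      assert (Hv3 : / 2 <= 1 + v).
      { apply Rabs_def2 in S1. apply Rabs_le_between in Hv. unfold Rabs in Hv; destruct (Rcase_abs s); lra. }
      assert (Hb : Rabs (v ^ 2 / (1 + v)) <= 2 * Rabs s ^ 2).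
      { assert (Hv4 := pow2_ge_0 v).
        rewrite Rabs_pos_eq by (apply Rdiv_le_0_compat; lra).
        assert (Hv5 : v ^ 2 <= Rabs s ^ 2) by (rewrite <- (pow2_abs v); apply pow_incr; split; [apply Rabs_pos|easy]).
        apply Rmult_le_reg_r with (1 + v); [lra|]. unfold Rdiv. rewrite Rmult_assoc, Rinv_l by lra. nra. }
      replace (2 * Rabs s ^ 3) with (2 * Rabs s ^ 2 * Rabs s) by ring.
      apply Rmult_le_compat_r; [apply Rabs_pos|easy]. }
  rewrite <- (pow2_abs s) at 2 3. assert (Hs0 := Rabs_pos s). assert (Hs2 := pow2_ge_0 (Rabs s)).
  fold (g s). split; [nra|].
  replace (ln (1 + s) - s) with (g s - s ^ 2 / 2) by (unfold g; ring).
  eapply Rle_trans; [apply Rabs_triang|]. rewrite Rabs_Ropp.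
  rewrite (Rabs_pos_eq (s ^ 2 / 2)) by (assert (H' := pow2_ge_0 s); lra).
  rewrite <- (pow2_abs s). nra.
Qed.

(** Continuity on the product space, where the rules for sums, products and compositions apply. *)
Definition ct3 (f : R -> R -> R -> R) : Prop :=
  forall p : R * R * R, continuous (fun p : R * R * R => f (fst (fst p)) (snd (fst p)) (snd p)) p.

Lemma continuous3_intro (f : R -> R -> R -> R) : ct3 f -> continuous3 f.
Proof.
  intros H x y z eps Heps.
  assert (H1 := proj1 (filterlim_locally _ _) (H (x, y, z)) (mkposreal eps Heps)).
  destruct H1 as [d Hd]. exists d. split; [apply cond_pos|].
  intros x' y' z' Hx Hy Hz. apply (Hd (x', y', z')). split; [split|]; easy.
Qed.

Lemma ct3_const c : ct3 (fun _ _ _ => c).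
Proof. intros p. apply continuous_const. Qed.
Lemma ct3_1 : ct3 (fun x _ _ => x).
Proof.
  intros p. apply (continuous_comp (fun p : R * R * R => fst p) (fun q : R * R => fst q));
    apply continuous_fst.
Qed.
Lemma ct3_2 : ct3 (fun _ y _ => y).
Proof.
  intros p. apply (continuous_comp (fun p : R * R * R => fst p) (fun q : R * R => snd q));
    [apply continuous_fst|apply continuous_snd].
Qed.
Lemma ct3_3 (g : R -> R) : ctn g -> ct3 (fun _ _ z => g z).
Proof.
  intros Hg p. apply (continuous_comp (fun p : R * R * R => snd p) g);
    [apply continuous_snd|apply Hg].
Qed.
Lemma ct3_plus f g : ct3 f -> ct3 g -> ct3 (fun x y z => f x y z + g x y z).
Proof. intros Hf Hg p. apply (continuous_plus (fun p : R * R * R => f (fst (fst p)) (snd (fst p)) (snd p))); auto. Qed.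
Lemma ct3_mult f g : ct3 f -> ct3 g -> ct3 (fun x y z => f x y z * g x y z).
Proof. intros Hf Hg p. apply (continuous_mult (fun p : R * R * R => f (fst (fst p)) (snd (fst p)) (snd p))); auto. Qed.

Ltac solve_ct3 := cbv beta; lazymatch goal with
  | |- ct3 (fun x y z => x) => exact ct3_1
  | |- ct3 (fun x y z => y) => exact ct3_2
  | |- ct3 (fun x y z => @?f x y z + @?g x y z) => apply (ct3_plus f g); solve_ct3
  | |- ct3 (fun x y z => @?f x y z * @?g x y z) => apply (ct3_mult f g); solve_ct3
  | |- _ => first [apply ct3_const|apply ct3_3]
  end.

(** Squares are written as products so that [solve_ct3] can take them apart. *)
Lemma quadratic_test_fn (om om' : R -> R) (S0 H0 t0 c1 c2 d11 d12 d22 : R) :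
  (forall s, is_derive om s (om' s)) -> ctn om' ->
  test_fn
    (fun S H t => om (t - t0) + (c1 * (S - S0) + c2 * (H - H0)
       + (d11 * ((S - S0) * (S - S0)) + d12 * ((S - S0) * (H - H0)) + d22 * ((H - H0) * (H - H0)))))
    (fun S H t => om' (t - t0))
    (fun S H t => c1 + (2 * d11 * (S - S0) + d12 * (H - H0)))
    (fun S H t => c2 + (d12 * (S - S0) + 2 * d22 * (H - H0)))
    (fun S H t => 2 * d11) (fun S H t => d12) (fun S H t => 2 * d22).
Proof.
  intros Hom Hom'.
  assert (Hct : forall g, ctn g -> ctn (fun t => g (t - t0))) by (intros g Hg; now apply (ctn_shift g (- t0))).
  assert (Homc : ctn om) by (intros s; apply (ex_derive_continuous om); eexists; apply Hom).
  unfold test_fn, Rminus.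
  refine (conj _ (conj _ (conj _ (conj _ (conj _ (conj _ (conj _ (fun S H t =>
    conj _ (conj _ (conj _ (conj _ (conj _ _)))))))))))).
  1-7: apply continuous3_intro; solve_ct3; now apply Hct.
  - replace (om' (t + - t0)) with (plus (scal 1 (om' (t + - t0))) 0)
      by (unfold plus, scal; simpl; unfold mult; simpl; ring).
    apply (is_derive_plus (fun t' => om (t' + - t0)) (fun _ =>
      c1 * (S + - S0) + c2 * (H + - H0) + (d11 * ((S + - S0) * (S + - S0))
        + d12 * ((S + - S0) * (H + - H0)) + d22 * ((H + - H0) * (H + - H0))))).
    + apply (is_derive_comp om (fun t' => t' + - t0)); [apply Hom|auto_derive; auto].
    + apply @is_derive_const.
  - auto_derive; auto. ring.
  - auto_derive; auto. ring.
  - auto_derive; auto. ring.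
  - auto_derive; auto. ring.
  - auto_derive; auto. ring.
Qed.

(** * Superjets in logarithmic variables *)

(* [touch] says that U has the parabolic superjet (q, p, X) at (x, y, t); the errors allowed are
   k |dz|^2 for every k > 0 in space and o(|dt|) in time. *)
Definition touch (T : R) (U : R -> R -> R -> R) (x y t q p1 p2 X11 X12 X22 : R) : Prop :=
  forall k, 0 < k -> exists W d, small_o W /\ 0 < d /\ forall x' y' t', 0 <= t' <= T ->
    Rabs (x' - x) < d -> Rabs (y' - y) < d -> Rabs (t' - t) < d ->
    U x' y' t' <= U x y t + q * (t' - t) + W (t' - t) + p1 * (x' - x) + p2 * (y' - y)
      + / 2 * (X11 * (x' - x) ^ 2 + 2 * X12 * (x' - x) * (y' - y) + X22 * (y' - y) ^ 2)
      + k * ((x' - x) ^ 2 + (y' - y) ^ 2).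

Lemma small_o_plus W W' : small_o W -> small_o W' -> small_o (fun s => W s + W' s).
Proof.
  intros H H' e He. destruct (H (e / 2) ltac:(lra)) as [d [Hd H1]].
  destruct (H' (e / 2) ltac:(lra)) as [d' [Hd' H1']].
  exists (Rmin d d'). split; [now apply Rmin_glb_lt|]. intros s Hs.
  assert (Ha := H1 s (Rlt_le_trans _ _ _ Hs (Rmin_l _ _))).
  assert (Hb := H1' s (Rlt_le_trans _ _ _ Hs (Rmin_r _ _))). lra.
Qed.

Lemma small_o_square c : small_o (fun s => c * s ^ 2).
Proof.
  intros e He. exists (e / (Rabs c + 1)). assert (Hc := Rabs_pos c).
  split; [apply Rdiv_lt_0_compat; lra|]. intros s Hs.
  rewrite <- (pow2_abs s). assert (Hp := Rabs_pos s).
  assert (H : (Rabs c + 1) * Rabs s <= e).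
  { apply Rle_trans with ((Rabs c + 1) * (e / (Rabs c + 1))); [apply Rmult_le_compat_l; lra|right; field; lra]. }
  assert (Hcc := Rle_abs c).
  apply Rle_trans with ((Rabs c + 1) * Rabs s * Rabs s); [|apply Rmult_le_compat_r; lra].
  assert (c * Rabs s ^ 2 <= (Rabs c + 1) * Rabs s ^ 2) by (apply Rmult_le_compat_r; [apply pow2_ge_0|lra]). lra.
Qed.

Lemma small_o_scal c W : 0 <= c -> small_o W -> small_o (fun s => c * W s).
Proof.
  intros Hc H e He. destruct (H (e / (c + 1)) ltac:(apply Rdiv_lt_0_compat; lra)) as [d [Hd Hd']].
  exists d. split; [easy|]. intros s Hs. specialize (Hd' s Hs).
  apply Rle_trans with (c * (e / (c + 1) * Rabs s)); [now apply Rmult_le_compat_l|].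
  assert (Hp := Rabs_pos s). replace (c * (e / (c + 1) * Rabs s)) with (c / (c + 1) * (e * Rabs s)) by (field; lra).
  assert (c / (c + 1) <= 1).
  { apply Rmult_le_reg_r with (c + 1); [lra|]. unfold Rdiv. rewrite Rmult_assoc, Rinv_l; lra. }
  assert (0 <= e * Rabs s) by (apply Rmult_le_pos; lra). nra.
Qed.

Lemma touch_plus T U U' x y t q p1 p2 X11 X12 X22 q' p1' p2' X11' X12' X22' :
  touch T U x y t q p1 p2 X11 X12 X22 -> touch T U' x y t q' p1' p2' X11' X12' X22' ->
  touch T (fun x y t => U x y t + U' x y t) x y t (q + q') (p1 + p1') (p2 + p2')
    (X11 + X11') (X12 + X12') (X22 + X22').
Proof.
  intros H H' k Hk. destruct (H (k / 2) ltac:(lra)) as [W [d [HW [Hd H1]]]].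
  destruct (H' (k / 2) ltac:(lra)) as [W' [d' [HW' [Hd' H1']]]].
  exists (fun s => W s + W' s), (Rmin d d').
  split; [now apply small_o_plus|split; [now apply Rmin_glb_lt|]].
  intros x' y' t' Ht Hx Hy Htt.
  assert (A1 := H1 x' y' t' Ht (Rlt_le_trans _ _ _ Hx (Rmin_l _ _)) (Rlt_le_trans _ _ _ Hy (Rmin_l _ _))
    (Rlt_le_trans _ _ _ Htt (Rmin_l _ _))).
  assert (A2 := H1' x' y' t' Ht (Rlt_le_trans _ _ _ Hx (Rmin_r _ _)) (Rlt_le_trans _ _ _ Hy (Rmin_r _ _))
    (Rlt_le_trans _ _ _ Htt (Rmin_r _ _))). lra.
Qed.

(** Lowering a function away from the contact point keeps its superjets. This turns jets of a
    truncation into jets of the original function. *)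
Lemma touch_local T U U' x y t q p1 p2 X11 X12 X22 d0 : 0 < d0 -> 0 <= t <= T ->
  U x y t = U' x y t ->
  (forall x' y' t', 0 <= t' <= T -> Rabs (x' - x) < d0 -> Rabs (y' - y) < d0 -> Rabs (t' - t) < d0 ->
     U' x' y' t' <= U x' y' t') ->
  touch T U x y t q p1 p2 X11 X12 X22 -> touch T U' x y t q p1 p2 X11 X12 X22.
Proof.
  intros Hd0 Ht0 Heq Hle H k Hk. destruct (H k Hk) as [W [d [HW [Hd H1]]]].
  exists W, (Rmin d d0). split; [easy|split; [now apply Rmin_glb_lt|]].
  intros x' y' t' Ht Hx Hy Htt.
  assert (A1 := H1 x' y' t' Ht (Rlt_le_trans _ _ _ Hx (Rmin_l _ _)) (Rlt_le_trans _ _ _ Hy (Rmin_l _ _))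
    (Rlt_le_trans _ _ _ Htt (Rmin_l _ _))).
  assert (A2 := Hle x' y' t' Ht (Rlt_le_trans _ _ _ Hx (Rmin_r _ _)) (Rlt_le_trans _ _ _ Hy (Rmin_r _ _))
    (Rlt_le_trans _ _ _ Htt (Rmin_r _ _))). lra.
Qed.

(* In the variables x = ln S, y = ln H: volatilities sg, bb, drifts m1, m2, and the coefficient gm of
   |P_x|. *)
Record coef := Coef {
  sg : R -> R -> R; bb : R -> R -> R; m1 : R -> R -> R -> R; m2 : R -> R -> R; gm : R -> R -> R }.

Definition ham (r rho : R) (c : coef) (x y t V q p1 p2 X11 X12 X22 : R) : R :=
  q + m1 c x y t * p1 + m2 c y t * p2 + gm c x t * Rabs p1
  + / 2 * sg c x t ^ 2 * X11 + rho * sg c x t * bb c y t * X12 + / 2 * bb c y t ^ 2 * X22 - r * V.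

(** P selects the values of U at which the inequality is claimed; a truncation at - L keeps it only
    for values above - L. *)
Definition jsub (T r rho : R) (c : coef) (P : R -> Prop) (U : R -> R -> R -> R) : Prop :=
  forall x y t q p1 p2 X11 X12 X22, 0 < t < T -> P (U x y t) ->
    touch T U x y t q p1 p2 X11 X12 X22 ->
    0 <= ham r rho c x y t (U x y t) q p1 p2 X11 X12 X22.

(** The terms with - 1/2 are the corrections due to the second derivative of the logarithm. *)
Definition logcoef (mu sigma a b : R -> R -> R) (r rho alpha : R) : coef :=
  Coef (fun x t => sigma (exp x) t) (fun y t => b (exp y) t)
    (fun x y t => mu_tilde mu sigma a b r rho (exp x) (exp y) t - / 2 * sigma (exp x) t ^ 2)
    (fun y t => r - / 2 * b (exp y) t ^ 2)
    (fun x t => alpha * sqrt (1 - rho ^ 2) * sigma (exp x) t).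

Lemma exp_log_step x S : 0 < S -> ln S - x = ln (1 + (S - exp x) / exp x).
Proof.
  intros HS. assert (H := exp_pos x).
  replace (1 + (S - exp x) / exp x) with (S / exp x) by (field; lra).
  unfold Rdiv. rewrite ln_mult, ln_Rinv, ln_exp; [ring|easy|easy|now apply Rinv_0_lt_compat].
Qed.

(** Second-order chain rule with dx = ln(1 + s): the terms p s^2 / 2 migrate from the gradient to
    the Hessian. All other errors are at most k/8 + 3k/8 = k/2 times s^2 + h^2. *)
Lemma log_jet_algebra (s h dx dy p1 p2 X11 X12 X22 k c : R) :
  0 < k -> 0 < c -> c <= / 4 ->
  c * (Rabs p1 + Rabs p2 + 3 * Rabs X11 + 3 * Rabs X12 + 3 * Rabs X22 + 1) <= k / 8 ->
  Rabs s <= c -> Rabs h <= c ->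
  Rabs (dx - (s - s ^ 2 / 2)) <= c * s ^ 2 -> Rabs (dy - (h - h ^ 2 / 2)) <= c * h ^ 2 ->
  Rabs (dx - s) <= s ^ 2 -> Rabs (dy - h) <= h ^ 2 ->
  p1 * dx + p2 * dy + / 2 * (X11 * dx ^ 2 + 2 * X12 * dx * dy + X22 * dy ^ 2) + k / 8 * (dx ^ 2 + dy ^ 2)
  <= p1 * (s - s ^ 2 / 2) + p2 * (h - h ^ 2 / 2)
     + / 2 * (X11 * s ^ 2 + 2 * X12 * s * h + X22 * h ^ 2) + / 2 * k * (s ^ 2 + h ^ 2).
Proof.
  intros Hk Hc Hc4 Hcp Hs Hh E1 E2 E3 E4.
  assert (Hmul : forall p u v b, Rabs (u - v) <= b -> p * u <= p * v + Rabs p * b).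
  { intros p u v b Huv. assert (H := Rle_abs (p * (u - v))). rewrite Rabs_mult in H.
    assert (H' := Rmult_le_compat_l (Rabs p) _ _ (Rabs_pos p) Huv). lra. }
  set (N := s ^ 2 + h ^ 2).
  assert (Hs2 := pow2_ge_0 s). assert (Hh2 := pow2_ge_0 h).
  assert (Hsh : forall u v e f, Rabs u <= c -> Rabs v <= c -> Rabs (e - u) <= u ^ 2 -> Rabs (f - v) <= v ^ 2 ->
            Rabs (e * f - u * v) <= 3 * c * (u ^ 2 + v ^ 2)).
  { intros u v e f Hu Hv He Hf.
    replace (e * f - u * v) with ((e - u) * (f - v) + (e - u) * v + u * (f - v)) by ring.
    eapply Rle_trans; [apply Rabs_triang|]. eapply Rle_trans; [apply Rplus_le_compat_r, Rabs_triang|].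
    rewrite !Rabs_mult. assert (Hu2 := pow2_ge_0 u). assert (Hv2 := pow2_ge_0 v).
    assert (Hpa := Rabs_pos (e - u)). assert (Hpb := Rabs_pos (f - v)).
    assert (Hpu := Rabs_pos u). assert (Hpv := Rabs_pos v).
    assert (A1 : Rabs (e - u) * Rabs (f - v) <= u ^ 2 * v ^ 2) by (apply Rmult_le_compat; easy).
    assert (A2 : Rabs (e - u) * Rabs v <= u ^ 2 * c) by (apply Rmult_le_compat; easy).
    assert (A3 : Rabs u * Rabs (f - v) <= c * v ^ 2) by (apply Rmult_le_compat; easy).
    assert (A4 : v ^ 2 <= c).
    { rewrite <- (pow2_abs v). apply Rle_trans with (c * c); [|nra]. simpl. rewrite Rmult_1_r.
      apply Rmult_le_compat; easy. }
    assert (A5 : u ^ 2 * v ^ 2 <= u ^ 2 * c) by (apply Rmult_le_compat_l; easy). nra. }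
  assert (B1 := Hmul p1 _ _ _ E1). assert (B2 := Hmul p2 _ _ _ E2).
  assert (C11 := Hsh s s dx dx Hs Hs E3 E3). assert (C12 := Hsh s h dx dy Hs Hh E3 E4).
  assert (C22 := Hsh h h dy dy Hh Hh E4 E4).
  assert (B3 := Hmul X11 _ _ _ C11). assert (B4 := Hmul X12 _ _ _ C12). assert (B5 := Hmul X22 _ _ _ C22).
  apply Rabs_le_between in C11. apply Rabs_le_between in C22.
  assert (P1 := Rabs_pos p1). assert (P2 := Rabs_pos p2). assert (P3 := Rabs_pos X11).
  assert (P4 := Rabs_pos X12). assert (P5 := Rabs_pos X22).
  assert (HcN : 0 <= c * N) by (apply Rmult_le_pos; unfold N; lra).
  assert (M : (c * (Rabs p1 + Rabs p2 + 3 * Rabs X11 + 3 * Rabs X12 + 3 * Rabs X22 + 1)) * N <= k / 8 * N)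
    by (apply Rmult_le_compat_r; unfold N; lra).
  assert (D1 : Rabs p1 * (c * s ^ 2) <= Rabs p1 * (c * N)).
  { apply Rmult_le_compat_l; [easy|]. apply Rmult_le_compat_l; unfold N; lra. }
  assert (D2 : Rabs p2 * (c * h ^ 2) <= Rabs p2 * (c * N)).
  { apply Rmult_le_compat_l; [easy|]. apply Rmult_le_compat_l; unfold N; lra. }
  assert (D3 : Rabs X11 * (3 * c * (s ^ 2 + s ^ 2)) <= Rabs X11 * (6 * (c * N))).
  { apply Rmult_le_compat_l; [easy|]. unfold N. assert (0 <= c * h ^ 2) by (apply Rmult_le_pos; lra). lra. }
  assert (D5 : Rabs X22 * (3 * c * (h ^ 2 + h ^ 2)) <= Rabs X22 * (6 * (c * N))).
  { apply Rmult_le_compat_l; [easy|]. unfold N. assert (0 <= c * s ^ 2) by (apply Rmult_le_pos; lra). lra. }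
  assert (D4 : Rabs X12 * (3 * c * (s ^ 2 + h ^ 2)) = Rabs X12 * (3 * (c * N))) by (unfold N; ring).
  assert (Q1 : dx ^ 2 + dy ^ 2 <= 3 * N).
  { assert (6 * c * s ^ 2 <= 6 * (/ 4) * s ^ 2) by (apply Rmult_le_compat_r; lra).
    assert (6 * c * h ^ 2 <= 6 * (/ 4) * h ^ 2) by (apply Rmult_le_compat_r; lra).
    unfold N. lra. }
  assert (Q2 : k / 8 * (dx ^ 2 + dy ^ 2) <= k / 8 * (3 * N)) by (apply Rmult_le_compat_l; lra).
  replace ((c * (Rabs p1 + Rabs p2 + 3 * Rabs X11 + 3 * Rabs X12 + 3 * Rabs X22 + 1)) * N) with
    (Rabs p1 * (c * N) + Rabs p2 * (c * N) + 3 * (Rabs X11 * (c * N)) + 3 * (Rabs X12 * (c * N))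
      + 3 * (Rabs X22 * (c * N)) + c * N) in M by ring.
  fold N. unfold N in *. lra.
Qed.

(** The error in space is absorbed by enlarging the Hessian by k. The error in time is replaced by
    its C^1 majorant, whose derivative vanishes at the contact time, so the time slope is exactly
    q. *)
Lemma jet_test_fn (T : R) (u : R -> R -> R -> R) (x y t q p1 p2 X11 X12 X22 k : R) :
  touch T (fun x y t => u (exp x) (exp y) t) x y t q p1 p2 X11 X12 X22 -> 0 < k ->
  exists phi phit phiS phiH phiSS phiSH phiHH,
    test_fn phi phit phiS phiH phiSS phiSH phiHH /\
    local_max_G T u phi (exp x) (exp y) t /\
    phit (exp x) (exp y) t = q /\ phiS (exp x) (exp y) t = p1 / exp x /\ phiH (exp x) (exp y) t = p2 / exp y /\
    phiSS (exp x) (exp y) t = (X11 - p1 + k) / exp x ^ 2 /\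
    phiSH (exp x) (exp y) t = X12 / (exp x * exp y) /\
    phiHH (exp x) (exp y) t = (X22 - p2 + k) / exp y ^ 2.
Proof.
  intros Htouch Hk.
  destruct (Htouch (k / 8) ltac:(lra)) as [W [d [HW [Hd Hmax]]]].
  destruct (small_o_C1_majorant W HW) as [om [om' [Hom [Hom' [Hom0 [Hom'0 [dw [Hdw Hmaj]]]]]]]].
  set (S0 := exp x). set (H0 := exp y).
  assert (HS0 : 0 < S0) by apply exp_pos. assert (HH0 : 0 < H0) by apply exp_pos.
  set (om2 := fun s => q * s + om s). set (om2' := fun s => q + om' s).
  assert (Ht := quadratic_test_fn om2 om2' S0 H0 t (p1 / S0) (p2 / H0)
    (/ 2 * (X11 - p1 + k) / S0 ^ 2) (X12 / (S0 * H0)) (/ 2 * (X22 - p2 + k) / H0 ^ 2)).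
  do 7 eexists. split; [apply Ht|split].
  - intros s. unfold om2, om2'. apply (is_derive_plus (fun s => q * s) om); [|apply Hom].
    auto_derive; auto. ring.
  - intros s. unfold om2'. apply (continuous_plus (fun _ => q) om'); [apply continuous_const|apply Hom'].
  - set (M := Rabs p1 + Rabs p2 + 3 * Rabs X11 + 3 * Rabs X12 + 3 * Rabs X22 + 1).
    assert (HM : 0 < M).
    { unfold M. assert (P1 := Rabs_pos p1). assert (P2 := Rabs_pos p2). assert (P3 := Rabs_pos X11).
      assert (P4 := Rabs_pos X12). assert (P5 := Rabs_pos X22). lra. }
    set (c := Rmin (/ 4) (k / 8 / M)).
    assert (HkM : 0 < k / 8 / M) by (apply Rdiv_lt_0_compat; lra).
    assert (Hc : 0 < c) by (apply Rmin_glb_lt; lra). assert (Hc4 : c <= / 4) by apply Rmin_l.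
    assert (HcM : c * M <= k / 8).
    { apply Rle_trans with (k / 8 / M * M); [apply Rmult_le_compat_r; [lra|apply Rmin_r]|right; field; lra]. }
    destruct (ln1p_expansion c Hc) as [dl [Hdl [Hdl2 Hln]]].
    set (ds := Rmin (Rmin dl c) (d / 2)).
    assert (Hds : 0 < ds) by (repeat apply Rmin_glb_lt; lra).
    assert (Hds1 : ds <= dl) by (eapply Rle_trans; [apply Rmin_l|apply Rmin_l]).
    assert (Hds2 : ds <= c) by (eapply Rle_trans; [apply Rmin_l|apply Rmin_r]).
    assert (Hds3 : ds <= d / 2) by apply Rmin_r.
    exists (Rmin (Rmin (ds * S0) (ds * H0)) (Rmin d dw)). split.
    { repeat apply Rmin_glb_lt; try lra; apply Rmult_lt_0_compat; lra. }
    intros S H t' [HS [HH Ht']] HSd HHd Htd.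
    assert (HSd' : Rabs ((S - S0) / S0) < ds).
    { unfold Rdiv. rewrite Rabs_mult, (Rabs_pos_eq (/ S0)) by (left; now apply Rinv_0_lt_compat).
      apply Rmult_lt_reg_r with S0; [easy|]. rewrite Rmult_assoc, Rinv_l, Rmult_1_r by lra.
      eapply Rlt_le_trans; [exact HSd|]. eapply Rle_trans; [apply Rmin_l|apply Rmin_l]. }
    assert (HHd' : Rabs ((H - H0) / H0) < ds).
    { unfold Rdiv. rewrite Rabs_mult, (Rabs_pos_eq (/ H0)) by (left; now apply Rinv_0_lt_compat).
      apply Rmult_lt_reg_r with H0; [easy|]. rewrite Rmult_assoc, Rinv_l, Rmult_1_r by lra.
      eapply Rlt_le_trans; [exact HHd|]. eapply Rle_trans; [apply Rmin_l|apply Rmin_r]. }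
    assert (Htd1 : Rabs (t' - t) < d).
    { eapply Rlt_le_trans; [exact Htd|]. eapply Rle_trans; [apply Rmin_r|apply Rmin_l]. }
    assert (Htd2 : Rabs (t' - t) < dw).
    { eapply Rlt_le_trans; [exact Htd|]. eapply Rle_trans; [apply Rmin_r|apply Rmin_r]. }
    set (s := (S - S0) / S0) in *. set (h := (H - H0) / H0) in *.
    assert (Hx := exp_log_step x S HS). assert (Hy := exp_log_step y H HH). fold S0 in Hx. fold H0 in Hy.
    fold s in Hx. fold h in Hy.
    destruct (Hln s ltac:(lra)) as [L1 L2]. destruct (Hln h ltac:(lra)) as [L3 L4].
    rewrite <- Hx in L1, L2. rewrite <- Hy in L3, L4.
    assert (Hsmall : forall v w, Rabs w < ds -> Rabs (v - w) <= w ^ 2 -> Rabs v < d).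
    { intros v w Hw Hvw. assert (Hw1 := Rabs_pos w). rewrite <- (pow2_abs w) in Hvw.
      assert (Hw2 : Rabs w ^ 2 <= / 4 * Rabs w) by (simpl; rewrite Rmult_1_r; apply Rmult_le_compat_r; lra).
      replace v with ((v - w) + w) by ring. eapply Rle_lt_trans; [apply Rabs_triang|]. lra. }
    assert (Hm := Hmax (ln S) (ln H) t' Ht' (Hsmall _ _ HSd' L2) (Hsmall _ _ HHd' L4) Htd1).
    cbv beta in Hm. rewrite !exp_ln in Hm by easy. fold S0 H0 in Hm.
    assert (Halg := log_jet_algebra s h (ln S - x) (ln H - y) p1 p2 X11 X12 X22 k c Hk Hc Hc4 HcM
      ltac:(lra) ltac:(lra) L1 L3 L2 L4).
    assert (Homt := Hmaj (t' - t) Htd2).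
    unfold om2. rewrite !Rminus_diag, Hom0.
    replace (p1 / S0 * (S - S0)) with (p1 * s) by (unfold s; field; lra).
    replace (p2 / H0 * (H - H0)) with (p2 * h) by (unfold h; field; lra).
    replace (/ 2 * (X11 - p1 + k) / S0 ^ 2 * ((S - S0) * (S - S0))) with (/ 2 * (X11 - p1 + k) * s ^ 2)
      by (unfold s; field; lra).
    replace (/ 2 * (X22 - p2 + k) / H0 ^ 2 * ((H - H0) * (H - H0))) with (/ 2 * (X22 - p2 + k) * h ^ 2)
      by (unfold h; field; lra).
    replace (X12 / (S0 * H0) * ((S - S0) * (H - H0))) with (X12 * s * h) by (unfold s, h; field; lra).
    lra.
  - fold S0 H0. unfold om2'. rewrite !Rminus_diag, Hom'0. repeat split; try (field; lra); ring.
Qed.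

(** Each test function costs e times the half squares of the volatilities; then e tends to 0. *)
Lemma visc_sub_jsub (T : R) (mu sigma a b : R -> R -> R) (r rho alpha : R) (u : R -> R -> R -> R) :
  visc_sub T mu sigma a b r rho alpha u ->
  jsub T r rho (logcoef mu sigma a b r rho alpha) (fun _ => True) (fun x y t => u (exp x) (exp y) t).
Proof.
  intros Hsub x y t q p1 p2 X11 X12 X22 Ht _ Htouch.
  set (s := sigma (exp x) t). set (bt := b (exp y) t).
  set (h0 := ham r rho (logcoef mu sigma a b r rho alpha) x y t (u (exp x) (exp y) t) q p1 p2 X11 X12 X22).
  assert (HS : 0 < exp x) by apply exp_pos. assert (HH : 0 < exp y) by apply exp_pos.
  assert (H : forall e, 0 < e < 1 -> - h0 <= e * (/ 2 * s ^ 2 + / 2 * bt ^ 2)).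
  { intros e He.
    destruct (jet_test_fn T u x y t q p1 p2 X11 X12 X22 e Htouch ltac:(lra))
      as [phi [phit [phiS [phiH [phiSS [phiSH [phiHH [Htest [Hmax [E1 [E2 [E3 [E4 [E5 E6]]]]]]]]]]]]]].
    assert (H := Hsub _ _ _ _ _ _ _ Htest (exp x) (exp y) t ltac:(unfold inG; lra) ltac:(lra) Hmax).
    rewrite E1, E2, E3, E4, E5, E6 in H. unfold Fop in H.
    replace (Rabs (p1 / exp x)) with (Rabs p1 / exp x) in H
      by (unfold Rdiv; rewrite Rabs_mult, (Rabs_pos_eq (/ exp x)); [easy|left; now apply Rinv_0_lt_compat]).
    fold s bt in H.
    match type of H with 0 <= ?z => assert (Hz : z = h0 + e * (/ 2 * s ^ 2 + / 2 * bt ^ 2)) end.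
    { unfold h0, ham, logcoef. cbn [sg bb m1 m2 gm]. fold s bt. field. lra. }
    lra. }
  assert (- h0 <= 0); [|lra]. now apply le_small_mult with (/ 2 * s ^ 2 + / 2 * bt ^ 2).
Qed.

(** * The equation and its transformations *)

(** Bounds and Lipschitz constants in space at each frozen time; different times are not related.
    One distance in both variables serves all coefficients. *)
Definition coef_ok (T : R) (c : coef) (Cb Cl : R) : Prop :=
  forall t, 0 <= t <= T -> forall x y x' y',
    (Rabs (sg c x t) <= Cb /\ Rabs (bb c y t) <= Cb /\ Rabs (m1 c x y t) <= Cb /\
     Rabs (m2 c y t) <= Cb /\ Rabs (gm c x t) <= Cb) /\
    (Rabs (sg c x' t - sg c x t) <= Cl * (Rabs (x' - x) + Rabs (y' - y)) /\
     Rabs (bb c y' t - bb c y t) <= Cl * (Rabs (x' - x) + Rabs (y' - y)) /\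
     Rabs (m1 c x' y' t - m1 c x y t) <= Cl * (Rabs (x' - x) + Rabs (y' - y)) /\
     Rabs (m2 c y' t - m2 c y t) <= Cl * (Rabs (x' - x) + Rabs (y' - y)) /\
     Rabs (gm c x' t - gm c x t) <= Cl * (Rabs (x' - x) + Rabs (y' - y))).

Lemma Rabs_sq_diff u v m l : Rabs u <= m -> Rabs v <= m -> Rabs (u - v) <= l ->
  Rabs (u ^ 2 - v ^ 2) <= 2 * m * l.
Proof.
  intros Hu Hv Hl. replace (u ^ 2 - v ^ 2) with ((u + v) * (u - v)) by ring. rewrite Rabs_mult.
  apply Rmult_le_compat; try apply Rabs_pos; [|easy].
  eapply Rle_trans; [apply Rabs_triang|lra].
Qed.

Lemma Rabs_minus_le u v : Rabs (u - v) <= Rabs u + Rabs v.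
Proof. rewrite <- (Rabs_Ropp v). apply Rabs_triang. Qed.

Lemma Rabs_half_diff u v : Rabs (/ 2 * u - / 2 * v) = / 2 * Rabs (u - v).
Proof. rewrite <- Rmult_minus_distr_l, Rabs_mult, (Rabs_pos_eq (/ 2)); [easy|lra]. Qed.

Lemma standing_coef_ok (T : R) (mu sigma a b : R -> R -> R) (r rho alpha : R) (g : R -> R) :
  -1 <= rho <= 1 -> standing T mu sigma a b r rho g ->
  exists Cb Cl, 0 <= Cb /\ 0 <= Cl /\ coef_ok T (logcoef mu sigma a b r rho alpha) Cb Cl.
Proof.
  intros Hrho [[C1 [HC1 L1]] [[C3 [HC3 L3]] [_ [_ [_ [[C5 [HC5 L5]] [_ [_ [[M HM] [del [Hdel Hell]]]]]]]]]]].
  set (M' := Rabs M). assert (HM' : 0 <= M') by apply Rabs_pos. assert (HMM : M <= M') by apply Rle_abs.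
  set (sd := sqrt del). assert (Hsd : 0 < sd) by now apply sqrt_lt_R0.
  (* Ellipticity in the direction (0, 1) keeps b away from 0, which bounds the quotient in
     [mu_tilde]. *)
  assert (Hb : forall y t, 0 <= t <= T -> sd <= Rabs (b (exp y) t)).
  { intros y t Ht. assert (H := Hell 0 y t 0 1 Ht).
    replace (Rabs (b (exp y) t)) with (sqrt ((b (exp y) t) ^ 2)).
    - apply sqrt_le_1_alt. lra.
    - rewrite <- Rsqr_pow2. apply sqrt_Rsqr_abs. }
  set (K := Rabs alpha * sqrt (1 - rho ^ 2)).
  assert (HK : 0 <= K) by (apply Rmult_le_pos; [apply Rabs_pos|apply sqrt_pos]).
  set (Cb := M' + (M' + Rabs r) * M' / sd + Rabs r + M' ^ 2 + K * M').
  set (Cl := C1 + C3 + C5 + M' * C1 + M' * C3 + K * C1).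
  assert (Hr := Rabs_pos r).
  assert (Hq : 0 <= (M' + Rabs r) * M' / sd) by (apply Rdiv_le_0_compat; [apply Rmult_le_pos; lra|easy]).
  assert (HM2 := pow2_ge_0 M'). assert (HKM : 0 <= K * M') by now apply Rmult_le_pos.
  exists Cb, Cl. split; [unfold Cb; lra|]. split.
  { unfold Cl. assert (0 <= M' * C1) by (apply Rmult_le_pos; lra).
    assert (0 <= M' * C3) by (apply Rmult_le_pos; lra). assert (0 <= K * C1) by (apply Rmult_le_pos; lra). lra. }
  intros t Ht x y x' y'.
  assert (Hex := exp_pos x). assert (Hey := exp_pos y). assert (Hex' := exp_pos x'). assert (Hey' := exp_pos y').
  destruct (HM (exp x) (exp y) t) as [B1 [B2 [B3 B4]]]; [unfold inG; lra|].
  destruct (HM (exp x') (exp y') t) as [_ [B2' [_ B4']]]; [unfold inG; lra|].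
  assert (D1 := L1 (exp x') (exp x) t Hex' Hex Ht). assert (D3 := L3 (exp y') (exp y) t Hey' Hey Ht).
  assert (D5 := L5 (exp x') (exp y') (exp x) (exp y) t ltac:(unfold inG; lra) ltac:(unfold inG; lra)).
  rewrite (ln_exp x'), (ln_exp x) in D1. rewrite (ln_exp y'), (ln_exp y) in D3.
  rewrite (ln_exp x'), (ln_exp x), (ln_exp y'), (ln_exp y) in D5.
  set (dx := Rabs (x' - x)) in *. set (dy := Rabs (y' - y)) in *.
  assert (Hdx : 0 <= dx) by apply Rabs_pos. assert (Hdy : 0 <= dy) by apply Rabs_pos.
  assert (N1 : 0 <= C1 * dx) by (apply Rmult_le_pos; lra). assert (N2 : 0 <= C1 * dy) by (apply Rmult_le_pos; lra).
  assert (N3 : 0 <= C3 * dx) by (apply Rmult_le_pos; lra). assert (N4 : 0 <= C3 * dy) by (apply Rmult_le_pos; lra).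
  assert (N5 : 0 <= C5 * dx) by (apply Rmult_le_pos; lra). assert (N6 : 0 <= C5 * dy) by (apply Rmult_le_pos; lra).
  assert (N7 : 0 <= M' * C1 * dx) by (apply Rmult_le_pos; [apply Rmult_le_pos; lra|lra]).
  assert (N8 : 0 <= M' * C1 * dy) by (apply Rmult_le_pos; [apply Rmult_le_pos; lra|lra]).
  assert (N9 : 0 <= M' * C3 * dx) by (apply Rmult_le_pos; [apply Rmult_le_pos; lra|lra]).
  assert (N10 : 0 <= M' * C3 * dy) by (apply Rmult_le_pos; [apply Rmult_le_pos; lra|lra]).
  assert (N11 : 0 <= K * C1 * dx) by (apply Rmult_le_pos; [apply Rmult_le_pos; lra|lra]).
  assert (N12 : 0 <= K * C1 * dy) by (apply Rmult_le_pos; [apply Rmult_le_pos; lra|lra]).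
  assert (HCl : Cl * (dx + dy) = C1 * dx + C1 * dy + C3 * dx + C3 * dy + C5 * dx + C5 * dy + M' * C1 * dx + M' * C1 * dy
     + M' * C3 * dx + M' * C3 * dy + K * C1 * dx + K * C1 * dy) by (unfold Cl; ring).
  assert (Hsq : forall z, Rabs z <= M' -> Rabs (/ 2 * z ^ 2) <= / 2 * M' ^ 2).
  { intros z Hz. rewrite Rabs_mult, (Rabs_pos_eq (/ 2)) by lra. apply Rmult_le_compat_l; [lra|].
    rewrite <- RPow_abs. apply pow_incr. split; [apply Rabs_pos|easy]. }
  assert (S1 := Hsq (sigma (exp x) t) ltac:(lra)). assert (S2 := Hsq (b (exp y) t) ltac:(lra)).
  assert (Q1 := Rabs_sq_diff (sigma (exp x') t) (sigma (exp x) t) M' _ ltac:(lra) ltac:(lra) D1).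
  assert (Q2 := Rabs_sq_diff (b (exp y') t) (b (exp y) t) M' _ ltac:(lra) ltac:(lra) D3).
  cbn [logcoef sg bb m1 m2 gm].
  assert (HKs : forall z, Rabs (alpha * sqrt (1 - rho ^ 2) * z) = K * Rabs z).
  { intros z. rewrite !Rabs_mult, (Rabs_pos_eq (sqrt _)) by apply sqrt_pos. reflexivity. }
  split; split; [| split; [|split; [|split]] | | split; [|split; [|split]]].
  - unfold Cb; lra.
  - unfold Cb; lra.
  - unfold Rminus at 1. eapply Rle_trans; [apply Rabs_triang|]. rewrite Rabs_Ropp.
    assert (Hmt : Rabs (mu_tilde mu sigma a b r rho (exp x) (exp y) t) <= M' + (M' + Rabs r) * M' / sd).
    { unfold mu_tilde, Rminus at 1. eapply Rle_trans; [apply Rabs_triang|]. rewrite Rabs_Ropp.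
      apply Rplus_le_compat; [lra|]. unfold Rdiv. rewrite !Rabs_mult, Rabs_inv.
      assert (Hbp := Hb y t Ht).
      apply Rmult_le_compat.
      - repeat apply Rmult_le_pos; apply Rabs_pos.
      - left. apply Rinv_0_lt_compat. lra.
      - apply Rmult_le_compat; [apply Rmult_le_pos; apply Rabs_pos|apply Rabs_pos| |lra].
        rewrite <- (Rmult_1_r (M' + Rabs r)). apply Rmult_le_compat; try apply Rabs_pos.
        + eapply Rle_trans; [apply Rabs_triang|]. rewrite Rabs_Ropp. lra.
        + apply Rabs_le; lra.
      - apply Rinv_le_contravar; lra. }
    unfold Cb. lra.
  - unfold Rminus at 1. eapply Rle_trans; [apply Rabs_triang|]. rewrite Rabs_Ropp. unfold Cb. lra.
  - rewrite HKs. assert (K * Rabs (sigma (exp x) t) <= K * M') by (apply Rmult_le_compat_l; lra). unfold Cb. lra.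
  - lra.
  - lra.
  - match goal with |- Rabs (?u - ?v - (?w - ?z)) <= _ => replace (u - v - (w - z)) with ((u - w) - (v - z)) by ring end.
    eapply Rle_trans; [apply Rabs_minus_le|]. rewrite Rabs_half_diff. lra.
  - match goal with |- Rabs (?u - ?v - (?w - ?z)) <= _ => replace (u - v - (w - z)) with (- (v - z)) by ring end.
    rewrite Rabs_Ropp, Rabs_half_diff. lra.
  - rewrite <- Rmult_minus_distr_l, HKs.
    assert (K * Rabs (sigma (exp x') t - sigma (exp x) t) <= K * (C1 * dx)) by (apply Rmult_le_compat_l; lra). lra.
Qed.

(** * Change of sign and of drift in viscosity inequalities *)

Lemma continuous3_opp f : continuous3 f -> continuous3 (fun x y z => - f x y z).
Proof.
  intros H x y z eps Heps. destruct (H x y z eps Heps) as [d [Hd Hd']]. exists d. split; [easy|].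
  intros. replace (- f x' y' z' - - f x y z) with (- (f x' y' z' - f x y z)) by ring. rewrite Rabs_Ropp. auto.
Qed.

Lemma test_fn_opp phi phit phiS phiH phiSS phiSH phiHH :
  test_fn phi phit phiS phiH phiSS phiSH phiHH ->
  test_fn (fun S H t => - phi S H t) (fun S H t => - phit S H t) (fun S H t => - phiS S H t)
    (fun S H t => - phiH S H t) (fun S H t => - phiSS S H t) (fun S H t => - phiSH S H t)
    (fun S H t => - phiHH S H t).
Proof.
  intros [C0 [C1 [C2 [C3 [C4 [C5 [C6 HD]]]]]]].
  refine (conj (continuous3_opp _ C0) (conj (continuous3_opp _ C1) (conj (continuous3_opp _ C2)
    (conj (continuous3_opp _ C3) (conj (continuous3_opp _ C4) (conj (continuous3_opp _ C5)
    (conj (continuous3_opp _ C6) _))))))).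
  intros S H t. destruct (HD S H t) as [D1 [D2 [D3 [D4 [D5 D6]]]]].
  refine (conj _ (conj _ (conj _ (conj _ (conj _ _)))));
    [ apply (is_derive_opp (fun t' => phi S H t'))
    | apply (is_derive_opp (fun s => phi s H t))
    | apply (is_derive_opp (fun h => phi S h t))
    | apply (is_derive_opp (fun s => phiS s H t))
    | apply (is_derive_opp (fun h => phiS S h t))
    | apply (is_derive_opp (fun h => phiH S h t)) ]; assumption.
Qed.

(** Everything but the term with |p| is odd under negation, so only alpha changes sign. *)
Lemma visc_super_opp T mu sigma a b r rho alpha v :
  visc_super T mu sigma a b r rho alpha v ->
  visc_sub T mu sigma a b r rho (- alpha) (fun S H t => - v S H t).
Proof.
  intros Hsup phi phit phiS phiH phiSS phiSH phiHH Htest S0 H0 t0 HG Ht0 [d [Hd Hmax]].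
  assert (H := Hsup _ _ _ _ _ _ _ (test_fn_opp _ _ _ _ _ _ _ Htest) S0 H0 t0 HG Ht0).
  assert (Hmin : local_min_G T v (fun S H t => - phi S H t) S0 H0 t0).
  { exists d. split; [easy|]. intros. assert (H' := Hmax S H1 t H2 H3 H4 H5). lra. }
  specialize (H Hmin). unfold Fop in *. rewrite Rabs_Ropp in H. lra.
Qed.

Lemma derivative_at_local_max (f : R -> R) (x l d : R) : 0 < d ->
  (forall y, Rabs (y - x) < d -> f y <= f x) -> is_derive f x l -> l = 0.
Proof.
  intros Hd Hmax Hl. apply is_derive_Reals in Hl.
  assert (H : forall e, 0 < e -> Rabs l <= e).
  { intros e He. destruct (Hl e He) as [[dd Hdd] Hdl]. simpl in Hdl.
    set (h := Rmin (d / 2) (dd / 2)).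
    assert (Hh : 0 < h) by (apply Rmin_glb_lt; lra).
    assert (Hh1 : h <= d / 2) by apply Rmin_l. assert (Hh2 : h <= dd / 2) by apply Rmin_r.
    assert (A1 := Hdl h ltac:(lra) ltac:(rewrite Rabs_pos_eq; lra)).
    assert (A2 := Hdl (- h) ltac:(lra) ltac:(rewrite Rabs_left; lra)).
    assert (M1 := Hmax (x + h) ltac:(replace (x + h - x) with h by ring; rewrite Rabs_pos_eq; lra)).
    assert (M2 := Hmax (x + - h) ltac:(replace (x + - h - x) with (- h) by ring; rewrite Rabs_left; lra)).
    apply Rabs_def2 in A1. apply Rabs_def2 in A2.
    assert ((f (x + h) - f x) / h <= 0).
    { unfold Rdiv. assert (0 < / h) by now apply Rinv_0_lt_compat. nra. }
    assert (0 <= (f (x + - h) - f x) / - h).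
    { replace ((f (x + - h) - f x) / - h) with ((f x - f (x + - h)) / h) by (field; lra).
      apply Rdiv_le_0_compat; lra. }
    apply Rabs_le. lra. }
  apply NNPP. intros Hl0. apply Rabs_pos_lt in Hl0. specialize (H (Rabs l / 2) ltac:(lra)). lra.
Qed.

(** At a contact point the test function has the same S-derivative as u, hence a slope satisfying P,
    and the operator changes only by (mu' - mu) S times this slope. *)
Lemma visc_sub_change_mu T mu mu' sigma a b r rho alpha u (P : R -> Prop) :
  (forall S H t, inG T S H t -> exists d, is_derive (fun s => u s H t) S d /\ P d) ->
  (forall S t d, 0 < S -> 0 <= t <= T -> P d -> mu S t * d <= mu' S t * d) ->
  visc_sub T mu sigma a b r rho alpha u -> visc_sub T mu' sigma a b r rho alpha u.
Proof.
  intros HP Hmu Hsub phi phit phiS phiH phiSS phiSH phiHH Htest S0 H0 t0 HG Ht0 Hmax.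
  assert (H := Hsub _ _ _ _ _ _ _ Htest S0 H0 t0 HG Ht0 Hmax).
  destruct (HP S0 H0 t0 HG) as [l [Hl HPl]].
  assert (El : phiS S0 H0 t0 = l).
  { destruct Hmax as [d [Hd Hm]]. destruct HG as [HS0 [HH0 Ht]].
    assert (D2 : is_derive (fun s => phi s H0 t0) S0 (phiS S0 H0 t0)) by (apply Htest).
    (* The radius is capped by S0 so that the compared points keep S > 0. *)
    assert (E := derivative_at_local_max (fun s => minus (u s H0 t0) (phi s H0 t0)) S0
      (minus l (phiS S0 H0 t0)) (Rmin d S0) ltac:(now apply Rmin_glb_lt)).
    unfold minus, plus, opp in E; simpl in E.
    assert (E' : l + - phiS S0 H0 t0 = 0); [|lra]. apply E.
    - intros y Hy. assert (Hy1 := Rlt_le_trans _ _ _ Hy (Rmin_l _ _)).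
      assert (Hy2 := Rlt_le_trans _ _ _ Hy (Rmin_r _ _)). apply Rabs_def2 in Hy2.
      apply (Hm y H0 t0); [unfold inG; lra|easy| |]; rewrite Rminus_diag, Rabs_R0; easy.
    - apply (is_derive_minus (fun s => u s H0 t0) (fun s => phi s H0 t0)); easy. }
  destruct HG as [HS0 [HH0 Ht]].
  assert (Hm := Hmu S0 t0 l HS0 Ht HPl). rewrite El in *.
  unfold Fop, mu_tilde in *.
  assert (S0 * (mu S0 t0 * l) <= S0 * (mu' S0 t0 * l)) by (apply Rmult_le_compat_l; lra). lra.
Qed.

(** Twice the hyperbolic cosine. It is its own second derivative and dominates its first one, which
    makes it a convenient barrier for operators with bounded coefficients. *)
Definition ch (x : R) : R := exp x + exp (- x).
Definition sh (x : R) : R := exp x - exp (- x).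

Lemma ch_pos x : 0 < ch x.
Proof. unfold ch. assert (H := exp_pos x). assert (H' := exp_pos (- x)). lra. Qed.

Lemma sh_le_ch x : Rabs (sh x) <= ch x.
Proof. unfold sh, ch. assert (H := exp_pos x). assert (H' := exp_pos (- x)). apply Rabs_le. lra. Qed.

Lemma ch_derive x : is_derive ch x (sh x).
Proof. unfold ch, sh. auto_derive; auto. ring. Qed.

Lemma sh_derive x : is_derive sh x (ch x).
Proof. unfold ch, sh. auto_derive; auto. ring. Qed.

Lemma taylor2_local (f f1 f2 : R -> R) (x k : R) :
  (forall s, is_derive f s (f1 s)) -> (forall s, is_derive f1 s (f2 s)) -> continuous f2 x -> 0 < k ->
  exists d, 0 < d /\ forall e, Rabs e < d -> Rabs (f (x + e) - f x - e * f1 x - / 2 * e ^ 2 * f2 x) <= k * e ^ 2.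
Proof.
  intros H1 H2 Hc Hk.
  destruct (proj1 (filterlim_locally _ _) Hc (mkposreal k Hk)) as [d Hd].
  exists d. split; [apply cond_pos|]. intros e He.
  assert (H := mvt_bound (fun s => f s - (s - x) * f1 x - / 2 * (s - x) ^ 2 * f2 x)
    (fun s => f1 s - f1 x - (s - x) * f2 x) x e (k * Rabs e)).
  replace (f (x + e) - f x - e * f1 x - / 2 * e ^ 2 * f2 x) with
    (f (x + e) - (x + e - x) * f1 x - / 2 * (x + e - x) ^ 2 * f2 x -
      (f x - (x - x) * f1 x - / 2 * (x - x) ^ 2 * f2 x)) by ring.
  rewrite <- (pow2_abs e). replace (k * Rabs e ^ 2) with (k * Rabs e * Rabs e) by ring. apply H.
  - intros s. apply (is_derive_minus (fun s => f s - (s - x) * f1 x) (fun s => / 2 * (s - x) ^ 2 * f2 x)).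
    + apply (is_derive_minus f (fun s => (s - x) * f1 x)); [apply H1|]. auto_derive; auto. ring.
    + auto_derive; auto. simpl. field.
  - intros s Hs.
    assert (H0 := mvt_bound (fun u => f1 u - (u - x) * f2 x) (fun u => f2 u - f2 x) x (s - x) k).
    replace (f1 s - f1 x - (s - x) * f2 x) with
      (f1 (x + (s - x)) - (x + (s - x) - x) * f2 x - (f1 x - (x - x) * f2 x)).
    2: { replace (x + (s - x)) with s by ring. ring. }
    eapply Rle_trans; [apply H0|].
    + intros u. apply (is_derive_minus f1 (fun u => (u - x) * f2 x)); [apply H2|]. auto_derive; auto. ring.
    + intros u Hu. left. apply (Hd u). unfold ball; simpl; unfold AbsRing_ball, abs, minus, plus, opp; simpl.
      fold (u - x). lra.
    + apply Rmult_le_compat_l; [lra|easy].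
Qed.

Lemma exp_mono x y : x <= y -> exp x <= exp y.
Proof. intros [H| ->]; [left; now apply exp_increasing|apply Rle_refl]. Qed.

Lemma ch_step x e d : Rabs e < d -> d <= 1 -> Rabs (ch (x + e) - ch x) <= ch x * exp 1 * Rabs e.
Proof.
  intros He Hd. apply (mvt_bound ch sh x e); [apply ch_derive|].
  intros s Hs. eapply Rle_trans; [apply sh_le_ch|].
  unfold ch. replace s with (x + (s - x)) by ring. rewrite Ropp_plus_distr, !exp_plus.
  apply Rabs_le_between in Hs.
  assert (E1 : exp (s - x) <= exp 1) by (apply exp_mono; lra).
  assert (E2 : exp (- (s - x)) <= exp 1) by (apply exp_mono; lra).
  assert (P1 := exp_pos x). assert (P2 := exp_pos (- x)). nra.
Qed.

(** The barrier is smooth and its derivatives form the jet. The only term outside the format of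
    [touch] is the product of a time and a space increment, which Young's inequality splits. *)
Lemma touch_exp_ch (T A del x y t : R) : 0 <= del ->
  let Et := del * exp (A * (T - t)) in
  touch T (fun x y t => del * exp (A * (T - t)) * (ch x + ch y)) x y t
    (- A * Et * (ch x + ch y)) (Et * sh x) (Et * sh y) (Et * ch x) 0 (Et * ch y).
Proof.
  intros Hdel Et k Hk.
  assert (HE : 0 <= Et) by (apply Rmult_le_pos; [easy|left; apply exp_pos]).
  assert (Hct : ctn ch) by (intros s; apply (ex_derive_continuous ch); eexists; apply ch_derive).
  set (k1 := k / 4 / (Et + 1)). assert (Hk1 : 0 < k1) by (repeat apply Rdiv_lt_0_compat; lra).
  destruct (taylor2_local ch sh ch x k1 ch_derive sh_derive (Hct x) Hk1) as [d1 [Hd1 T1]].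
  destruct (taylor2_local ch sh ch y k1 ch_derive sh_derive (Hct y) Hk1) as [d2 [Hd2 T2]].
  set (g := fun s => del * exp (A * (T - s))).
  assert (Hg : is_derive g t (- A * Et)).
  { unfold g, Et. auto_derive; auto. replace (T + - t) with (T - t) by ring. ring. }
  set (w := fun s => Rabs (g (t + s) - g t - (- A * Et) * s)).
  assert (Hw : small_o w).
  { intros e He. apply is_derive_Reals in Hg. destruct (Hg e He) as [[d Hd] Hd']. simpl in Hd'.
    exists d. split; [easy|]. intros s Hs. unfold w.
    destruct (Req_dec s 0) as [->|Hs0].
    - rewrite Rplus_0_r, Rmult_0_r, Rminus_diag, Rminus_0_r, Rabs_R0. lra.
    - assert (H := Hd' s Hs0 Hs).
      replace (g (t + s) - g t - - A * Et * s) with (((g (t + s) - g t) / s - - A * Et) * s) by (field; easy).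
      rewrite Rabs_mult. apply Rmult_le_compat_r; [apply Rabs_pos|lra]. }
  set (B := (ch x + ch y) * exp 1). assert (HB : 0 < B).
  { unfold B. apply Rmult_lt_0_compat; [|apply exp_pos]. assert (H := ch_pos x). assert (H' := ch_pos y). lra. }
  set (L := Rabs (A * Et)).
  (* The constant left over by Young's inequality: (L + 1) bounds the time quotient, B the space
     quotient, and k / 4 is kept on each square. *)
  set (c3 := 4 * B ^ 2 * (L + 1) ^ 2 / k).
  destruct (Hw 1 Rlt_0_1) as [d3 [Hd3 Hw3]].
  exists (fun s => (ch x + ch y) * w s + c3 * s ^ 2), (Rmin (Rmin d1 d2) (Rmin 1 d3)).
  split; [|split].
  - apply small_o_plus; [|apply small_o_square]. apply small_o_scal; [|easy].
    assert (H := ch_pos x). assert (H' := ch_pos y). lra.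
  - repeat apply Rmin_glb_lt; lra.
  - intros x' y' t' Ht' Hx Hy Htt.
    assert (X1 := Rlt_le_trans _ _ _ Hx (Rmin_l _ _)). assert (X2 := Rlt_le_trans _ _ _ X1 (Rmin_l _ _)).
    assert (X3 := Rlt_le_trans _ _ _ (Rlt_le_trans _ _ _ Hx (Rmin_r _ _)) (Rmin_l _ _)).
    assert (Y2 := Rlt_le_trans _ _ _ (Rlt_le_trans _ _ _ Hy (Rmin_l _ _)) (Rmin_r _ _)).
    assert (Y3 := Rlt_le_trans _ _ _ (Rlt_le_trans _ _ _ Hy (Rmin_r _ _)) (Rmin_l _ _)).
    assert (Z3 := Rlt_le_trans _ _ _ (Rlt_le_trans _ _ _ Htt (Rmin_r _ _)) (Rmin_r _ _)).
    set (e := x' - x) in *. set (f := y' - y) in *. set (s := t' - t) in *.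
    assert (A1 := T1 e X2). assert (A2 := T2 f Y2).
    assert (S1 := ch_step x e 1 X3 ltac:(lra)). assert (S2 := ch_step y f 1 Y3 ltac:(lra)).
    assert (W1 := Hw3 s Z3). rewrite Rmult_1_l in W1.
    assert (Ex : x' = x + e) by (unfold e; ring). assert (Ey : y' = y + f) by (unfold f; ring).
    assert (Est : t' = t + s) by (unfold s; ring). rewrite Ex, Ey, Est.
    fold (g (t + s)). change (del * exp (A * (T - t))) with Et.
    assert (Gt : g t = Et) by reflexivity.
    set (D := (ch (x + e) + ch (y + f)) - (ch x + ch y)).
    assert (HD1 : Et * D <= Et * (e * sh x + / 2 * e ^ 2 * ch x + f * sh y + / 2 * f ^ 2 * ch y) + k / 4 * (e ^ 2 + f ^ 2)).
    { apply Rabs_le_between in A1. apply Rabs_le_between in A2.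
      assert (HDle : D <= e * sh x + / 2 * e ^ 2 * ch x + f * sh y + / 2 * f ^ 2 * ch y + k1 * (e ^ 2 + f ^ 2))
        by (unfold D; lra).
      apply Rmult_le_compat_l with (r := Et) in HDle; [|easy].
      assert (Et * k1 <= k / 4).
      { unfold k1. replace (Et * (k / 4 / (Et + 1))) with (k / 4 * (Et / (Et + 1))) by (field; lra).
        assert (Et / (Et + 1) <= 1); [|assert (0 < k / 4) by lra; nra].
        apply Rmult_le_reg_r with (Et + 1); [lra|]. unfold Rdiv. rewrite Rmult_assoc, Rinv_l; lra. }
      assert (Hef : 0 <= e ^ 2 + f ^ 2) by (assert (H' := pow2_ge_0 e); assert (H'' := pow2_ge_0 f); lra).
      assert (Et * k1 * (e ^ 2 + f ^ 2) <= k / 4 * (e ^ 2 + f ^ 2)) by now apply Rmult_le_compat_r. lra. }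
    assert (Hgs : Rabs (g (t + s) - Et) <= (L + 1) * Rabs s).
    { replace (g (t + s) - Et) with ((g (t + s) - g t - - A * Et * s) + - (A * Et) * s) by (rewrite Gt; ring).
      eapply Rle_trans; [apply Rabs_triang|]. rewrite Rabs_mult, Rabs_Ropp. fold L. fold (w s). lra. }
    assert (HDa : Rabs D <= B * (Rabs e + Rabs f)).
    { unfold D. replace (ch (x + e) + ch (y + f) - (ch x + ch y)) with ((ch (x + e) - ch x) + (ch (y + f) - ch y)) by ring.
      eapply Rle_trans; [apply Rabs_triang|]. unfold B.
      assert (Hxp := ch_pos x). assert (Hyp := ch_pos y). assert (He1 := exp_pos 1).
      assert (Ha := Rabs_pos e). assert (Hb := Rabs_pos f).
      assert (0 <= ch y * exp 1 * Rabs e) by (repeat apply Rmult_le_pos; lra).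
      assert (0 <= ch x * exp 1 * Rabs f) by (repeat apply Rmult_le_pos; lra). lra. }
    assert (HL : 0 <= L) by apply Rabs_pos.
    assert (Hcross : (g (t + s) - Et) * D <= k / 4 * (e ^ 2 + f ^ 2) + c3 * s ^ 2).
    { eapply Rle_trans; [apply Rle_abs|]. rewrite Rabs_mult.
      apply Rle_trans with ((L + 1) * Rabs s * (B * (Rabs e + Rabs f))).
      - apply Rmult_le_compat; auto using Rabs_pos.
      - rewrite <- (pow2_abs e), <- (pow2_abs f), <- (pow2_abs s).
        set (a := Rabs e). set (b := Rabs f). set (z := Rabs s).
        set (m := B * (L + 1) * z).
        replace ((L + 1) * z * (B * (a + b))) with (m * (a + b)) by (unfold m; ring).
        replace (c3 * z ^ 2) with (4 * m ^ 2 / k) by (unfold c3, m; field; lra).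
        assert (Hyoung : forall v, m * v <= k / 4 * v ^ 2 + m ^ 2 / k).
        { intros v. assert (H := pow2_ge_0 (k / 2 * v - m)).
          assert (H' : 0 <= / k * (k / 2 * v - m) ^ 2) by (apply Rmult_le_pos; [left; now apply Rinv_0_lt_compat|easy]).
          replace (/ k * (k / 2 * v - m) ^ 2) with (k / 4 * v ^ 2 + m ^ 2 / k - m * v) in H' by (field; lra). lra. }
        assert (H1 := Hyoung a). assert (H2 := Hyoung b).
        assert (0 <= m ^ 2 / k) by (apply Rdiv_le_0_compat; [apply pow2_ge_0|easy]). lra. }
    assert (Hlin : (g (t + s) - Et) * (ch x + ch y) <= - A * Et * (ch x + ch y) * s + (ch x + ch y) * w s).
    { assert (H := Rle_abs (g (t + s) - g t - - A * Et * s)). fold (w s) in H. rewrite Gt in H.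
      assert (Hxp := ch_pos x). assert (Hyp := ch_pos y).
      apply Rmult_le_compat_r with (r := ch x + ch y) in H; [|lra]. lra. }
    replace (g (t + s) * (ch (x + e) + ch (y + f))) with
      (Et * (ch x + ch y) + Et * D + (g (t + s) - Et) * (ch x + ch y) + (g (t + s) - Et) * D) by (unfold D; ring).
    replace (x + e - x) with e by ring. replace (y + f - y) with f by ring. replace (t + s - t) with s by ring.
    assert (Hef : 0 <= k * (e ^ 2 + f ^ 2)).
    { apply Rmult_le_pos; [lra|]. assert (H' := pow2_ge_0 e). assert (H'' := pow2_ge_0 f). lra. }
    lra.
Qed.

(** The time derivative with A = 2 Cb + Cb^2 dominates the drift, gradient and diffusion terms of
    the barrier. Subtracting it therefore preserves subsolutions. *)
Lemma jsub_minus_exp_ch (T r rho : R) (c : coef) (Cb Cl del : R) (U : R -> R -> R -> R) :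
  0 <= r -> 0 <= Cb -> 0 <= del -> coef_ok T c Cb Cl -> jsub T r rho c (fun _ => True) U ->
  jsub T r rho c (fun _ => True)
    (fun x y t => U x y t - del * exp ((2 * Cb + Cb ^ 2) * (T - t)) * (ch x + ch y)).
Proof.
  intros Hr HCb Hdel Hok Hsub x y t q p1 p2 X11 X12 X22 Ht _ Htouch.
  set (A := 2 * Cb + Cb ^ 2) in *.
  assert (Htl := touch_exp_ch T A del x y t Hdel). cbv zeta in Htl.
  set (Et := del * exp (A * (T - t))) in *.
  assert (HE : 0 <= Et) by (apply Rmult_le_pos; [easy|left; apply exp_pos]).
  assert (Hsum := touch_plus _ _ _ _ _ _ _ _ _ _ _ _ _ _ _ _ _ _ Htouch Htl).
  cbv beta in Hsum.
  replace (fun x y t => U x y t - del * exp (A * (T - t)) * (ch x + ch y) + del * exp (A * (T - t)) * (ch x + ch y))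
    with U in Hsum by (extensionality x'; extensionality y'; extensionality t'; ring).
  assert (H := Hsub _ _ _ _ _ _ _ _ _ Ht I Hsum).
  destruct (Hok t ltac:(lra) x y x y) as [[B1 [B2 [B3 [B4 B5]]]] _].
  unfold ham in *.
  assert (Hx := ch_pos x). assert (Hy := ch_pos y).
  assert (Hsx := sh_le_ch x). assert (Hsy := sh_le_ch y).
  assert (Hmul : forall m s k, Rabs m <= Cb -> Rabs s <= k -> m * s <= Cb * k).
  { intros m s k Hm Hs. eapply Rle_trans; [apply Rle_abs|]. rewrite Rabs_mult.
    apply Rmult_le_compat; auto using Rabs_pos. }
  assert (M1 := Hmul _ _ _ B3 Hsx). assert (M2 := Hmul _ _ _ B4 Hsy).
  (* gm may have either sign, so the Lipschitz property of the absolute value is used and not its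
     subadditivity. *)
  assert (M3 : gm c x t * Rabs (p1 + Et * sh x) <= gm c x t * Rabs p1 + Et * (Cb * ch x)).
  { assert (Hd : Rabs (Rabs (p1 + Et * sh x) - Rabs p1) <= Et * ch x).
    { eapply Rle_trans; [apply Rabs_triang_inv2|]. replace (p1 + Et * sh x - p1) with (Et * sh x) by ring.
      rewrite Rabs_mult, (Rabs_pos_eq Et) by easy. apply Rmult_le_compat_l; easy. }
    assert (H' := Hmul _ _ _ B5 Hd). lra. }
  assert (Hsq : forall z, Rabs z <= Cb -> z ^ 2 <= Cb ^ 2).
  { intros z Hz. rewrite <- (pow2_abs z). apply pow_incr. split; [apply Rabs_pos|easy]. }
  assert (M4 := Hsq _ B1). assert (M5 := Hsq _ B2).
  assert (N1 := Rmult_le_compat_l Et _ _ HE M1). assert (N2 := Rmult_le_compat_l Et _ _ HE M2).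
  assert (N4 : sg c x t ^ 2 * (Et * ch x) <= Cb ^ 2 * (Et * ch x)).
  { apply Rmult_le_compat_r; [apply Rmult_le_pos; lra|easy]. }
  assert (N5 : bb c y t ^ 2 * (Et * ch y) <= Cb ^ 2 * (Et * ch y)).
  { apply Rmult_le_compat_r; [apply Rmult_le_pos; lra|easy]. }
  assert (P1 : 0 <= Et * ch x) by (apply Rmult_le_pos; lra).
  assert (P2 : 0 <= Et * ch y) by (apply Rmult_le_pos; lra).
  assert (P3 : 0 <= Cb * (Et * ch y)) by (apply Rmult_le_pos; lra).
  assert (P4 : 0 <= Cb ^ 2 * (Et * ch x)) by (apply Rmult_le_pos; [apply pow2_ge_0|lra]).
  assert (P5 : 0 <= Cb ^ 2 * (Et * ch y)) by (apply Rmult_le_pos; [apply pow2_ge_0|lra]).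
  assert (P6 : 0 <= r * (Et * (ch x + ch y))) by (apply Rmult_le_pos; [easy|apply Rmult_le_pos; lra]).
  unfold A in *. lra.
Qed.

(** * Growth and truncation *)

Definition contT (T : R) (U : R -> R -> R -> R) : Prop :=
  forall x y t, 0 <= t <= T -> forall e, 0 < e -> exists d, 0 < d /\
    forall x' y' t', 0 <= t' <= T -> Rabs (x' - x) < d -> Rabs (y' - y) < d -> Rabs (t' - t) < d ->
      Rabs (U x' y' t' - U x y t) < e.

Definition ucT (T : R) (V : R -> R -> R -> R) : Prop :=
  forall e, 0 < e -> exists d, 0 < d /\ forall x y t x' y' t', 0 <= t <= T -> 0 <= t' <= T ->
    Rabs (x' - x) < d -> Rabs (y' - y) < d -> Rabs (t' - t) < d ->
    Rabs (V x' y' t' - V x y t) < e.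

Definition decays (T : R) (U : R -> R -> R -> R) : Prop :=
  forall L, exists r, 0 < r /\ forall x y t, 0 <= t <= T -> r < Rabs x \/ r < Rabs y -> U x y t <= - L.

Lemma contG_log T u : contG T u -> contT T (fun x y t => u (exp x) (exp y) t).
Proof.
  intros H x y t Ht e He.
  destruct (H (exp x) (exp y) t) with (eps := e) as [d [Hd Hd']].
  - unfold inG. assert (Hx := exp_pos x). assert (Hy := exp_pos y). lra.
  - easy.
  - assert (Hc : forall z, exists d', 0 < d' /\ forall z', Rabs (z' - z) < d' -> Rabs (exp z' - exp z) < d).
    { intros z. assert (Hcz : continuous exp z) by (apply (ex_derive_continuous exp); auto_derive; auto).
      destruct (proj1 (filterlim_locally _ _) Hcz (mkposreal d Hd)) as [d' Hd''].
      exists d'. split; [apply cond_pos|]. intros z' Hz. apply (Hd'' z' Hz). }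
    destruct (Hc x) as [d1 [Hd1 C1]]. destruct (Hc y) as [d2 [Hd2 C2]].
    exists (Rmin d (Rmin d1 d2)). split; [repeat apply Rmin_glb_lt; lra|].
    intros x' y' t' Ht' Hx Hy Htt. apply Hd'.
    + unfold inG. assert (Hx' := exp_pos x'). assert (Hy' := exp_pos y'). lra.
    + apply C1. eapply Rlt_le_trans; [exact Hx|]. eapply Rle_trans; [apply Rmin_r|apply Rmin_l].
    + apply C2. eapply Rlt_le_trans; [exact Hy|]. eapply Rle_trans; [apply Rmin_r|apply Rmin_r].
    + eapply Rlt_le_trans; [exact Htt|apply Rmin_l].
Qed.

Lemma ln_le_sub1 z : 0 < z -> ln z <= z - 1.
Proof. intros Hz. assert (H := exp_ineq1_le (ln z)). rewrite exp_ln in H by easy. lra. Qed.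

(** With s = |x| + |y|, the inequality ln z <= z - 1 at z = s / (4 k) gives s^k <= (4 k)^k exp(s /
    4). The rate 1/4 is half of the rate 1/2 available from the barrier. *)
Lemma class_C_growth T u : class_C T u ->
  exists c M, 0 <= c /\ 0 < M /\ forall x y t, 0 <= t <= T -> M < Rabs x + Rabs y ->
    Rabs (u (exp x) (exp y) t) <= 1 + c * exp ((Rabs x + Rabs y) / 4).
Proof.
  intros [_ [k [Hk H]]]. destruct (H 1 Rlt_0_1) as [M [HM HM']].
  exists (exp (k * ln (4 * k))), M. split; [left; apply exp_pos|split; [easy|]].
  intros x y t Ht Hxy.
  assert (Hx := exp_pos x). assert (Hy := exp_pos y).
  assert (H1 := HM' (exp x) (exp y) t ltac:(unfold inG; lra)). rewrite (ln_exp x), (ln_exp y) in H1.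
  specialize (H1 Hxy). set (s := Rabs x + Rabs y) in *. unfold rpow0 in H1.
  destruct (Req_EM_T s 0) as [E|_]; [lra|].
  assert (Hp : Rpower s k <= exp (k * ln (4 * k)) * exp (s / 4)).
  { unfold Rpower. rewrite <- exp_plus. apply exp_mono.
    assert (Hq : 0 < s / (4 * k)) by (apply Rdiv_lt_0_compat; lra).
    assert (Hln : ln s <= s / (4 * k) + ln (4 * k)).
    { replace (ln s) with (ln (s / (4 * k) * (4 * k))) by (f_equal; field; lra).
      rewrite ln_mult by lra. assert (H2 := ln_le_sub1 _ Hq). lra. }
    apply Rmult_le_compat_l with (r := k) in Hln; [|lra].
    replace (k * (s / (4 * k) + ln (4 * k))) with (k * ln (4 * k) + s / 4) in Hln by (field; lra). lra. }
  assert (Hp0 : 0 < Rpower s k) by apply exp_pos.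
  assert (H2 : Rabs (u (exp x) (exp y) t) < 1 + Rpower s k); [|lra].
  apply Rmult_lt_reg_r with (/ (1 + Rpower s k)); [apply Rinv_0_lt_compat; lra|].
  rewrite Rinv_r by lra. exact H1.
Qed.

Lemma ch_exp_abs x : exp (Rabs x) <= ch x.
Proof.
  unfold ch. assert (H := exp_pos x). assert (H' := exp_pos (- x)).
  unfold Rabs. destruct (Rcase_abs x); lra.
Qed.

(** The larger of |x| and |y| is at least s / 2, so ch x + ch y >= exp(s / 2) = z^2 with z = exp(s /
    4), and del z^2 beats 1 + c z. *)
Lemma decays_minus_exp_ch T U c M A del :
  0 <= c -> 0 < M -> 0 < del -> 0 <= A ->
  (forall x y t, 0 <= t <= T -> M < Rabs x + Rabs y -> U x y t <= 1 + c * exp ((Rabs x + Rabs y) / 4)) ->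
  decays T (fun x y t => U x y t - del * exp (A * (T - t)) * (ch x + ch y)).
Proof.
  intros Hc HM Hdel HA HU L.
  (* Since z >= 1 + s / 4, s > r0 gives del z >= c + 1 + |L| + del. *)
  set (r0 := 4 * ((c + 1 + Rabs L) / del + 1)).
  assert (Hr0 : 0 <= (c + 1 + Rabs L) / del).
  { apply Rdiv_le_0_compat; [|easy]. assert (H := Rabs_pos L). lra. }
  exists (M + r0). split; [unfold r0; lra|]. intros x y t Ht Hxy.
  set (s := Rabs x + Rabs y).
  assert (Hs : M + r0 < s).
  { unfold s. assert (H1 := Rabs_pos x). assert (H2 := Rabs_pos y). destruct Hxy; lra. }
  assert (H1 := HU x y t Ht ltac:(unfold s, r0 in *; lra)). fold s in H1.
  assert (Hch : exp (s / 2) <= ch x + ch y).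
  { assert (P1 := ch_exp_abs x). assert (P2 := ch_exp_abs y).
    assert (P3 := exp_pos (Rabs x)). assert (P4 := exp_pos (Rabs y)).
    destruct (Rle_lt_dec (Rabs x) (Rabs y)) as [H|H].
    - assert (exp (s / 2) <= exp (Rabs y)) by (apply exp_mono; unfold s; lra). lra.
    - assert (exp (s / 2) <= exp (Rabs x)) by (apply exp_mono; unfold s; lra). lra. }
  set (z := exp (s / 4)).
  assert (Hz : exp (s / 2) = z * z) by (unfold z; rewrite <- exp_plus; f_equal; field).
  assert (Hz1 : 1 + s / 4 <= z) by apply exp_ineq1_le.
  assert (He1 : 1 <= exp (A * (T - t))).
  { rewrite <- exp_0. apply exp_mono. apply Rmult_le_pos; lra. }
  assert (Hzz : (c + 1 + Rabs L) / del + 1 <= z) by (unfold r0 in Hs; lra).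
  assert (Hdz : c + 1 + Rabs L + del <= del * z).
  { apply Rmult_le_compat_l with (r := del) in Hzz; [|lra].
    replace (del * ((c + 1 + Rabs L) / del + 1)) with (c + 1 + Rabs L + del) in Hzz by (field; lra). easy. }
  assert (HzL : (c + 1 + Rabs L + del) * z <= del * z * z) by (apply Rmult_le_compat_r; lra).
  assert (Hlow : del * (z * z) <= del * exp (A * (T - t)) * (ch x + ch y)).
  { rewrite <- Hz. apply Rmult_le_compat; [lra|left; apply exp_pos| |easy].
    rewrite <- (Rmult_1_r del) at 1. apply Rmult_le_compat_l; lra. }
  assert (HL := Rle_abs L). assert (HLp := Rabs_pos L).
  assert (1 <= z) by lra. assert ((1 + Rabs L) * 1 <= (1 + Rabs L) * z) by (apply Rmult_le_compat_l; lra).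
  assert (0 <= del * z) by (apply Rmult_le_pos; lra). fold z in H1. lra.
Qed.

Definition box (T r : R) (p : R * R * R) : Prop :=
  ((- r <= fst (fst p) <= r) /\ (- r <= snd (fst p) <= r)) /\ (0 <= snd p <= T).

Lemma bwc_box T r : bwc (distp (distp dist1 dist1) dist1) (box T r).
Proof.
  apply (bwc_prod (distp dist1 dist1) dist1
    (fun q => (- r <= fst q <= r) /\ (- r <= snd q <= r)) (fun t => 0 <= t <= T));
    [|apply bwc_interval].
  apply (bwc_prod dist1 dist1 (fun x => - r <= x <= r) (fun x => - r <= x <= r)); apply bwc_interval.
Qed.

Lemma dist_box x y t x' y' t' d :
  distp (distp dist1 dist1) dist1 ((x', y'), t') ((x, y), t) < d <->
  Rabs (x' - x) < d /\ Rabs (y' - y) < d /\ Rabs (t' - t) < d.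
Proof.
  unfold distp, dist1. simpl. split.
  - intros H. assert (H1 := Rle_lt_trans _ _ _ (Rmax_l _ _) H). assert (H2 := Rle_lt_trans _ _ _ (Rmax_r _ _) H).
    assert (H3 := Rle_lt_trans _ _ _ (Rmax_l _ _) H1). assert (H4 := Rle_lt_trans _ _ _ (Rmax_r _ _) H1). easy.
  - intros [H1 [H2 H3]]. repeat apply Rmax_lub_lt; easy.
Qed.

Lemma contT_contd T U r : contT T U ->
  contd (distp (distp dist1 dist1) dist1) (box T r) (fun p => U (fst (fst p)) (snd (fst p)) (snd p)).
Proof.
  intros H [[x y] t] [_ Ht] e He. simpl in Ht.
  destruct (H x y t Ht e He) as [d [Hd Hd']]. exists d. split; [easy|].
  intros [[x' y'] t'] [_ Ht'] Hdist. simpl in *. apply dist_box in Hdist. apply Hd'; easy.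
Qed.

Lemma decays_bounded T U : contT T U -> decays T U ->
  exists C, 0 <= C /\ forall x y t, 0 <= t <= T -> U x y t <= C.
Proof.
  intros Hc Hdec. destruct (Hdec 0) as [r [Hr Hout]].
  destruct (bwc_bounded _ _ _ (bwc_box T r) (contT_contd T U r Hc)) as [C HC].
  exists (Rmax 0 C). split; [apply Rmax_l|]. intros x y t Ht.
  destruct (Rlt_le_dec r (Rabs x)) as [Hx|Hx]; [|destruct (Rlt_le_dec r (Rabs y)) as [Hy|Hy]].
  - eapply Rle_trans; [|apply Rmax_l]. assert (H := Hout x y t Ht (or_introl Hx)). lra.
  - eapply Rle_trans; [|apply Rmax_l]. assert (H := Hout x y t Ht (or_intror Hy)). lra.
  - eapply Rle_trans; [|apply Rmax_r]. apply (HC ((x, y), t)).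
    apply Rabs_le_between in Hx. apply Rabs_le_between in Hy. unfold box. simpl. lra.
Qed.

(** Outside a box the truncation is the constant - L. Heine's theorem is applied on the box enlarged
    by one, which contains both points if one lies in the smaller box and their distance is less
    than one. *)
Lemma decays_truncate_uc T U L : contT T U -> decays T U -> ucT T (fun x y t => Rmax (- L) (U x y t)).
Proof.
  intros Hc Hdec e He. destruct (Hdec L) as [r [Hr Hout]].
  set (V := fun x y t => Rmax (- L) (U x y t)).
  assert (HVc : contT T V).
  { intros x y t Ht e' He'. destruct (Hc x y t Ht e' He') as [d [Hd Hd']]. exists d. split; [easy|].
    intros. eapply Rle_lt_trans; [apply Rmax_lip|]. apply Hd'; easy. }
  destruct (bwc_heine _ _ _ (distp_tri _ _ (distp_tri _ _ dist1_tri dist1_tri) dist1_tri)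
    (bwc_box T (r + 1)) (contT_contd T V (r + 1) HVc) e He) as [d [Hd Hd']].
  exists (Rmin d 1). split; [apply Rmin_glb_lt; lra|].
  intros x y t x' y' t' Ht Ht' Hx Hy Htt.
  assert (X1 := Rlt_le_trans _ _ _ Hx (Rmin_l _ _)). assert (X2 := Rlt_le_trans _ _ _ Hx (Rmin_r _ _)).
  assert (Y1 := Rlt_le_trans _ _ _ Hy (Rmin_l _ _)). assert (Y2 := Rlt_le_trans _ _ _ Hy (Rmin_r _ _)).
  assert (T1 := Rlt_le_trans _ _ _ Htt (Rmin_l _ _)).
  assert (HVout : forall x y t, 0 <= t <= T -> r < Rabs x \/ r < Rabs y -> V x y t = - L).
  { intros u v w Hw Huv. unfold V. apply Rmax_left. now apply Hout. }
  assert (Hbox : forall u v u' v', Rabs (u - u') < 1 -> Rabs (v - v') < 1 -> Rabs u' <= r -> Rabs v' <= r ->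
     - (r + 1) <= u <= r + 1 /\ - (r + 1) <= v <= r + 1).
  { intros u v u' v' A1 A2 A3 A4. apply Rabs_def2 in A1. apply Rabs_def2 in A2.
    apply Rabs_le_between in A3. apply Rabs_le_between in A4. lra. }
  assert (Hself : forall z, Rabs (z - z) < 1) by (intros z; rewrite Rminus_diag, Rabs_R0; lra).
  assert (Hin : forall u v u' v' w w', 0 <= w <= T -> 0 <= w' <= T ->
     - (r + 1) <= u <= r + 1 /\ - (r + 1) <= v <= r + 1 -> - (r + 1) <= u' <= r + 1 /\ - (r + 1) <= v' <= r + 1 ->
     Rabs (u' - u) < d -> Rabs (v' - v) < d -> Rabs (w' - w) < d -> Rabs (V u' v' w' - V u v w) < e).
  { intros u v u' v' w w' Hw Hw' Hb Hb' D1 D2 D3.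
    apply (Hd' ((u', v'), w') ((u, v), w)); [unfold box; simpl; lra|unfold box; simpl; lra|].
    now apply dist_box. }
  destruct (classic (r < Rabs x \/ r < Rabs y)) as [Ho|Hi]; [destruct (classic (r < Rabs x' \/ r < Rabs y')) as [Ho'|Hi']|].
  - fold (V x' y' t') (V x y t). rewrite !HVout by easy. rewrite Rminus_diag, Rabs_R0. easy.
  - apply not_or_and in Hi'. apply Hin; try easy.
    + apply (Hbox x y x' y'); try lra; rewrite Rabs_minus_sym; easy.
    + apply (Hbox x' y' x' y'); try apply Hself; lra.
  - apply not_or_and in Hi. apply Hin; try easy.
    + apply (Hbox x y x y); try apply Hself; lra.
    + apply (Hbox x' y' x y); lra || easy.
Qed.

Lemma jsub_truncate T r rho c U L : jsub T r rho c (fun _ => True) U ->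
  jsub T r rho c (fun v => - L < v) (fun x y t => Rmax (- L) (U x y t)).
Proof.
  intros H x y t q p1 p2 X11 X12 X22 Ht HL Htouch.
  assert (E : Rmax (- L) (U x y t) = U x y t).
  { destruct (Rle_lt_dec (- L) (U x y t)) as [Hl|Hl]; [now apply Rmax_right|].
    rewrite Rmax_left in HL; lra. }
  rewrite E. apply (H x y t q p1 p2 X11 X12 X22 Ht I).
  apply (touch_local T (fun x y t => Rmax (- L) (U x y t)) U x y t q p1 p2 X11 X12 X22 1); try lra; try easy.
  intros. apply Rmax_r.
Qed.

(** * Sup- and inf-convolutions *)

Definition sconv (al : R) (f : R -> R -> R) (x y : R) : R :=
  Sup (fun z : R * R => f (fst z) (snd z) - al * ((fst z - x) ^ 2 + (snd z - y) ^ 2)).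
Definition iconv (al : R) (g : R -> R -> R) (x y : R) : R := - sconv al (fun x y => - g x y) x y.

Section Conv.
Variables (al B : R).
Hypothesis Hal : 0 < al.

Lemma sq_sum_pos u v : 0 <= al * (u ^ 2 + v ^ 2).
Proof. apply Rmult_le_pos; [lra|]. assert (H := pow2_ge_0 u). assert (H' := pow2_ge_0 v). lra. Qed.

Lemma sconv_ge f x y u v : (forall x y, f x y <= B) ->
  f u v - al * ((u - x) ^ 2 + (v - y) ^ 2) <= sconv al f x y.
Proof.
  intros Hf. apply (Sup_ub (fun z : R * R => f (fst z) (snd z) - al * ((fst z - x) ^ 2 + (snd z - y) ^ 2)) B (u, v)).
  intros z. assert (H := Hf (fst z) (snd z)). assert (H' := sq_sum_pos (fst z - x) (snd z - y)). lra.
Qed.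

Lemma sconv_le f x y b : (forall u v, f u v - al * ((u - x) ^ 2 + (v - y) ^ 2) <= b) -> sconv al f x y <= b.
Proof. intros H. apply (Sup_le _ _ (0, 0)). intros z. apply H. Qed.

Lemma sconv_above f x y : (forall x y, f x y <= B) -> f x y <= sconv al f x y.
Proof.
  intros Hf. assert (H := sconv_ge f x y x y Hf). rewrite !Rminus_diag in H. lra.
Qed.

Lemma sconv_bound f x y : (forall x y, f x y <= B) -> sconv al f x y <= B.
Proof.
  intros Hf. apply sconv_le. intros u v. assert (H := Hf u v). assert (H' := sq_sum_pos (u - x) (v - y)). lra.
Qed.

Lemma sconv_cmp f f' h1 h2 e x y : (forall x y, f' x y <= B) ->
  (forall x y, f (x + h1) (y + h2) <= f' x y + e) -> sconv al f (x + h1) (y + h2) <= sconv al f' x y + e.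
Proof.
  intros Hf' H. apply sconv_le. intros u v.
  assert (H1 := sconv_ge f' x y (u - h1) (v - h2) Hf'). assert (H2 := H (u - h1) (v - h2)).
  replace (u - h1 + h1) with u in H2 by ring. replace (v - h2 + h2) with v in H2 by ring.
  replace (u - (x + h1)) with (u - h1 - x) by ring. replace (v - (y + h2)) with (v - h2 - y) by ring. lra.
Qed.

Lemma sconv_attained f x y : unif_cont2 f -> (forall x y, Rabs (f x y) <= B) ->
  exists u v, sconv al f x y = f u v - al * ((u - x) ^ 2 + (v - y) ^ 2).
Proof.
  intros Huc HB.
  assert (HB0 : 0 <= B) by (eapply Rle_trans; [apply Rabs_pos|apply (HB 0 0)]).
  assert (Hlo : forall x y, - B <= f x y <= B) by (intros u v; assert (H := HB u v); apply Rabs_le_between in H; lra).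
  set (F := fun u v => f u v - al * ((u - x) ^ 2 + (v - y) ^ 2)).
  (* Beyond distance r0 >= 1 the penalty al d^2 exceeds 2 B, the largest oscillation of f. *)
  set (r0 := 2 * B / al + 1).
  assert (Hr0 : 1 <= r0).
  { unfold r0. assert (0 <= 2 * B / al) by (apply Rdiv_le_0_compat; lra). lra. }
  assert (Hfar : forall d, r0 < Rabs d -> 2 * B <= al * d ^ 2).
  { intros d Hd. rewrite <- (pow2_abs d).
    assert (H : Rabs d <= Rabs d ^ 2) by (simpl; rewrite Rmult_1_r; nra).
    apply Rle_trans with (al * Rabs d); [|apply Rmult_le_compat_l; lra].
    apply Rle_trans with (al * (2 * B / al)); [right; field; lra|]. apply Rmult_le_compat_l; [lra|unfold r0 in Hd; lra]. }
  destruct (cont2_max F (r0 + Rabs x + Rabs y) x y) as [u [v Huv]].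
  - intros u v e He. destruct (Huc (e / 2) ltac:(lra)) as [d1 [Hd1 H1]].
    set (k := al * (2 * Rabs (u - x) + 2 * Rabs (v - y) + 2)).
    assert (Hp1 := Rabs_pos (u - x)). assert (Hp2 := Rabs_pos (v - y)).
    assert (Hk : 0 < k) by (unfold k; apply Rmult_lt_0_compat; lra).
    exists (Rmin d1 (Rmin 1 (e / (2 * k)))). split.
    { repeat apply Rmin_glb_lt; try lra. apply Rdiv_lt_0_compat; lra. }
    intros u' v' Hu Hv.
    assert (U1 := Rlt_le_trans _ _ _ Hu (Rmin_l _ _)). assert (V1 := Rlt_le_trans _ _ _ Hv (Rmin_l _ _)).
    assert (U2 := Rlt_le_trans _ _ _ (Rlt_le_trans _ _ _ Hu (Rmin_r _ _)) (Rmin_l _ _)).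
    assert (V2 := Rlt_le_trans _ _ _ (Rlt_le_trans _ _ _ Hv (Rmin_r _ _)) (Rmin_l _ _)).
    assert (U3 := Rlt_le_trans _ _ _ (Rlt_le_trans _ _ _ Hu (Rmin_r _ _)) (Rmin_r _ _)).
    assert (V3 := Rlt_le_trans _ _ _ (Rlt_le_trans _ _ _ Hv (Rmin_r _ _)) (Rmin_r _ _)).
    assert (H2 := H1 u v u' v' U1 V1). unfold F.
    set (eta := e / (2 * k)) in *.
    assert (Hke : k * eta = e / 2) by (unfold eta; field; lra).
    assert (Hq : forall p p' q, Rabs (p' - p) < 1 -> Rabs (p' - p) < eta ->
              Rabs ((p' - q) ^ 2 - (p - q) ^ 2) <= (2 * Rabs (p - q) + 1) * eta).
    { intros p p' q Ha Hb. replace ((p' - q) ^ 2 - (p - q) ^ 2) with ((2 * (p - q) + (p' - p)) * (p' - p)) by ring.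
      rewrite Rabs_mult. apply Rmult_le_compat; try apply Rabs_pos; [|lra].
      eapply Rle_trans; [apply Rabs_triang|]. rewrite Rabs_mult, (Rabs_pos_eq 2) by lra. lra. }
    assert (Q1 := Hq u u' x U2 U3). assert (Q2 := Hq v v' y V2 V3).
    apply Rabs_le_between in Q1. apply Rabs_le_between in Q2. apply Rabs_def2 in H2.
    assert (E : al * ((2 * Rabs (u - x) + 1) * eta) + al * ((2 * Rabs (v - y) + 1) * eta) = e / 2)
      by (rewrite <- Hke; unfold k; ring).
    assert (A1 : al * ((u' - x) ^ 2 - (u - x) ^ 2) <= al * ((2 * Rabs (u - x) + 1) * eta)) by (apply Rmult_le_compat_l; lra).
    assert (A2 : al * ((v' - y) ^ 2 - (v - y) ^ 2) <= al * ((2 * Rabs (v - y) + 1) * eta)) by (apply Rmult_le_compat_l; lra).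
    assert (A3 : al * - ((2 * Rabs (u - x) + 1) * eta) <= al * ((u' - x) ^ 2 - (u - x) ^ 2)) by (apply Rmult_le_compat_l; lra).
    assert (A4 : al * - ((2 * Rabs (v - y) + 1) * eta) <= al * ((v' - y) ^ 2 - (v - y) ^ 2)) by (apply Rmult_le_compat_l; lra).
    apply Rabs_def1; lra.
  - intros u v Huv. unfold F. rewrite !Rminus_diag.
    assert (H1 := Hlo u v). assert (H2 := Hlo x y).
    assert (H3 : 2 * B <= al * ((u - x) ^ 2 + (v - y) ^ 2)).
    { assert (Hx := Rabs_pos x). assert (Hy := Rabs_pos y).
      assert (P1 : 0 <= al * (u - x) ^ 2) by (apply Rmult_le_pos; [lra|apply pow2_ge_0]).
      assert (P2 : 0 <= al * (v - y) ^ 2) by (apply Rmult_le_pos; [lra|apply pow2_ge_0]).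
      destruct Huv as [Hu|Hv].
      - assert (T := Rabs_triang (u - x) x). replace (u - x + x) with u in T by ring.
        assert (H := Hfar (u - x) ltac:(lra)). lra.
      - assert (T := Rabs_triang (v - y) y). replace (v - y + y) with v in T by ring.
        assert (H := Hfar (v - y) ltac:(lra)). lra. }
    simpl. lra.
  - exists u, v. apply (Sup_eq_max (fun z : R * R => f (fst z) (snd z) - al * ((fst z - x) ^ 2 + (snd z - y) ^ 2)) (u, v)).
    intros [u' v']. apply Huv.
Qed.

Lemma iconv_le g x y u v : (forall x y, - B <= g x y) ->
  iconv al g x y <= g u v + al * ((u - x) ^ 2 + (v - y) ^ 2).
Proof.
  intros Hg. unfold iconv. assert (H := sconv_ge (fun x y => - g x y) x y u v).
  cbv beta in H. specialize (H ltac:(intros a b; specialize (Hg a b); lra)). lra.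
Qed.

Lemma iconv_ge g x y b : (forall u v, b <= g u v + al * ((u - x) ^ 2 + (v - y) ^ 2)) -> b <= iconv al g x y.
Proof.
  intros H. unfold iconv. assert (sconv al (fun x y => - g x y) x y <= - b); [|lra].
  apply sconv_le. intros u v. specialize (H u v). lra.
Qed.

Lemma iconv_approx g x y e : (forall x y, - B <= g x y) -> 0 < e ->
  exists u v, g u v + al * ((u - x) ^ 2 + (v - y) ^ 2) < iconv al g x y + e.
Proof.
  intros Hg He. apply NNPP. intros Hn.
  assert (iconv al g x y + e <= iconv al g x y); [|lra].
  apply iconv_ge. intros u v. apply Rnot_lt_le. intros H. apply Hn. now exists u, v.
Qed.

End Conv.

(** * Lasry-Lions regularization *)

Section Hull.
Variables (be B : R) (V : R -> R -> R).
Hypothesis Hbe : 0 < be.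
Hypothesis HB : forall x y, Rabs (V x y) <= B.

(** The sup-convolution provides semiconvexity; the stiffer inf-convolution adds semiconcavity
    without destroying it. *)
Definition hull : R -> R -> R := iconv (2 * be) (sconv be V).

Lemma V_le x y : V x y <= B.
Proof. assert (H := HB x y). apply Rabs_le_between in H. lra. Qed.

Lemma V_ge x y : - B <= V x y.
Proof. assert (H := HB x y). apply Rabs_le_between in H. lra. Qed.

Lemma sconv_V_ge x y : - B <= sconv be V x y.
Proof. eapply Rle_trans; [apply (V_ge x y)|]. apply (sconv_above be B Hbe). exact V_le. Qed.

Lemma hull_bound x y : Rabs (hull x y) <= B.
Proof.
  apply Rabs_le. split.
  - apply iconv_ge. intros u v. assert (H := sconv_V_ge u v).
    assert (H' := sq_sum_pos (2 * be) ltac:(lra) (u - x) (v - y)). lra.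
  - eapply Rle_trans; [apply (iconv_le (2 * be) B ltac:(lra) (sconv be V) x y x y sconv_V_ge)|].
    rewrite !Rminus_diag. assert (H := sconv_bound be B Hbe V x y V_le). lra.
Qed.

(** The parameters be, 2 be, 2 be fit because |p - u|^2 <= 2 |p - x|^2 + 2 |u - x|^2. *)
Lemma hull_above x y : sconv (2 * be) V x y <= hull x y.
Proof.
  apply iconv_ge. intros u v. apply sconv_le. intros p q.
  assert (H := sconv_ge be B Hbe V u v p q V_le).
  assert (Hq : forall a b c, be * (a - b) ^ 2 <= 2 * be * (a - c) ^ 2 + 2 * be * (b - c) ^ 2).
  { intros a b c. assert (P := pow2_ge_0 ((a - c) + (b - c))).
    assert (0 <= be * ((a - c) + (b - c)) ^ 2) by (apply Rmult_le_pos; lra). lra. }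
  assert (Q1 := Hq p u x). assert (Q2 := Hq q v y). lra.
Qed.

Lemma sconv_semiconvex x y d1 d2 :
  2 * sconv be V x y - 2 * be * (d1 ^ 2 + d2 ^ 2) <= sconv be V (x + d1) (y + d2) + sconv be V (x - d1) (y - d2).
Proof.
  assert (sconv be V x y <= (sconv be V (x + d1) (y + d2) + sconv be V (x - d1) (y - d2)) / 2 + be * (d1 ^ 2 + d2 ^ 2)); [|lra].
  apply sconv_le. intros u v.
  assert (H1 := sconv_ge be B Hbe V (x + d1) (y + d2) u v V_le).
  assert (H2 := sconv_ge be B Hbe V (x - d1) (y - d2) u v V_le). lra.
Qed.

(** The upper bound uses one near-minimizer at all three points. For the lower bound the midpoint of
    near-minimizers at the two shifted points competes at the centre, and semiconvexity of the
    sup-convolution is applied there. *)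
Lemma hull_second_diff : second_diff hull (4 * be).
Proof.
  intros x y e d. apply Rabs_le. split.
  - apply le_epsilon. intros eps Heps.
    destruct (iconv_approx (2 * be) B (sconv be V) (x + e) (y + d) (eps / 2) (sconv_V_ge) ltac:(lra)) as [u1 [v1 H1]].
    destruct (iconv_approx (2 * be) B (sconv be V) (x - e) (y - d) (eps / 2) (sconv_V_ge) ltac:(lra)) as [u2 [v2 H2]].
    fold hull in H1, H2.
    set (mu := (u1 + u2) / 2). set (mv := (v1 + v2) / 2). set (du := (u1 - u2) / 2). set (dv := (v1 - v2) / 2).
    assert (H3 := sconv_semiconvex mu mv du dv).
    replace (mu + du) with u1 in H3 by (unfold mu, du; field). replace (mu - du) with u2 in H3 by (unfold mu, du; field).
    replace (mv + dv) with v1 in H3 by (unfold mv, dv; field). replace (mv - dv) with v2 in H3 by (unfold mv, dv; field).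
    assert (H4 := iconv_le (2 * be) B ltac:(lra) (sconv be V) x y mu mv sconv_V_ge). fold hull in H4.
    (* The penalties at the shifted points pay for the doubled penalty at the midpoint and for the
       semiconvexity defect, up to 4 be c^2. *)
    assert (Hq : forall z1 z2 w c, 2 * (2 * be * ((z1 + z2) / 2 - w) ^ 2) + 2 * be * ((z1 - z2) / 2) ^ 2 - 4 * be * c ^ 2 <=
       2 * be * (z1 - (w + c)) ^ 2 + 2 * be * (z2 - (w - c)) ^ 2).
    { intros z1 z2 w c. assert (P := pow2_ge_0 ((z1 - z2) / 2 - 2 * c)).
      assert (P' : 0 <= 2 * be * ((z1 - z2) / 2 - 2 * c) ^ 2) by (apply Rmult_le_pos; lra).
      assert (E : 2 * be * (z1 - (w + c)) ^ 2 + 2 * be * (z2 - (w - c)) ^ 2 =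
        2 * (2 * be * ((z1 + z2) / 2 - w) ^ 2) + 2 * be * ((z1 - z2) / 2) ^ 2 - 4 * be * c ^ 2
         + 2 * be * ((z1 - z2) / 2 - 2 * c) ^ 2) by field. lra. }
    assert (Q1 := Hq u1 u2 x e). assert (Q2 := Hq v1 v2 y d). fold mu du in Q1. fold mv dv in Q2. lra.
  - apply le_epsilon. intros eps Heps.
    destruct (iconv_approx (2 * be) B (sconv be V) x y (eps / 2) (sconv_V_ge) ltac:(lra)) as [u [v H]]. fold hull in H.
    assert (H1 := iconv_le (2 * be) B ltac:(lra) (sconv be V) (x + e) (y + d) u v sconv_V_ge).
    assert (H2 := iconv_le (2 * be) B ltac:(lra) (sconv be V) (x - e) (y - d) u v sconv_V_ge).
    fold hull in H1, H2. lra.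
Qed.

Lemma hull_unif_cont : unif_cont2 V -> unif_cont2 hull.
Proof.
  intros Huc e He. destruct (Huc (e / 2) ltac:(lra)) as [d [Hd Hd']]. exists d. split; [easy|].
  assert (Hone : forall x y x' y', Rabs (x' - x) < d -> Rabs (y' - y) < d -> hull x' y' <= hull x y + e / 2).
  { intros x y x' y' Hx Hy.
    set (h1 := x - x'). set (h2 := y - y').
    assert (Hs : forall u v, sconv be V u v <= sconv be V (u + h1) (v + h2) + e / 2).
    { intros u v. replace u with (u + h1 + - h1) at 1 by ring. replace v with (v + h2 + - h2) at 1 by ring.
      apply (sconv_cmp be B Hbe V V (- h1) (- h2)); [exact V_le|].
      intros p q. assert (H := Hd' p q (p + - h1) (q + - h2)).
      replace (p + - h1 - p) with (x' - x) in H by (unfold h1; ring).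
      replace (q + - h2 - q) with (y' - y) in H by (unfold h2; ring).
      specialize (H Hx Hy). apply Rabs_def2 in H. lra. }
    assert (hull x' y' - e / 2 <= hull x y); [|lra].
    apply iconv_ge. intros u v.
    assert (H1 := iconv_le (2 * be) B ltac:(lra) (sconv be V) x' y' (u - h1) (v - h2) sconv_V_ge). fold hull in H1.
    assert (H2 := Hs (u - h1) (v - h2)).
    replace (u - h1 + h1) with u in H2 by ring. replace (v - h2 + h2) with v in H2 by ring.
    replace (u - h1 - x') with (u - x) in H1 by (unfold h1; ring).
    replace (v - h2 - y') with (v - y) in H1 by (unfold h2; ring). lra. }
  intros x y x' y' Hx Hy. assert (H1 := Hone x y x' y' Hx Hy).
  assert (H2 := Hone x' y' x y ltac:(rewrite Rabs_minus_sym; easy) ltac:(rewrite Rabs_minus_sym; easy)).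
  apply Rabs_def1; lra.
Qed.

End Hull.

(** Quadratic penalties combine like springs in series. Two sup-convolutions turn be/4 into be/2,
    since 4/be = 1/be + 2/be + 1/be; two inf-convolutions turn be/2 into be/3, since 3/be = 1/(2 be)
    + 2/be + 1/(2 be). *)
Lemma hull_pair be B V1 V2 m : 0 < be -> (forall x y, Rabs (V1 x y) <= B) -> (forall x y, Rabs (V2 x y) <= B) ->
  (forall x y x' y', V1 x y + V2 x' y' <= m + be / 4 * ((x - x') ^ 2 + (y - y') ^ 2)) ->
  forall x y x' y', hull be V1 x y + hull be V2 x' y' <= m + be / 3 * ((x - x') ^ 2 + (y - y') ^ 2).
Proof.
  intros Hbe HB1 HB2 H x y x' y'.
  assert (Hg : forall u v u' v', sconv be V1 u v + sconv be V2 u' v' <= m + be / 2 * ((u - u') ^ 2 + (v - v') ^ 2)).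
  { intros u v u' v'.
    assert (sconv be V1 u v <= m + be / 2 * ((u - u') ^ 2 + (v - v') ^ 2) - sconv be V2 u' v'); [|lra].
    apply sconv_le. intros p q.
    assert (sconv be V2 u' v' <= m + be / 2 * ((u - u') ^ 2 + (v - v') ^ 2) - V1 p q + be * ((p - u) ^ 2 + (q - v) ^ 2)); [|lra].
    apply sconv_le. intros p' q'. assert (H1 := H p q p' q').
    assert (Hq : forall a b c d, be / 4 * (a - d) ^ 2 <= be * (a - b) ^ 2 + be / 2 * (b - c) ^ 2 + be * (d - c) ^ 2).
    { intros a b c d.
      assert (P1 : 0 <= be * (2 * (a - b) - (b - c)) ^ 2) by (apply Rmult_le_pos; [lra|apply pow2_ge_0]).
      assert (P2 : 0 <= be * ((b - c) - 2 * (c - d)) ^ 2) by (apply Rmult_le_pos; [lra|apply pow2_ge_0]).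
      assert (P3 : 0 <= be * ((a - b) - (c - d)) ^ 2) by (apply Rmult_le_pos; [lra|apply pow2_ge_0]).
      assert (E : be * (a - b) ^ 2 + be / 2 * (b - c) ^ 2 + be * (d - c) ^ 2 - be / 4 * (a - d) ^ 2 =
        / 8 * (be * (2 * (a - b) - (b - c)) ^ 2) + / 8 * (be * ((b - c) - 2 * (c - d)) ^ 2)
        + / 4 * (be * ((a - b) - (c - d)) ^ 2)) by field. lra. }
    assert (Q1 := Hq p u u' p'). assert (Q2 := Hq q v v' q'). lra. }
  (* The optimal split of the segment in the ratio 1/6, 2/3, 1/6, proportional to the compliances
     1/(2 be), 2/be, 1/(2 be). *)
  set (u := x + (x' - x) / 6). set (v := y + (y' - y) / 6).
  set (u' := x' - (x' - x) / 6). set (v' := y' - (y' - y) / 6).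
  assert (H1 := iconv_le (2 * be) B ltac:(lra) (sconv be V1) x y u v (sconv_V_ge be B V1 Hbe HB1)).
  assert (H2 := iconv_le (2 * be) B ltac:(lra) (sconv be V2) x' y' u' v' (sconv_V_ge be B V2 Hbe HB2)).
  fold (hull be V1) in H1. fold (hull be V2) in H2. assert (H3 := Hg u v u' v').
  assert (E : be / 2 * ((u - u') ^ 2 + (v - v') ^ 2) + 2 * be * ((u - x) ^ 2 + (v - y) ^ 2)
    + 2 * be * ((u' - x') ^ 2 + (v' - y') ^ 2) = be / 3 * ((x - x') ^ 2 + (y - y') ^ 2))
    by (unfold u, v, u', v'; field). lra.
Qed.

(** A superjet of the sup-convolution is a superjet of V at the maximizing point, and with parameter
    2 be the gradient p = 4 be (z - x) locates this point. *)
Lemma sconv_touch T be B V x y t q p1 p2 X11 X12 X22 : 0 < be -> 0 <= t <= T ->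
  (forall x y t, 0 <= t <= T -> Rabs (V x y t) <= B) -> unif_cont2 (fun x y => V x y t) ->
  touch T (fun x y t => sconv (2 * be) (fun x y => V x y t) x y) x y t q p1 p2 X11 X12 X22 ->
  let zx := x + p1 / (4 * be) in let zy := y + p2 / (4 * be) in
  touch T V zx zy t q p1 p2 X11 X12 X22 /\
  sconv (2 * be) (fun x y => V x y t) x y = V zx zy t - 2 * be * ((zx - x) ^ 2 + (zy - y) ^ 2).
Proof.
  intros Hbe Ht HB Huc Htouch zx zy.
  set (Uh := fun x y t => sconv (2 * be) (fun x y => V x y t) x y) in *.
  destruct (sconv_attained (2 * be) B ltac:(lra) (fun x y => V x y t) x y Huc (fun x y => HB x y t Ht))
    as [u [v Huv]]. cbv beta in Huv.
  assert (Hlow : forall x' y' t' u' v', 0 <= t' <= T ->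
     V u' v' t' - 2 * be * ((u' - x') ^ 2 + (v' - y') ^ 2) <= Uh x' y' t').
  { intros x' y' t' u' v' Ht'. apply (sconv_ge (2 * be) B ltac:(lra) (fun x y => V x y t')).
    intros a b. assert (H := HB a b t' Ht'). apply Rabs_le_between in H. lra. }
  (* Moving the base point together with the competitor leaves the penalty unchanged, so increments
     of V are bounded by increments of the convolution. *)
  assert (HT : touch T V u v t q p1 p2 X11 X12 X22).
  { intros k Hk. destruct (Htouch k Hk) as [W [d [HW [Hd H]]]].
    exists W, d. split; [easy|split; [easy|]]. intros u' v' t' Ht' Hu Hv Htt.
    assert (H1 := H (x + (u' - u)) (y + (v' - v)) t' Ht').
    replace (x + (u' - u) - x) with (u' - u) in H1 by ring.
    replace (y + (v' - v) - y) with (v' - v) in H1 by ring.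
    specialize (H1 Hu Hv Htt). assert (H2 := Hlow (x + (u' - u)) (y + (v' - v)) t' u' v' Ht').
    unfold Uh in H1, H2. rewrite Huv in H1.
    replace (u' - (x + (u' - u))) with (u - x) in H2 by ring.
    replace (v' - (y + (v' - v))) with (v - y) in H2 by ring. lra. }
  (* With the competitor (u, v) fixed, the convolution is bounded below by a paraboloid that agrees
     with it at (x, y); its slope must equal that of the superjet. The boolean chooses the
     coordinate. *)
  assert (Hgrad : forall (e : bool), (if e then p1 - 4 * be * (u - x) else p2 - 4 * be * (v - y)) = 0).
  { intros e. destruct (Htouch 1 Rlt_0_1) as [W [d [HW [Hd H]]]].
    set (c := Rabs X11 + Rabs X22 + 2 * be + 2).
    assert (Hc : 0 < c) by (unfold c; assert (H1 := Rabs_pos X11); assert (H2 := Rabs_pos X22); lra).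
    assert (HW0 : W 0 <= 0).
    { apply le_epsilon. intros eps Heps. destruct (HW 1 Rlt_0_1) as [d1 [Hd1 HW1]].
      specialize (HW1 0 ltac:(rewrite Rabs_R0; easy)). rewrite Rabs_R0 in HW1. lra. }
    set (g := if e then p1 - 4 * be * (u - x) else p2 - 4 * be * (v - y)).
    assert (Hs : forall s, Rabs s < d -> 0 <= g * s + c * s ^ 2).
    { intros s Hs. assert (H0 : Rabs 0 < d) by (rewrite Rabs_R0; easy).
      assert (HX1 := Rle_abs X11). assert (HX2 := Rle_abs X22). assert (Hs2 := pow2_ge_0 s).
      assert (M1 : X11 * s ^ 2 <= Rabs X11 * s ^ 2) by (apply Rmult_le_compat_r; lra).
      assert (M2 : X22 * s ^ 2 <= Rabs X22 * s ^ 2) by (apply Rmult_le_compat_r; lra).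
      assert (N1 : 0 <= Rabs X11 * s ^ 2) by (apply Rmult_le_pos; [apply Rabs_pos|lra]).
      assert (N2 : 0 <= Rabs X22 * s ^ 2) by (apply Rmult_le_pos; [apply Rabs_pos|lra]).
      unfold g, c. destruct e.
      - assert (H1 := H (x + s) y t Ht). rewrite !Rminus_diag in H1. replace (x + s - x) with s in H1 by ring.
        specialize (H1 Hs H0 H0). assert (H2 := Hlow (x + s) y t u v Ht).
        unfold Uh in H1, H2. rewrite Huv in H1. lra.
      - assert (H1 := H x (y + s) t Ht). rewrite !Rminus_diag in H1. replace (y + s - y) with s in H1 by ring.
        specialize (H1 H0 Hs H0). assert (H2 := Hlow x (y + s) t u v Ht).
        unfold Uh in H1, H2. rewrite Huv in H1. lra. }
    apply NNPP. intros Hg.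
    assert (Hgp : 0 < Rabs g) by now apply Rabs_pos_lt.
    set (s := Rmin (d / 2) (Rabs g / (2 * c))).
    assert (Hq : 0 < Rabs g / (2 * c)) by (apply Rdiv_lt_0_compat; lra).
    assert (Hs0 : 0 < s) by (apply Rmin_glb_lt; lra).
    assert (Hs1 : s <= d / 2) by apply Rmin_l. assert (Hs2 : s <= Rabs g / (2 * c)) by apply Rmin_r.
    assert (Hcs : c * s <= Rabs g / 2).
    { apply Rle_trans with (c * (Rabs g / (2 * c))); [apply Rmult_le_compat_l; lra|right; field; lra]. }
    destruct (Rle_lt_dec 0 g) as [Hg0|Hg0].
    - assert (H1 := Hs (- s) ltac:(rewrite Rabs_Ropp, Rabs_pos_eq; lra)).
      rewrite (Rabs_pos_eq g) in * by lra. nra.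
    - assert (H1 := Hs s ltac:(rewrite Rabs_pos_eq; lra)). rewrite (Rabs_left g) in * by lra. nra. }
  assert (G1 := Hgrad true). assert (G2 := Hgrad false). cbv beta iota in G1, G2.
  assert (Eu : zx = u) by (unfold zx; replace p1 with (4 * be * (u - x)) by lra; field; lra).
  assert (Ev : zy = v) by (unfold zy; replace p2 with (4 * be * (v - y)) by lra; field; lra).
  rewrite Eu, Ev. split; [exact HT|exact Huv].
Qed.

(** * Elementary estimates *)

Lemma Rabs_prod_diff u v u0 v0 mu mv e f : Rabs u <= mu -> Rabs v0 <= mv -> Rabs (u - u0) <= e -> Rabs (v - v0) <= f ->
  Rabs (u * v - u0 * v0) <= mu * f + e * mv.
Proof.
  intros H1 H2 H3 H4. replace (u * v - u0 * v0) with (u * (v - v0) + (u - u0) * v0) by ring.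
  eapply Rle_trans; [apply Rabs_triang|]. rewrite !Rabs_mult.
  apply Rplus_le_compat; apply Rmult_le_compat; auto using Rabs_pos.
Qed.

Lemma Rabs_prod_le u v a b : Rabs u <= a -> Rabs v <= b -> Rabs (u * v) <= a * b.
Proof. intros. rewrite Rabs_mult. apply Rmult_le_compat; auto using Rabs_pos. Qed.

(** [ham] splits into the time slope, [lower] and [second]: the generator of the walk matches
    [second], while [lower] is frozen into a constant rate. *)
Definition lower (r m1 m2 g V p1 p2 : R) : R := m1 * p1 + m2 * p2 + g * Rabs p1 - r * V.
Definition second (rho s b X11 X12 X22 : R) : R := / 2 * s ^ 2 * X11 + rho * s * b * X12 + / 2 * b ^ 2 * X22.

Lemma second_diff_coef rho s b s0 b0 X11 X12 X22 Cb C2 z :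
  -1 <= rho <= 1 -> 0 <= Cb -> 0 <= C2 -> Rabs s <= Cb -> Rabs b <= Cb -> Rabs s0 <= Cb -> Rabs b0 <= Cb ->
  Rabs (s - s0) <= z -> Rabs (b - b0) <= z -> Rabs X11 <= C2 -> Rabs X12 <= 2 * C2 -> Rabs X22 <= C2 ->
  Rabs (second rho s b X11 X12 X22 - second rho s0 b0 X11 X12 X22) <= 6 * Cb * C2 * z.
Proof.
  intros Hrho HCb HC2 Hs Hb Hs0 Hb0 Ds Db H11 H12 H22.
  assert (Hz : 0 <= z) by (eapply Rle_trans; [apply Rabs_pos|exact Ds]).
  unfold second.
  replace (/ 2 * s ^ 2 * X11 + rho * s * b * X12 + / 2 * b ^ 2 * X22 -
    (/ 2 * s0 ^ 2 * X11 + rho * s0 * b0 * X12 + / 2 * b0 ^ 2 * X22)) with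
    (/ 2 * ((s ^ 2 - s0 ^ 2) * X11) + rho * ((s * b - s0 * b0) * X12) + / 2 * ((b ^ 2 - b0 ^ 2) * X22)) by ring.
  assert (Q1 := Rabs_sq_diff s s0 Cb z Hs Hs0 Ds). assert (Q2 := Rabs_sq_diff b b0 Cb z Hb Hb0 Db).
  assert (Q3 := Rabs_prod_diff s b s0 b0 Cb Cb z z Hs Hb0 Ds Db).
  assert (R1 := Rabs_prod_le _ _ _ _ Q1 H11). assert (R2 := Rabs_prod_le _ _ _ _ Q2 H22).
  assert (R3 := Rabs_prod_le _ _ _ _ Q3 H12).
  assert (R4 : Rabs (rho * ((s * b - s0 * b0) * X12)) <= 1 * ((Cb * z + z * Cb) * (2 * C2)))
    by (apply Rabs_prod_le; [apply Rabs_le; lra|exact R3]).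
  eapply Rle_trans; [apply Rabs_triang|]. eapply Rle_trans; [apply Rplus_le_compat_r, Rabs_triang|].
  rewrite (Rabs_mult (/ 2)), (Rabs_mult (/ 2)), (Rabs_pos_eq (/ 2)) by lra. lra.
Qed.

Lemma second_bound rho s b X11 X12 X22 Cb C2 :
  -1 <= rho <= 1 -> 0 <= C2 -> Rabs s <= Cb -> Rabs b <= Cb ->
  Rabs X11 <= C2 -> Rabs X12 <= 2 * C2 -> Rabs X22 <= C2 ->
  Rabs (second rho s b X11 X12 X22) <= 3 * Cb ^ 2 * C2.
Proof.
  intros Hrho HC2 Hs Hb H11 H12 H22. unfold second.
  assert (R1 := Rabs_prod_le _ _ _ _ (Rabs_prod_le _ _ _ _ Hs Hs) H11).
  assert (R2 := Rabs_prod_le _ _ _ _ (Rabs_prod_le _ _ _ _ Hb Hb) H22).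
  assert (R3 := Rabs_prod_le _ _ _ _ (Rabs_prod_le _ _ _ _ Hs Hb) H12).
  assert (R4 : Rabs (rho * (s * b * X12)) <= 1 * (Cb * Cb * (2 * C2)))
    by (apply Rabs_prod_le; [apply Rabs_le; lra|exact R3]).
  replace (/ 2 * s ^ 2 * X11 + rho * s * b * X12 + / 2 * b ^ 2 * X22) with
    (/ 2 * (s * s * X11) + rho * (s * b * X12) + / 2 * (b * b * X22)) by ring.
  eapply Rle_trans; [apply Rabs_triang|]. eapply Rle_trans; [apply Rplus_le_compat_r, Rabs_triang|].
  rewrite (Rabs_mult (/ 2)), (Rabs_mult (/ 2)), (Rabs_pos_eq (/ 2)) by lra. lra.
Qed.

Lemma lower_diff r m1 m2 g V p1 p2 m10 m20 g0 V0 p10 p20 Cb Pb z :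
  0 <= r -> Rabs m1 <= Cb -> Rabs m2 <= Cb -> Rabs g <= Cb -> Rabs p10 <= Pb -> Rabs p20 <= Pb ->
  Rabs (m1 - m10) <= z -> Rabs (m2 - m20) <= z -> Rabs (g - g0) <= z ->
  Rabs (p1 - p10) <= z -> Rabs (p2 - p20) <= z -> Rabs (V - V0) <= z ->
  Rabs (lower r m1 m2 g V p1 p2 - lower r m10 m20 g0 V0 p10 p20) <= (3 * Cb + 3 * Pb + r) * z.
Proof.
  intros Hr H1 H2 H3 P1 P2 D1 D2 D3 E1 E2 E3. unfold lower.
  replace (m1 * p1 + m2 * p2 + g * Rabs p1 - r * V - (m10 * p10 + m20 * p20 + g0 * Rabs p10 - r * V0)) with
    ((m1 * p1 - m10 * p10) + (m2 * p2 - m20 * p20) + (g * Rabs p1 - g0 * Rabs p10) - r * (V - V0)) by ring.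
  assert (Q1 := Rabs_prod_diff _ _ _ _ _ _ _ _ H1 P1 D1 E1).
  assert (Q2 := Rabs_prod_diff _ _ _ _ _ _ _ _ H2 P2 D2 E2).
  assert (P1' : Rabs (Rabs p10) <= Pb) by now rewrite Rabs_Rabsolu.
  assert (E1' : Rabs (Rabs p1 - Rabs p10) <= z) by (eapply Rle_trans; [apply Rabs_triang_inv2|easy]).
  assert (Q3 := Rabs_prod_diff _ _ _ _ _ _ _ _ H3 P1' D3 E1').
  eapply Rle_trans; [apply Rabs_minus_le|]. rewrite (Rabs_mult r), (Rabs_pos_eq r) by easy.
  assert (r * Rabs (V - V0) <= r * z) by (apply Rmult_le_compat_l; easy).
  eapply Rle_trans; [apply Rplus_le_compat_r; eapply Rle_trans; [apply Rabs_triang|apply Rplus_le_compat_r, Rabs_triang]|]. lra.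
Qed.

Lemma lower_bound r m1 m2 g V p1 p2 Cb Pb B :
  0 <= r -> Rabs m1 <= Cb -> Rabs m2 <= Cb -> Rabs g <= Cb -> Rabs p1 <= Pb -> Rabs p2 <= Pb -> Rabs V <= B ->
  Rabs (lower r m1 m2 g V p1 p2) <= 3 * Cb * Pb + r * B.
Proof.
  intros Hr H1 H2 H3 P1 P2 HV. unfold lower.
  assert (Q1 := Rabs_prod_le _ _ _ _ H1 P1). assert (Q2 := Rabs_prod_le _ _ _ _ H2 P2).
  assert (Q3 : Rabs (g * Rabs p1) <= Cb * Pb) by (apply Rabs_prod_le; [easy|now rewrite Rabs_Rabsolu]).
  eapply Rle_trans; [apply Rabs_minus_le|]. rewrite (Rabs_mult r), (Rabs_pos_eq r) by easy.
  assert (r * Rabs V <= r * B) by (apply Rmult_le_compat_l; easy).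
  eapply Rle_trans; [apply Rplus_le_compat_r; eapply Rle_trans; [apply Rabs_triang|apply Rplus_le_compat_r, Rabs_triang]|]. lra.
Qed.

Lemma C21_hessian_entries F p1 p2 X11 X12 X22 Q C x y :
  0 <= Q -> C21 F p1 p2 X11 X12 X22 Q -> second_diff F C ->
  Rabs (X11 x y) <= C /\ Rabs (X12 x y) <= 2 * C /\ Rabs (X22 x y) <= C.
Proof.
  intros HQ HF HC.
  assert (H1 := C21_hessian_form F p1 p2 X11 X12 X22 Q C x y 1 0 HQ HF HC).
  assert (H2 := C21_hessian_form F p1 p2 X11 X12 X22 Q C x y 0 1 HQ HF HC).
  assert (H3 := C21_hessian_form F p1 p2 X11 X12 X22 Q C x y 1 1 HQ HF HC).
  replace (X11 x y * 1 ^ 2 + 2 * X12 x y * 1 * 0 + X22 x y * 0 ^ 2) with (X11 x y) in H1 by ring.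
  replace (X11 x y * 0 ^ 2 + 2 * X12 x y * 0 * 1 + X22 x y * 1 ^ 2) with (X22 x y) in H2 by ring.
  apply Rabs_le_between in H3. assert (H1' := H1). assert (H2' := H2).
  apply Rabs_le_between in H1'. apply Rabs_le_between in H2'.
  split; [lra|split; [|lra]]. apply Rabs_le. lra.
Qed.

(** Polarization: X12 is twice the form at (1/2, 1/2) minus (X11 + X22) / 2, whence 60 = 2 20 +
    20. *)
Lemma C21_hessian_entries_lip F p1 p2 X11 X12 X22 Q x y v1 v2 :
  0 <= Q -> C21 F p1 p2 X11 X12 X22 Q ->
  let n := Rabs v1 + Rabs v2 in
  Rabs (X11 (x + v1) (y + v2) - X11 x y) <= 60 * Q * n /\
  Rabs (X12 (x + v1) (y + v2) - X12 x y) <= 60 * Q * n /\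
  Rabs (X22 (x + v1) (y + v2) - X22 x y) <= 60 * Q * n.
Proof.
  intros HQ HF n.
  assert (H1 := C21_hessian_lip F p1 p2 X11 X12 X22 Q x y v1 v2 1 0 HQ HF ltac:(rewrite Rabs_R1, Rabs_R0; lra)).
  assert (H2 := C21_hessian_lip F p1 p2 X11 X12 X22 Q x y v1 v2 0 1 HQ HF ltac:(rewrite Rabs_R1, Rabs_R0; lra)).
  assert (H3 := C21_hessian_lip F p1 p2 X11 X12 X22 Q x y v1 v2 (/ 2) (/ 2) HQ HF ltac:(rewrite Rabs_pos_eq; lra)).
  fold n in H1, H2, H3.
  assert (Hn : 0 <= Q * n) by (apply Rmult_le_pos; [easy|unfold n; assert (Ha := Rabs_pos v1); assert (Hb := Rabs_pos v2); lra]).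
  apply Rabs_le_between in H1. apply Rabs_le_between in H2. apply Rabs_le_between in H3.
  repeat split; apply Rabs_le; lra.
Qed.

Lemma C21_interp F p1 p2 X11 X12 X22 G q1 q2 Y11 Y12 Y22 Q th : 0 <= th <= 1 ->
  C21 F p1 p2 X11 X12 X22 Q -> C21 G q1 q2 Y11 Y12 Y22 Q ->
  C21 (fun x y => F x y + th * (G x y - F x y)) (fun x y => p1 x y + th * (q1 x y - p1 x y))
    (fun x y => p2 x y + th * (q2 x y - p2 x y)) (fun x y => X11 x y + th * (Y11 x y - X11 x y))
    (fun x y => X12 x y + th * (Y12 x y - X12 x y)) (fun x y => X22 x y + th * (Y22 x y - X22 x y)) Q.
Proof.
  intros Hth HF HG x y e d.
  assert (H1 := HF x y e d). assert (H2 := HG x y e d).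
  match type of H1 with Rabs ?a <= ?b => set (A1 := a) in H1; set (bd := b) in * end.
  match type of H2 with Rabs ?a <= _ => set (A2 := a) in H2 end.
  match goal with |- Rabs ?g <= _ => replace g with ((1 - th) * A1 + th * A2) by (unfold A1, A2; ring) end.
  eapply Rle_trans; [apply Rabs_triang|]. rewrite !Rabs_mult, (Rabs_pos_eq (1 - th)), (Rabs_pos_eq th) by lra.
  assert ((1 - th) * Rabs A1 <= (1 - th) * bd) by (apply Rmult_le_compat_l; lra).
  assert (th * Rabs A2 <= th * bd) by (apply Rmult_le_compat_l; lra). lra.
Qed.

Lemma second_diff_interp F G C th : 0 <= th <= 1 -> second_diff F C -> second_diff G C ->
  second_diff (fun x y => F x y + th * (G x y - F x y)) C.
Proof.
  intros Hth HF HG x y e d.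
  assert (H1 := HF x y e d). assert (H2 := HG x y e d).
  match type of H1 with Rabs ?a <= ?b => set (A1 := a) in H1; set (bd := b) in * end.
  match type of H2 with Rabs ?a <= _ => set (A2 := a) in H2 end.
  match goal with |- Rabs ?g <= _ => replace g with ((1 - th) * A1 + th * A2) by (unfold A1, A2; ring) end.
  eapply Rle_trans; [apply Rabs_triang|]. rewrite !Rabs_mult, (Rabs_pos_eq (1 - th)), (Rabs_pos_eq th) by lra.
  assert ((1 - th) * Rabs A1 <= (1 - th) * bd) by (apply Rmult_le_compat_l; lra).
  assert (th * Rabs A2 <= th * bd) by (apply Rmult_le_compat_l; lra). lra.
Qed.

(** The upper paraboloid with slope q meets the lower quadratic bound of F along each coordinate
    direction at distance s. The free length s balances curvature against the error nu. *)
Lemma gradient_near_vertex F p1 p2 X11 X12 X22 Q C x y q1 q2 k nu s :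
  0 <= Q -> C21 F p1 p2 X11 X12 X22 Q -> second_diff F C -> 0 < s ->
  (forall e d, F (x + e) (y + d) <= F x y + q1 * e + q2 * d + k * (e ^ 2 + d ^ 2) + nu) ->
  Rabs (p1 x y - q1) <= (k + C / 2) * s + nu / s /\ Rabs (p2 x y - q2) <= (k + C / 2) * s + nu / s.
Proof.
  intros HQ HF HC Hs Hup.
  assert (Hq : forall e d, (p1 x y - q1) * e + (p2 x y - q2) * d <= (k + C / 2) * (e ^ 2 + d ^ 2) + nu).
  { intros e d. assert (H1 := Hup e d).
    assert (H2 := C21_quadratic_bound F p1 p2 X11 X12 X22 Q C x y e d HQ HF HC).
    apply Rabs_le_between in H2. lra. }
  assert (Hdiv : forall z, z * s <= (k + C / 2) * s ^ 2 + nu -> z <= (k + C / 2) * s + nu / s).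
  { intros z Hz. apply Rmult_le_reg_r with s; [easy|].
    replace (((k + C / 2) * s + nu / s) * s) with ((k + C / 2) * s ^ 2 + nu) by (field; lra). easy. }
  split; apply Rabs_le; split.
  - assert (H := Hq (- s) 0). assert (- (p1 x y - q1) <= (k + C / 2) * s + nu / s) by (apply Hdiv; lra). lra.
  - assert (H := Hq s 0). apply Hdiv. lra.
  - assert (H := Hq 0 (- s)). assert (- (p2 x y - q2) <= (k + C / 2) * s + nu / s) by (apply Hdiv; lra). lra.
  - assert (H := Hq 0 s). apply Hdiv. lra.
Qed.

(** A common end point at distance R0 is expanded from both base points. The three quadratic errors
    add up to 9/2 C R0^2, rounded up to 5. *)
Lemma gradient_lip F p1 p2 X11 X12 X22 Q C x y v1 v2 R0 :
  0 <= Q -> C21 F p1 p2 X11 X12 X22 Q -> second_diff F C -> 0 < R0 -> Rabs v1 <= R0 -> Rabs v2 <= R0 ->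
  Rabs (p1 (x + v1) (y + v2) - p1 x y) <= 5 * C * R0 /\ Rabs (p2 (x + v1) (y + v2) - p2 x y) <= 5 * C * R0.
Proof.
  intros HQ HF HC HR0 Hv1 Hv2.
  assert (HCp : 0 <= C).
  { assert (H := HC 0 0 1 0). assert (H' := Rabs_pos (F (0 + 1) (0 + 0) + F (0 - 1) (0 - 0) - 2 * F 0 0)). lra. }
  assert (V1 : v1 ^ 2 <= R0 ^ 2) by (rewrite <- (pow2_abs v1); apply pow_incr; split; [apply Rabs_pos|easy]).
  assert (V2 : v2 ^ 2 <= R0 ^ 2) by (rewrite <- (pow2_abs v2); apply pow_incr; split; [apply Rabs_pos|easy]).
  assert (Hq : forall e d, e ^ 2 + d ^ 2 = R0 ^ 2 ->
     (p1 (x + v1) (y + v2) - p1 x y) * e + (p2 (x + v1) (y + v2) - p2 x y) * d <= 5 * C * R0 ^ 2).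
  { intros e d Hed.
    assert (H1 := C21_quadratic_bound F p1 p2 X11 X12 X22 Q C (x + v1) (y + v2) e d HQ HF HC).
    assert (H2 := C21_quadratic_bound F p1 p2 X11 X12 X22 Q C x y (v1 + e) (v2 + d) HQ HF HC).
    assert (H3 := C21_quadratic_bound F p1 p2 X11 X12 X22 Q C x y v1 v2 HQ HF HC).
    rewrite <- !Rplus_assoc in H2.
    apply Rabs_le_between in H1. apply Rabs_le_between in H2. apply Rabs_le_between in H3.
    assert (A1 : (v1 + e) ^ 2 + (v2 + d) ^ 2 <= 6 * R0 ^ 2).
    { assert (P1 := pow2_ge_0 (v1 - e)). assert (P2 := pow2_ge_0 (v2 - d)). lra. }
    assert (A2 : C * (v1 ^ 2 + v2 ^ 2) <= C * (2 * R0 ^ 2)) by (apply Rmult_le_compat_l; lra).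
    assert (A3 : C * ((v1 + e) ^ 2 + (v2 + d) ^ 2) <= C * (6 * R0 ^ 2)) by (apply Rmult_le_compat_l; lra).
    rewrite Hed in H1. assert (0 <= C * R0 ^ 2) by (apply Rmult_le_pos; [easy|apply pow2_ge_0]). lra. }
  assert (Hdiv : forall z, z * R0 <= 5 * C * R0 ^ 2 -> z <= 5 * C * R0).
  { intros z Hz. apply Rmult_le_reg_r with R0; [easy|]. lra. }
  split; apply Rabs_le; split.
  - assert (H := Hq (- R0) 0 ltac:(ring)). assert (- (p1 (x + v1) (y + v2) - p1 x y) <= 5 * C * R0) by (apply Hdiv; lra). lra.
  - assert (H := Hq R0 0 ltac:(ring)). apply Hdiv. lra.
  - assert (H := Hq 0 (- R0) ltac:(ring)). assert (- (p2 (x + v1) (y + v2) - p2 x y) <= 5 * C * R0) by (apply Hdiv; lra). lra.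
  - assert (H := Hq 0 R0 ltac:(ring)). apply Hdiv. lra.
Qed.

Lemma walk_bound u1 u2 v1 v2 F b : (forall x y, Rabs (F x y) <= b) -> forall x y, Rabs (walk u1 u2 v1 v2 F x y) <= b.
Proof. intros H x y. apply Rabs4; apply H. Qed.

Lemma walks_bound u1 u2 v1 v2 k F b : (forall x y, Rabs (F x y) <= b) -> forall x y, Rabs (walks u1 u2 v1 v2 k F x y) <= b.
Proof. intros H. induction k as [|k IH]; [easy|]. simpl. apply walk_bound. exact IH. Qed.

Lemma walk_close u1 u2 v1 v2 F b x y n :
  (forall d e, Rabs d + Rabs e <= n -> Rabs (F (x + d) (y + e) - F x y) <= b) ->
  Rabs u1 + Rabs u2 + Rabs v1 + Rabs v2 <= n -> Rabs (walk u1 u2 v1 v2 F x y - F x y) <= b.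
Proof.
  intros H Hn.
  assert (A1 := Rabs_pos u1). assert (A2 := Rabs_pos u2). assert (A3 := Rabs_pos v1). assert (A4 := Rabs_pos v2).
  assert (H1 := H u1 u2 ltac:(lra)). assert (H2 := H (- u1) (- u2) ltac:(rewrite !Rabs_Ropp; lra)).
  assert (H3 := H v1 v2 ltac:(lra)). assert (H4 := H (- v1) (- v2) ltac:(rewrite !Rabs_Ropp; lra)).
  assert (H5 := Rabs4 _ _ _ _ _ H1 H2 H3 H4).
  eapply Rle_trans; [|exact H5]. right. f_equal. unfold walk, Rminus. field.
Qed.

(** * Evolution along a frozen random walk *)

Lemma ucT_slice T V t : 0 <= t <= T -> ucT T V -> unif_cont2 (fun x y => V x y t).
Proof.
  intros Ht H e He. destruct (H e He) as [d [Hd Hd']]. exists d. split; [easy|].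
  intros. apply Hd'; try easy. rewrite Rminus_diag, Rabs_R0. easy.
Qed.

Lemma Rabs_le_upper u b : Rabs u <= b -> u <= b.
Proof. intros H. apply Rabs_le_between in H. lra. Qed.

Lemma Rabs_le_lower u b : Rabs u <= b -> - b <= u.
Proof. intros H. apply Rabs_le_between in H. lra. Qed.

Lemma sconv_uc T V al B : 0 < al -> (forall x y t, 0 <= t <= T -> Rabs (V x y t) <= B) -> ucT T V ->
  forall e, 0 < e -> exists d, 0 < d /\ forall x y t x' y' t', 0 <= t <= T -> 0 <= t' <= T ->
    Rabs (x' - x) < d -> Rabs (y' - y) < d -> Rabs (t' - t) < d ->
    Rabs (sconv al (fun x y => V x y t') x' y' - sconv al (fun x y => V x y t) x y) <= e.
Proof.
  intros Hal HB H e He. destruct (H e He) as [d [Hd Hd']]. exists d. split; [easy|].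
  assert (Hone : forall x y t x' y' t', 0 <= t <= T -> 0 <= t' <= T ->
    Rabs (x' - x) < d -> Rabs (y' - y) < d -> Rabs (t' - t) < d ->
    sconv al (fun x y => V x y t') x' y' <= sconv al (fun x y => V x y t) x y + e).
  { intros x y t x' y' t' Ht Ht' Hx Hy Htt.
    replace x' with (x + (x' - x)) by ring. replace y' with (y + (y' - y)) by ring.
    apply (sconv_cmp al B Hal (fun x y => V x y t') (fun x y => V x y t)).
    - intros u v. now apply Rabs_le_upper, HB.
    - intros u v. assert (H1 := Hd' u v t (u + (x' - x)) (v + (y' - y)) t' Ht Ht').
      replace (u + (x' - x) - u) with (x' - x) in H1 by ring.
      replace (v + (y' - y) - v) with (y' - y) in H1 by ring.
      specialize (H1 Hx Hy Htt). apply Rabs_def2 in H1. lra. }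
  intros x y t x' y' t' Ht Ht' Hx Hy Htt.
  assert (H1 := Hone x y t x' y' t' Ht Ht' Hx Hy Htt).
  assert (H2 := Hone x' y' t' x y t Ht' Ht).
  rewrite (Rabs_minus_sym x x'), (Rabs_minus_sym y y'), (Rabs_minus_sym t t') in H2.
  specialize (H2 Hx Hy Htt). apply Rabs_le. lra.
Qed.

Lemma C21_local_lip F p1 p2 X11 X12 X22 Q x y : 0 <= Q -> C21 F p1 p2 X11 X12 X22 Q ->
  exists l, 0 < l /\ forall e d, Rabs e <= 1 -> Rabs d <= 1 ->
    Rabs (F (x + e) (y + d) - F x y) <= l * (Rabs e + Rabs d).
Proof.
  intros HQ HF.
  set (l := Rabs (p1 x y) + Rabs (p2 x y) + Rabs (X11 x y) + Rabs (X12 x y) + Rabs (X22 x y) + 4 * Q + 1).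
  assert (A1 := Rabs_pos (p1 x y)). assert (A2 := Rabs_pos (p2 x y)). assert (A3 := Rabs_pos (X11 x y)).
  assert (A4 := Rabs_pos (X12 x y)). assert (A5 := Rabs_pos (X22 x y)).
  exists l. split; [unfold l; lra|]. intros e d He Hd. assert (H := HF x y e d).
  assert (He0 := Rabs_pos e). assert (Hd0 := Rabs_pos d).
  set (n := Rabs e + Rabs d) in *.
  assert (Hn : 0 <= n <= 2) by (unfold n; lra).
  assert (Hn3 : n ^ 3 <= 4 * n) by (replace (n ^ 3) with (n * n * n) by ring; nra).
  assert (B0 : Q * n ^ 3 <= 4 * Q * n).
  { apply Rle_trans with (Q * (4 * n)); [apply Rmult_le_compat_l; lra|lra]. }
  assert (B1 := Rabs_prod_le _ _ _ _ (Rle_refl (Rabs (p1 x y))) (Rle_refl (Rabs e))).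
  assert (B2 := Rabs_prod_le _ _ _ _ (Rle_refl (Rabs (p2 x y))) (Rle_refl (Rabs d))).
  assert (Hee : Rabs (e ^ 2) <= n) by (rewrite <- RPow_abs; unfold n; nra).
  assert (Hdd : Rabs (d ^ 2) <= n) by (rewrite <- RPow_abs; unfold n; nra).
  assert (Hed : Rabs (e * d) <= n) by (rewrite Rabs_mult; unfold n; nra).
  assert (B3 := Rabs_prod_le _ _ _ _ (Rle_refl (Rabs (X11 x y))) Hee).
  assert (B4 := Rabs_prod_le _ _ _ _ (Rle_refl (Rabs (X12 x y))) Hed).
  assert (B5 := Rabs_prod_le _ _ _ _ (Rle_refl (Rabs (X22 x y))) Hdd).
  assert (N1 : Rabs (p1 x y) * Rabs e <= Rabs (p1 x y) * n) by (apply Rmult_le_compat_l; unfold n; lra).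
  assert (N2 : Rabs (p2 x y) * Rabs d <= Rabs (p2 x y) * n) by (apply Rmult_le_compat_l; unfold n; lra).
  assert (N3 : 0 <= Rabs (X11 x y) * n) by (apply Rmult_le_pos; lra).
  assert (N5 : 0 <= Rabs (X22 x y) * n) by (apply Rmult_le_pos; lra).
  apply Rabs_le_between in H. apply Rabs_le_between in B1. apply Rabs_le_between in B2.
  apply Rabs_le_between in B3. apply Rabs_le_between in B4. apply Rabs_le_between in B5.
  apply Rabs_le. unfold l. lra.
Qed.

Lemma C21_cont2 F p1 p2 X11 X12 X22 Q : 0 <= Q -> C21 F p1 p2 X11 X12 X22 Q -> cont2 F.
Proof.
  intros HQ HF x y e He. destruct (C21_local_lip F p1 p2 X11 X12 X22 Q x y HQ HF) as [l [Hl Hl']].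
  exists (Rmin 1 (e / (2 * l))). split; [apply Rmin_glb_lt; [lra|apply Rdiv_lt_0_compat; lra]|].
  intros x' y' Hx Hy.
  assert (X1 := Rlt_le_trans _ _ _ Hx (Rmin_l _ _)). assert (X2 := Rlt_le_trans _ _ _ Hx (Rmin_r _ _)).
  assert (Y1 := Rlt_le_trans _ _ _ Hy (Rmin_l _ _)). assert (Y2 := Rlt_le_trans _ _ _ Hy (Rmin_r _ _)).
  assert (H := Hl' (x' - x) (y' - y) ltac:(lra) ltac:(lra)).
  replace (x + (x' - x)) with x' in H by ring. replace (y + (y' - y)) with y' in H by ring.
  eapply Rle_lt_trans; [exact H|].
  apply Rlt_le_trans with (l * (e / (2 * l) + e / (2 * l))); [apply Rmult_lt_compat_l; lra|right; field; lra].
Qed.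

Lemma C21_add_quad F p1 p2 X11 X12 X22 Q K x0 y0 : C21 F p1 p2 X11 X12 X22 Q ->
  C21 (fun x y => F x y + K * ((x - x0) ^ 2 + (y - y0) ^ 2)) (fun x y => p1 x y + 2 * K * (x - x0))
    (fun x y => p2 x y + 2 * K * (y - y0)) (fun x y => X11 x y + 2 * K) X12 (fun x y => X22 x y + 2 * K) Q.
Proof.
  intros HF x y e d. assert (H := HF x y e d). eapply Rle_trans; [|exact H]. right. f_equal. field.
Qed.

(** * One interval of time with frozen coefficients *)

Section Step.
Variables (T r rho : R) (c : coef) (Cb Cl L B be : R) (V : R -> R -> R -> R).
Hypothesis Hr : 0 <= r.
Hypothesis Hrho : -1 <= rho <= 1.
Hypothesis HCb : 0 <= Cb.
Hypothesis Hbe : 0 < be.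
Hypothesis Hok : coef_ok T c Cb Cl.
Hypothesis HB : forall x y t, 0 <= t <= T -> Rabs (V x y t) <= B.
Hypothesis HucV : ucT T V.
Hypothesis Hsub : jsub T r rho c (fun v => - L < v) V.

Definition env (x y t : R) : R := sconv (2 * be) (fun x y => V x y t) x y.

Variables (x0 y0 p01 p02 t0 : R).
(** By [sconv_touch], jets of [env] at (x0, y0) with gradient (p01, p02) are jets of V at this base
    point; hence the coefficients are frozen here and not at (x0, y0). *)
Definition base_x : R := x0 + p01 / (4 * be).
Definition base_y : R := y0 + p02 / (4 * be).
Definition base_sg : R := sg c base_x t0.
Definition base_bb : R := bb c base_y t0.
Definition base_lower : R :=
  lower r (m1 c base_x base_y t0) (m2 c base_y t0) (gm c base_x t0) (V base_x base_y t0) p01 p02.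
Hypothesis Ht0 : 0 <= t0 <= T.

Variables (Pb K R0 z zg kap rr send : R) (E : R -> Prop).
(** The growth per unit of backward time allowed besides the diffusion of the walk; kap is the slack
    that absorbs all errors at the times of E. *)
Definition rate : R := base_lower + kap.
Hypothesis Hp01 : Rabs p01 <= Pb.
Hypothesis Hp02 : Rabs p02 <= Pb.
Hypothesis Hkap : 0 < kap.
Hypothesis HK : 0 < K.
Hypothesis HKz : K <= z.
Hypothesis Hz1 : z <= 1.
Hypothesis HR0 : 0 < R0.
Hypothesis Hzg : zg <= z.
Hypothesis Hrr : R0 + zg / (4 * be) <= rr.
Hypothesis HKR : 2 * K * R0 <= zg / 2.
(** Collects the factors of z from [lower_diff], from [second_diff_coef] and from the Hessian 2 K of
    the localizing penalty. *)
Definition modulus_const : R := 3 * Cb + 3 * Pb + r + 6 * Cb * (4 * be + 2) + 2 * Cb ^ 2.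
Hypothesis HC3 : modulus_const * z <= kap / 2.
Definition time_const : R := 3 * Cb ^ 2 * (4 * be + 2) + (3 * Cb * (Pb + 1) + r * B) + (3 * Cb * Pb + r * B) + 4 * be * Cb ^ 2.

(** The excess over the model solution G + rate (send - t); the term with K keeps positive maxima
    near (x0, y0). *)
Definition gap (G : R -> R -> R) (t x y : R) : R :=
  env x y t - G x y - rate * (send - t) - K * ((x - x0) ^ 2 + (y - y0) ^ 2).
(** The positive part is taken because a maximizer is localized only where the gap is positive. *)
Definition max_gap (G : R -> R -> R) (t : R) : R := Rmax 0 (Sup (fun w : R * R => gap G t (fst w) (snd w))).

Lemma Uh_bound x y t : 0 <= t <= T -> env x y t <= B.
Proof. intros Ht. apply sconv_bound; [lra|]. intros u v. now apply Rabs_le_upper, HB. Qed.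

Section OneStep.
Variables (G p1 p2 X11 X12 X22 : R -> R -> R) (Q BG tau h1 u1 u2 v1 v2 : R).
Hypothesis HQ : 0 <= Q.
Hypothesis HG : C21 G p1 p2 X11 X12 X22 Q.
Hypothesis HGsd : second_diff G (4 * be).
Hypothesis HGb : forall x y, Rabs (G x y) <= BG.
Hypothesis Hh1 : 0 < h1.
Hypothesis Htau0 : 0 <= tau - h1.
Hypothesis HtauT : tau <= T.
Hypothesis HW11 : u1 ^ 2 + v1 ^ 2 = 2 * h1 * base_sg ^ 2.
Hypothesis HW12 : u1 * u2 + v1 * v2 = 2 * h1 * (rho * base_sg * base_bb).
Hypothesis HW22 : u2 ^ 2 + v2 ^ 2 = 2 * h1 * base_bb ^ 2.
Let n : R := Rabs u1 + Rabs u2 + Rabs v1 + Rabs v2.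
Hypothesis HWQ : Q * n ^ 3 <= h1 * (kap / 8).
Hypothesis HWn : 180 * Cb ^ 2 * Q * n <= kap / 8.
Let G' : R -> R -> R := walk u1 u2 v1 v2 G.
Let p1' : R -> R -> R := walk u1 u2 v1 v2 p1.
Let p2' : R -> R -> R := walk u1 u2 v1 v2 p2.
Hypothesis Hgr : forall th x y, 0 <= th <= 1 -> Rabs (x - x0) <= R0 -> Rabs (y - y0) <= R0 ->
  Rabs (p1 x y + th * (p1' x y - p1 x y) - p01) <= zg / 2 /\
  Rabs (p2 x y + th * (p2' x y - p2 x y) - p02) <= zg / 2.
Hypothesis Hloc : forall th t x y, 0 <= th <= 1 -> tau - h1 < t < tau ->
  env x y t - (G x y + th * (G' x y - G x y)) - rate * (send - t) <= K * R0 ^ 2.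
Hypothesis Hnear : forall t x y, tau - h1 < t < tau -> Rabs (x - base_x) <= rr -> Rabs (y - base_y) <= rr ->
  Rabs (V x y t - V base_x base_y t0) <= z /\ - L < V x y t.
Hypothesis Hcoef : forall t x y, tau - h1 < t < tau -> E t -> Rabs (x - base_x) <= rr -> Rabs (y - base_y) <= rr ->
  Rabs (sg c x t - base_sg) <= z /\ Rabs (bb c y t - base_bb) <= z /\
  Rabs (m1 c x y t - m1 c base_x base_y t0) <= z /\ Rabs (m2 c y t - m2 c base_y t0) <= z /\
  Rabs (gm c x t - gm c base_x t0) <= z.

Let Ht (t x y : R) : R := G x y + (tau - t) / h1 * (G' x y - G x y).

(** The prescribed covariance of the step vectors turns the quadratic part of [walk_increment] into
    h1 times [second]. *)
Lemma frozen_generator x y :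
  Rabs ((G' x y - G x y) / h1 - second rho base_sg base_bb (X11 x y) (X12 x y) (X22 x y)) <= kap / 8.
Proof.
  assert (H := walk_increment u1 u2 v1 v2 G p1 p2 X11 X12 X22 Q x y HQ HG). fold G' in H.
  apply Rmult_le_reg_l with h1; [easy|].
  rewrite <- (Rabs_pos_eq h1) at 1 by lra. rewrite <- Rabs_mult.
  eapply Rle_trans; [|exact HWQ]. eapply Rle_trans; [|exact H]. right. f_equal.
  replace (/ 4 * (X11 x y * u1 ^ 2 + 2 * X12 x y * u1 * u2 + X22 x y * u2 ^ 2
      + (X11 x y * v1 ^ 2 + 2 * X12 x y * v1 * v2 + X22 x y * v2 ^ 2))) with
    (/ 4 * (X11 x y * (u1 ^ 2 + v1 ^ 2) + 2 * X12 x y * (u1 * u2 + v1 * v2) + X22 x y * (u2 ^ 2 + v2 ^ 2))) by ring.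
  rewrite HW11, HW12, HW22. unfold second. field. lra.
Qed.

Lemma Cb_s0 : Rabs base_sg <= Cb /\ Rabs base_bb <= Cb.
Proof. destruct (Hok t0 Ht0 base_x base_y base_x base_y) as [[H1 [H2 _]] _]. easy. Qed.

Lemma walk_hessian_close x y :
  Rabs (walk u1 u2 v1 v2 X11 x y - X11 x y) <= 60 * Q * n /\
  Rabs (walk u1 u2 v1 v2 X12 x y - X12 x y) <= 60 * Q * n /\
  Rabs (walk u1 u2 v1 v2 X22 x y - X22 x y) <= 60 * Q * n.
Proof.
  assert (Hc : forall d e, Rabs d + Rabs e <= n -> 60 * Q * (Rabs d + Rabs e) <= 60 * Q * n).
  { intros d e Hde. apply Rmult_le_compat_l; lra. }
  repeat split; apply walk_close with n; try apply Rle_refl; intros d e Hde;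
    (eapply Rle_trans; [|apply (Hc d e Hde)]);
    apply (C21_hessian_entries_lip G p1 p2 X11 X12 X22 Q x y d e HQ HG).
Qed.

Lemma theta_range t : tau - h1 <= t <= tau -> 0 <= (tau - t) / h1 <= 1.
Proof.
  intros Htt. split; [apply Rdiv_le_0_compat; lra|].
  apply Rmult_le_reg_r with h1; [easy|]. unfold Rdiv. rewrite Rmult_assoc, Rinv_l; lra.
Qed.

Lemma Psi_upper t x y : tau - h1 <= t <= tau ->
  gap (Ht t) t x y <= B + BG + Rabs rate * Rabs (send - t) - K * ((x - x0) ^ 2 + (y - y0) ^ 2).
Proof.
  intros Htt. unfold gap, Ht. assert (HU := Uh_bound x y t ltac:(lra)).
  assert (HG1 := HGb x y). assert (HG2 := walk_bound u1 u2 v1 v2 G BG HGb x y). fold G' in HG2.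
  apply Rabs_le_lower in HG1. apply Rabs_le_lower in HG2.
  assert (Hth := theta_range t Htt). set (th := (tau - t) / h1) in *.
  assert (A1 : - BG <= G x y + th * (G' x y - G x y)).
  { replace (G x y + th * (G' x y - G x y)) with ((1 - th) * G x y + th * G' x y) by ring.
    assert ((1 - th) * - BG <= (1 - th) * G x y) by (apply Rmult_le_compat_l; lra).
    assert (th * - BG <= th * G' x y) by (apply Rmult_le_compat_l; lra). lra. }
  assert (A2 := Rle_abs (- (rate * (send - t)))). rewrite Rabs_Ropp, Rabs_mult in A2. lra.
Qed.

Lemma Psi_bounded t x y : tau - h1 <= t <= tau -> gap (Ht t) t x y <= B + BG + Rabs rate * Rabs (send - t).
Proof.
  intros Htt. assert (H := Psi_upper t x y Htt). assert (H' := sq_sum_pos K HK (x - x0) (y - y0)). lra.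
Qed.

Lemma Psi_le_Phi t x y : tau - h1 <= t <= tau -> gap (Ht t) t x y <= max_gap (Ht t) t.
Proof.
  intros Htt. eapply Rle_trans; [|apply Rmax_r].
  apply (Sup_ub (fun w : R * R => gap (Ht t) t (fst w) (snd w)) (B + BG + Rabs rate * Rabs (send - t)) (x, y)).
  intros w. now apply Psi_bounded.
Qed.

Lemma Phi_cont : cont_on (tau - h1) tau (fun t => max_gap (Ht t) t).
Proof.
  intros t Htt e He.
  destruct (sconv_uc T V (2 * be) B ltac:(lra) HB HucV (e / 4) ltac:(lra)) as [d [Hd Hd']].
  set (k := 2 * BG / h1 + Rabs rate + 1).
  assert (HBG : 0 <= BG) by (eapply Rle_trans; [apply Rabs_pos|apply (HGb 0 0)]).
  assert (Hk : 0 < k).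
  { unfold k. assert (H := Rabs_pos rate). assert (0 <= 2 * BG / h1) by (apply Rdiv_le_0_compat; lra). lra. }
  exists (Rmin d (e / (4 * k))). split; [apply Rmin_glb_lt; [easy|apply Rdiv_lt_0_compat; lra]|].
  intros s Hs Hst.
  assert (S1 := Rlt_le_trans _ _ _ Hst (Rmin_l _ _)). assert (S2 := Rlt_le_trans _ _ _ Hst (Rmin_r _ _)).
  assert (Hks : k * Rabs (s - t) <= e / 4).
  { apply Rle_trans with (k * (e / (4 * k))); [apply Rmult_le_compat_l; lra|right; field; lra]. }
  assert (Hdiff : forall x y, Rabs (gap (Ht s) s x y - gap (Ht t) t x y) <= e / 2).
  { intros x y. assert (HU := Hd' x y t x y s ltac:(lra) ltac:(lra)).
    rewrite !Rminus_diag, Rabs_R0 in HU. specialize (HU Hd Hd S1). fold (env x y s) in HU. fold (env x y t) in HU.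
    unfold gap, Ht.
    replace (env x y s - (G x y + (tau - s) / h1 * (G' x y - G x y)) - rate * (send - s)
        - K * ((x - x0) ^ 2 + (y - y0) ^ 2) - (env x y t - (G x y + (tau - t) / h1 * (G' x y - G x y))
        - rate * (send - t) - K * ((x - x0) ^ 2 + (y - y0) ^ 2))) with
      ((env x y s - env x y t) + ((G' x y - G x y) / h1 + rate) * (s - t)) by (field; lra).
    eapply Rle_trans; [apply Rabs_triang|].
    assert (HD : Rabs ((G' x y - G x y) / h1 + rate) <= k).
    { eapply Rle_trans; [apply Rabs_triang|]. unfold k, Rdiv. rewrite Rabs_mult, (Rabs_pos_eq (/ h1)).
      2: { left. now apply Rinv_0_lt_compat. }
      assert (HGG : Rabs (G' x y - G x y) <= 2 * BG).
      { eapply Rle_trans; [apply Rabs_minus_le|]. assert (A1 := HGb x y).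
        assert (A2 := walk_bound u1 u2 v1 v2 G BG HGb x y). fold G' in A2. lra. }
      assert (Hi := Rinv_0_lt_compat h1 Hh1).
      apply Rmult_le_compat_r with (r := / h1) in HGG; lra. }
    rewrite Rabs_mult.
    assert (Rabs ((G' x y - G x y) / h1 + rate) * Rabs (s - t) <= k * Rabs (s - t))
      by (apply Rmult_le_compat_r; [apply Rabs_pos|easy]). lra. }
  assert (Hsup : forall t1 t2, tau - h1 <= t1 <= tau -> tau - h1 <= t2 <= tau ->
     (forall x y, gap (Ht t1) t1 x y <= gap (Ht t2) t2 x y + e / 2) -> max_gap (Ht t1) t1 <= max_gap (Ht t2) t2 + e / 2).
  { intros t1 t2 H1 H2 Hle. unfold max_gap at 1. apply Rmax_lub.
    - assert (H := Rmax_l 0 (Sup (fun w : R * R => gap (Ht t2) t2 (fst w) (snd w)))). fold (max_gap (Ht t2) t2) in H. lra.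
    - apply (Sup_le _ _ (0, 0)). intros w. assert (H := Hle (fst w) (snd w)).
      assert (H' := Psi_le_Phi t2 (fst w) (snd w) H2). lra. }
  assert (A1 := Hsup s t Hs Htt ltac:(intros x y; assert (H := Hdiff x y); apply Rabs_le_upper in H; lra)).
  assert (A2 := Hsup t s Htt Hs ltac:(intros x y; assert (H := Hdiff x y); apply Rabs_le_lower in H; lra)).
  apply Rabs_def1; lra.
Qed.

Lemma Psi_attained t : tau - h1 <= t <= tau -> exists x y, forall x' y', gap (Ht t) t x' y' <= gap (Ht t) t x y.
Proof.
  intros Htt.
  set (M := Rabs (B + BG + Rabs rate * Rabs (send - t) - gap (Ht t) t x0 y0) / K + 1).
  assert (HM : 1 <= M).
  { unfold M. assert (0 <= Rabs (B + BG + Rabs rate * Rabs (send - t) - gap (Ht t) t x0 y0) / K)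
      by (apply Rdiv_le_0_compat; [apply Rabs_pos|easy]). lra. }
  apply (cont2_max (gap (Ht t) t) (M + Rabs x0 + Rabs y0) x0 y0).
  - assert (HF := C21_add_quad _ _ _ _ _ _ _ K x0 y0 (C21_interp _ _ _ _ _ _ _ _ _ _ _ _ _ _
      (theta_range t Htt) HG (walk_C21 u1 u2 v1 v2 _ _ _ _ _ _ _ HG))).
    apply C21_cont2 in HF; [|easy].
    intros x y e He. destruct (HF x y (e / 2) ltac:(lra)) as [d1 [Hd1 H1]].
    destruct (sconv_uc T V (2 * be) B ltac:(lra) HB HucV (e / 4) ltac:(lra)) as [d2 [Hd2 H2]].
    exists (Rmin d1 d2). split; [now apply Rmin_glb_lt|]. intros x' y' Hx Hy.
    assert (A1 := H1 x' y' (Rlt_le_trans _ _ _ Hx (Rmin_l _ _)) (Rlt_le_trans _ _ _ Hy (Rmin_l _ _))).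
    assert (A2 := H2 x y t x' y' t ltac:(lra) ltac:(lra) (Rlt_le_trans _ _ _ Hx (Rmin_r _ _))
      (Rlt_le_trans _ _ _ Hy (Rmin_r _ _)) ltac:(rewrite Rminus_diag, Rabs_R0; lra)).
    fold (env x' y' t) (env x y t) in A2. apply Rabs_le_between in A2. apply Rabs_def2 in A1.
    unfold gap, Ht. fold G' in A1. apply Rabs_def1; lra.
  - intros x y Hxy. assert (H := Psi_upper t x y Htt).
    assert (Hfar : forall d, M < Rabs d -> M <= d ^ 2).
    { intros d Hd. rewrite <- (pow2_abs d). simpl. rewrite Rmult_1_r. nra. }
    assert (Hsq : M <= (x - x0) ^ 2 + (y - y0) ^ 2).
    { assert (P1 := pow2_ge_0 (x - x0)). assert (P2 := pow2_ge_0 (y - y0)).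
      assert (Q1 := Rabs_pos x0). assert (Q2 := Rabs_pos y0).
      destruct Hxy as [Hx|Hy].
      - assert (Tx := Rabs_triang (x - x0) x0). replace (x - x0 + x0) with x in Tx by ring.
        assert (H' := Hfar (x - x0) ltac:(lra)). lra.
      - assert (Ty := Rabs_triang (y - y0) y0). replace (y - y0 + y0) with y in Ty by ring.
        assert (H' := Hfar (y - y0) ltac:(lra)). lra. }
    apply Rmult_le_compat_l with (r := K) in Hsq; [|lra].
    assert (HKM : Rabs (B + BG + Rabs rate * Rabs (send - t) - gap (Ht t) t x0 y0) <= K * M).
    { unfold M. rewrite Rmult_plus_distr_l, Rmult_1_r.
      replace (K * (Rabs (B + BG + Rabs rate * Rabs (send - t) - gap (Ht t) t x0 y0) / K)) with
        (Rabs (B + BG + Rabs rate * Rabs (send - t) - gap (Ht t) t x0 y0)) by (field; lra). lra. }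
    apply Rabs_le_upper in HKM. lra.
Qed.

(** Near (x, y, t) the envelope is at most [max_gap] plus the model plus the penalty, with equality
    at the point. The slope q and the Taylor coefficients of the interpolation thus form a superjet
    of [env]. *)
Lemma Phi_touch t q x y : tau - h1 < t < tau -> touch_above (fun t => max_gap (Ht t) t) t q ->
  (forall x' y', gap (Ht t) t x' y' <= gap (Ht t) t x y) -> 0 < gap (Ht t) t x y ->
  let th := (tau - t) / h1 in
  touch T env x y t (q - (G' x y - G x y) / h1 - rate)
    (p1 x y + th * (p1' x y - p1 x y) + 2 * K * (x - x0))
    (p2 x y + th * (p2' x y - p2 x y) + 2 * K * (y - y0))
    (X11 x y + th * (walk u1 u2 v1 v2 X11 x y - X11 x y) + 2 * K)
    (X12 x y + th * (walk u1 u2 v1 v2 X12 x y - X12 x y))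
    (X22 x y + th * (walk u1 u2 v1 v2 X22 x y - X22 x y) + 2 * K).
Proof.
  intros Htt Hq Hmax Hpos th k Hk.
  assert (HPhi : max_gap (Ht t) t = gap (Ht t) t x y).
  { unfold max_gap. rewrite (Sup_eq_max (fun w : R * R => gap (Ht t) t (fst w) (snd w)) (x, y)).
    - apply Rmax_right. simpl. lra.
    - intros w. apply Hmax. }
  set (F := fun x y => G x y + th * (G' x y - G x y) + K * ((x - x0) ^ 2 + (y - y0) ^ 2)).
  assert (HF := C21_add_quad _ _ _ _ _ _ _ K x0 y0 (C21_interp _ _ _ _ _ _ _ _ _ _ _ _ _ _
    (theta_range t ltac:(lra)) HG (walk_C21 u1 u2 v1 v2 _ _ _ _ _ _ _ HG))).
  fold th G' p1' p2' in HF. cbv beta in HF.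
  destruct (C21_local_lip G p1 p2 X11 X12 X22 Q x y HQ HG) as [la [Hla Hla']].
  destruct (C21_local_lip G' _ _ _ _ _ Q x y HQ (walk_C21 u1 u2 v1 v2 _ _ _ _ _ _ _ HG)) as [lb [Hlb Hlb']].
  set (lc := (la + lb) / h1). assert (Hlc : 0 < lc) by (apply Rdiv_lt_0_compat; lra).
  set (W := fun s => max_gap (Ht (t + s)) (t + s) - max_gap (Ht t) t - q * s).
  assert (HW : small_o W).
  { intros e He. destruct (Hq e He) as [d [Hd Hd']]. exists d. split; [easy|]. intros s Hs.
    assert (H := Hd' (t + s)). replace (t + s - t) with s in H by ring. specialize (H Hs). unfold W. lra. }
  set (cw := 4 * lc ^ 2 / k).
  set (d1 := Rmin (t - (tau - h1)) (tau - t)).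
  set (d2 := k / (8 * (Q + 1))).
  assert (Hd2 : 0 < d2) by (apply Rdiv_lt_0_compat; lra).
  exists (fun s => W s + cw * s ^ 2), (Rmin d1 (Rmin 1 d2)). split; [|split].
  - apply small_o_plus; [easy|apply small_o_square].
  - unfold d1. repeat apply Rmin_glb_lt; lra.
  - intros x' y' t' Ht' Hx Hy Htd.
    assert (X1 := Rlt_le_trans _ _ _ (Rlt_le_trans _ _ _ Hx (Rmin_r _ _)) (Rmin_l _ _)).
    assert (X2 := Rlt_le_trans _ _ _ (Rlt_le_trans _ _ _ Hx (Rmin_r _ _)) (Rmin_r _ _)).
    assert (Y1 := Rlt_le_trans _ _ _ (Rlt_le_trans _ _ _ Hy (Rmin_r _ _)) (Rmin_l _ _)).
    assert (Y2 := Rlt_le_trans _ _ _ (Rlt_le_trans _ _ _ Hy (Rmin_r _ _)) (Rmin_r _ _)).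
    assert (Z1 := Rlt_le_trans _ _ _ (Rlt_le_trans _ _ _ Htd (Rmin_l _ _)) (Rmin_l _ _)).
    assert (Z2 := Rlt_le_trans _ _ _ (Rlt_le_trans _ _ _ Htd (Rmin_l _ _)) (Rmin_r _ _)).
    apply Rabs_def2 in Z1. apply Rabs_def2 in Z2.
    assert (HP := Psi_le_Phi t' x' y' ltac:(lra)).
    assert (HPW : max_gap (Ht t') t' = gap (Ht t) t x y + q * (t' - t) + W (t' - t)).
    { unfold W. replace (t + (t' - t)) with t' by ring. rewrite HPhi. ring. }
    rewrite HPW in HP. unfold gap, Ht in HP. fold th in HP.
    set (e := x' - x) in *. set (d := y' - y) in *. set (s := t' - t) in *.
    assert (HFe := HF x y e d).
    assert (La := Hla' e d ltac:(lra) ltac:(lra)). assert (Lb := Hlb' e d ltac:(lra) ltac:(lra)).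
    replace (x + e) with x' in * by (unfold e; ring). replace (y + d) with y' in * by (unfold d; ring).
    set (n1 := Rabs e + Rabs d) in *.
    assert (He0 := Rabs_pos e). assert (Hd0 := Rabs_pos d).
    assert (Hn1 : n1 <= 2 * d2) by (unfold n1; lra).
    assert (Hn2 : n1 ^ 2 <= 2 * (e ^ 2 + d ^ 2)).
    { rewrite <- (pow2_abs e), <- (pow2_abs d). unfold n1. assert (H := pow2_ge_0 (Rabs e - Rabs d)). lra. }
    assert (HN0 : 0 <= e ^ 2 + d ^ 2) by (assert (A1 := pow2_ge_0 e); assert (A2 := pow2_ge_0 d); lra).
    assert (HQn : Q * n1 ^ 3 <= k / 2 * (e ^ 2 + d ^ 2)).
    { replace (Q * n1 ^ 3) with (Q * n1 * n1 ^ 2) by ring.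
      assert (Q * n1 <= k / 4).
      { apply Rle_trans with ((Q + 1) * (2 * d2)); [apply Rmult_le_compat; unfold n1; lra|].
        right. unfold d2. field. lra. }
      apply Rle_trans with (k / 4 * n1 ^ 2); [apply Rmult_le_compat_r; [apply pow2_ge_0|easy]|].
      assert (k / 4 * n1 ^ 2 <= k / 4 * (2 * (e ^ 2 + d ^ 2))) by (apply Rmult_le_compat_l; lra). lra. }
    (* The interpolation speed varies with the point. Local Lipschitz bounds and Young's inequality
       split this product of space and time increments. *)
    assert (Hcross : - (s / h1 * ((G' x' y' - G x' y') - (G' x y - G x y))) <= k / 2 * (e ^ 2 + d ^ 2) + cw * s ^ 2).
    { eapply Rle_trans; [apply Rle_abs|]. rewrite Rabs_Ropp.
      replace (s / h1 * (G' x' y' - G x' y' - (G' x y - G x y))) with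
        (s * (/ h1 * ((G' x' y' - G' x y) - (G x' y' - G x y)))) by (field; lra).
      rewrite Rabs_mult.
      assert (HD : Rabs (/ h1 * ((G' x' y' - G' x y) - (G x' y' - G x y))) <= lc * n1).
      { rewrite Rabs_mult, (Rabs_pos_eq (/ h1)) by (left; now apply Rinv_0_lt_compat).
        apply Rle_trans with (/ h1 * (la * n1 + lb * n1)).
        - apply Rmult_le_compat_l; [left; now apply Rinv_0_lt_compat|].
          eapply Rle_trans; [apply Rabs_minus_le|]. lra.
        - right. unfold lc. field. lra. }
      apply Rle_trans with (Rabs s * (lc * n1)); [apply Rmult_le_compat_l; [apply Rabs_pos|easy]|].
      rewrite <- (pow2_abs s). set (a := Rabs s).
      assert (Hy2 : a * (lc * n1) <= k / 4 * n1 ^ 2 + / k * (lc * a) ^ 2).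
      { assert (H := pow2_ge_0 (k / 2 * n1 - lc * a)).
        assert (H' : 0 <= / k * (k / 2 * n1 - lc * a) ^ 2) by (apply Rmult_le_pos; [left; now apply Rinv_0_lt_compat|easy]).
        replace (/ k * (k / 2 * n1 - lc * a) ^ 2) with (k / 4 * n1 ^ 2 + / k * (lc * a) ^ 2 - a * (lc * n1)) in H' by (field; lra). lra. }
      assert (cw * a ^ 2 = 4 * (/ k * (lc * a) ^ 2)) by (unfold cw; field; lra).
      assert (0 <= / k * (lc * a) ^ 2) by (apply Rmult_le_pos; [left; now apply Rinv_0_lt_compat|apply pow2_ge_0]).
      assert (k / 4 * n1 ^ 2 <= k / 4 * (2 * (e ^ 2 + d ^ 2))) by (apply Rmult_le_compat_l; lra). lra. }
    apply Rabs_le_upper in HFe.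
    assert (Hth : (tau - t') / h1 = th - s / h1) by (unfold th, s; field; lra).
    rewrite Hth in HP.
    assert (Hcs : rate * (send - t') = rate * (send - t) - rate * s) by (unfold s; ring).
    replace ((G' x y - G x y) / h1) with (/ h1 * (G' x y - G x y)) by (unfold Rdiv; ring).
    replace (s / h1) with (s * / h1) in * by reflexivity. lra.
Qed.

Lemma Phi_slopes t q : tau - h1 < t < tau -> touch_above (fun t => max_gap (Ht t) t) t q ->
  - time_const <= q /\ (E t -> 0 <= q).
Proof.
  intros Htt Hq.
  destruct Cb_s0 as [Hs0 Hb0].
  assert (HPb : 0 <= Pb) by (eapply Rle_trans; [apply Rabs_pos|exact Hp01]).
  assert (HB0 : 0 <= B) by (eapply Rle_trans; [apply Rabs_pos|apply (HB 0 0 t0 Ht0)]).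
  assert (HCst : 0 <= time_const).
  { unfold time_const. assert (A1 := pow2_ge_0 Cb).
    assert (0 <= 3 * Cb ^ 2 * (4 * be + 2)) by (apply Rmult_le_pos; lra).
    assert (0 <= 3 * Cb * (Pb + 1)) by (apply Rmult_le_pos; lra).
    assert (0 <= 3 * Cb * Pb) by (apply Rmult_le_pos; lra).
    assert (0 <= r * B) by now apply Rmult_le_pos.
    assert (0 <= 4 * be * Cb ^ 2) by (apply Rmult_le_pos; lra). lra. }
  destruct (Psi_attained t ltac:(lra)) as [x [y Hmax]].
  destruct (Rle_lt_dec (gap (Ht t) t x y) 0) as [Hneg|Hpos].
  (* If the gap is nowhere positive, [max_gap] attains its minimum 0 at t, so 0 is its only possible
     slope from above. *)
  { assert (HP0 : max_gap (Ht t) t = 0).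
    { unfold max_gap. rewrite (Sup_eq_max (fun w : R * R => gap (Ht t) t (fst w) (snd w)) (x, y)).
      - apply Rmax_left. simpl. easy.
      - intros w. apply Hmax. }
    assert (Hq0 : q = 0).
    { assert (Hsmall : forall e, 0 < e -> Rabs q <= e).
      { intros e He. destruct (Hq e He) as [d [Hd Hd']].
        assert (H1 := Hd' (t + d / 2)). assert (H2 := Hd' (t - d / 2)).
        replace (t + d / 2 - t) with (d / 2) in H1 by ring. replace (t - d / 2 - t) with (- (d / 2)) in H2 by ring.
        rewrite Rabs_Ropp in H2. rewrite (Rabs_pos_eq (d / 2)) in * by lra.
        specialize (H1 ltac:(lra)). specialize (H2 ltac:(lra)). rewrite HP0 in *.
        assert (P1 := Rmax_l 0 (Sup (fun w : R * R => gap (Ht (t + d / 2)) (t + d / 2) (fst w) (snd w)))).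
        assert (P2 := Rmax_l 0 (Sup (fun w : R * R => gap (Ht (t - d / 2)) (t - d / 2) (fst w) (snd w)))).
        unfold max_gap in H1, H2. apply Rabs_le. clear - H1 H2 P1 P2 Hd He. nra. }
      apply NNPP. intros Hn. apply Rabs_pos_lt in Hn. assert (H := Hsmall (Rabs q / 2) ltac:(lra)). lra. }
    subst q. split; [lra|]. intros _. lra. }
  assert (Htouch := Phi_touch t q x y Htt Hq Hmax Hpos). cbv zeta in Htouch.
  assert (Hth := theta_range t ltac:(lra)). set (th := (tau - t) / h1) in *.
  assert (Hclose := Hloc th t x y Hth Htt).
  (* Without the penalty the gap is at most K R0^2 by [Hloc], so positivity forces the maximizer
     into the ball of radius R0. *)
  assert (Hsq : K * ((x - x0) ^ 2 + (y - y0) ^ 2) < K * R0 ^ 2).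
  { unfold gap, Ht in Hpos. fold th in Hpos. lra. }
  apply Rmult_lt_reg_l in Hsq; [|easy].
  assert (Hx : Rabs (x - x0) <= R0).
  { apply Rnot_lt_le. intros H. assert (A1 := pow2_ge_0 (y - y0)).
    assert (R0 ^ 2 <= (x - x0) ^ 2) by (rewrite <- (pow2_abs (x - x0)); apply pow_incr; lra). lra. }
  assert (Hy : Rabs (y - y0) <= R0).
  { apply Rnot_lt_le. intros H. assert (A1 := pow2_ge_0 (x - x0)).
    assert (R0 ^ 2 <= (y - y0) ^ 2) by (rewrite <- (pow2_abs (y - y0)); apply pow_incr; lra). lra. }
  destruct (Hgr th x y Hth Hx Hy) as [Hg1 Hg2].
  set (P1 := p1 x y + th * (p1' x y - p1 x y) + 2 * K * (x - x0)) in *.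
  set (P2 := p2 x y + th * (p2' x y - p2 x y) + 2 * K * (y - y0)) in *.
  assert (HKx : forall a, Rabs a <= R0 -> Rabs (2 * K * a) <= zg / 2).
  { intros a Ha. rewrite Rabs_mult, (Rabs_pos_eq (2 * K)) by lra.
    apply Rle_trans with (2 * K * R0); [apply Rmult_le_compat_l; lra|easy]. }
  assert (HP1' : Rabs (P1 - p01) <= zg).
  { unfold P1. replace (p1 x y + th * (p1' x y - p1 x y) + 2 * K * (x - x0) - p01) with
      ((p1 x y + th * (p1' x y - p1 x y) - p01) + 2 * K * (x - x0)) by ring.
    eapply Rle_trans; [apply Rabs_triang|]. assert (H := HKx _ Hx). lra. }
  assert (HP2' : Rabs (P2 - p02) <= zg).
  { unfold P2. replace (p2 x y + th * (p2' x y - p2 x y) + 2 * K * (y - y0) - p02) with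
      ((p2 x y + th * (p2' x y - p2 x y) - p02) + 2 * K * (y - y0)) by ring.
    eapply Rle_trans; [apply Rabs_triang|]. assert (H := HKx _ Hy). lra. }
  assert (HP1 : Rabs (P1 - p01) <= z) by lra. assert (HP2 : Rabs (P2 - p02) <= z) by lra.
  destruct (sconv_touch T be B V x y t _ _ _ _ _ _ Hbe ltac:(lra) HB (ucT_slice T V t ltac:(lra) HucV) Htouch)
    as [HtV _].
  set (zx := x + P1 / (4 * be)) in *. set (zy := y + P2 / (4 * be)) in *.
  assert (Hdiv : forall a b a0 base_bb : R, Rabs (a - a0) <= R0 -> Rabs (b - base_bb) <= zg ->
            Rabs (a + b / (4 * be) - (a0 + base_bb / (4 * be))) <= rr).
  { intros a b a0 b1 Ha Hb. replace (a + b / (4 * be) - (a0 + b1 / (4 * be))) with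
      ((a - a0) + (b - b1) * / (4 * be)) by (field; lra).
    eapply Rle_trans; [apply Rabs_triang|]. rewrite Rabs_mult.
    assert (Hi : 0 < / (4 * be)) by (apply Rinv_0_lt_compat; lra).
    rewrite (Rabs_pos_eq (/ (4 * be))) by lra.
    assert (Rabs (b - b1) * / (4 * be) <= zg * / (4 * be)) by (apply Rmult_le_compat_r; lra).
    unfold Rdiv in Hrr. lra. }
  assert (Hzx : Rabs (zx - base_x) <= rr) by (apply Hdiv; easy).
  assert (Hzy : Rabs (zy - base_y) <= rr) by (apply Hdiv; easy).
  destruct (Hnear t zx zy Htt Hzx Hzy) as [HVd HVL].
  assert (HtT : 0 < t < T) by lra.
  assert (Hineq := Hsub _ _ _ _ _ _ _ _ _ HtT HVL HtV).
  unfold ham in Hineq.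
  set (Y11 := X11 x y + th * (walk u1 u2 v1 v2 X11 x y - X11 x y)) in *.
  set (Y12 := X12 x y + th * (walk u1 u2 v1 v2 X12 x y - X12 x y)) in *.
  set (Y22 := X22 x y + th * (walk u1 u2 v1 v2 X22 x y - X22 x y)) in *.
  assert (HY := C21_hessian_entries _ _ _ _ _ _ _ _ x y HQ
    (C21_interp _ _ _ _ _ _ _ _ _ _ _ _ _ _ Hth HG (walk_C21 u1 u2 v1 v2 _ _ _ _ _ _ _ HG))
    (second_diff_interp _ _ _ _ Hth HGsd (walk_second_diff u1 u2 v1 v2 _ _ HGsd))).
  cbv beta in HY. fold Y11 Y12 Y22 in HY. destruct HY as [HY11 [HY12 HY22]].
  assert (HZ11 : Rabs (Y11 + 2 * K) <= 4 * be + 2).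
  { eapply Rle_trans; [apply Rabs_triang|]. rewrite (Rabs_pos_eq (2 * K)) by lra. lra. }
  assert (HZ22 : Rabs (Y22 + 2 * K) <= 4 * be + 2).
  { eapply Rle_trans; [apply Rabs_triang|]. rewrite (Rabs_pos_eq (2 * K)) by lra. lra. }
  assert (HZ12 : Rabs Y12 <= 2 * (4 * be + 2)) by lra.
  destruct (Hok t ltac:(lra) zx zy zx zy) as [[O1 [O2 [O3 [O4 O5]]]] _].
  destruct (Hok t0 Ht0 base_x base_y base_x base_y) as [[_ [_ [O30 [O40 O50]]]] _].
  set (low := lower r (m1 c zx zy t) (m2 c zy t) (gm c zx t) (V zx zy t) P1 P2).
  set (sec := second rho (sg c zx t) (bb c zy t) (Y11 + 2 * K) Y12 (Y22 + 2 * K)).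
  assert (Hq1 : (G' x y - G x y) / h1 + rate - low - sec <= q) by (unfold low, sec, lower, second; lra).
  split.
  - assert (Hlow : Rabs low <= 3 * Cb * (Pb + 1) + r * B).
    { apply lower_bound; try easy.
      - replace P1 with ((P1 - p01) + p01) by ring. eapply Rle_trans; [apply Rabs_triang|]. lra.
      - replace P2 with ((P2 - p02) + p02) by ring. eapply Rle_trans; [apply Rabs_triang|]. lra.
      - apply HB; lra. }
    assert (Hsec : Rabs sec <= 3 * Cb ^ 2 * (4 * be + 2)) by (apply second_bound; lra || easy).
    assert (Hl0 : Rabs base_lower <= 3 * Cb * Pb + r * B) by (apply lower_bound; try easy; apply HB; easy).
    assert (Hwalk : - (4 * be * Cb ^ 2) <= (G' x y - G x y) / h1).
    { assert (H := walk_increment_bound u1 u2 v1 v2 G (4 * be) x y HGsd). fold G' in H.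
      apply Rabs_le_lower in H.
      replace (u1 ^ 2 + u2 ^ 2 + (v1 ^ 2 + v2 ^ 2)) with ((u1 ^ 2 + v1 ^ 2) + (u2 ^ 2 + v2 ^ 2)) in H by ring.
      rewrite HW11, HW22 in H.
      assert (Hs2 : base_sg ^ 2 <= Cb ^ 2) by (rewrite <- (pow2_abs base_sg); apply pow_incr; split; [apply Rabs_pos|easy]).
      assert (Hb2 : base_bb ^ 2 <= Cb ^ 2) by (rewrite <- (pow2_abs base_bb); apply pow_incr; split; [apply Rabs_pos|easy]).
      apply Rmult_le_reg_r with h1; [easy|].
      replace ((G' x y - G x y) / h1 * h1) with (G' x y - G x y) by (field; lra).
      eapply Rle_trans; [|exact H].
      assert (be * h1 * (base_sg ^ 2 + base_bb ^ 2) <= be * h1 * (2 * Cb ^ 2)).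
      { apply Rmult_le_compat_l; [apply Rmult_le_pos; lra|lra]. } lra. }
    apply Rabs_le_upper in Hlow. apply Rabs_le_upper in Hsec. apply Rabs_le_lower in Hl0.
    unfold rate, time_const in *. lra.
  (* Of the slack kap, one half covers the change of coefficients and the penalty, one eighth the
     Hessian of the interpolation, and one eighth the generator. *)
  - intros HE. destruct (Hcoef t zx zy Htt HE Hzx Hzy) as [D1 [D2 [D3 [D4 D5]]]].
    assert (Hlow : Rabs (low - base_lower) <= (3 * Cb + 3 * Pb + r) * z) by (apply lower_diff; easy).
    assert (Hsec : Rabs (sec - second rho base_sg base_bb (Y11 + 2 * K) Y12 (Y22 + 2 * K)) <= 6 * Cb * (4 * be + 2) * z).
    { apply second_diff_coef; lra || easy. }
    assert (Hs2 : base_sg ^ 2 <= Cb ^ 2) by (rewrite <- (pow2_abs base_sg); apply pow_incr; split; [apply Rabs_pos|easy]).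
    assert (Hb2 : base_bb ^ 2 <= Cb ^ 2) by (rewrite <- (pow2_abs base_bb); apply pow_incr; split; [apply Rabs_pos|easy]).
    assert (HK2 : second rho base_sg base_bb (Y11 + 2 * K) Y12 (Y22 + 2 * K) <= second rho base_sg base_bb Y11 Y12 Y22 + 2 * Cb ^ 2 * z).
    { unfold second. assert (base_sg ^ 2 * K <= Cb ^ 2 * z) by (apply Rmult_le_compat; try apply pow2_ge_0; lra).
      assert (base_bb ^ 2 * K <= Cb ^ 2 * z) by (apply Rmult_le_compat; try apply pow2_ge_0; lra). lra. }
    destruct (walk_hessian_close x y) as [W1 [W2 W3]].
    assert (Hn0 : 0 <= n).
    { unfold n. assert (A1 := Rabs_pos u1). assert (A2 := Rabs_pos u2). assert (A3 := Rabs_pos v1).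
      assert (A4 := Rabs_pos v2). lra. }
    assert (HQn : 0 <= 60 * Q * n) by (apply Rmult_le_pos; lra).
    assert (Hdth : Rabs (second rho base_sg base_bb (walk u1 u2 v1 v2 X11 x y - X11 x y) (walk u1 u2 v1 v2 X12 x y - X12 x y)
        (walk u1 u2 v1 v2 X22 x y - X22 x y)) <= 3 * Cb ^ 2 * (60 * Q * n)) by (apply second_bound; lra || easy).
    assert (Hlinear : second rho base_sg base_bb Y11 Y12 Y22 = second rho base_sg base_bb (X11 x y) (X12 x y) (X22 x y) +
       th * second rho base_sg base_bb (walk u1 u2 v1 v2 X11 x y - X11 x y) (walk u1 u2 v1 v2 X12 x y - X12 x y)
        (walk u1 u2 v1 v2 X22 x y - X22 x y)) by (unfold second, Y11, Y12, Y22; ring).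
    set (dsec := second rho base_sg base_bb (walk u1 u2 v1 v2 X11 x y - X11 x y) (walk u1 u2 v1 v2 X12 x y - X12 x y)
        (walk u1 u2 v1 v2 X22 x y - X22 x y)) in *.
    assert (Hthd : th * dsec <= kap / 8).
    { apply Rabs_le_upper in Hdth.
      assert (Hds : dsec <= kap / 8) by lra. apply Rle_trans with (th * (kap / 8)); [apply Rmult_le_compat_l; lra|].
      apply Rle_trans with (1 * (kap / 8)); [apply Rmult_le_compat_r; lra|lra]. }
    assert (Hgen := frozen_generator x y). apply Rabs_le_lower in Hgen.
    apply Rabs_le_upper in Hlow. apply Rabs_le_upper in Hsec.
    unfold modulus_const in HC3. unfold rate in Hq1. lra.
Qed.

(** The interpolation equals G' and G at the two ends, and [Phi_slopes] supplies the slopes required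
    by [touch_above_increment]. *)
Lemma Phi_one_step :
  max_gap G' (tau - h1) <= max_gap G tau + time_const * (h1 - (theta E 0 tau - theta E 0 (tau - h1))).
Proof.
  assert (E1 : Ht (tau - h1) = G').
  { extensionality x. extensionality y. unfold Ht. field. lra. }
  assert (E2 : Ht tau = G).
  { extensionality x. extensionality y. unfold Ht. field. lra. }
  assert (HPb : 0 <= Pb) by (eapply Rle_trans; [apply Rabs_pos|exact Hp01]).
  assert (HB0 : 0 <= B) by (eapply Rle_trans; [apply Rabs_pos|apply (HB 0 0 t0 Ht0)]).
  assert (HCst : 0 <= time_const).
  { unfold time_const. assert (A1 := pow2_ge_0 Cb).
    assert (0 <= 3 * Cb ^ 2 * (4 * be + 2)) by (apply Rmult_le_pos; lra).
    assert (0 <= 3 * Cb * (Pb + 1)) by (apply Rmult_le_pos; lra).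
    assert (0 <= 3 * Cb * Pb) by (apply Rmult_le_pos; lra).
    assert (0 <= r * B) by now apply Rmult_le_pos.
    assert (0 <= 4 * be * Cb ^ 2) by (apply Rmult_le_pos; lra). lra. }
  assert (H := touch_above_increment E (fun t => max_gap (Ht t) t) 0 (tau - h1) tau time_const Htau0 ltac:(lra) HCst
    Phi_cont (fun t q Htt Hq => Phi_slopes t q Htt Hq)).
  cbv beta in H. rewrite E1, E2 in H. replace (tau - (tau - h1)) with h1 in H by ring. exact H.
Qed.

End OneStep.

(** * Iteration of the steps *)

Section Evolve.
Variables (F f1 f2 F11 F12 F22 : R -> R -> R) (Q BG h nu sg0 : R) (N : nat).
Hypothesis HQ : 0 <= Q.
Hypothesis HF : C21 F f1 f2 F11 F12 F22 Q.
Hypothesis HFsd : second_diff F (4 * be).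
Hypothesis HFb : forall x y, Rabs (F x y) <= BG.
Hypothesis Hh : 0 < h.
Hypothesis Hsend : send = t0 + h.
Hypothesis HsendT : send <= T.
Hypothesis HN : (0 < N)%nat.
Let h1 : R := h / INR N.
Variables (u1 u2 v1 v2 : R).
Hypothesis HW11 : u1 ^ 2 + v1 ^ 2 = 2 * h1 * base_sg ^ 2.
Hypothesis HW12 : u1 * u2 + v1 * v2 = 2 * h1 * (rho * base_sg * base_bb).
Hypothesis HW22 : u2 ^ 2 + v2 ^ 2 = 2 * h1 * base_bb ^ 2.
Let n : R := Rabs u1 + Rabs u2 + Rabs v1 + Rabs v2.
Hypothesis HWQ : Q * n ^ 3 <= h1 * (kap / 8).
Hypothesis HWn : 180 * Cb ^ 2 * Q * n <= kap / 8.
Hypothesis Hpar : forall e d, F (x0 + e) (y0 + d) <= F x0 y0 + p01 * e + p02 * d + be / 3 * (e ^ 2 + d ^ 2) + nu.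
Hypothesis Hsg0 : 0 < sg0.
Hypothesis Hgrad : (be / 3 + 2 * be) * sg0 + (nu + 8 * be * Cb ^ 2 * h) / sg0 + 20 * be * R0 <= zg / 2.
Hypothesis Hloc : forall t x y, t0 < t < send ->
  env x y t - F x y + 4 * be * Cb ^ 2 * h + Rabs rate * h <= K * R0 ^ 2.
Hypothesis Hnear : forall t x y, t0 < t < send -> Rabs (x - base_x) <= rr -> Rabs (y - base_y) <= rr ->
  Rabs (V x y t - V base_x base_y t0) <= z /\ - L < V x y t.
Hypothesis Hcoef : forall t x y, t0 < t < send -> E t -> Rabs (x - base_x) <= rr -> Rabs (y - base_y) <= rr ->
  Rabs (sg c x t - base_sg) <= z /\ Rabs (bb c y t - base_bb) <= z /\
  Rabs (m1 c x y t - m1 c base_x base_y t0) <= z /\ Rabs (m2 c y t - m2 c base_y t0) <= z /\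
  Rabs (gm c x t - gm c base_x t0) <= z.

Lemma steps_close k x y : (k <= N)%nat -> Rabs (walks u1 u2 v1 v2 k F x y - F x y) <= 4 * be * Cb ^ 2 * h.
Proof.
  intros Hk. eapply Rle_trans; [apply walks_increment_bound; exact HFsd|].
  replace (u1 ^ 2 + u2 ^ 2 + (v1 ^ 2 + v2 ^ 2)) with ((u1 ^ 2 + v1 ^ 2) + (u2 ^ 2 + v2 ^ 2)) by ring.
  rewrite HW11, HW22. destruct Cb_s0 as [Hs0 Hb0].
  assert (Hs2 : base_sg ^ 2 <= Cb ^ 2) by (rewrite <- (pow2_abs base_sg); apply pow_incr; split; [apply Rabs_pos|easy]).
  assert (Hb2 : base_bb ^ 2 <= Cb ^ 2) by (rewrite <- (pow2_abs base_bb); apply pow_incr; split; [apply Rabs_pos|easy]).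
  assert (HNR : 0 < INR N) by now apply lt_0_INR.
  assert (Hkh : INR k * h1 <= h).
  { apply Rle_trans with (INR N * h1).
    - apply Rmult_le_compat_r; [left; apply Rdiv_lt_0_compat; easy|now apply le_INR].
    - right. unfold h1. field. lra. }
  assert (Hkh0 : 0 <= INR k * h1) by (apply Rmult_le_pos; [apply pos_INR|left; apply Rdiv_lt_0_compat; easy]).
  replace (INR k * (/ 4 * (4 * be) * (2 * h1 * base_sg ^ 2 + 2 * h1 * base_bb ^ 2))) with
    ((INR k * h1) * (2 * be * (base_sg ^ 2 + base_bb ^ 2))) by field.
  replace (4 * be * Cb ^ 2 * h) with (h * (2 * be * (2 * Cb ^ 2))) by ring.
  assert (A1 := pow2_ge_0 base_sg). assert (A2 := pow2_ge_0 base_bb).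
  apply Rmult_le_compat; [easy|apply Rmult_le_pos; lra|easy|apply Rmult_le_compat_l; lra].
Qed.

(** Every iterate inherits Q and the second difference bound, and by [steps_close] it stays near F.
    So the localization and gradient hypotheses of a single step hold all along. *)
Lemma Phi_steps k : (k <= N)%nat -> max_gap (walks u1 u2 v1 v2 k F) (send - INR k * h1) <=
  max_gap F send + time_const * (INR k * h1 - (theta E 0 send - theta E 0 (send - INR k * h1))).
Proof.
  assert (HNR : 0 < INR N) by now apply lt_0_INR.
  assert (Hh1 : 0 < h1) by (apply Rdiv_lt_0_compat; easy).
  induction k as [|k IH]; intros Hk.
  { simpl. replace (send - 0 * h1) with send by ring. lra. }
  specialize (IH ltac:(lia)).
  assert (Hkh : INR (S k) * h1 <= h).
  { apply Rle_trans with (INR N * h1).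
    - apply Rmult_le_compat_r; [lra|now apply le_INR].
    - right. unfold h1. field. lra. }
  assert (Hk0 := pos_INR k).
  assert (Hkh0 : 0 <= INR k * h1) by (apply Rmult_le_pos; lra).
  rewrite S_INR in *.
  set (tau := send - INR k * h1) in *.
  replace (send - (INR k + 1) * h1) with (tau - h1) by (unfold tau; ring).
  assert (HFk := walks_C21 u1 u2 v1 v2 k _ _ _ _ _ _ _ HF).
  assert (HFk' := walk_C21 u1 u2 v1 v2 _ _ _ _ _ _ _ HFk).
  assert (Hsdk := walks_second_diff u1 u2 v1 v2 k _ _ HFsd).
  assert (Hsdk' := walk_second_diff u1 u2 v1 v2 _ _ Hsdk).
  assert (Hcl : forall th x y, 0 <= th <= 1 -> Rabs (walks u1 u2 v1 v2 k F x y +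
     th * (walk u1 u2 v1 v2 (walks u1 u2 v1 v2 k F) x y - walks u1 u2 v1 v2 k F x y) - F x y) <= 4 * be * Cb ^ 2 * h).
  { intros th x y Hth. assert (H1 := steps_close k x y ltac:(lia)). assert (H2 := steps_close (S k) x y Hk).
    change (walks u1 u2 v1 v2 (S k) F) with (walk u1 u2 v1 v2 (walks u1 u2 v1 v2 k F)) in H2.
    set (A := walks u1 u2 v1 v2 k F x y) in *. set (D := walk u1 u2 v1 v2 (walks u1 u2 v1 v2 k F) x y) in *.
    replace (A + th * (D - A) - F x y) with ((1 - th) * (A - F x y) + th * (D - F x y)) by ring.
    eapply Rle_trans; [apply Rabs_triang|]. rewrite !Rabs_mult, (Rabs_pos_eq (1 - th)), (Rabs_pos_eq th) by lra.
    assert ((1 - th) * Rabs (A - F x y) <= (1 - th) * (4 * be * Cb ^ 2 * h)) by (apply Rmult_le_compat_l; lra).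
    assert (th * Rabs (D - F x y) <= th * (4 * be * Cb ^ 2 * h)) by (apply Rmult_le_compat_l; lra). lra. }
  assert (Hone : max_gap (walk u1 u2 v1 v2 (walks u1 u2 v1 v2 k F)) (tau - h1) <=
    max_gap (walks u1 u2 v1 v2 k F) tau + time_const * (h1 - (theta E 0 tau - theta E 0 (tau - h1)))).
  { apply (Phi_one_step (walks u1 u2 v1 v2 k F) (walks u1 u2 v1 v2 k f1) (walks u1 u2 v1 v2 k f2)
      (walks u1 u2 v1 v2 k F11) (walks u1 u2 v1 v2 k F12) (walks u1 u2 v1 v2 k F22) Q BG tau h1 u1 u2 v1 v2);
      try easy.
    - intros x y. now apply walks_bound.
    - unfold tau. lra.
    - unfold tau. lra.
    - intros th x y Hth Hx Hy.
      assert (HI := C21_interp _ _ _ _ _ _ _ _ _ _ _ _ _ _ Hth HFk HFk').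
      assert (HS := second_diff_interp _ _ _ _ Hth Hsdk Hsdk').
      (* The distance 4 be Cb^2 h to F is spent twice, at the vertex and at the displaced point;
         hence 8 be Cb^2 h. *)
      assert (Hv := gradient_near_vertex _ _ _ _ _ _ Q (4 * be) x0 y0 p01 p02 (be / 3) (nu + 8 * be * Cb ^ 2 * h) sg0
        HQ HI HS Hsg0).
      cbv beta in Hv. destruct Hv as [Hv1 Hv2].
      { intros e d. assert (C1 := Hcl th (x0 + e) (y0 + d) Hth). assert (C2 := Hcl th x0 y0 Hth).
        assert (P := Hpar e d). apply Rabs_le_upper in C1. apply Rabs_le_lower in C2. lra. }
      assert (Hl := gradient_lip _ _ _ _ _ _ Q (4 * be) x0 y0 (x - x0) (y - y0) R0 HQ HI HS HR0 Hx Hy).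
      cbv beta in Hl. replace (x0 + (x - x0)) with x in Hl by ring. replace (y0 + (y - y0)) with y in Hl by ring.
      destruct Hl as [Hl1 Hl2].
      apply Rabs_le_between in Hv1. apply Rabs_le_between in Hv2. apply Rabs_le_between in Hl1. apply Rabs_le_between in Hl2.
      split; apply Rabs_le; lra.
    - intros th t x y Hth Ht. assert (Hl := Hloc t x y ltac:(unfold tau in Ht; lra)).
      assert (C1 := Hcl th x y Hth). apply Rabs_le_lower in C1.
      assert (HC : - (rate * (send - t)) <= Rabs rate * h).
      { eapply Rle_trans; [apply Rle_abs|]. rewrite Rabs_Ropp, Rabs_mult.
        apply Rmult_le_compat_l; [apply Rabs_pos|]. unfold tau in Ht. rewrite Rabs_pos_eq; lra. }
      lra.
    - intros t x y Ht. apply Hnear. unfold tau in Ht. lra.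
    - intros t x y Ht. apply Hcoef. unfold tau in Ht. lra. }
  change (walks u1 u2 v1 v2 (S k) F) with (walk u1 u2 v1 v2 (walks u1 u2 v1 v2 k F)).
  eapply Rle_trans; [exact Hone|]. lra.
Qed.

(** Evaluated at the vertex, where the penalty vanishes. One kap is the slack of [rate], the other
    the initial error at [send]. *)
Lemma evolve_bound : (forall x y, env x y send <= F x y + kap * h) ->
  env x0 y0 t0 <= walks u1 u2 v1 v2 N F x0 y0 + (base_lower + 2 * kap) * h
    + time_const * (h - (theta E 0 send - theta E 0 t0)).
Proof.
  intros HU.
  assert (HNR : 0 < INR N) by now apply lt_0_INR.
  assert (H := Phi_steps N ltac:(lia)).
  assert (Hkap' : 0 <= kap * h) by (apply Rmult_le_pos; lra).
  replace (INR N * h1) with h in H by (unfold h1; field; lra).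
  replace (send - h) with t0 in H by lra.
  assert (H1 : max_gap F send <= kap * h).
  { apply Rmax_lub; [easy|]. apply (Sup_le _ _ (0, 0)). intros w. unfold gap.
    assert (H2 := HU (fst w) (snd w)). rewrite Rminus_diag.
    assert (H3 := sq_sum_pos K HK (fst w - x0) (snd w - y0)). lra. }
  assert (H2 : gap (walks u1 u2 v1 v2 N F) t0 x0 y0 <= max_gap (walks u1 u2 v1 v2 N F) t0).
  { eapply Rle_trans; [|apply Rmax_r].
    apply (Sup_ub (fun w : R * R => gap (walks u1 u2 v1 v2 N F) t0 (fst w) (snd w))
      (B + BG + Rabs (rate * (send - t0))) (x0, y0)).
    intros w. unfold gap. assert (A1 := Uh_bound (fst w) (snd w) t0 Ht0).
    assert (A2 := walks_bound u1 u2 v1 v2 N F BG HFb (fst w) (snd w)). apply Rabs_le_lower in A2.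
    assert (A3 := Rle_abs (- (rate * (send - t0)))). rewrite Rabs_Ropp in A3.
    assert (A4 := sq_sum_pos K HK (fst w - x0) (snd w - y0)). lra. }
  unfold gap in H2. rewrite !Rminus_diag in H2. unfold rate in H2.
  replace (send - t0) with h in H2 by lra. lra.
Qed.

End Evolve.
End Step.

(** The directions (s, (rho + a) b) and (s, (rho - a) b) with a = sqrt(1 - rho^2) average to the
    covariance s^2, rho s b, b^2. They are linear in (s, b), so the difference of two coupled walks
    has the same form. *)
Definition cowalk (rho s b h : R) (N : nat) (F : R -> R -> R) : R -> R -> R :=
  walks (sqrt (h / INR N) * s) (sqrt (h / INR N) * ((rho + sqrt (1 - rho ^ 2)) * b))
    (sqrt (h / INR N) * s) (sqrt (h / INR N) * ((rho - sqrt (1 - rho ^ 2)) * b)) N F.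

Lemma exists_below (l : list R) : (forall a, In a l -> 0 < a) -> exists d, 0 < d /\ forall a, In a l -> d <= a.
Proof.
  induction l as [|a l IH]; intros H.
  - exists 1. split; [lra|]. intros a [].
  - destruct IH as [d [Hd Hd']]; [intros b Hb; apply H; now right|].
    exists (Rmin a d). split; [apply Rmin_glb_lt; [apply H; now left|easy]|].
    intros b [->|Hb]; [apply Rmin_l|]. eapply Rle_trans; [apply Rmin_r|now apply Hd'].
Qed.

Lemma le_of_le_div a k x : 0 < k -> x <= a / k -> k * x <= a.
Proof.
  intros Hk H. apply Rmult_le_compat_l with (r := k) in H; [|lra].
  replace (k * (a / k)) with a in H by (field; lra). easy.
Qed.

Lemma small_multiple k x e : 0 <= k -> 0 <= x -> x <= e / (k + 1) -> k * x <= e.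
Proof. intros Hk Hx H. apply le_of_le_div in H; lra. Qed.

(** The moves are of order sqrt h1, so the cubic error is of order h1^(3/2), negligible against h1
    however large Q is. *)
Lemma cowalk_steps_small rho s b Cb Q kap : -1 <= rho <= 1 -> 0 <= Cb -> 0 <= Q -> 0 < kap ->
  Rabs s <= Cb -> Rabs b <= Cb -> exists sg, 0 < sg /\ forall h1, 0 < h1 <= sg ->
  let n := Rabs (sqrt h1 * s) + Rabs (sqrt h1 * ((rho + sqrt (1 - rho ^ 2)) * b)) + Rabs (sqrt h1 * s)
    + Rabs (sqrt h1 * ((rho - sqrt (1 - rho ^ 2)) * b)) in
  Q * n ^ 3 <= h1 * (kap / 8) /\ 180 * Cb ^ 2 * Q * n <= kap / 8.
Proof.
  intros Hrho HCb HQ Hkap Hs Hb.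
  assert (HC3 : 0 <= Cb ^ 3) by now apply pow_le.
  assert (HCQ : 0 <= Cb ^ 3 * Q) by now apply Rmult_le_pos.
  (* The step lengths sum to at most 6 Cb sqrt h1; 1080 = 180 times 6 also exceeds 216 = 6^3. *)
  set (q := kap / 8 / (1080 * (Cb ^ 3 * Q) + 1)).
  assert (Hq : 0 < q) by (apply Rdiv_lt_0_compat; lra).
  exists (q ^ 2). split; [now apply pow_lt|]. intros h1 Hh1 n.
  assert (Hw := sqrt_pos h1). assert (Hw2 : sqrt h1 ^ 2 = h1) by (rewrite pow2_sqrt; lra).
  assert (Hwq : sqrt h1 <= q).
  { rewrite <- (sqrt_pow2 q) by lra. apply sqrt_le_1_alt. lra. }
  assert (Hr1 := sqrt_pos (1 - rho ^ 2)).
  assert (Hr2 : sqrt (1 - rho ^ 2) <= 1).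
  { rewrite <- sqrt_1. apply sqrt_le_1_alt. rewrite sqrt_1. assert (H := pow2_ge_0 rho). lra. }
  assert (Hn : n <= 6 * Cb * sqrt h1).
  { assert (A1 : Rabs (sqrt h1 * s) <= Cb * sqrt h1).
    { rewrite Rabs_mult, (Rabs_pos_eq (sqrt h1)) by easy. rewrite Rmult_comm. now apply Rmult_le_compat_r. }
    assert (A2 : forall k, Rabs k <= 2 -> Rabs (sqrt h1 * (k * b)) <= 2 * Cb * sqrt h1).
    { intros k Hk. rewrite Rabs_mult, (Rabs_pos_eq (sqrt h1)) by easy. rewrite Rmult_comm.
      apply Rmult_le_compat_r; [easy|]. now apply Rabs_prod_le. }
    assert (K1 : Rabs (rho + sqrt (1 - rho ^ 2)) <= 2) by (apply Rabs_le; lra).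
    assert (K2 : Rabs (rho - sqrt (1 - rho ^ 2)) <= 2) by (apply Rabs_le; lra).
    apply A2 in K1. apply A2 in K2. unfold n. lra. }
  assert (Hn0 : 0 <= n).
  { unfold n. repeat apply Rplus_le_le_0_compat; apply Rabs_pos. }
  assert (Hkey : 1080 * (Cb ^ 3 * Q) * sqrt h1 <= kap / 8) by (apply small_multiple; [lra|easy|exact Hwq]).
  split.
  - apply Rle_trans with (Q * (6 * Cb * sqrt h1) ^ 3).
    + apply Rmult_le_compat_l; [easy|]. apply pow_incr. lra.
    + replace (Q * (6 * Cb * sqrt h1) ^ 3) with (216 * (Cb ^ 3 * Q) * sqrt h1 * sqrt h1 ^ 2) by ring.
      rewrite Hw2, (Rmult_comm h1). apply Rmult_le_compat_r; [lra|].
      assert (0 <= Cb ^ 3 * Q * sqrt h1) by now apply Rmult_le_pos. lra.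
  - apply Rle_trans with (180 * Cb ^ 2 * Q * (6 * Cb * sqrt h1)).
    + apply Rmult_le_compat_l; [|easy]. apply Rmult_le_pos; [|easy]. apply Rmult_le_pos; [lra|apply pow2_ge_0].
    + replace (180 * Cb ^ 2 * Q * (6 * Cb * sqrt h1)) with (1080 * (Cb ^ 3 * Q) * sqrt h1) by ring. easy.
Qed.

Lemma cowalk_covariance rho s b h1 : -1 <= rho <= 1 -> 0 <= h1 ->
  let w := sqrt h1 in let a := sqrt (1 - rho ^ 2) in
  (w * s) ^ 2 + (w * s) ^ 2 = 2 * h1 * s ^ 2 /\
  (w * s) * (w * ((rho + a) * b)) + (w * s) * (w * ((rho - a) * b)) = 2 * h1 * (rho * s * b) /\
  (w * ((rho + a) * b)) ^ 2 + (w * ((rho - a) * b)) ^ 2 = 2 * h1 * b ^ 2.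
Proof.
  intros Hrho Hh w a.
  assert (Hw2 : w ^ 2 = h1) by (unfold w; rewrite pow2_sqrt; lra).
  assert (Ha2 : a ^ 2 = 1 - rho ^ 2) by (unfold a; rewrite pow2_sqrt; [easy|nra]).
  split; [|split].
  - rewrite <- Hw2. ring.
  - rewrite <- Hw2. ring.
  - replace ((w * ((rho + a) * b)) ^ 2 + (w * ((rho - a) * b)) ^ 2) with (2 * w ^ 2 * (rho ^ 2 + a ^ 2) * b ^ 2) by ring.
    rewrite Hw2, Ha2. ring.
Qed.

Lemma archimed_div h sg : 0 < h -> 0 < sg -> exists N0, (0 < N0)%nat /\ forall N, (N0 <= N)%nat -> 0 < h / INR N <= sg.
Proof.
  intros Hh Hsg. destruct (archimed_cor1 (sg / h)) as [N0 [HN0 HN0']]; [now apply Rdiv_lt_0_compat|].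
  exists N0. split; [easy|]. intros N HN.
  assert (H0 : 0 < INR N0) by now apply lt_0_INR.
  assert (H1 : INR N0 <= INR N) by now apply le_INR.
  split; [apply Rdiv_lt_0_compat; lra|].
  apply Rle_trans with (h * / INR N0).
  - apply Rmult_le_compat_l; [lra|]. now apply Rinv_le_contravar.
  - apply Rmult_lt_compat_l with (r := h) in HN0; [|easy].
    replace (h * (sg / h)) with sg in HN0 by (field; lra). lra.
Qed.

Section Evolution.
Variables (T r rho : R) (c : coef) (Cb Cl L B be : R) (V : R -> R -> R -> R).
Hypothesis Hr : 0 <= r.
Hypothesis Hrho : -1 <= rho <= 1.
Hypothesis HCb : 0 <= Cb.
Hypothesis HCl : 0 <= Cl.
Hypothesis Hbe : 0 < be.
Hypothesis Hok : coef_ok T c Cb Cl.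
Hypothesis HB : forall x y t, 0 <= t <= T -> Rabs (V x y t) <= B.
Hypothesis HucV : ucT T V.
Hypothesis Hsub : jsub T r rho c (fun v => - L < v) V.

Definition coef_near (eta x y t0 t : R) : Prop :=
  Rabs (sg c x t - sg c x t0) <= eta /\ Rabs (bb c y t - bb c y t0) <= eta /\
  Rabs (m1 c x y t - m1 c x y t0) <= eta /\ Rabs (m2 c y t - m2 c y t0) <= eta /\
  Rabs (gm c x t - gm c x t0) <= eta.

(** The order of the quantifiers matters: eta, h0 and nu are uniform in the point, the time and F,
    so one colouring serves all times. Only N0 may depend on F and hence on Q. *)
Lemma evolution kap Pb : 0 < kap -> 0 <= Pb -> exists eta h0 nu, 0 < eta /\ 0 < h0 /\ 0 < nu /\
  forall x0 y0 p01 p02 t0 E, 0 <= t0 <= T -> Rabs p01 <= Pb -> Rabs p02 <= Pb ->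
  let zx := x0 + p01 / (4 * be) in let zy := y0 + p02 / (4 * be) in
  - L + 1 <= V zx zy t0 -> (forall t, 0 <= t <= T -> E t -> coef_near eta zx zy t0 t) ->
  forall h, 0 < h < h0 -> t0 + h <= T ->
  forall F f1 f2 F11 F12 F22 Q BG, 0 <= Q -> C21 F f1 f2 F11 F12 F22 Q -> second_diff F (4 * be) ->
  (forall x y, Rabs (F x y) <= BG) ->
  (forall e d, F (x0 + e) (y0 + d) <= F x0 y0 + p01 * e + p02 * d + be / 3 * (e ^ 2 + d ^ 2) + nu) ->
  (forall x y, sconv (2 * be) (fun x y => V x y (t0 + h)) x y <= F x y + kap * h) ->
  exists N0, (0 < N0)%nat /\ forall N, (N0 <= N)%nat ->
  sconv (2 * be) (fun x y => V x y t0) x0 y0 <= cowalk rho (sg c zx t0) (bb c zy t0) h N F x0 y0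
    + (lower r (m1 c zx zy t0) (m2 c zy t0) (gm c zx t0) (V zx zy t0) p01 p02 + 2 * kap) * h
    + time_const r Cb B be Pb * (h - (theta E 0 (t0 + h) - theta E 0 t0)).
Proof.
  intros Hkap HPb.
  destruct (Rlt_le_dec T 0) as [HT|HT].
  { exists 1, 1, 1. split; [lra|]. split; [lra|]. split; [lra|]. intros. lra. }
  assert (HB0 : 0 <= B) by (eapply Rle_trans; [apply Rabs_pos|apply (HB 0 0 0 ltac:(lra))]).
  assert (HCC : 0 <= Cb ^ 2) by apply pow2_ge_0.
  assert (HCP : 0 <= Cb * Pb) by now apply Rmult_le_pos.
  assert (HrB : 0 <= r * B) by now apply Rmult_le_pos.
  assert (HbC : 0 <= be * Cb ^ 2) by (apply Rmult_le_pos; lra).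
  assert (HCbe : 0 <= Cb * be) by (apply Rmult_le_pos; lra).
  assert (HC3 : 0 <= modulus_const r Cb be Pb) by (unfold modulus_const; lra).
  (* z <= 1/2 keeps V above - L near a point where it is at least - L + 1, so the truncated
     inequality applies there. *)
  set (z := Rmin (1 / 2) (kap / 2 / (modulus_const r Cb be Pb + 1))).
  assert (Hz : 0 < z) by (apply Rmin_glb_lt; [lra|apply Rdiv_lt_0_compat; lra]).
  assert (Hz1 : z <= 1 / 2) by apply Rmin_l.
  assert (Hz3 : modulus_const r Cb be Pb * z <= kap / 2) by (apply small_multiple; [easy|lra|apply Rmin_r]).
  destruct (HucV z Hz) as [d [Hd Hd']].
  set (rr := Rmin (d / 2) (z / 4 / (Cl + 1))).
  assert (Hrr0 : 0 < rr) by (apply Rmin_glb_lt; [lra|apply Rdiv_lt_0_compat; lra]).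
  assert (Hrrd : rr < d) by (apply Rle_lt_trans with (d / 2); [apply Rmin_l|lra]).
  assert (HrrC : Cl * rr <= z / 4) by (apply small_multiple; [easy|lra|apply Rmin_r]).
  (* A gradient error zg displaces the base point by zg / (4 be), at most rr / 2. *)
  set (zg := Rmin z (2 * be * rr)).
  assert (Hber : 0 < be * rr) by now apply Rmult_lt_0_compat.
  assert (Hzg0 : 0 < zg) by (apply Rmin_glb_lt; lra).
  assert (Hzg : zg <= z) by apply Rmin_l.
  assert (Hzgr : zg / (4 * be) <= rr / 2).
  { apply Rle_trans with (2 * be * rr / (4 * be)); [|right; field; lra].
    apply Rmult_le_compat_r; [left; apply Rinv_0_lt_compat; lra|apply Rmin_r]. }
  set (R0 := Rmin 1 (Rmin (rr / 2) (zg / (160 * be)))).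
  assert (HR0 : 0 < R0) by (repeat apply Rmin_glb_lt; try apply Rdiv_lt_0_compat; lra).
  assert (HR1 : R0 <= 1) by apply Rmin_l.
  assert (HR2 : R0 <= rr / 2) by (eapply Rle_trans; [apply Rmin_r|apply Rmin_l]).
  assert (HR3 : 160 * be * R0 <= zg) by (apply le_of_le_div; [lra|]; eapply Rle_trans; [apply Rmin_r|apply Rmin_r]).
  set (K := Rmin z (zg / 4)).
  assert (HK : 0 < K) by (apply Rmin_glb_lt; lra).
  assert (HKz : K <= z) by apply Rmin_l.
  assert (HKR : 2 * K * R0 <= zg / 2).
  { apply Rle_trans with (2 * (zg / 4) * 1); [|lra]. apply Rmult_le_compat; try lra.
    assert (H := Rmin_r z (zg / 4)). fold K in H. lra. }
  (* The gradient budget is zg / 2: the curvature term takes 7/72 zg, the vertex errors divided by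
     sg0 take zg / 8, and 20 be R0 takes zg / 8. *)
  set (sg0 := zg / (24 * be)).
  assert (Hsg0 : 0 < sg0) by (apply Rdiv_lt_0_compat; lra).
  assert (Hsgz : 0 < sg0 * zg) by now apply Rmult_lt_0_compat.
  assert (HKR0 : 0 < K * R0 ^ 2) by (apply Rmult_lt_0_compat; [easy|now apply pow_lt]).
  destruct (sconv_uc T V (2 * be) B ltac:(lra) HB HucV (K * R0 ^ 2 / 2) ltac:(lra)) as [d2 [Hd2 Hd2']].
  set (ccb := 3 * Cb * Pb + r * B + kap).
  assert (Hccb : 0 <= ccb) by (unfold ccb; lra).
  (* The bounds on h serve, in this order, the modulus of V, the modulus of its envelope, the vertex
     error and the localization. *)
  destruct (exists_below (cons d (cons d2 (cons (sg0 * zg / 16 / (8 * be * Cb ^ 2 + 1)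
      ) (cons (K * R0 ^ 2 / 2 / (kap + 4 * be * Cb ^ 2 + ccb + 1)) nil))))) as [h0 [Hh0 Hh0']].
  { intros a [<-|[<-|[<-|[<-|[]]]]]; try easy; apply Rdiv_lt_0_compat; lra. }
  (* Moving in space by rr uses up half of the tolerance z; the other half is left to the change of
     coefficients in time. *)
  exists (z / 2), h0, (sg0 * zg / 16). split; [lra|]. split; [easy|]. split; [lra|].
  intros x0 y0 p01 p02 t0 E Ht0 Hp01 Hp02 zx zy HVL Hnr h Hh HhT F f1 f2 F11 F12 F22 Q BG HQ HF HFsd HFb Hpar HU.
  assert (L1 := Hh0' d ltac:(simpl; tauto)). assert (L2 := Hh0' d2 ltac:(simpl; tauto)).
  assert (L3 := Hh0' (sg0 * zg / 16 / (8 * be * Cb ^ 2 + 1)) ltac:(simpl; tauto)).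
  assert (L4 := Hh0' (K * R0 ^ 2 / 2 / (kap + 4 * be * Cb ^ 2 + ccb + 1)) ltac:(simpl; tauto)).
  assert (M3 : 8 * be * Cb ^ 2 * h <= sg0 * zg / 16) by (apply small_multiple; lra).
  assert (M4 : (kap + 4 * be * Cb ^ 2 + ccb) * h <= K * R0 ^ 2 / 2) by (apply small_multiple; lra).
  destruct (Hok t0 Ht0 zx zy zx zy) as [[O1 [O2 [O3 [O4 O5]]]] _].
  destruct (cowalk_steps_small rho (sg c zx t0) (bb c zy t0) Cb Q kap Hrho HCb HQ Hkap O1 O2) as [sm [Hsm Hsteps]].
  destruct (archimed_div h sm ltac:(lra) Hsm) as [N0 [HN0 HN]].
  exists N0. split; [easy|]. intros N HNN.
  assert (Hh1 := HN N HNN). destruct (Hsteps _ Hh1) as [S1 S2].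
  destruct (cowalk_covariance rho (sg c zx t0) (bb c zy t0) (h / INR N) Hrho ltac:(lra)) as [W1 [W2 W3]].
  set (w := sqrt (h / INR N)) in *.
  assert (Hl0 : Rabs (lower r (m1 c zx zy t0) (m2 c zy t0) (gm c zx t0) (V zx zy t0) p01 p02) <= 3 * Cb * Pb + r * B).
  { apply lower_bound; try easy. now apply HB. }
  apply (evolve_bound T r rho c Cb Cl L B be V Hr Hrho HCb Hbe Hok HB HucV Hsub x0 y0 p01 p02 t0 Ht0
    Pb K R0 z zg kap rr (t0 + h) E Hp01 Hp02 Hkap HK HKz ltac:(lra) HR0 Hzg ltac:(lra) HKR Hz3
    F f1 f2 F11 F12 F22 Q BG h (sg0 * zg / 16) sg0 N HQ HF HFsd HFb ltac:(lra) eq_refl HhT ltac:(lia)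
    _ _ _ _ W1 W2 W3 S1 S2 Hpar Hsg0).
  - replace ((be / 3 + 2 * be) * sg0) with (7 / 72 * zg) by (unfold sg0; field; lra).
    assert ((sg0 * zg / 16 + 8 * be * Cb ^ 2 * h) / sg0 <= zg / 8).
    { apply Rle_trans with ((sg0 * zg / 16 + sg0 * zg / 16) / sg0); [|right; field; lra].
      apply Rmult_le_compat_r; [left; now apply Rinv_0_lt_compat|lra]. }
    lra.
  - intros t x y Ht.
    assert (H1 := Hd2' x y (t0 + h) x y t ltac:(lra) ltac:(lra)).
    rewrite !Rminus_diag, Rabs_R0 in H1. specialize (H1 Hd2 Hd2 ltac:(apply Rabs_def1; lra)).
    apply Rabs_le_upper in H1. unfold env. assert (H2 := HU x y).
    assert (H3 : Rabs (rate r c be V x0 y0 p01 p02 t0 kap) <= ccb).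
    { unfold rate, ccb. eapply Rle_trans; [apply Rabs_triang|]. rewrite (Rabs_pos_eq kap) by lra.
      apply Rplus_le_compat_r. exact Hl0. }
    apply Rmult_le_compat_r with (r := h) in H3; lra.
  - intros t x y Ht Hx Hy.
    assert (H1 := Hd' zx zy t0 x y t Ht0 ltac:(lra) ltac:(eapply Rle_lt_trans; [exact Hx|easy])
      ltac:(eapply Rle_lt_trans; [exact Hy|easy]) ltac:(apply Rabs_def1; lra)).
    change (base_x be x0 p01) with zx. change (base_y be y0 p02) with zy.
    apply Rabs_def2 in H1. split; [apply Rabs_le; lra|lra].
  - intros t x y Ht HE Hx Hy. change (Rabs (x - zx) <= rr) in Hx. change (Rabs (y - zy) <= rr) in Hy.
    destruct (Hok t ltac:(lra) zx zy x y) as [_ [K1 [K2 [K3 [K4 K5]]]]].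
    destruct (Hnr t ltac:(lra) HE) as [N1 [N2 [N3 [N4 N5]]]].
    assert (HK' : Cl * (Rabs (x - zx) + Rabs (y - zy)) <= z / 2).
    { apply Rle_trans with (Cl * (rr + rr)); [apply Rmult_le_compat_l; lra|lra]. }
    assert (Htri : forall u v q, Rabs (u - v) <= Cl * (Rabs (x - zx) + Rabs (y - zy)) -> Rabs (v - q) <= z / 2 -> Rabs (u - q) <= z).
    { intros u v q A1 A2. replace (u - q) with ((u - v) + (v - q)) by ring.
      eapply Rle_trans; [apply Rabs_triang|]. lra. }
    repeat split; eapply Htri; eassumption.
  - exact HU.
Qed.

End Evolution.

(** * Doubling of variables *)

(** Colours are naturals because [coloured_time_mono] takes a countable union over them. *)
Definition colourable (T : R) (P : R -> R -> Prop) : Prop :=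
  exists j : R -> nat, forall t u, 0 <= t <= T -> 0 <= u <= T -> j u = j t -> P t u.

Lemma colourable_and T P Q : colourable T P -> colourable T Q -> colourable T (fun t u => P t u /\ Q t u).
Proof.
  intros [j Hj] [k Hk]. exists (fun t => to_nat (j t, k t)). intros t u Ht Hu H.
  apply (f_equal of_nat) in H. rewrite !cancel_of_to in H. injection H as H1 H2. split; auto.
Qed.

Lemma colourable_forall T (P : nat -> R -> R -> Prop) : (forall i, colourable T (P i)) ->
  forall n, colourable T (fun t u => forall i, (i < n)%nat -> P i t u).
Proof.
  intros H n. induction n as [|n IH].
  - exists (fun _ => O). intros. lia.
  - destruct (colourable_and _ _ _ IH (H n)) as [j Hj]. exists j. intros t u Ht Hu Htu i Hi.
    destruct (Hj t u Ht Hu Htu) as [H1 H2]. destruct (Nat.eq_dec i n) as [->|Hn]; [easy|apply H1; lia].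
Qed.

Lemma colourable_values T f C eta : 0 < eta -> (forall t, 0 <= t <= T -> Rabs (f t) <= C) ->
  colourable T (fun t u => Rabs (f u - f t) <= eta).
Proof.
  (* The colour is the cell of length eta containing the value. The shift by C makes its index
     nonnegative, where [Z.to_nat] is injective. *)
  intros Heta HC. exists (fun t => Z.to_nat (up ((f t + C) / eta))). intros t u Ht Hu H.
  assert (H0 : forall t, 0 <= t <= T -> (0 <= up ((f t + C) / eta))%Z).
  { intros s Hs. apply le_IZR. destruct (archimed ((f s + C) / eta)) as [A1 _].
    assert (A2 := HC s Hs). apply Rabs_le_lower in A2.
    assert (0 <= (f s + C) / eta) by (apply Rdiv_le_0_compat; lra). lra. }
  apply Z2Nat.inj in H; [|now apply H0|now apply H0].
  destruct (archimed ((f t + C) / eta)) as [A1 A2]. destruct (archimed ((f u + C) / eta)) as [A3 A4].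
  rewrite H in A3, A4.
  assert (E : f u - f t = ((f u + C) / eta - (f t + C) / eta) * eta) by (field; lra).
  rewrite E, Rabs_mult, (Rabs_pos_eq eta) by lra.
  assert (Rabs ((f u + C) / eta - (f t + C) / eta) <= 1) by (apply Rabs_le; lra).
  apply Rle_trans with (1 * eta); [apply Rmult_le_compat_r; lra|lra].
Qed.

Lemma colourable_impl T (P Q : R -> R -> Prop) :
  (forall t u, 0 <= t <= T -> 0 <= u <= T -> P t u -> Q t u) -> colourable T P -> colourable T Q.
Proof. intros H [j Hj]. exists j. intros t u Ht Hu Htu. auto. Qed.

Lemma interval_net Rb step : 0 < step -> exists n (p : nat -> R), forall x, - Rb <= x <= Rb ->
  exists i, (i < n)%nat /\ Rabs (x - p i) <= step.
Proof.
  intros Hstep. exists (Z.to_nat (up (2 * Rb / step)) + 1)%nat, (fun i => - Rb + INR i * step).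
  intros x Hx. exists (Z.to_nat (up ((x + Rb) / step) - 1)).
  destruct (archimed ((x + Rb) / step)) as [A1 A2]. destruct (archimed (2 * Rb / step)) as [A3 A4].
  assert (H0 : 0 <= (x + Rb) / step) by (apply Rdiv_le_0_compat; lra).
  assert (H1 : (x + Rb) / step <= 2 * Rb / step).
  { apply Rmult_le_compat_r; [left; now apply Rinv_0_lt_compat|lra]. }
  assert (Hp : (0 < up ((x + Rb) / step))%Z) by (apply lt_IZR; lra).
  split.
  - assert (up ((x + Rb) / step) - 1 < up (2 * Rb / step))%Z by (apply lt_IZR; rewrite minus_IZR; lra). lia.
  - rewrite INR_IZR_INZ, Z2Nat.id, minus_IZR by lia.
    replace (x - (- Rb + (IZR (up ((x + Rb) / step)) - 1) * step)) with
      (((x + Rb) / step - (IZR (up ((x + Rb) / step)) - 1)) * step) by (field; lra).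
    rewrite Rabs_mult, (Rabs_pos_eq step) by lra.
    assert (Rabs ((x + Rb) / step - (IZR (up ((x + Rb) / step)) - 1)) <= 1) by (apply Rabs_le; lra).
    apply Rle_trans with (1 * step); [apply Rmult_le_compat_r; lra|lra].
Qed.

(** The Lipschitz bounds in space reduce the box to a finite net, and at the net points finitely
    many bounded functions of time are quantized. *)
Lemma coef_colourable T c Cb Cl Rb eta : 0 <= Cl -> coef_ok T c Cb Cl -> 0 < eta ->
  colourable T (fun t u => forall x y, - Rb <= x <= Rb -> - Rb <= y <= Rb -> coef_near c eta x y t u).
Proof.
  intros HCl Hok Heta.
  (* Passing to the net costs eta / 8 per coordinate at each of the two times, in all eta / 2; the
     quantization takes the rest. *)
  set (step := eta / 8 / (Cl + 1)).
  assert (Hstep : 0 < step) by (apply Rdiv_lt_0_compat; lra).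
  assert (Hs : Cl * step <= eta / 8) by (apply small_multiple; [lra|lra|apply Rle_refl]).
  destruct (interval_net Rb step Hstep) as [n [p Hp]].
  apply colourable_impl with (fun t u => forall i, (i < n)%nat -> forall k, (k < n)%nat -> coef_near c (eta / 2) (p i) (p k) t u).
  - intros t u Ht Hu H x y Hx Hy.
    destruct (Hp x Hx) as [i [Hi Hi']]. destruct (Hp y Hy) as [k [Hk Hk']].
    destruct (H i Hi k Hk) as [N1 [N2 [N3 [N4 N5]]]].
    destruct (Hok t Ht (p i) (p k) x y) as [_ [K1 [K2 [K3 [K4 K5]]]]].
    destruct (Hok u Hu (p i) (p k) x y) as [_ [J1 [J2 [J3 [J4 J5]]]]].
    assert (HD : Cl * (Rabs (x - p i) + Rabs (y - p k)) <= eta / 4).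
    { apply Rle_trans with (Cl * (step + step)); [apply Rmult_le_compat_l; lra|lra]. }
    assert (Htri : forall a a' b b', Rabs (a - a') <= Cl * (Rabs (x - p i) + Rabs (y - p k)) ->
      Rabs (b - b') <= Cl * (Rabs (x - p i) + Rabs (y - p k)) -> Rabs (a' - b') <= eta / 2 -> Rabs (a - b) <= eta).
    { intros a a' b b' H1 H2 H3. apply Rabs_le_between in H1. apply Rabs_le_between in H2.
      apply Rabs_le_between in H3. apply Rabs_le. lra. }
    unfold coef_near. repeat split; eapply Htri; eassumption.
  - apply (colourable_forall T (fun i t u => forall k, (k < n)%nat -> coef_near c (eta / 2) (p i) (p k) t u)).
    intros i. apply (colourable_forall T (fun k t u => coef_near c (eta / 2) (p i) (p k) t u)).
    intros k. unfold coef_near.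
    repeat apply colourable_and; apply colourable_values with Cb; try lra; intros t Ht;
      destruct (Hok t Ht (p i) (p k) (p i) (p k)) as [[O1 [O2 [O3 [O4 O5]]]] _]; easy.
Qed.

(** The weight be/4 is the one that [hull_pair] converts into be/3. *)
Definition dbl (V1 V2 : R -> R -> R -> R) (be t : R) (w : R * R * (R * R)) : R :=
  V1 (fst (fst w)) (snd (fst w)) t + V2 (fst (snd w)) (snd (snd w)) t
  - be / 4 * ((fst (fst w) - fst (snd w)) ^ 2 + (snd (fst w) - snd (snd w)) ^ 2).

Definition dblmax (V1 V2 : R -> R -> R -> R) (be t : R) : R := Sup (dbl V1 V2 be t).

Section Doubling.
Variables (T B L Rb : R) (V1 V2 : R -> R -> R -> R).
Hypothesis HB1 : forall x y t, 0 <= t <= T -> Rabs (V1 x y t) <= B.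
Hypothesis HB2 : forall x y t, 0 <= t <= T -> Rabs (V2 x y t) <= B.
Hypothesis Huc1 : ucT T V1.
Hypothesis Huc2 : ucT T V2.

Lemma dblmax_ub be t x y x' y' : 0 < be -> 0 <= t <= T ->
  V1 x y t + V2 x' y' t <= dblmax V1 V2 be t + be / 4 * ((x - x') ^ 2 + (y - y') ^ 2).
Proof.
  intros Hbe Ht. assert (H := Sup_ub (dbl V1 V2 be t) (2 * B) ((x, y), (x', y'))).
  unfold dblmax, dbl in *. simpl fst in H. simpl snd in H.
  assert (H' : V1 x y t + V2 x' y' t - be / 4 * ((x - x') ^ 2 + (y - y') ^ 2) <= Sup (dbl V1 V2 be t)).
  { apply H. intros w. assert (A1 := HB1 (fst (fst w)) (snd (fst w)) t Ht).
    assert (A2 := HB2 (fst (snd w)) (snd (snd w)) t Ht). apply Rabs_le_upper in A1. apply Rabs_le_upper in A2.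
    assert (A3 := sq_sum_pos (be / 4) ltac:(lra) (fst (fst w) - fst (snd w)) (snd (fst w) - snd (snd w))). lra. }
  unfold dbl in H'. lra.
Qed.

Lemma dblmax_le be t m :
  (forall x y x' y', V1 x y t + V2 x' y' t - be / 4 * ((x - x') ^ 2 + (y - y') ^ 2) <= m) -> dblmax V1 V2 be t <= m.
Proof. intros H. apply (Sup_le _ _ ((0, 0), (0, 0))). intros [[x y] [x' y']]. apply H. Qed.

Lemma dblmax_uc be e : 0 < be -> 0 < e -> exists d, 0 < d /\ forall s t, 0 <= s <= T -> 0 <= t <= T -> Rabs (s - t) < d ->
  dblmax V1 V2 be s <= dblmax V1 V2 be t + e.
Proof.
  intros Hbe He.
  destruct (Huc1 (e / 2) ltac:(lra)) as [d1 [Hd1 H1]]. destruct (Huc2 (e / 2) ltac:(lra)) as [d2 [Hd2 H2]].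
  exists (Rmin d1 d2). split; [now apply Rmin_glb_lt|]. intros s t Hs Ht Hst.
  apply dblmax_le. intros x y x' y'. assert (H := dblmax_ub be t x y x' y' Hbe Ht).
  assert (A1 := H1 x y t x y s Ht Hs). assert (A2 := H2 x' y' t x' y' s Ht Hs).
  rewrite !Rminus_diag, Rabs_R0 in A1, A2.
  specialize (A1 Hd1 Hd1 (Rlt_le_trans _ _ _ Hst (Rmin_l _ _))).
  specialize (A2 Hd2 Hd2 (Rlt_le_trans _ _ _ Hst (Rmin_r _ _))).
  apply Rabs_def2 in A1. apply Rabs_def2 in A2. lra.
Qed.

Hypothesis Hup1 : forall x y t, 0 <= t <= T -> V1 x y t <= L - 1.
Hypothesis Hup2 : forall x y t, 0 <= t <= T -> V2 x y t <= L - 1.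
Hypothesis Hfar1 : forall x y t, 0 <= t <= T -> Rb < Rabs x \/ Rb < Rabs y -> V1 x y t <= - L.
Hypothesis Hfar2 : forall x y t, 0 <= t <= T -> Rb < Rabs x \/ Rb < Rabs y -> V2 x y t <= - L.

(** If one of the two points lies outside the box, one function is at most - L and the other at most
    L - 1, so a positive supremum comes from the box. *)
Lemma dblmax_attained be t : 0 < be -> 0 <= t <= T -> 0 < dblmax V1 V2 be t -> exists x y x' y',
  dblmax V1 V2 be t = V1 x y t + V2 x' y' t - be / 4 * ((x - x') ^ 2 + (y - y') ^ 2).
Proof.
  intros Hbe Ht Hpos.
  destruct (bwc_max (distp (distp dist1 dist1) (distp dist1 dist1))
    (fun w => (- Rabs Rb <= fst (fst w) <= Rabs Rb /\ - Rabs Rb <= snd (fst w) <= Rabs Rb) /\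
              (- Rabs Rb <= fst (snd w) <= Rabs Rb /\ - Rabs Rb <= snd (snd w) <= Rabs Rb))
    (dbl V1 V2 be t) ((0, 0), (0, 0))) as [[[x y] [x' y']] [_ Hm]].
  - apply (bwc_prod (distp dist1 dist1) (distp dist1 dist1)
      (fun q => - Rabs Rb <= fst q <= Rabs Rb /\ - Rabs Rb <= snd q <= Rabs Rb)
      (fun q => - Rabs Rb <= fst q <= Rabs Rb /\ - Rabs Rb <= snd q <= Rabs Rb));
    apply (bwc_prod dist1 dist1 (fun x => - Rabs Rb <= x <= Rabs Rb) (fun x => - Rabs Rb <= x <= Rabs Rb));
    apply bwc_interval.
  - intros [[x y] [x' y']] _ e He.
    destruct (Huc1 (e / 4) ltac:(lra)) as [d1 [Hd1 H1]]. destruct (Huc2 (e / 4) ltac:(lra)) as [d2 [Hd2 H2]].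
    assert (Hsq : forall a b, exists d, 0 < d /\ forall a' b', Rabs (a' - a) < d -> Rabs (b' - b) < d ->
       Rabs (be / 4 * (a' - b') ^ 2 - be / 4 * (a - b) ^ 2) <= e / 4).
    { intros a b.
      assert (Hc : continuous (fun v => be / 4 * v ^ 2) (a - b)) by (apply (ex_derive_continuous (fun v => be / 4 * v ^ 2)); auto_derive; easy).
      destruct (proj1 (filterlim_locally _ _) Hc (mkposreal (e / 4) ltac:(lra))) as [d Hd].
      assert (Hd0 := cond_pos d). exists (d / 2). split; [lra|]. intros a' b' Ha Hb. left. apply Hd.
      change (Rabs (a' - b' - (a - b)) < d). apply Rabs_def2 in Ha. apply Rabs_def2 in Hb. apply Rabs_def1; lra. }
    destruct (Hsq x x') as [d3 [Hd3 H3]]. destruct (Hsq y y') as [d4 [Hd4 H4]].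
    destruct (exists_below (cons d1 (cons d2 (cons d3 (cons d4 nil))))) as [d [Hd Hd']].
    { intros a [<-|[<-|[<-|[<-|[]]]]]; easy. }
    exists d. split; [easy|]. intros [[u v] [u' v']] _ Hdist. unfold distp, dist1 in Hdist. simpl fst in Hdist. simpl snd in Hdist.
    assert (L1 := Hd' d1 ltac:(simpl; tauto)). assert (L2 := Hd' d2 ltac:(simpl; tauto)).
    assert (L3 := Hd' d3 ltac:(simpl; tauto)). assert (L4 := Hd' d4 ltac:(simpl; tauto)).
    apply Rmax_Rlt in Hdist. destruct Hdist as [D1 D2]. apply Rmax_Rlt in D1. apply Rmax_Rlt in D2.
    destruct D1 as [Du Dv]. destruct D2 as [Du' Dv'].
    assert (A1 := H1 x y t u v t Ht Ht). assert (A2 := H2 x' y' t u' v' t Ht Ht).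
    rewrite Rminus_diag, Rabs_R0 in A1, A2.
    specialize (A1 ltac:(lra) ltac:(lra) Hd1). specialize (A2 ltac:(lra) ltac:(lra) Hd2).
    assert (A3 := H3 u u' ltac:(lra) ltac:(lra)). assert (A4 := H4 v v' ltac:(lra) ltac:(lra)).
    unfold dbl. simpl fst. simpl snd. apply Rabs_def2 in A1. apply Rabs_def2 in A2.
    apply Rabs_le_between in A3. apply Rabs_le_between in A4. apply Rabs_def1; lra.
  - simpl. assert (H := Rabs_pos Rb). lra.
  - exists x, y, x', y'. change (dblmax V1 V2 be t = dbl V1 V2 be t ((x, y), (x', y'))).
    assert (Hall : forall w, dbl V1 V2 be t w <= Rmax 0 (dbl V1 V2 be t ((x, y), (x', y')))).
    { intros w. destruct w as [[u v] [u' v']].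
      assert (P := sq_sum_pos (be / 4) ltac:(lra) (u - u') (v - v')).
      assert (P1 := Hup1 u v t Ht). assert (P2 := Hup2 u' v' t Ht).
      assert (HRb := Rle_abs Rb).
      destruct (classic (Rb < Rabs u \/ Rb < Rabs v)) as [F|F].
      { eapply Rle_trans; [|apply Rmax_l]. unfold dbl. simpl fst. simpl snd. assert (F' := Hfar1 u v t Ht F). lra. }
      destruct (classic (Rb < Rabs u' \/ Rb < Rabs v')) as [F'|F'].
      { eapply Rle_trans; [|apply Rmax_l]. unfold dbl. simpl fst. simpl snd. assert (F2 := Hfar2 u' v' t Ht F'). lra. }
      eapply Rle_trans; [|apply Rmax_r]. apply Hm. simpl fst. simpl snd.
      assert (Q : forall q, ~ Rb < Rabs q -> - Rabs Rb <= q <= Rabs Rb).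
      { intros q Hq. apply Rabs_le_between. lra. }
      repeat split; apply Q; tauto. }
    unfold dblmax. destruct (Rle_lt_dec (dbl V1 V2 be t ((x, y), (x', y'))) 0) as [Hle|Hgt].
    + rewrite Rmax_left in Hall by easy. exfalso. assert (H := Sup_le _ _ ((0, 0), (0, 0)) Hall).
      unfold dblmax in Hpos. lra.
    + rewrite Rmax_right in Hall by lra. now apply Sup_eq_max.
Qed.

(** Comparison with the diagonal point (x, y, x, y) bounds the penalty by V2 (x', y') - V2 (x, y),
    which is small once the two points are close. *)
Lemma penalty_small e : 0 < e -> exists be0, 0 < be0 /\ forall be, be0 <= be -> forall t x y x' y', 0 <= t <= T ->
  0 < dblmax V1 V2 be t ->
  dblmax V1 V2 be t = V1 x y t + V2 x' y' t - be / 4 * ((x - x') ^ 2 + (y - y') ^ 2) ->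
  be * ((x - x') ^ 2 + (y - y') ^ 2) <= e /\ V2 x' y' t <= V2 x y t + e.
Proof.
  intros He. destruct (Huc2 (e / 4) ltac:(lra)) as [d [Hd Hd']].
  destruct (Rlt_le_dec T 0) as [HT|HT]. { exists 1. split; [lra|]. intros. lra. }
  assert (HB0 : 0 <= B) by (eapply Rle_trans; [apply Rabs_pos|apply (HB1 0 0 0 ltac:(lra))]).
  (* A positive maximum has be / 4 D <= 2 B, so this threshold forces D < d^2. *)
  exists (8 * B / d ^ 2 + 1). assert (Hd2 : 0 < d ^ 2) by now apply pow_lt.
  assert (H8 : 0 <= 8 * B / d ^ 2) by (apply Rdiv_le_0_compat; lra).
  split; [lra|]. intros be Hbe t x y x' y' Ht Hpos Heq.
  set (D := (x - x') ^ 2 + (y - y') ^ 2) in *.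
  assert (HV := dblmax_ub be t x y x y ltac:(lra) Ht). rewrite !Rminus_diag in HV.
  assert (A1 := HB1 x y t Ht). assert (A2 := HB2 x' y' t Ht). apply Rabs_le_upper in A1. apply Rabs_le_upper in A2.
  assert (HD : D < d ^ 2).
  { apply Rnot_le_lt. intros H. assert (H1 : (8 * B / d ^ 2 + 1) * d ^ 2 <= be * D) by (apply Rmult_le_compat; lra).
    replace ((8 * B / d ^ 2 + 1) * d ^ 2) with (8 * B + d ^ 2) in H1 by (field; lra). lra. }
  assert (Hc : forall a b, a ^ 2 + b ^ 2 < d ^ 2 -> Rabs a < d).
  { intros a b H. assert (Hb := pow2_ge_0 b). apply Rnot_le_lt. intros Ha.
    assert (d ^ 2 <= a ^ 2) by (rewrite <- (pow2_abs a); apply pow_incr; lra). lra. }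
  assert (Hx : Rabs (x' - x) < d) by (rewrite Rabs_minus_sym; now apply (Hc _ (y - y'))).
  assert (Hy : Rabs (y' - y) < d) by (rewrite Rabs_minus_sym; apply (Hc _ (x - x')); unfold D in HD; lra).
  assert (HH := Hd' x y t x' y' t Ht Ht Hx Hy ltac:(rewrite Rminus_diag, Rabs_R0; easy)).
  apply Rabs_def2 in HH. lra.
Qed.

End Doubling.

(** Opposite gradients and opposite [gm] leave only differences of coefficients at the two points.
    Each of the three terms is at most 2 Cl k D, and - r (V + V') has a favourable sign. *)
Lemma lower_pair r c1 c2 Cb Cl T t x y x' y' V V' k : 0 <= k -> 0 <= r -> 0 <= T -> 0 <= t <= T -> coef_ok T c1 Cb Cl ->
  (forall x y t, m1 c2 x y t = m1 c1 x y t) -> (forall y t, m2 c2 y t = m2 c1 y t) ->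
  (forall x t, gm c2 x t = - gm c1 x t) -> 0 <= V + V' ->
  lower r (m1 c1 x y t) (m2 c1 y t) (gm c1 x t) V (k * (x - x')) (k * (y - y'))
  + lower r (m1 c2 x' y' t) (m2 c2 y' t) (gm c2 x' t) V' (- (k * (x - x'))) (- (k * (y - y')))
  <= 6 * Cl * k * ((x - x') ^ 2 + (y - y') ^ 2).
Proof.
  intros Hk Hr HT Ht Hok E1 E2 E3 HV. rewrite E1, E2, E3. unfold lower. rewrite Rabs_Ropp.
  destruct (Hok t Ht x' y' x y) as [_ [_ [_ [K1 [K2 K3]]]]].
  set (n := Rabs (x - x') + Rabs (y - y')) in *.
  assert (A1 := Rabs_pos (x - x')). assert (A2 := Rabs_pos (y - y')).
  assert (P1 : Rabs (k * (x - x')) <= k * n).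
  { rewrite Rabs_mult, (Rabs_pos_eq k) by easy. apply Rmult_le_compat_l; unfold n; lra. }
  assert (P2 : Rabs (k * (y - y')) <= k * n).
  { rewrite Rabs_mult, (Rabs_pos_eq k) by easy. apply Rmult_le_compat_l; unfold n; lra. }
  assert (P3 : Rabs (Rabs (k * (x - x'))) <= k * n) by now rewrite Rabs_Rabsolu.
  assert (Q1 := Rabs_prod_le _ _ _ _ K1 P1). assert (Q2 := Rabs_prod_le _ _ _ _ K2 P2).
  assert (Q3 := Rabs_prod_le _ _ _ _ K3 P3).
  apply Rabs_le_upper in Q1. apply Rabs_le_upper in Q2. apply Rabs_le_upper in Q3.
  assert (HrV : 0 <= r * (V + V')) by now apply Rmult_le_pos.
  assert (HCl : 0 <= Cl * n) by (eapply Rle_trans; [apply Rabs_pos|exact K1]).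
  assert (Hn2 : Cl * n * (k * n) <= 2 * Cl * k * ((x - x') ^ 2 + (y - y') ^ 2)).
  { rewrite <- (pow2_abs (x - x')), <- (pow2_abs (y - y')).
    destruct (Req_dec n 0) as [Hn|Hn].
    - rewrite Hn. assert (Z1 : Rabs (x - x') = 0) by (unfold n in Hn; lra). assert (Z2 : Rabs (y - y') = 0) by (unfold n in Hn; lra).
      rewrite Z1, Z2. right. ring.
    - assert (Hn0 : 0 < n) by (unfold n in *; lra).
      assert (HCl0 : 0 <= Cl) by (apply Rmult_le_reg_r with n; lra).
      replace (Cl * n * (k * n)) with (Cl * k * n ^ 2) by ring.
      replace (2 * Cl * k * (Rabs (x - x') ^ 2 + Rabs (y - y') ^ 2)) with
        (Cl * k * (2 * (Rabs (x - x') ^ 2 + Rabs (y - y') ^ 2))) by ring.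
      apply Rmult_le_compat_l; [now apply Rmult_le_pos|]. unfold n.
      assert (H := pow2_ge_0 (Rabs (x - x') - Rabs (y - y'))). lra. }
  lra.
Qed.

(** The difference of the coupled walks is a walk with volatilities s - s' and b - b', whose
    variance feeds the penalty. The weight be/3 corresponds to e = 3 / (2 be) in
    [walks_coupling]. *)
Lemma cowalk_coupling rho s b s' b' be m h N F G : -1 <= rho <= 1 -> 0 < be -> 0 < h -> (0 < N)%nat ->
  (forall x y x' y', F x y + G x' y' <= m + be / 3 * ((x - x') ^ 2 + (y - y') ^ 2)) ->
  forall x y x' y', cowalk rho s b h N F x y + cowalk rho s' b' h N G x' y' <=
    m + be / 3 * ((x - x') ^ 2 + (y - y') ^ 2) + h * (be / 3 * ((s - s') ^ 2 + (b - b') ^ 2)).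
Proof.
  intros Hrho Hbe Hh HN H x y x' y'.
  assert (HNR : 0 < INR N) by now apply lt_0_INR.
  assert (Hh1 : 0 < h / INR N) by (apply Rdiv_lt_0_compat; easy).
  unfold cowalk. set (w := sqrt (h / INR N)). set (a := sqrt (1 - rho ^ 2)).
  eapply Rle_trans; [apply (walks_coupling _ _ _ _ _ _ _ _ (3 / (2 * be)) m N F G)|].
  - apply Rdiv_lt_0_compat; lra.
  - intros u v u' v'. eapply Rle_trans; [apply H|]. right. field. lra.
  - destruct (cowalk_covariance rho (s - s') (b - b') (h / INR N) Hrho ltac:(lra)) as [W1 [_ W3]].
    fold w a in W1, W3.
    replace ((w * s - w * s') ^ 2) with ((w * (s - s')) ^ 2) by ring.
    replace ((w * ((rho + a) * b) - w * ((rho + a) * b')) ^ 2) with ((w * ((rho + a) * (b - b'))) ^ 2) by ring.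
    replace ((w * ((rho - a) * b) - w * ((rho - a) * b')) ^ 2) with ((w * ((rho - a) * (b - b'))) ^ 2) by ring.
    set (q1 := (w * (s - s')) ^ 2) in *. set (q2 := (w * ((rho + a) * (b - b'))) ^ 2) in *.
    set (q3 := (w * ((rho - a) * (b - b'))) ^ 2) in *.
    replace (q1 + q2 + q1 + q3) with (2 * (h / INR N) * ((s - s') ^ 2 + (b - b') ^ 2)) by lra.
    right. field. lra.
Qed.

(** * Backward growth of the doubled maximum *)

Section Comparison.
Variables (T r rho : R) (c1 c2 : coef) (Cb Cl L B Rb : R) (V1 V2 : R -> R -> R -> R).
Hypothesis HT : 0 < T.
Hypothesis Hr : 0 <= r.
Hypothesis Hrho : -1 <= rho <= 1.
Hypothesis HCb : 0 <= Cb.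
Hypothesis HCl : 0 <= Cl.
Hypothesis Hok1 : coef_ok T c1 Cb Cl.
Hypothesis Hok2 : coef_ok T c2 Cb Cl.
Hypothesis Esg : forall x t, sg c2 x t = sg c1 x t.
Hypothesis Ebb : forall y t, bb c2 y t = bb c1 y t.
Hypothesis Em1 : forall x y t, m1 c2 x y t = m1 c1 x y t.
Hypothesis Em2 : forall y t, m2 c2 y t = m2 c1 y t.
Hypothesis Egm : forall x t, gm c2 x t = - gm c1 x t.
Hypothesis HB1 : forall x y t, 0 <= t <= T -> Rabs (V1 x y t) <= B.
Hypothesis HB2 : forall x y t, 0 <= t <= T -> Rabs (V2 x y t) <= B.
Hypothesis Huc1 : ucT T V1.
Hypothesis Huc2 : ucT T V2.
Hypothesis Hup1 : forall x y t, 0 <= t <= T -> V1 x y t <= L - 1.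
Hypothesis Hup2 : forall x y t, 0 <= t <= T -> V2 x y t <= L - 1.
Hypothesis Hfar1 : forall x y t, 0 <= t <= T -> Rb < Rabs x \/ Rb < Rabs y -> V1 x y t <= - L.
Hypothesis Hfar2 : forall x y t, 0 <= t <= T -> Rb < Rabs x \/ Rb < Rabs y -> V2 x y t <= - L.
Hypothesis Hsub1 : jsub T r rho c1 (fun v => - L < v) V1.
Hypothesis Hsub2 : jsub T r rho c2 (fun v => - L < v) V2.

Let M (be t : R) : R := dblmax V1 V2 be t.
(** Majorizes 3 Cl from the lower-order terms plus 4/3 Cl^2 from the volatilities in the coupled
    walks. *)
Let Cd : R := 6 * Cl + 2 * Cl ^ 2.

(** [evolution] is applied to both functions at the maximum point and the two walks are coupled. The
    Lipschitz coefficients leave an error proportional to the penalty, which is small for large be.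
    The colouring and C do not depend on t0. *)
Lemma time_step be kap : 0 < be -> 0 < kap -> exists j C, 0 <= C /\ forall t0, 0 < t0 < T ->
  0 < M be t0 -> forall x y x' y',
  M be t0 = V1 x y t0 + V2 x' y' t0 - be / 4 * ((x - x') ^ 2 + (y - y') ^ 2) ->
  exists h0, 0 < h0 /\ forall h, 0 < h < h0 ->
  M be t0 <= M be (t0 + h) + (Cd * (be * ((x - x') ^ 2 + (y - y') ^ 2)) + 6 * kap) * h
    + C * (h - (theta (fun u : R => j u = j t0 :> nat) 0 (t0 + h) - theta (fun u => j u = j t0) 0 t0)).
Proof.
  intros Hbe Hkap.
  assert (HB0 : 0 <= B) by (eapply Rle_trans; [apply Rabs_pos|apply (HB1 0 0 0 ltac:(lra))]).
  assert (H8B : 0 <= 8 * B / be) by (apply Rdiv_le_0_compat; lra).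
  (* A positive maximum has D <= 8 B / be, and |d| <= 1 + d^2 then bounds the gradients be / 2 dx
     and be / 2 dy. *)
  set (Pb := be / 2 * (1 + 8 * B / be)).
  assert (HPb : 0 <= Pb) by (apply Rmult_le_pos; lra).
  destruct (evolution T r rho c1 Cb Cl L B be V1 Hr Hrho HCb HCl Hbe Hok1 HB1 Huc1 Hsub1 kap Pb Hkap HPb)
    as [eta1 [h1 [nu1 [Heta1 [Hh1 [Hnu1 Hev1]]]]]].
  destruct (evolution T r rho c2 Cb Cl L B be V2 Hr Hrho HCb HCl Hbe Hok2 HB2 Huc2 Hsub2 kap Pb Hkap HPb)
    as [eta2 [h2 [nu2 [Heta2 [Hh2 [Hnu2 Hev2]]]]]].
  destruct (colourable_and _ _ _ (coef_colourable T c1 Cb Cl Rb eta1 HCl Hok1 Heta1)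
    (coef_colourable T c2 Cb Cl Rb eta2 HCl Hok2 Heta2)) as [j Hj].
  set (nu := Rmin nu1 nu2). assert (Hnu : 0 < nu) by now apply Rmin_glb_lt.
  assert (Hn1 : nu <= nu1) by apply Rmin_l. assert (Hn2 : nu <= nu2) by apply Rmin_r.
  exists j, (2 * time_const r Cb B be Pb). split.
  { assert (A1 := pow2_ge_0 Cb). unfold time_const.
    assert (0 <= 3 * Cb ^ 2 * (4 * be + 2)) by (apply Rmult_le_pos; lra).
    assert (0 <= 3 * Cb * (Pb + 1)) by (apply Rmult_le_pos; lra).
    assert (0 <= 3 * Cb * Pb) by (apply Rmult_le_pos; lra).
    assert (0 <= r * B) by now apply Rmult_le_pos.
    assert (0 <= 4 * be * Cb ^ 2) by (apply Rmult_le_pos; lra). lra. }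
  intros t0 Ht0 Hpos x y x' y' Hmax.
  destruct (sconv_uc T V1 (2 * be) B ltac:(lra) HB1 Huc1 (nu / 8) ltac:(lra)) as [d1 [Hd1 U1]].
  destruct (sconv_uc T V2 (2 * be) B ltac:(lra) HB2 Huc2 (nu / 8) ltac:(lra)) as [d2 [Hd2 U2]].
  destruct (dblmax_uc T B V1 V2 HB1 HB2 Huc1 Huc2 be (nu / 8) Hbe ltac:(lra)) as [d3 [Hd3 U3]].
  destruct (exists_below (cons h1 (cons h2 (cons d1 (cons d2 (cons d3 (cons (T - t0) (cons (nu / 8 / (4 * kap + 1)) nil))))))))
    as [h0 [Hh0 Hh0']].
  { intros a [<-|[<-|[<-|[<-|[<-|[<-|[<-|[]]]]]]]]; try lra; apply Rdiv_lt_0_compat; lra. }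
  exists h0. split; [easy|]. intros h Hh.
  assert (L1 := Hh0' h1 ltac:(simpl; tauto)). assert (L2 := Hh0' h2 ltac:(simpl; tauto)).
  assert (L3 := Hh0' d1 ltac:(simpl; tauto)). assert (L4 := Hh0' d2 ltac:(simpl; tauto)).
  assert (L5 := Hh0' d3 ltac:(simpl; tauto)). assert (L6 := Hh0' (T - t0) ltac:(simpl; tauto)).
  assert (L7 := Hh0' (nu / 8 / (4 * kap + 1)) ltac:(simpl; tauto)). clear Hh0'.
  assert (Hkh : 4 * kap * h <= nu / 8) by (apply small_multiple; lra).
  set (s := t0 + h).
  assert (Hs : 0 <= s <= T) by (unfold s; lra). assert (Ht : 0 <= t0 <= T) by lra.
  assert (Hst : Rabs (s - t0) < h0) by (unfold s; apply Rabs_def1; lra).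
  set (dx := x - x') in *. set (dy := y - y') in *. set (D := dx ^ 2 + dy ^ 2) in *.
  assert (A1 := Hup1 x y t0 Ht). assert (A2 := Hup2 x' y' t0 Ht).
  assert (Hdx2 := pow2_ge_0 dx). assert (Hdy2 := pow2_ge_0 dy).
  assert (HbD : 0 <= be * D) by (apply Rmult_le_pos; unfold D; lra).
  assert (Hxy : - Rb <= x <= Rb /\ - Rb <= y <= Rb).
  { split; apply Rabs_le_between; apply Rnot_lt_le; intros H;
      [assert (H' := Hfar1 x y t0 Ht (or_introl H))|assert (H' := Hfar1 x y t0 Ht (or_intror H))]; lra. }
  assert (Hxy' : - Rb <= x' <= Rb /\ - Rb <= y' <= Rb).
  { split; apply Rabs_le_between; apply Rnot_lt_le; intros H;
      [assert (H' := Hfar2 x' y' t0 Ht (or_introl H))|assert (H' := Hfar2 x' y' t0 Ht (or_intror H))]; lra. }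
  assert (HDB : D <= 8 * B / be).
  { assert (Q1 := HB1 x y t0 Ht). assert (Q2 := HB2 x' y' t0 Ht). apply Rabs_le_upper in Q1. apply Rabs_le_upper in Q2.
    apply Rmult_le_reg_l with be; [easy|]. replace (be * (8 * B / be)) with (8 * B) by (field; lra). lra. }
  assert (HpB : forall d, d ^ 2 <= D -> Rabs (be / 2 * d) <= Pb).
  { intros d Hd. rewrite Rabs_mult, (Rabs_pos_eq (be / 2)) by lra. apply Rmult_le_compat_l; [lra|].
    assert (H := pow2_ge_0 (Rabs d - 1)). assert (H' := Rabs_pos d). rewrite <- (pow2_abs d) in Hd. lra. }
  assert (Hp1 := HpB dx ltac:(unfold D; lra)). assert (Hp2 := HpB dy ltac:(unfold D; lra)).
  assert (Hm : forall u v u' v', V1 u v s + V2 u' v' s <= M be s + be / 4 * ((u - u') ^ 2 + (v - v') ^ 2)).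
  { intros. now apply (dblmax_ub T B V1 V2 HB1 HB2). }
  assert (Hhull := hull_pair be B (fun u v => V1 u v s) (fun u v => V2 u v s) (M be s) Hbe
    (fun u v => HB1 u v s Hs) (fun u v => HB2 u v s Hs) Hm).
  set (f1 := hull be (fun u v => V1 u v s)) in *. set (f2 := hull be (fun u v => V2 u v s)) in *.
  assert (Hf1 : forall u v, Rabs (f1 u v) <= B) by (apply hull_bound; [easy|intros; now apply HB1]).
  assert (Hf2 : forall u v, Rabs (f2 u v) <= B) by (apply hull_bound; [easy|intros; now apply HB2]).
  assert (Hkap' : 0 < kap * h) by (apply Rmult_lt_0_compat; lra).
  destruct (smoothing f1 B (4 * be) (kap * h)) as [F1 [g1 [g2 [G11 [G12 [G22 [Q [HQ [HF [HFsd HFc]]]]]]]]]]; try easy.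
  { apply (hull_unif_cont be B); [easy|intros; now apply HB1|now apply ucT_slice with T]. }
  { apply (hull_second_diff be B); [easy|intros; now apply HB1]. }
  destruct (smoothing f2 B (4 * be) (kap * h)) as [F2 [g1' [g2' [G11' [G12' [G22' [Q' [HQ' [HF' [HFsd' HFc']]]]]]]]]]; try easy.
  { apply (hull_unif_cont be B); [easy|intros; now apply HB2|now apply ucT_slice with T]. }
  { apply (hull_second_diff be B); [easy|intros; now apply HB2]. }
  assert (HFu : forall u v, sconv (2 * be) (fun u v => V1 u v s) u v <= F1 u v + kap * h).
  { intros u v. assert (H1 := hull_above be B (fun u v => V1 u v s) Hbe (fun u v => HB1 u v s Hs) u v). fold f1 in H1.
    assert (H2 := HFc u v). apply Rabs_le_lower in H2. lra. }
  assert (HFu' : forall u v, sconv (2 * be) (fun u v => V2 u v s) u v <= F2 u v + kap * h).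
  { intros u v. assert (H1 := hull_above be B (fun u v => V2 u v s) Hbe (fun u v => HB2 u v s Hs) u v). fold f2 in H1.
    assert (H2 := HFc' u v). apply Rabs_le_lower in H2. lra. }
  assert (HFb : forall u v, Rabs (F1 u v) <= B + kap * h).
  { intros u v. replace (F1 u v) with ((F1 u v - f1 u v) + f1 u v) by ring. eapply Rle_trans; [apply Rabs_triang|].
    assert (H1 := HFc u v). assert (H2 := Hf1 u v). lra. }
  assert (HFb' : forall u v, Rabs (F2 u v) <= B + kap * h).
  { intros u v. replace (F2 u v) with ((F2 u v - f2 u v) + f2 u v) by ring. eapply Rle_trans; [apply Rabs_triang|].
    assert (H1 := HFc' u v). assert (H2 := Hf2 u v). lra. }
  assert (Hpair : forall u v u' v', F1 u v + F2 u' v' <= (M be s + 2 * (kap * h)) + be / 3 * ((u - u') ^ 2 + (v - v') ^ 2)).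
  { intros u v u' v'. assert (H1 := HFc u v). assert (H2 := HFc' u' v'). apply Rabs_le_upper in H1. apply Rabs_le_upper in H2.
    assert (H3 := Hhull u v u' v'). lra. }
  (* The shift p / (4 be) with p = be / 2 dx is dx / 8, so the base points of these vertices are the
     maximum points. Their distance is 3/4 dx, where be/3 |.|^2 has precisely the gradient be / 2
     dx. *)
  set (wx := x - dx / 8). set (wy := y - dy / 8). set (wx' := x' + dx / 8). set (wy' := y' + dy / 8).
  set (S1 := sconv (2 * be) (fun u v => V1 u v t0) wx wy). set (S2 := sconv (2 * be) (fun u v => V2 u v t0) wx' wy').
  assert (HS1 : V1 x y t0 - be / 32 * D <= S1).
  { assert (H := sconv_ge (2 * be) B ltac:(lra) (fun u v => V1 u v t0) wx wy x y (fun u v => Rabs_le_upper _ _ (HB1 u v t0 Ht))).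
    cbv beta in H. fold S1 in H. unfold wx, wy in H. unfold D. lra. }
  assert (HS2 : V2 x' y' t0 - be / 32 * D <= S2).
  { assert (H := sconv_ge (2 * be) B ltac:(lra) (fun u v => V2 u v t0) wx' wy' x' y' (fun u v => Rabs_le_upper _ _ (HB2 u v t0 Ht))).
    cbv beta in H. fold S2 in H. unfold wx', wy' in H. unfold D. lra. }
  (* Here 3/16 = 1/4 - 2/32, which coincides with 1/3 (3/4)^2. So at the vertices the inequality for
     the regularized pair is nearly an equality. *)
  assert (HSS : M be t0 + 3 / 16 * (be * D) <= S1 + S2) by lra.
  assert (HFw : S1 - nu / 8 - kap * h <= F1 wx wy).
  { assert (H := U1 wx wy t0 wx wy s Ht Hs). rewrite !Rminus_diag, Rabs_R0 in H.
    specialize (H Hd1 Hd1 ltac:(lra)). fold S1 in H. apply Rabs_le_lower in H. assert (H' := HFu wx wy). lra. }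
  assert (HFw' : S2 - nu / 8 - kap * h <= F2 wx' wy').
  { assert (H := U2 wx' wy' t0 wx' wy' s Ht Hs). rewrite !Rminus_diag, Rabs_R0 in H.
    specialize (H Hd2 Hd2 ltac:(lra)). fold S2 in H. apply Rabs_le_lower in H. assert (H' := HFu' wx' wy'). lra. }
  assert (HMs : M be s <= M be t0 + nu / 8) by (apply U3; lra).
  (* The error consists of nu / 8 for each envelope, nu / 8 for M and 4 kap h for the smoothing,
     altogether at most nu / 2. *)
  assert (Hpar : forall e d, F1 (wx + e) (wy + d) <= F1 wx wy + be / 2 * dx * e + be / 2 * dy * d + be / 3 * (e ^ 2 + d ^ 2) + nu).
  { intros e d. assert (H := Hpair (wx + e) (wy + d) wx' wy').
    replace (wx + e - wx') with (3 / 4 * dx + e) in H by (unfold wx, wx', dx; field).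
    replace (wy + d - wy') with (3 / 4 * dy + d) in H by (unfold wy, wy', dy; field). unfold D in HSS. lra. }
  assert (Hpar' : forall e d, F2 (wx' + e) (wy' + d) <=
    F2 wx' wy' + - (be / 2 * dx) * e + - (be / 2 * dy) * d + be / 3 * (e ^ 2 + d ^ 2) + nu).
  { intros e d. assert (H := Hpair wx wy (wx' + e) (wy' + d)).
    replace (wx - (wx' + e)) with (3 / 4 * dx - e) in H by (unfold wx, wx', dx; field).
    replace (wy - (wy' + d)) with (3 / 4 * dy - d) in H by (unfold wy, wy', dy; field). unfold D in HSS. lra. }
  assert (Ex : wx + be / 2 * dx / (4 * be) = x) by (unfold wx; field; lra).
  assert (Ey : wy + be / 2 * dy / (4 * be) = y) by (unfold wy; field; lra).
  assert (Ex' : wx' + - (be / 2 * dx) / (4 * be) = x') by (unfold wx'; field; lra).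
  assert (Ey' : wy' + - (be / 2 * dy) / (4 * be) = y') by (unfold wy'; field; lra).
  assert (R1 := Hev1 wx wy (be / 2 * dx) (be / 2 * dy) t0 (fun u => j u = j t0) Ht Hp1 Hp2).
  cbv zeta in R1. rewrite Ex, Ey in R1.
  specialize (R1 ltac:(lra) (fun t Htt E => proj1 (Hj t0 t Ht Htt E) x y (proj1 Hxy) (proj2 Hxy)) h ltac:(lra) ltac:(unfold s in Hs; lra)
    F1 g1 g2 G11 G12 G22 Q (B + kap * h) HQ HF HFsd HFb
    (fun e d => Rle_trans _ _ _ (Hpar e d) (Rplus_le_compat_l _ _ _ Hn1)) HFu).
  assert (R2 := Hev2 wx' wy' (- (be / 2 * dx)) (- (be / 2 * dy)) t0 (fun u => j u = j t0) Ht
    ltac:(rewrite Rabs_Ropp; exact Hp1) ltac:(rewrite Rabs_Ropp; exact Hp2)).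
  cbv zeta in R2. rewrite Ex', Ey' in R2.
  specialize (R2 ltac:(lra) (fun t Htt E => proj2 (Hj t0 t Ht Htt E) x' y' (proj1 Hxy') (proj2 Hxy')) h ltac:(lra) ltac:(unfold s in Hs; lra)
    F2 g1' g2' G11' G12' G22' Q' (B + kap * h) HQ' HF' HFsd' HFb'
    (fun e d => Rle_trans _ _ _ (Hpar' e d) (Rplus_le_compat_l _ _ _ Hn2)) HFu').
  destruct R1 as [N1 [HN1 R1]]. destruct R2 as [N2 [HN2 R2]].
  (* Coupling requires the same number of steps for both walks. *)
  specialize (R1 (N1 + N2)%nat ltac:(lia)). specialize (R2 (N1 + N2)%nat ltac:(lia)).
  fold S1 in R1. fold S2 in R2. fold s in R1, R2. fold s.
  assert (Hc := cowalk_coupling rho (sg c1 x t0) (bb c1 y t0) (sg c2 x' t0) (bb c2 y' t0) be (M be s + 2 * (kap * h)) h (N1 + N2)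
    F1 F2 Hrho Hbe ltac:(lra) ltac:(lia) Hpair wx wy wx' wy').
  replace (wx - wx') with (3 / 4 * dx) in Hc by (unfold wx, wx', dx; field).
  replace (wy - wy') with (3 / 4 * dy) in Hc by (unfold wy, wy', dy; field).
  rewrite Esg, Ebb in Hc. rewrite Esg, Ebb in R2.
  assert (Hlow := lower_pair r c1 c2 Cb Cl T t0 x y x' y' (V1 x y t0) (V2 x' y' t0) (be / 2) ltac:(lra) Hr ltac:(lra) Ht Hok1
    Em1 Em2 Egm ltac:(lra)).
  fold dx dy in Hlow. fold D in Hlow.
  set (l1 := lower r (m1 c1 x y t0) (m2 c1 y t0) (gm c1 x t0) (V1 x y t0) (be / 2 * dx) (be / 2 * dy)) in *.
  set (l2 := lower r (m1 c2 x' y' t0) (m2 c2 y' t0) (gm c2 x' t0) (V2 x' y' t0) (- (be / 2 * dx)) (- (be / 2 * dy))) in *.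
  assert (Hcoef : (sg c1 x t0 - sg c1 x' t0) ^ 2 + (bb c1 y t0 - bb c1 y' t0) ^ 2 <= 4 * Cl ^ 2 * D).
  { destruct (Hok1 t0 Ht x' y' x y) as [_ [K1 [K2 _]]]. fold dx dy in K1, K2.
    assert (HnD : (Rabs dx + Rabs dy) ^ 2 <= 2 * D).
    { unfold D. rewrite <- (pow2_abs dx), <- (pow2_abs dy). assert (H := pow2_ge_0 (Rabs dx - Rabs dy)). lra. }
    assert (Hsq : forall q, Rabs q <= Cl * (Rabs dx + Rabs dy) -> q ^ 2 <= Cl ^ 2 * (2 * D)).
    { intros q Hq. rewrite <- (pow2_abs q). apply Rle_trans with ((Cl * (Rabs dx + Rabs dy)) ^ 2).
      - apply pow_incr. split; [apply Rabs_pos|easy].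
      - rewrite Rpow_mult_distr. apply Rmult_le_compat_l; [apply pow2_ge_0|easy]. }
    assert (X1 := Hsq _ K1). assert (X2 := Hsq _ K2). lra. }
  assert (Hcoef' : h * (be / 3 * ((sg c1 x t0 - sg c1 x' t0) ^ 2 + (bb c1 y t0 - bb c1 y' t0) ^ 2)) <= h * (be / 3 * (4 * Cl ^ 2 * D))).
  { apply Rmult_le_compat_l; [lra|]. apply Rmult_le_compat_l; lra. }
  assert (Hlow' : (l1 + l2) * h <= 6 * Cl * (be / 2) * D * h) by (apply Rmult_le_compat_r; lra).
  assert (HCD : 0 <= Cl * (be * D) * h) by (apply Rmult_le_pos; [now apply Rmult_le_pos|lra]).
  assert (HCD2 : 0 <= Cl ^ 2 * (be * D) * h) by (apply Rmult_le_pos; [apply Rmult_le_pos; [apply pow2_ge_0|easy]|lra]).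
  (* The terms 3/16 be D on both sides cancel. Of the 6 kap h, two come from [Hpair] and two from
     each evolution. *)
  unfold Cd. unfold D in *. lra.
Qed.

Hypothesis Hend : forall x y, V1 x y T + V2 x y T <= 0.

(** The positive part of M is propagated, because [time_step] speaks only of times with M > 0. The
    parameter be is fixed before the colouring and C, which depend on it. *)
Lemma truncated_comparison x y t : 0 <= t <= T -> V1 x y t + V2 x y t <= 0.
Proof.
  intros Ht. apply le_epsilon. intros e He.
  assert (HCd : 0 <= Cd).
  { assert (H := pow2_ge_0 Cl). unfold Cd. lra. }
  (* Over the time T the penalty error contributes e / 4 and 6 kap another e / 4; the terminal time
     adds at most e / 4. *)
  set (e1 := Rmin (e / 4) (e / 4 / T / (Cd + 1))). set (kap := e / 24 / T).
  assert (He1 : 0 < e1).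
  { apply Rmin_glb_lt; [lra|]. apply Rdiv_lt_0_compat; [apply Rdiv_lt_0_compat|]; lra. }
  assert (Hkap : 0 < kap) by (apply Rdiv_lt_0_compat; lra).
  assert (HCe : Cd * e1 <= e / 4 / T) by (apply small_multiple; [lra|lra|apply Rmin_r]).
  destruct (penalty_small T B V1 V2 HB1 HB2 Huc2 e1 He1) as [be [Hbe Hpen]].
  specialize (Hpen be (Rle_refl be)).
  destruct (time_step be kap Hbe Hkap) as [j [C [HC Hstep]]].
  set (k := Cd * e1 + 6 * kap).
  assert (Hk0 : 0 <= k) by (assert (0 <= Cd * e1) by (apply Rmult_le_pos; lra); unfold k; lra).
  assert (HkT : k * T <= e / 2).
  { apply Rle_trans with ((e / 4 / T + 6 * kap) * T); [apply Rmult_le_compat_r; unfold k; lra|].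
    right. unfold kap. field. lra. }
  assert (Hatt : forall s, 0 <= s <= T -> 0 < M be s -> exists x y x' y',
     M be s = V1 x y s + V2 x' y' s - be / 4 * ((x - x') ^ 2 + (y - y') ^ 2)).
  { intros s Hs Hpos. now apply (dblmax_attained T L Rb V1 V2 Huc1 Huc2 Hup1 Hup2 Hfar1 Hfar2). }
  assert (Hmono : Rmax 0 (M be t) <= Rmax 0 (M be T) + k * (T - t)).
  { apply (coloured_time_mono T C k j (fun t => Rmax 0 (M be t)) HT HC); try lra.
    - intros s Hs eps Heps.
      destruct (dblmax_uc T B V1 V2 HB1 HB2 Huc1 Huc2 be (eps / 2) Hbe ltac:(lra)) as [d [Hd Hd']].
      exists d. split; [easy|]. intros s' Hs' Hss.
      assert (A1 := Hd' s' s Hs' Hs Hss). rewrite Rabs_minus_sym in Hss. assert (A2 := Hd' s s' Hs Hs' Hss).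
      fold (M be s) (M be s') in A1, A2. eapply Rle_lt_trans; [apply Rmax_lip|].
      apply Rabs_def1; lra.
    - intros s Hs. destruct (Rle_lt_dec (M be s) 0) as [Hneg|Hpos].
      + exists (T - s). split; [lra|]. intros h Hh. rewrite Rmax_left by easy.
        assert (P := Rmax_l 0 (M be (s + h))).
        assert (Th := theta_incr (fun u => j u = j s) 0 s (s + h) ltac:(lra) ltac:(lra)).
        assert (0 <= k * h) by (apply Rmult_le_pos; lra).
        assert (0 <= C * (h - (theta (fun u => j u = j s) 0 (s + h) - theta (fun u => j u = j s) 0 s)))
          by (apply Rmult_le_pos; lra). lra.
      + destruct (Hatt s ltac:(lra) Hpos) as [u [v [u' [v' Hmax]]]].
        destruct (Hstep s Hs Hpos u v u' v' Hmax) as [h0 [Hh0 Hh0']].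
        destruct (Hpen s u v u' v' ltac:(lra) Hpos Hmax) as [HbD _].
        exists h0. split; [easy|]. intros h Hh. rewrite Rmax_right by lra.
        eapply Rle_trans; [apply (Hh0' h Hh)|].
        assert (P := Rmax_r 0 (M be (s + h))).
        apply Rplus_le_compat_r. apply Rplus_le_compat; [easy|]. apply Rmult_le_compat_r; [lra|].
        unfold k. apply Rplus_le_compat_r. now apply Rmult_le_compat_l. }
  assert (HMT : Rmax 0 (M be T) <= e / 4).
  { apply Rmax_lub; [lra|]. destruct (Rle_lt_dec (M be T) 0) as [Hneg|Hpos]; [lra|].
    destruct (Hatt T ltac:(lra) Hpos) as [u [v [u' [v' Hmax]]]].
    destruct (Hpen T u v u' v' ltac:(lra) Hpos Hmax) as [_ HV].
    assert (H := Hend u v). assert (He4 : e1 <= e / 4) by apply Rmin_l.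
    assert (P := sq_sum_pos (be / 4) ltac:(lra) (u - u') (v - v')). lra. }
  assert (Hub := dblmax_ub T B V1 V2 HB1 HB2 be t x y x y Hbe Ht). fold (M be t) in Hub. rewrite !Rminus_diag in Hub.
  assert (P := Rmax_r 0 (M be t)).
  assert (k * (T - t) <= k * T) by (apply Rmult_le_compat_l; lra). lra.
Qed.

End Comparison.

(** * Comparison of solutions *)

Lemma contT_minus_exp_ch T U A del : contT T U ->
  contT T (fun x y t => U x y t - del * exp (A * (T - t)) * (ch x + ch y)).
Proof.
  intros HU x y t Ht e He.
  assert (Hc : forall f : R -> R, (forall s, ex_derive f s) -> forall v eta, 0 < eta -> exists d, 0 < d /\
     forall v', Rabs (v' - v) < d -> Rabs (f v' - f v) < eta).
  { intros f Hf v eta Heta. assert (Hv := ex_derive_continuous f v (Hf v)).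
    destruct (proj1 (filterlim_locally _ _) Hv (mkposreal eta Heta)) as [d Hd].
    exists d. split; [apply cond_pos|]. intros v' Hv'. apply Hd. exact Hv'. }
  set (E := fun s => del * exp (A * (T - s))).
  set (S := ch x + ch y).
  assert (HS := Rabs_pos S). assert (HE := Rabs_pos (E t)).
  set (e1 := e / 2 / (2 * Rabs (E t) + Rabs S + 3)).
  set (eta := Rmin 1 e1).
  assert (Heta : 0 < eta) by (apply Rmin_glb_lt; [lra|apply Rdiv_lt_0_compat; lra]).
  assert (Hch : forall s, ex_derive ch s) by (intros s; exists (sh s); apply ch_derive).
  destruct (HU x y t Ht (e / 2) ltac:(lra)) as [d1 [Hd1 H1]].
  destruct (Hc ch Hch x eta Heta) as [d2 [Hd2 H2]]. destruct (Hc ch Hch y eta Heta) as [d3 [Hd3 H3]].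
  destruct (Hc E ltac:(intros s; unfold E; auto_derive; easy) t eta Heta) as [d4 [Hd4 H4]].
  destruct (exists_below (cons d1 (cons d2 (cons d3 (cons d4 nil))))) as [d [Hd Hd']].
  { intros a [<-|[<-|[<-|[<-|[]]]]]; easy. }
  assert (L1 := Hd' d1 ltac:(simpl; tauto)). assert (L2 := Hd' d2 ltac:(simpl; tauto)).
  assert (L3 := Hd' d3 ltac:(simpl; tauto)). assert (L4 := Hd' d4 ltac:(simpl; tauto)).
  exists d. split; [easy|]. intros x' y' t' Ht' Hx Hy Htt.
  assert (A1 := H1 x' y' t' Ht' ltac:(lra) ltac:(lra) ltac:(lra)).
  assert (A2 := H2 x' ltac:(lra)). assert (A3 := H3 y' ltac:(lra)). assert (A4 := H4 t' ltac:(lra)).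
  fold (E t) (E t'). fold S. set (S' := ch x' + ch y') in *.
  assert (HSS : Rabs (S' - S) <= 2 * eta).
  { apply Rabs_def2 in A2. apply Rabs_def2 in A3. apply Rabs_le. unfold S, S'. lra. }
  assert (Hprod : Rabs (E t' * S' - E t * S) <= (Rabs (E t) + 1) * (2 * eta) + eta * Rabs S).
  { apply Rabs_prod_diff; [|apply Rle_refl|now left|easy].
    replace (E t') with ((E t' - E t) + E t) by ring. eapply Rle_trans; [apply Rabs_triang|].
    assert (eta <= 1) by apply Rmin_l. lra. }
  assert (He1 : (2 * Rabs (E t) + Rabs S + 3) * eta <= e / 2).
  { apply le_of_le_div; [lra|]. apply Rmin_r. }
  apply Rabs_def2 in A1. apply Rabs_le_between in Hprod. apply Rabs_def1; lra.
Qed.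

Lemma coef_ok_opp T mu sigma a b r rho alpha Cb Cl :
  coef_ok T (logcoef mu sigma a b r rho alpha) Cb Cl -> coef_ok T (logcoef mu sigma a b r rho (- alpha)) Cb Cl.
Proof.
  intros H t Ht x y x' y'. destruct (H t Ht x y x' y') as [[O1 [O2 [O3 [O4 O5]]]] [K1 [K2 [K3 [K4 K5]]]]].
  cbn [sg bb m1 m2 gm logcoef] in *.
  assert (E : forall x, - alpha * sqrt (1 - rho ^ 2) * sigma (exp x) t = - (alpha * sqrt (1 - rho ^ 2) * sigma (exp x) t))
    by (intros; ring).
  rewrite !E. rewrite Rabs_Ropp.
  replace (- (alpha * sqrt (1 - rho ^ 2) * sigma (exp x') t) - - (alpha * sqrt (1 - rho ^ 2) * sigma (exp x) t)) with
    (- (alpha * sqrt (1 - rho ^ 2) * sigma (exp x') t - alpha * sqrt (1 - rho ^ 2) * sigma (exp x) t)) by ring.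
  rewrite Rabs_Ropp. repeat split; easy.
Qed.

(** A barrier of weight del is subtracted from both functions, the truncations are compared, and del
    tends to 0. The bound in between holds for the untruncated functions, which lie below their
    truncations. *)
Lemma visc_comparison T mu sigma a b r rho alpha g u w :
  0 < T -> 0 <= r -> -1 <= rho <= 1 -> standing T mu sigma a b r rho g ->
  contG T u -> contG T w -> class_C T u -> class_C T w ->
  visc_sub T mu sigma a b r rho alpha u -> visc_sub T mu sigma a b r rho (- alpha) w ->
  (forall S H, 0 < S -> 0 < H -> u S H T + w S H T <= 0) ->
  forall S H t, inG T S H t -> u S H t + w S H t <= 0.
Proof.
  intros HT Hr Hrho Hst Hcu Hcw HCu HCw Hu Hw Hend S H t [HS [HH Ht]].
  destruct (standing_coef_ok T mu sigma a b r rho alpha g Hrho Hst) as [Cb [Cl [HCb [HCl Hok]]]].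
  assert (Hok' := coef_ok_opp _ _ _ _ _ _ _ _ _ _ Hok).
  apply visc_sub_jsub in Hu. apply visc_sub_jsub in Hw.
  apply contG_log in Hcu. apply contG_log in Hcw.
  destruct (class_C_growth T u HCu) as [k1 [M1 [Hk1 [HM1 HG1]]]].
  destruct (class_C_growth T w HCw) as [k2 [M2 [Hk2 [HM2 HG2]]]].
  set (U := fun x y t => u (exp x) (exp y) t) in *. set (W := fun x y t => w (exp x) (exp y) t) in *.
  set (A := 2 * Cb + Cb ^ 2).
  assert (HA : 0 <= A) by (assert (P := pow2_ge_0 Cb); unfold A; lra).
  assert (Hdel : forall del, 0 < del -> forall x y s, 0 <= s <= T ->
    U x y s + W x y s <= 2 * (del * exp (A * (T - s)) * (ch x + ch y))).
  { intros del Hdel.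
    set (U1 := fun x y t => U x y t - del * exp (A * (T - t)) * (ch x + ch y)).
    set (W1 := fun x y t => W x y t - del * exp (A * (T - t)) * (ch x + ch y)).
    assert (Hsu := jsub_minus_exp_ch T r rho _ Cb Cl del U Hr HCb ltac:(lra) Hok Hu). fold A U1 in Hsu.
    assert (Hsw := jsub_minus_exp_ch T r rho _ Cb Cl del W Hr HCb ltac:(lra) Hok' Hw). fold A W1 in Hsw.
    assert (HcU : contT T U1) by now apply contT_minus_exp_ch.
    assert (HcW : contT T W1) by now apply contT_minus_exp_ch.
    assert (HdU : decays T U1).
    { apply decays_minus_exp_ch with k1 M1; try easy. intros x y s Hs Hxy. eapply Rle_trans; [apply Rle_abs|]. now apply HG1. }
    assert (HdW : decays T W1).
    { apply decays_minus_exp_ch with k2 M2; try easy. intros x y s Hs Hxy. eapply Rle_trans; [apply Rle_abs|]. now apply HG2. }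
    destruct (decays_bounded T U1 HcU HdU) as [C1 [HC1 HB1]].
    destruct (decays_bounded T W1 HcW HdW) as [C2 [HC2 HB2]].
    (* L exceeds both upper bounds by at least one and makes - L plus either bound negative, which
       settles the terminal time when a truncation is active. *)
    set (L := C1 + C2 + 1).
    destruct (HdU L) as [r1 [Hr1 F1]]. destruct (HdW L) as [r2 [Hr2 F2]].
    set (V1 := fun x y t => Rmax (- L) (U1 x y t)). set (V2 := fun x y t => Rmax (- L) (W1 x y t)).
    assert (Hp1 : forall x y t, 0 <= t <= T -> V1 x y t <= L - 1).
    { intros x y s Hs. assert (Q := HB1 x y s Hs). apply Rmax_lub; unfold L; lra. }
    assert (Hp2 : forall x y t, 0 <= t <= T -> V2 x y t <= L - 1).
    { intros x y s Hs. assert (Q := HB2 x y s Hs). apply Rmax_lub; unfold L; lra. }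
    assert (Hb1 : forall x y t, 0 <= t <= T -> Rabs (V1 x y t) <= L).
    { intros x y s Hs. assert (Q := Hp1 x y s Hs). apply Rabs_le. split; [apply Rmax_l|lra]. }
    assert (Hb2 : forall x y t, 0 <= t <= T -> Rabs (V2 x y t) <= L).
    { intros x y s Hs. assert (Q := Hp2 x y s Hs). apply Rabs_le. split; [apply Rmax_l|lra]. }
    assert (Hcmp := truncated_comparison T r rho (logcoef mu sigma a b r rho alpha) (logcoef mu sigma a b r rho (- alpha))
      Cb Cl L L (Rmax r1 r2) V1 V2 HT Hr Hrho HCb HCl Hok Hok' (fun _ _ => eq_refl) (fun _ _ => eq_refl)
      (fun _ _ _ => eq_refl) (fun _ _ => eq_refl)).
    assert (Hres : forall x y s, 0 <= s <= T -> V1 x y s + V2 x y s <= 0).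
    { intros x y s Hs. apply Hcmp; try easy.
      - intros z q. cbn [gm logcoef]. ring.
      - now apply decays_truncate_uc.
      - now apply decays_truncate_uc.
      - intros p q v Hv Hpq. apply Rmax_lub; [lra|]. apply F1; [easy|]. assert (Q := Rmax_l r1 r2). lra.
      - intros p q v Hv Hpq. apply Rmax_lub; [lra|]. apply F2; [easy|]. assert (Q := Rmax_r r1 r2). lra.
      - now apply jsub_truncate.
      - now apply jsub_truncate.
      - intros p q. assert (B1 := HB1 p q T ltac:(lra)). assert (B2 := HB2 p q T ltac:(lra)).
        assert (E := Hend (exp p) (exp q) (exp_pos _) (exp_pos _)).
        assert (P : 0 <= del * exp (A * (T - T)) * (ch p + ch q)).
        { assert (Q1 := ch_pos p). assert (Q2 := ch_pos q). apply Rmult_le_pos; [|lra].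
          apply Rmult_le_pos; [lra|left; apply exp_pos]. }
        assert (HUW : U1 p q T + W1 p q T <= 0) by (unfold U1, W1, U, W; lra).
        unfold V1, V2, Rmax. destruct (Rle_dec (- L) (U1 p q T)), (Rle_dec (- L) (W1 p q T)); unfold L in *; lra. }
    intros x y s Hs. assert (Q := Hres x y s Hs).
    assert (Q1 := Rmax_r (- L) (U1 x y s)). assert (Q2 := Rmax_r (- L) (W1 x y s)).
    unfold V1, V2, U1, W1 in *. lra. }
  assert (HUW : U (ln S) (ln H) t + W (ln S) (ln H) t <= 0).
  { apply le_epsilon. intros e He.
    set (q := exp (A * (T - t)) * (ch (ln S) + ch (ln H))).
    assert (Hq : 0 < q).
    { assert (Q1 := ch_pos (ln S)). assert (Q2 := ch_pos (ln H)). apply Rmult_lt_0_compat; [apply exp_pos|lra]. }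
    assert (Q := Hdel (e / (2 * q)) ltac:(apply Rdiv_lt_0_compat; lra) (ln S) (ln H) t Ht).
    rewrite Rmult_assoc in Q. fold q in Q. replace (2 * (e / (2 * q) * q)) with e in Q by (field; lra). lra. }
  unfold U, W in HUW. rewrite !exp_ln in HUW by easy. exact HUW.
Qed.

Lemma contG_opp T u : contG T u -> contG T (fun S H t => - u S H t).
Proof.
  intros Hu S0 H0 t0 HG e He. destruct (Hu S0 H0 t0 HG e He) as [d [Hd Hd']]. exists d. split; [easy|].
  intros S H t HG' HS HH Ht. rewrite <- Rabs_Ropp.
  replace (- (- u S H t - - u S0 H0 t0)) with (u S H t - u S0 H0 t0) by ring. now apply Hd'.
Qed.

Lemma class_C_opp T u : class_C T u -> class_C T (fun S H t => - u S H t).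
Proof.
  intros [Hl [k [Hk Hg]]]. split.
  - intros S0 H0 t0 HG. destruct (Hl S0 H0 t0 HG) as [d [M [Hd HM]]]. exists d, M. split; [easy|].
    intros. rewrite Rabs_Ropp. now apply HM.
  - exists k. split; [easy|]. intros e He. destruct (Hg e He) as [M [HM HM']]. exists M. split; [easy|].
    intros. rewrite Rabs_Ropp. now apply HM'.
Qed.

Lemma solutions_comparison T mu sigma a b r rho alpha g u v :
  0 < T -> 0 <= r -> -1 <= rho <= 1 -> standing T mu sigma a b r rho g ->
  contG T u -> contG T v -> class_C T u -> class_C T v ->
  visc_sub T mu sigma a b r rho alpha u -> visc_sub T mu sigma a b r rho (- alpha) (fun S H t => - v S H t) ->
  (forall S H, 0 < S -> 0 < H -> u S H T = v S H T) ->
  forall S H t, inG T S H t -> u S H t <= v S H t.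
Proof.
  intros HT Hr Hrho Hst Hcu Hcv HCu HCv Hu Hv Hend S H t HG.
  assert (Q := visc_comparison T mu sigma a b r rho alpha g u (fun S H t => - v S H t) HT Hr Hrho Hst
    Hcu (contG_opp _ _ Hcv) HCu (class_C_opp _ _ HCv) Hu Hv
    (fun S H HS HH => ltac:(rewrite (Hend S H HS HH); lra)) S H t HG). cbv beta in Q. lra.
Qed.

Theorem theorem2p9 (T r rho alpha : R) (mu1 mu2 sigma a b : R -> R -> R)
  (g : R -> R) (P1 P2 : R -> R -> R -> R) :
  0 < T -> 0 <= r -> -1 <= rho <= 1 -> 0 <= alpha ->
  (forall S t, 0 < S -> 0 <= t <= T -> r <= mu1 S t /\ mu1 S t <= mu2 S t) ->
  standing T mu1 sigma a b r rho g ->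
  standing T mu2 sigma a b r rho g ->
  is_solution T mu1 sigma a b r rho alpha g P1 ->
  is_solution T mu2 sigma a b r rho alpha g P2 ->
  ((PS_nonneg T P1 \/ PS_nonneg T P2) ->
     forall S H t, inG T S H t -> P1 S H t <= P2 S H t) /\
  ((PS_nonpos T P1 \/ PS_nonpos T P2) ->
     forall S H t, inG T S H t -> P2 S H t <= P1 S H t).
Proof.
  intros HT Hr Hrho Halpha Hmu Hst1 Hst2 [Hc1 [HC1 [Hsub1 [Hsup1 Hg1]]]] [Hc2 [HC2 [Hsub2 [Hsup2 Hg2]]]].
  apply visc_super_opp in Hsup1. apply visc_super_opp in Hsup2.
  assert (Hopp : forall (u : R -> R -> R -> R) S H t d, is_derive (fun s => u s H t) S d ->
    is_derive (fun s => - u s H t) S (- d)) by (intros; now apply (is_derive_opp (fun s => u s H t))).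
  assert (Heq : forall S H, 0 < S -> 0 < H -> P1 S H T = P2 S H T).
  { intros. now rewrite Hg1, Hg2. }
  assert (Hup : forall S t d, 0 < S -> 0 <= t <= T -> 0 <= d -> mu1 S t * d <= mu2 S t * d).
  { intros S t d HS Ht Hd. apply Rmult_le_compat_r; [easy|now apply Hmu]. }
  assert (Hdown : forall S t d, 0 < S -> 0 <= t <= T -> d <= 0 -> mu2 S t * d <= mu1 S t * d).
  { intros S t d HS Ht Hd. destruct (Hmu S t HS Ht). nra. }
  split; intros [HP|HP].
  (* P1 is a subsolution for the larger drift and is compared with P2 in the equation of mu2. *)
  - apply (solutions_comparison T mu2 sigma a b r rho alpha g); try easy.
    now apply (visc_sub_change_mu T mu1 mu2 sigma a b r rho alpha P1 (fun d => 0 <= d)).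
  (* Here P2 changes its equation: - P2 has nonpositive S-derivative, so lowering mu2 to mu1 keeps
     it a subsolution for - alpha. *)
  - apply (solutions_comparison T mu1 sigma a b r rho alpha g); try easy.
    apply (visc_sub_change_mu T mu2 mu1 sigma a b r rho (- alpha) _ (fun d => d <= 0)); try easy.
    intros S H t HG. destruct (HP S H t HG) as [d [Hd Hd']]. exists (- d). split; [now apply Hopp|lra].
  - apply (solutions_comparison T mu2 sigma a b r rho alpha g); try easy.
    + apply (visc_sub_change_mu T mu1 mu2 sigma a b r rho (- alpha) _ (fun d => 0 <= d)); try easy.
      intros S H t HG. destruct (HP S H t HG) as [d [Hd Hd']]. exists (- d). split; [now apply Hopp|lra].
    + intros. now rewrite Heq.
  - apply (solutions_comparison T mu1 sigma a b r rho alpha g); try easy.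
    + now apply (visc_sub_change_mu T mu2 mu1 sigma a b r rho alpha P2 (fun d => d <= 0)).
    + intros. now rewrite Heq.
Qed.
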